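(* Let $d\ge1$ and let $\mu$ be any Borel probability measure on $\mathbb{S}_d$. If $\Pi$ is a point process on $\mathbb{D}_d$ satisfying the small variance assumption and having first intensity measure $\lambda\mu_{\mathbb{D}_d}$ with $\lambda>0$ a constant, then for $\Pi$-almost any $X\in\mathrm{Conf}(\mathbb{D}_d)$: (1) For any $s>d$ and any $z\in\mathbb{D}_d$, the series $\sum_{x\in X}e^{-sd_B(x,z)}P^b_x$ converges unconditionally in $L^2(\mu)=L^2(\mathbb{S}_d,\mu)$. (2) For any $z\in\mathbb{D}_d$, $$\lim_{s\to d^+}\left\|\frac{\sum_{x\in X}e^{-sd_B(x,z)}P^b_x}{\sum_{x\in X}e^{-sd_B(x,z)}}-P^b_z\right\|_{L^2(\mu)}=0.$$ (3) For any $f\in h^2(\mathbb{D}_d;\mu)$, any $z\in\mathbb{D}_d$ and any $s>d$, the series $\sum_{x\in X}e^{-sd_B(x,z)}f(x)$ converges absolutely and $$f(z)=\lim_{s\to d^+}\frac{\sum_{x\in X}e^{-sd_B(x,z)}f(x)}{\sum_{x\in X}e^{-sd_B(x,z)}}.$$ (4) For all $z\in\mathbb{D}_d$, the following weak convergence of probability measures on $\overline{\mathbb{D}}_d$ holds: $$\lim_{s\to d^+}\frac{\sum_{x\in X}e^{-sd_B(x,z)}\delta_x}{\sum_{x\in X}e^{-sd_B(x,z)}}=P^b(z,\zeta)\,d\sigma_{\mathbb{S}_d}(\zeta),$$ where $\delta_x$ is the Dirac measure at $x$.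
   Context: $\mathbb{D}_d=\{z\in\mathbb{C}^d:|z|<1\}$, $\mathbb{S}_d=\{z\in\mathbb{C}^d:|z|=1\}$, $v_d$ is Lebesgue measure normalized so that $v_d(\mathbb{D}_d)=1$, $\sigma_{\mathbb{S}_d}$ is the normalized surface measure on $\mathbb{S}_d$, and $z\cdot w=\sum_jz_jw_j$. For $w\in\mathbb{D}_d\setminus\{0\}$, $$\varphi_w(z)=\frac{w-\frac{z\cdot\bar w}{|w|^2}w-\sqrt{1-|w|^2}\left(z-\frac{z\cdot\bar w}{|w|^2}w\right)}{1-z\cdot\bar w},$$ and $\varphi_0(z)=-z$. The Bergman distance is $d_B(z,w)=\log\frac{1+|\varphi_w(z)|}{1-|\varphi_w(z)|}$ and $d\mu_{\mathbb{D}_d}(z)=\frac{dv_d(z)}{(1-|z|^2)^{d+1}}$. The Poisson–Szegő kernel is $P^b(w,\zeta)=\frac{(1-|w|^2)^d}{|1-\zeta\cdot\bar w|^{2d}}$, $w\in\mathbb{D}_d,\zeta\in\mathbb{S}_d$; $P^b_w(\zeta)=P^b(w,\zeta)$; $P^b[\nu](z)=\int_{\mathbb{S}_d}P^b(z,\zeta)d\nu(\zeta)$; and $h^2(\mathbb{D}_d;\mu)=\{f:\mathbb{D}_d\to\mathbb{C}\mid f=P^b[g\mu],\ g\in L^2(\mathbb{S}_d,\mu)\}$. A series converges unconditionally if it converges and its sum does not change under any reordering of its terms. A configuration on a locally compact complete separable metric space $E$ is a collection of points of $E$ (possibly with multiplicities) with finitely many points in each relatively compact set; $\mathrm{Conf}(E)$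 is the space of configurations with the usual Borel structure. Sums over $x\in X$ are taken with multiplicity. A point process on $E$ is a Borel probability measure $\Pi$ on $\mathrm{Conf}(E)$; its first intensity measure is $B\mapsto\mathbb{E}_\Pi(\#_B(\mathscr{X}))$, with $\mathscr{X}$ the random configuration and $\#_B$ the number of points in $B$. Small variance assumption: there is a constant $C>0$ depending only on $\Pi$ such that for every $f:E\to\mathbb{C}$ with $\mathbb{E}_\Pi[\sum_{x\in\mathscr{X}}(|f(x)|+|f(x)|^2)]<\infty$, $$\mathrm{Var}_\Pi\Big(\sum_{x\in\mathscr{X}}f(x)\Big)\le C\,\mathbb{E}_\Pi\Big(\sum_{x\in\mathscr{X}}|f(x)|^2\Big).$$ *)

(* Defs.v *)
From HB Require Import structures.
From mathcomp Require Import all_boot all_order all_algebra.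
From mathcomp Require Import complex.
From mathcomp Require Import all_classical all_reals all_analysis.
From mathcomp Require Import measurable_realfun lra.

Set Implicit Arguments.
Unset Strict Implicit.
Unset Printing Implicit Defensive.

Import Order.TTheory GRing.Theory Num.Theory.
Import numFieldNormedType.Exports.

Local Open Scope classical_set_scope.
Local Open Scope complex_scope.
Local Open Scope ring_scope.

Notation cabs := Normc.normc.

(* C^d is 'rV[R[i]]_d, with the product topology and its Borel sigma-algebra.
   The library's norm on matrices is the sup norm; the Euclidean norm is enorm
   below. *)
HB.instance Definition _ (R : realType) := NormedModule.copy R[i] (R[i])^o.

Definition borel_display : measure_display.
Proof. exact: default_measure_display. Qed.

Section borel.
Context {R : realType} {d : nat}.
Local Notation V := 'rV[R[i]]_d.

HB.instance Definition _ := @isMeasurable.Build borel_display 'rV[R[i]]_d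
  <<s @open V >> (@sigma_algebra0 _ setT (@open V))
  (@sigma_algebraC _ (@open V)) (@sigma_algebra_bigcup _ setT (@open V)).

Lemma measurable_coord_aux (g : R[i] -> R) (j : 'I_d) :
  (forall x y, `|g x - g y| <= cabs (x - y)) ->
  measurable_fun [set: V] (fun z : V => g (z 0 j)).
Proof.
move=> gL; apply: (measurability _ (RGenOInfty.measurableE R)).
move=> _ [_ [a ->] <-]; rewrite setTI; apply: sub_sigma_algebra.
rewrite openE => z /=; rewrite in_itv/= andbT => agz.
apply/nbhs_ballP.
have e0 : (0 : R[i]) < (g (z 0 j) - a)%:C by rewrite ltcR subr_gt0.
exists (g (z 0 j) - a)%:C => //= w; rewrite /ball/= /mx_ball => -[_ /(_ 0 j)].
rewrite /ball/= -[`| _ |]/((cabs _)%:C) ltcR => h.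
rewrite /= in_itv/= andbT.
have := le_lt_trans (gL _ _) h; rewrite ltr_distlC => /andP[+ _].
by rewrite opprB addrC subrK.
Qed.

Lemma measurable_Re_coord (j : 'I_d) :
  measurable_fun [set: V] (fun z : V => complex.Re (z 0 j)).
Proof.
apply: measurable_coord_aux => -[a b] [c e] /=.
by rewrite -[leLHS]sqrtr_sqr ler_wsqrtr// lerDl sqr_ge0.
Qed.

Lemma measurable_Im_coord (j : 'I_d) :
  measurable_fun [set: V] (fun z : V => complex.Im (z 0 j)).
Proof.
apply: measurable_coord_aux => -[a b] [c e] /=.
by rewrite -[leLHS]sqrtr_sqr ler_wsqrtr// lerDr sqr_ge0.
Qed.

Let box (q : d.-tuple (rat * rat) * rat) : set V := [set z | forall j,
  `|complex.Re (z 0 j) - ratr (tnth q.1 j).1| < ratr q.2 /\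
  `|complex.Im (z 0 j) - ratr (tnth q.1 j).2| < ratr q.2].

Let open_box (U : set V) : open U ->
  U = \bigcup_(q in [set q | box q `<=` U]) box q.
Proof.
rewrite openE => Uo; apply/seteqP; split; last by move=> z [q /= + qz]; apply.
move=> z Uz; have /nbhs_ballP[e /= e0 eU] := Uo _ Uz.
have [e1 e1e e10] : exists2 e1 : R, e1%:C = e & 0 < e1.
  case: e e0 {eU} => a b; rewrite ltcE/= => /andP[/eqP -> a0].
  by exists a.
have /rat_in_itvoo[r] : 0 < e1 / 4 by rewrite divr_gt0.
rewrite in_itv/= => /andP[r0 re].
have app (x : R) : exists q : rat, `|x - ratr q| < ratr r.
  have /rat_in_itvoo[q] : x - ratr r < x + ratr r.
    by rewrite ltrD2l gtrN.
  rewrite in_itv/= => qx; exists q; rewrite distrC ltr_distl//.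
pose q j := (sval (cid (app (complex.Re (z 0 j)))),
             sval (cid (app (complex.Im (z 0 j))))).
have qz : box ([tuple q j | j < d], r) z.
  move=> j; rewrite tnth_mktuple /q/=.
  by split; case: cid.
exists ([tuple q j | j < d], r) => //= w qw.
apply: eU; split => // i j; rewrite ord1 /ball/= -e1e -[`| _ |]/((cabs _)%:C) ltcR.
have [zr zi] := qz j; have [wr wi] := qw j.
have hr : `|complex.Re (z 0 j) - complex.Re (w 0 j)| < ratr r + ratr r.
  rewrite -(subrKA (ratr (tnth [tuple q j | j < d] j).1)).
  by rewrite (le_lt_trans (ler_normD _ _))// ltrD// distrC.
have hi : `|complex.Im (z 0 j) - complex.Im (w 0 j)| < ratr r + ratr r.
  rewrite -(subrKA (ratr (tnth [tuple q j | j < d] j).2)).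
  by rewrite (le_lt_trans (ler_normD _ _))// ltrD// distrC.
move: hr hi; case: (z 0 j) (w 0 j) => a b [c f] /= hr hi.
apply: (@le_lt_trans _ _ (`|a - c| + `|b - f|)).
  rewrite -[leRHS]ger0_norm ?addr_ge0// -sqrtr_sqr ler_wsqrtr// [leRHS]sqrrD.
  by rewrite !real_normK ?num_real// -addrA lerD2l lerDr mulrn_wge0// mulr_ge0.
apply: (lt_trans (ltrD hr hi)).
by move: re; rewrite ltr_pdivlMr//; lra.
Qed.

Lemma measurable_to_row {d'} {T : measurableType d'} (f : T -> V) :
  (forall j, measurable_fun [set: T] (fun t => complex.Re (f t 0 j))) ->
  (forall j, measurable_fun [set: T] (fun t => complex.Im (f t 0 j))) ->
  measurable_fun [set: T] f.
Proof.
move=> mr mi; apply: (measurability (@open V)) => //.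
move=> _ [U oU <-]; rewrite setTI (open_box oU) preimage_bigcup.
rewrite bigcup_mkcond; apply: countable_bigcupT_measurable => //= q.
case: ifPn => // _; rewrite (_ : _ @^-1` _ = \bigcap_(j in [set: 'I_d])
  ((fun t => complex.Re (f t 0 j)) @^-1` ball (ratr (tnth q.1 j).1 : R) (ratr q.2) `&`
   (fun t => complex.Im (f t 0 j)) @^-1` ball (ratr (tnth q.1 j).2 : R) (ratr q.2))).
  apply: fin_bigcap_measurable => // j _; apply: measurableI.
    by rewrite -[X in measurable X]setTI; apply: mr => //; exact: measurable_ball.
  by rewrite -[X in measurable X]setTI; apply: mi => //; exact: measurable_ball.
apply/seteqP; split => t /= h j; first by move=> _; have := h j; rewrite /ball/= 2!(distrC (ratr _)).
by have := h j I; rewrite /ball/= 2!(distrC (ratr _)).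
Qed.

End borel.

Section cons_measure.
Context {dT : measure_display} {T : measurableType dT} {R : realType} {n : nat}.
Variables (m1 : {sigma_finite_measure set T -> \bar R})
          (m2 : {sigma_finite_measure set (n.-tuple T) -> \bar R}).
Let tcons (p : T * n.-tuple T) : n.+1.-tuple T := [tuple of p.1 :: p.2].

Definition cons_measure (A : set (n.+1.-tuple T)) : \bar R :=
  (m1 \x m2)%E (tcons @^-1` A).

Let mtcons : measurable_fun [set: T * n.-tuple T] tcons.
Proof. exact: measurable_cons. Qed.

Let cons_measure0 : cons_measure set0 = 0%E.
Proof. by rewrite /cons_measure preimage_set0 measure0. Qed.

Let cons_measure_ge0 A : (0 <= cons_measure A)%E.
Proof. exact: measure_ge0. Qed.

Let cons_measure_sigma_additive : semi_sigma_additive cons_measure.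
Proof.
exact: (@measure_semi_sigma_additive _ _ _
  (measure_function_pushforward__canonical__measure_function_Measure
    (m1 \x m2)%E mtcons)).
Qed.

HB.instance Definition _ := isMeasure.Build _ _ _ cons_measure
  cons_measure0 cons_measure_ge0 cons_measure_sigma_additive.

Let cons_measure_sigma_finite : sigma_finite [set: n.+1.-tuple T] cons_measure.
Proof.
have /sigma_finiteP[F [TF ndF Foo]] := sigma_finiteT m1.
have /sigma_finiteP[G [TG ndG Goo]] := sigma_finiteT m2.
have mF k : measurable (F k) by have [] := Foo k.
have mG k : measurable (G k) by have [] := Goo k.
exists (fun k => [set t | F k (thead t) /\ G k [tuple of behead t]]).
  rewrite predeqE => t; split => // _.
  have : [set: T] (thead t) by []. rewrite TF => -[i _ Fi].
  have : [set: n.-tuple T] [tuple of behead t] by []. rewrite TG => -[j _ Gj].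
  exists (maxn i j) => //; split.
  - by move: Fi; exact/subsetPset/ndF/leq_maxl.
  - by move: Gj; exact/subsetPset/ndG/leq_maxr.
move=> k; split.
  apply: measurableI.
    rewrite -[X in measurable X]setTI; apply: measurable_tnth => //.
  by rewrite -[X in measurable X]setTI; apply: measurable_behead.
rewrite /cons_measure (_ : _ @^-1` _ = F k `*` G k).
  have [? ?] := Foo k; have [? ?] := Goo k.
  by rewrite product_measure1E// lte_mul_pinfty// ge0_fin_numE.
apply/seteqP; split => -[x t] /=; rewrite theadE.
  by move=> [Fx Gt]; split => //=; move: Gt; congr (G k _); exact: val_inj.
by move=> [Fx Gt]; split => //=; move: Gt; congr (G k _); exact: val_inj.
Qed.

HB.instance Definition _ := Measure_isSigmaFinite.Build _ _ _ cons_measure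
  cons_measure_sigma_finite.

End cons_measure.

Fixpoint lebesgue_tuple (R : realType) (n : nat) :
    {sigma_finite_measure set (n.-tuple (measurableTypeR R)) -> \bar R} :=
  match n with
  | 0 => \d_([tuple] : 0.-tuple (measurableTypeR R))
  | n'.+1 => cons_measure (@lebesgue_measure R) (lebesgue_tuple R n')
  end.

Section complex_space.
Context {R : realType} {d : nat}.
Local Notation V := 'rV[R[i]]_d.
Implicit Types z w x zeta : V.

(* C^d is identified with R^(d + d) through (Re z, Im z). *)
Definition row_of_tuple (t : (d + d).-tuple (measurableTypeR R)) : V :=
  \row_j (tnth t (lshift d j) +i* tnth t (rshift d j)).

Definition lebesgue_C (A : set V) : \bar R :=
  lebesgue_tuple R (d + d) (row_of_tuple @^-1` A).

Lemma measurable_row_of_tuple : measurable_fun setT row_of_tuple.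
Proof.
apply: measurable_to_row => j.
  by under eq_fun do rewrite mxE/=; exact: measurable_tnth.
by under eq_fun do rewrite mxE/=; exact: measurable_tnth.
Qed.

HB.instance Definition _ := Measure.copy lebesgue_C
  (measure_function_pushforward__canonical__measure_function_Measure
    (lebesgue_tuple R (d + d)) measurable_row_of_tuple).

Definition cdot z w : R[i] := \sum_j z 0 j * w 0 j.

Definition conj_row w : V := map_mx (@conjc R) w.

Definition enorm z : R := Num.sqrt (\sum_j cabs (z 0 j) ^+ 2).

Definition unit_ball : set V := [set z | enorm z < 1].
Definition closed_unit_ball : set V := [set z | enorm z <= 1].
Definition unit_sphere : set V := [set z | enorm z = 1].

Definition ball_involution w z : V :=
  if w == 0 then - z else
  let pz := (cdot z (conj_row w) / (enorm w ^+ 2)%:C) *: w in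
  (1 - cdot z (conj_row w))^-1 *:
    (w - pz - (Num.sqrt (1 - enorm w ^+ 2))%:C *: (z - pz)).

Definition bergman_dist z w : R :=
  ln ((1 + enorm (ball_involution w z)) / (1 - enorm (ball_involution w z))).

Definition poisson_szego w zeta : R :=
  (1 - enorm w ^+ 2) ^+ d / cabs (1 - cdot zeta (conj_row w)) ^+ (2 * d).

Lemma measurable_enorm : measurable_fun [set: V] enorm.
Proof.
rewrite (_ : enorm = fun z => (\sum_j cabs (z 0 j) ^+ 2) `^ 2^-1); last first.
  apply/funext => z; rewrite powR12_sqrt//.
  by apply: sumr_ge0 => j _; exact: sqr_ge0.
apply: (measurableT_comp (measurable_powR _)); apply: measurable_sum => j.
rewrite (_ : (fun _ => _) = fun z : V =>
    complex.Re (z 0 j) ^+ 2 + complex.Im (z 0 j) ^+ 2).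
  by apply: measurable_funD; apply: measurable_funX;
    [exact: measurable_Re_coord|exact: measurable_Im_coord].
by apply/funext => z; case: (z 0 j) => a b /=; rewrite sqr_sqrtr ?addr_ge0 ?sqr_ge0.
Qed.

Lemma measurable_unit_ball : measurable unit_ball.
Proof.
have := measurable_enorm measurableT (measurable_itv `]-oo, 1[).
by rewrite setTI; congr measurable; apply/seteqP; split => z /=; rewrite in_itv.
Qed.

(* v_d, the multiple of Lebesgue measure with v_d(unit_ball) = 1 *)
Lemma ball_volume_inv_ge0 : 0 <= (fine (lebesgue_C unit_ball))^-1.
Proof. by rewrite invr_ge0 fine_ge0. Qed.

Definition normalized_lebesgue : {measure set V -> \bar R} :=
  mscale (NngNum ball_volume_inv_ge0) lebesgue_C.

(* mu_(D_d), meaningful on Borel subsets of the ball only *)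
Definition bergman_measure (B : set V) : \bar R :=
  \int[normalized_lebesgue]_(z in B) ((1 - enorm z ^+ 2) ^+ d.+1)^-1%:E.

(* sphere_proj 0 = 0 *)
Definition sphere_proj z : V := (enorm z)^-1%:C *: z.

Lemma measurable_sphere_proj : measurable_fun [set: V] sphere_proj.
Proof.
have menormV : measurable_fun [set: V] (fun z => (enorm z)^-1).
  rewrite (_ : (fun z => _) = fun z => enorm z `^ (-1)); last first.
    by apply/funext => z; rewrite powR_inv1// sqrtr_ge0.
  exact: (measurableT_comp (measurable_powR _) measurable_enorm).
apply: measurable_to_row => j.
  rewrite (_ : (fun t => _) = fun z => (enorm z)^-1 * complex.Re (z 0 j)).
    by apply: measurable_funM => //; exact: measurable_Re_coord.
  by apply/funext => z; rewrite mxE; case: (z 0 j) => a b /=; rewrite mul0r subr0.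
rewrite (_ : (fun t => _) = fun z => (enorm z)^-1 * complex.Im (z 0 j)).
  by apply: measurable_funM => //; exact: measurable_Im_coord.
by apply/funext => z; rewrite mxE; case: (z 0 j) => a b /=; rewrite mul0r addr0.
Qed.

(* The normalised surface measure of the sphere, as a measure on C^d: by polar
   coordinates, the mass of A is v_d {z in unit_ball | z / |z| \in A}. *)
Definition surface_measure (A : set V) : \bar R :=
  mrestr normalized_lebesgue measurable_unit_ball (sphere_proj @^-1` A).

HB.instance Definition _ := Measure.copy surface_measure
  (measure_function_pushforward__canonical__measure_function_Measure
    (mrestr normalized_lebesgue measurable_unit_ball) measurable_sphere_proj).

End complex_space.

Section configurations.
Context {R : realType} {d : nat}.
Local Notation V := 'rV[R[i]]_d.
Implicit Types (E B : set V) (x : V).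

(* A configuration on a subset E of C^d is encoded by its multiplicity function.
   A set is relatively compact in E iff it is contained in a compact K `<=` E. *)
Definition locally_finite E (m : V -> nat) : Prop :=
  (forall x, m x != 0%N -> E x) /\
  (forall K, compact K -> K `<=` E -> finite_set [set x | K x /\ m x != 0%N]).

Record Conf E := MkConf {
  mult :> V -> nat ;
  _ : locally_finite E mult }.

Lemma locally_finite0 E : locally_finite E (fun=> 0%N).
Proof.
by split => // K _ _; rewrite (_ : [set _ | _] = set0)//; apply/seteqP; split => x [].
Qed.

HB.instance Definition _ E := gen_eqMixin (Conf E).
HB.instance Definition _ E := gen_choiceMixin (Conf E).
HB.instance Definition _ E :=
  isPointed.Build (Conf E) (MkConf (locally_finite0 E)).

(* Sums over the points of X, with multiplicity. conf_esum is meant for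
   nonnegative g; conf_rsum and conf_csum are meaningful only for absolutely
   summable functions, and are junk values otherwise. *)
Definition conf_esum E (X : Conf E) (g : V -> \bar R) : \bar R :=
  (\esum_(x in [set: V]) ((X x)%:R%:E * g x))%E.

Definition conf_rsum E (X : Conf E) (g : V -> R) : R :=
  fine (conf_esum X (EFin \o g^\+)) - fine (conf_esum X (EFin \o g^\-)).

Definition conf_csum E (X : Conf E) (f : V -> R[i]) : R[i] :=
  conf_rsum X (fun x => complex.Re (f x)) +i*
  conf_rsum X (fun x => complex.Im (f x)).

Definition conf_count E (X : Conf E) B : \bar R :=
  (\esum_(x in B) (X x)%:R%:E)%E.

(* The Borel sigma-algebra of Conf(E) is the one generated by the maps
   X |-> #_B(X), B a Borel subset of E. *)
Definition counting_events E : set (set (Conf E)) :=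
  [set A | exists2 B, measurable B /\ B `<=` E &
           exists2 Y, measurable Y & A = (fun X => conf_count X B) @^-1` Y].

HB.instance Definition _ E := @isMeasurable.Build borel_display (Conf E)
  <<s @counting_events E >> (@sigma_algebra0 _ setT (@counting_events E))
  (@sigma_algebraC _ (@counting_events E))
  (@sigma_algebra_bigcup _ setT (@counting_events E)).

Definition first_intensity E (Pi : probability (Conf E) R) B : \bar R :=
  (\int[Pi]_X conf_count X B)%E.

End configurations.

Section complex_integration.
Context {dT : measure_display} {T : measurableType dT} {R : realType}.
Implicit Types (D : set T) (F : T -> R[i]).

Definition cmeasurable_fun D F : Prop :=
  measurable_fun D (fun t => complex.Re (F t)) /\
  measurable_fun D (fun t => complex.Im (F t)).

Definition cintegral (m : {measure set T -> \bar R}) D F : R[i] :=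
  (\int[m]_(t in D) complex.Re (F t)) +i* (\int[m]_(t in D) complex.Im (F t)).

Definition cvariance (P : probability T R) F : \bar R :=
  (\int[P]_t (cabs (F t - cintegral P setT F) ^+ 2)%:E)%E.

Definition L2norm (m : {measure set T -> \bar R}) D F : \bar R :=
  'N[m]_2%:E[(fun t => (cabs (F t))%:E) \_ D]%E.

Definition in_L2 (m : {measure set T -> \bar R}) D F : Prop :=
  cmeasurable_fun D F /\ (L2norm m D F < +oo)%E.

End complex_integration.

Section point_process.
Context {R : realType} {d : nat}.
Local Notation V := 'rV[R[i]]_d.
Local Notation ball := (@unit_ball R d).
Local Notation sphere := (@unit_sphere R d).

Definition small_variance (E : set V) (Pi : probability (Conf E) R) : Prop :=
  exists2 C : R, 0 < C & forall f : V -> R[i], cmeasurable_fun E f ->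
    (\int[Pi]_X conf_esum X (fun x => (cabs (f x) + cabs (f x) ^+ 2)%:E)
      < +oo)%E ->
    (cvariance Pi (fun X => conf_csum X f) <=
      C%:E * \int[Pi]_X conf_esum X (fun x => (cabs (f x) ^+ 2)%:E))%E.

(* The orderings of the terms of a series over X: each point is listed as many
   times as its multiplicity. None stands for a missing (zero) term, so that
   finite configurations are covered. *)
Definition enumerates (E : set V) (X : Conf E) (e : nat -> option V) : Prop :=
  forall x, ([set n | e n = Some x] #= `I_(X x))%card.

Definition partial_sum {T : Type} (F : V -> T -> R[i]) (e : nat -> option V)
    (n : nat) (t : T) : R[i] :=
  \sum_(k < n) (if e k is Some x then F x t else 0).

(* S is the L2(m)-sum of the series of the F x, x in X, in every ordering. *)
Definition L2_unconditional_sum {dT} {T : measurableType dT} (E : set V)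
    (X : Conf E) (m : {measure set T -> \bar R}) (D : set T)
    (F : V -> T -> R[i]) (S : T -> R[i]) : Prop :=
  [/\ in_L2 m D S, exists e, enumerates X e &
      forall e, enumerates X e ->
        L2norm m D (fun t => partial_sum F e n t - S t) @[n --> \oo] --> 0%E].

Definition hardy2 (mu : {measure set V -> \bar R}) (f : V -> R[i]) : Prop :=
  exists2 g : V -> R[i], in_L2 mu sphere g &
    forall z, ball z -> f z =
      cintegral mu sphere (fun zeta => (poisson_szego z zeta)%:C * g zeta).

Definition ps_weight (s : R) (z x : V) : R := expR (- s * bergman_dist x z).

(* \sum_(x in X) e^(- s d_B(x, z)) delta_x *)
Definition ps_sum_measure (X : Conf ball) s z (A : set V) : \bar R :=
  (\esum_(x in A) ((X x)%:R * ps_weight s z x)%:E)%E.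

Definition ps_mass (X : Conf ball) s z : \bar R :=
  conf_esum X (fun x => (ps_weight s z x)%:E).

Let ps_sum_measure0 X s z : ps_sum_measure X s z set0 = 0%E.
Proof. exact: esum_set0. Qed.

Let ps_term_ge0 (X : Conf ball) s z x :
  (0 <= ((X x)%:R * ps_weight s z x)%:E :> \bar R)%E.
Proof. by rewrite lee_fin mulr_ge0// expR_ge0. Qed.

Let ps_sum_measure_ge0 X s z A : (0 <= ps_sum_measure X s z A)%E.
Proof. exact: esum_ge0. Qed.

Let ps_sum_measure_sigma_additive X s z :
  semi_sigma_additive (ps_sum_measure X s z).
Proof.
move=> F mF tF mUF; rewrite /ps_sum_measure esum_bigcupT//.
rewrite -nneseries_esumT; last by move=> n; exact: esum_ge0.
by apply: is_cvg_ereal_nneg_natsum => n _; exact: esum_ge0.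
Qed.

HB.instance Definition _ X s z := isMeasure.Build _ _ _ (ps_sum_measure X s z)
  (ps_sum_measure0 X s z) (ps_sum_measure_ge0 X s z)
  (@ps_sum_measure_sigma_additive X s z).

Lemma ps_mass_inv_ge0 X s z : 0 <= (fine (ps_mass X s z))^-1.
Proof.
rewrite invr_ge0 fine_ge0//; apply: esum_ge0 => x _.
by rewrite mule_ge0// lee_fin expR_ge0.
Qed.

Definition ps_measure X s z : {measure set V -> \bar R} :=
  mscale (NngNum (ps_mass_inv_ge0 X s z)) (ps_sum_measure X s z).

End point_process.

(* Main.v *)
Require Import Defs.
From HB Require Import structures.
From mathcomp Require Import all_boot all_order all_algebra.
From mathcomp Require Import complex.
From mathcomp Require Import all_classical all_reals all_analysis.
From mathcomp Require Import measurable_realfun ring lra.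

Set Implicit Arguments.
Unset Strict Implicit.
Unset Printing Implicit Defensive.

Import Order.TTheory GRing.Theory Num.Theory.
Import numFieldNormedType.Exports.

Local Open Scope classical_set_scope.
Local Open Scope complex_scope.
Local Open Scope ring_scope.

(** Why the theorem holds.

    Write s = d + a. For a fixed boundary point zeta and a nonnegative continuous h
    on the closed ball, let the random variable T be the sum over the points x of the
    configuration of w_a(x) h(x) P(x, zeta), where w_a is a radial weight comparable to
    (1 - |x|^2)^(d + a). By Campbell's formula its mean is lambda times a radial
    average of Poisson-Szego integrals of h, and because the kernel has mass one and
    concentrates at zeta, a times the mean tends to lambda h(zeta) uniformly in zeta
    (core_mean_approx). The small variance assumption and P(x, zeta) <= 4^d / (1 -
    |x|^2)^d bound the variance by a multiple of 1 / a (core_variance). After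
    multiplication by a^2 and integration against any probability measure mu on the
    sphere, these variances are summable along a = 1 / ((n + 1) (n + 2)), so that
    almost surely a T tends to lambda h in L2(mu) along this sequence
    (core_sums_converge_ae); monotonicity in a gives all a tending to 0
    (core_sum_limit).

    This is used only for h = P(q, .) with q in a countable dense subset of the ball,
    once for mu and once for the surface measure sigma; what follows is deterministic.
    The explicit formula for 1 - |phi_z(x)|^2 shows that e^(-s d_B(x, z)) is
    (d / 4^d) w_a(x) P(z, x) up to a factor that is close to 1 when x is near the
    sphere, a is small and z is replaced by a nearby q (ps_weight_comparison). Since
    the finitely many points in a smaller ball do not matter in the limit, a times the
    sum W_a of e^(-s d_B(x, z)) P_x tends to (d / 4^d) lambda P_z in L2(mu)
    (weighted_sum_limit). In particular W_a is square integrable for every a > 0, and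
    its series of nonnegative terms converges in L2(mu) in every order.

    As the kernel has mass one, the total mass M_a of the weights is the integral of
    W_a against sigma, whence a M_a tends to (d / 4^d) lambda (mass_limit), and W_a /
    M_a tends to P_z in L2(mu) (normalized_sum_limit). For f = P[g mu] the sum of
    e^(-s d_B(x, z)) f(x) is the integral of W_a g against mu, so the Cauchy-Schwarz
    inequality gives the statement on the Hardy space. For a function phi continuous on
    the closed ball, phi differs from the Poisson-Szego integral of its boundary values
    by a function that is small near the sphere, and M_a tends to infinity, so the
    weak convergence follows from the Hardy space argument with mu = sigma
    (weak_limit_ge0).

    That the kernel has mass one (poisson_szego_mass) is proved by Gaussian integrals:
    translating the Gaussian on C^d by a z gives a generating function for the moments
    of <xi, z> on the sphere, a second Gaussian integration gives the weighted sum of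
    these moments that represents the integral of |1 - <xi, z>|^(-2d), and
    rotation invariance removes the mixed moments. *)

Ltac complex_ring :=
  apply/eqP; rewrite eq_complex /=; apply/andP; split; apply/eqP; ring.

(** * Complex numbers and the Hermitian form *)

Section complex_modulus.
Context {R : realType}.
Implicit Types a b : R[i].

Lemma cabs_ge0 a : 0 <= cabs a.
Proof. by case: a => x y; exact: sqrtr_ge0. Qed.

Lemma cabs_sqr a : cabs a ^+ 2 = complex.Re a ^+ 2 + complex.Im a ^+ 2.
Proof. by case: a => x y /=; rewrite sqr_sqrtr ?addr_ge0 ?sqr_ge0. Qed.

Lemma cabsM a b : cabs (a * b) = cabs a * cabs b.
Proof. exact: Normc.normcM. Qed.

Lemma cabsV a : cabs a^-1 = (cabs a)^-1.
Proof. exact: Normc.normcV. Qed.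

Lemma cabsN a : cabs (- a) = cabs a.
Proof. by case: a => x y /=; rewrite !sqrrN. Qed.

Lemma cabs_conj a : cabs (conjc a) = cabs a.
Proof. by case: a => x y /=; rewrite sqrrN. Qed.

Lemma cabsR (x : R) : cabs x%:C = `|x|.
Proof. by rewrite /= expr0n addr0 sqrtr_sqr. Qed.

Lemma cabs_triangle a b : cabs (a + b) <= cabs a + cabs b.
Proof.
have := ler_normD a b.
by rewrite -![`| _ |]/((cabs _)%:C) -rmorphD lecR.
Qed.

Lemma cabsB_ge a b : cabs a - cabs b <= cabs (a - b).
Proof. by rewrite lerBlDr (le_trans _ (cabs_triangle _ _))// subrK. Qed.

Lemma cabsX a n : cabs (a ^+ n) = cabs a ^+ n.
Proof.
elim: n => [|n ih]; first by rewrite !expr0 Normc.normc1.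
by rewrite !exprS cabsM ih.
Qed.

Lemma cabs_sum (I : Type) (r : seq I) (P : pred I) (F : I -> R[i]) :
  cabs (\sum_(i <- r | P i) F i) <= \sum_(i <- r | P i) cabs (F i).
Proof.
elim/big_rec2 : _ => [|i x y _ xy]; first by rewrite Normc.normc0.
by rewrite (le_trans (cabs_triangle _ _))// lerD2l.
Qed.

Lemma Re_le_cabs a : `|complex.Re a| <= cabs a.
Proof. by case: a => x y /=; rewrite -sqrtr_sqr ler_wsqrtr// lerDl sqr_ge0. Qed.

Lemma Im_le_cabs a : `|complex.Im a| <= cabs a.
Proof. by case: a => x y /=; rewrite -sqrtr_sqr ler_wsqrtr// lerDr sqr_ge0. Qed.

Lemma cabs_le_ReIm a : cabs a <= `|complex.Re a| + `|complex.Im a|.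
Proof.
rewrite -(@ler_pXn2r _ 2)// ?nnegrE ?cabs_ge0 ?addr_ge0//.
rewrite cabs_sqr sqrrD !real_normK ?num_real// -addrA lerD2l lerDr.
by rewrite mulrn_wge0// mulr_ge0.
Qed.

Lemma cabs_eq0 a : (cabs a == 0) = (a == 0).
Proof.
by apply/eqP/eqP => [|->]; [exact: Normc.eq0_normc|exact: Normc.normc0].
Qed.

Lemma cReM a b : complex.Re (a * b) =
  complex.Re a * complex.Re b - complex.Im a * complex.Im b.
Proof. by case: a b => x y [u v]. Qed.

Lemma cImM a b : complex.Im (a * b) =
  complex.Re a * complex.Im b + complex.Im a * complex.Re b.
Proof. by case: a b => x y [u v]. Qed.

Lemma cReD a b : complex.Re (a + b) = complex.Re a + complex.Re b.
Proof. by case: a b => x y [u v]. Qed.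

Lemma cImD a b : complex.Im (a + b) = complex.Im a + complex.Im b.
Proof. by case: a b => x y [u v]. Qed.

Lemma cReN a : complex.Re (- a) = - complex.Re a.
Proof. by case: a. Qed.

Lemma cImN a : complex.Im (- a) = - complex.Im a.
Proof. by case: a. Qed.

Lemma cRe_mulrn a n : complex.Re (a *+ n) = complex.Re a *+ n.
Proof. by elim: n => // n ih; rewrite !mulrS cReD ih. Qed.

Lemma cRe_conj a : complex.Re (conjc a) = complex.Re a.
Proof. by case: a. Qed.

Lemma cIm_conj a : complex.Im (conjc a) = - complex.Im a.
Proof. by case: a. Qed.

Lemma cRe_sum (I : Type) (r : seq I) (P : pred I) (F : I -> R[i]) :
  complex.Re (\sum_(i <- r | P i) F i) = \sum_(i <- r | P i) complex.Re (F i).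
Proof. by elim/big_rec2 : _ => //= i x y _ <-; rewrite cReD. Qed.

Lemma cIm_sum (I : Type) (r : seq I) (P : pred I) (F : I -> R[i]) :
  complex.Im (\sum_(i <- r | P i) F i) = \sum_(i <- r | P i) complex.Im (F i).
Proof. by elim/big_rec2 : _ => //= i x y _ <-; rewrite cImD. Qed.

End complex_modulus.

Section hermitian.
Context {R : realType} {d : nat}.
Local Notation V := 'rV[R[i]]_d.
Implicit Types z w x : V.

Definition herm z w : R[i] := cdot z (conj_row w).

Lemma hermE z w : herm z w = \sum_j z 0 j * conjc (w 0 j).
Proof. by apply: eq_bigr => j _; rewrite mxE. Qed.

Lemma enorm_ge0 z : 0 <= enorm z.
Proof. exact: sqrtr_ge0. Qed.

Lemma enorm_sqr z : enorm z ^+ 2 = \sum_j cabs (z 0 j) ^+ 2.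
Proof. by rewrite sqr_sqrtr// sumr_ge0// => j _; exact: sqr_ge0. Qed.

Lemma hermDl z w x : herm (z + w) x = herm z x + herm w x.
Proof. by rewrite !hermE -big_split; apply: eq_bigr => j _; rewrite mxE mulrDl. Qed.

Lemma hermDr z w x : herm x (z + w) = herm x z + herm x w.
Proof.
rewrite !hermE -big_split; apply: eq_bigr => j _; rewrite mxE /= -mulrDr.
case: (z 0 j) (w 0 j) (x 0 j) => a b [c e] [f g].
by complex_ring.
Qed.

Lemma hermZl (a : R[i]) z x : herm (a *: z) x = a * herm z x.
Proof. by rewrite !hermE mulr_sumr; apply: eq_bigr => j _; rewrite mxE mulrA. Qed.

Lemma herm_conjC z w : herm z w = conjc (herm w z).
Proof.
apply/eqP; rewrite eq_complex; case E : (conjc (herm w z)) => [a b] /=.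
have := congr1 (@complex.Re R) E; have := congr1 (@complex.Im R) E.
rewrite cRe_conj cIm_conj /= !hermE !cRe_sum !cIm_sum => <- <-.
rewrite -sumrN; apply/andP; split; apply/eqP; apply: eq_bigr => j _.
  by rewrite !cReM !cRe_conj !cIm_conj; ring.
by rewrite !cImM !cRe_conj !cIm_conj; ring.
Qed.

Lemma hermZr (a : R[i]) z x : herm x (a *: z) = conjc a * herm x z.
Proof.
rewrite !hermE mulr_sumr; apply: eq_bigr => j _; rewrite mxE mulrCA.
by congr (_ * _); case: a (z 0 j) => a b [c e] /=; simpc; congr (_ +i* _); ring.
Qed.

Lemma hermNl z w : herm (- z) w = - herm z w.
Proof. by rewrite -scaleN1r hermZl mulN1r. Qed.

Lemma hermNr z w : herm z (- w) = - herm z w.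
Proof. by rewrite herm_conjC hermNl; case: (herm w z) (herm_conjC z w) => a b ->. Qed.

Lemma enormZ (a : R[i]) z : enorm (a *: z) = cabs a * enorm z.
Proof.
apply/eqP; rewrite -(@eqrXn2 _ 2)// ?mulr_ge0 ?cabs_ge0 ?enorm_ge0//.
rewrite exprMn !enorm_sqr mulr_sumr; apply/eqP/eq_bigr => j _.
by rewrite mxE cabsM exprMn.
Qed.

Lemma enormN z : enorm (- z) = enorm z.
Proof. by rewrite -scaleN1r enormZ cabsN Normc.normc1 mul1r. Qed.

Lemma enorm_sqrD z w :
  enorm (z + w) ^+ 2 = enorm z ^+ 2 + enorm w ^+ 2 + 2 * complex.Re (herm z w).
Proof.
rewrite !enorm_sqr hermE cRe_sum mulr_sumr -!big_split; apply: eq_bigr => j _ /=.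
by rewrite mxE !cabs_sqr cReM cRe_conj cIm_conj cReD cImD; ring.
Qed.

Lemma enorm_sqrB z w :
  enorm (z - w) ^+ 2 = enorm z ^+ 2 + enorm w ^+ 2 - 2 * complex.Re (herm z w).
Proof. by rewrite enorm_sqrD enormN hermNr cReN mulrN. Qed.

Lemma enorm0 : enorm (0 : V) = 0.
Proof. by rewrite -(scale0r (0 : V)) enormZ Normc.normc0 mul0r. Qed.

Lemma enorm_eq0 z : (enorm z == 0) = (z == 0).
Proof.
apply/eqP/eqP => [z0|->]; last exact: enorm0.
apply/rowP => j; rewrite mxE; apply/eqP; rewrite -cabs_eq0.
have := enorm_sqr z; rewrite z0 expr0n => /esym/eqP.
rewrite psumr_eq0; last by move=> i _; exact: sqr_ge0.
by move=> /allP/(_ j (mem_index_enum j)); rewrite sqrf_eq0.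
Qed.

Lemma herm0r z : herm z 0 = 0.
Proof.
by rewrite -(scale0r (0 : V)) hermZr (_ : conjc 0 = 0) ?mul0r// /conjc/= oppr0.
Qed.

Lemma herm_cauchy_schwarz z w : cabs (herm z w) <= enorm z * enorm w.
Proof.
have [->|w0] := eqVneq w 0; first by rewrite herm0r Normc.normc0 enorm0 mulr0.
have n0 : 0 < enorm w by rewrite lt_def enorm_eq0 w0 enorm_ge0.
rewrite -(@ler_pXn2r _ 2)// ?nnegrE ?mulr_ge0 ?cabs_ge0 ?enorm_ge0//.
rewrite exprMn.
have := sqr_ge0 (enorm (z - (herm z w / (enorm w ^+ 2)%:C) *: w)).
rewrite enorm_sqrB enormZ exprMn hermZr cReM cRe_conj cIm_conj cabsM cabsV cabsR.
rewrite ger0_norm ?sqr_ge0// -fmorphV.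
rewrite cabs_sqr; move: (herm z w) => [a b] /=.
set n := enorm w in n0 *; rewrite !mulr0 subr0 add0r => h.
suff -> : enorm z ^+ 2 * n ^+ 2 = a ^+ 2 + b ^+ 2 + n ^+ 2 *
   (enorm z ^+ 2 + (Num.sqrt (a ^+ 2 + b ^+ 2) / n ^+ 2) ^+ 2 * n ^+ 2 -
      2 * (a * n ^- 2 * a - - (b * n ^- 2) * b)).
  by rewrite lerDl mulr_ge0// sqr_ge0.
have s2 : Num.sqrt (a ^+ 2 + b ^+ 2) ^+ 2 = a ^+ 2 + b ^+ 2.
  by rewrite sqr_sqrtr ?addr_ge0 ?sqr_ge0.
rewrite [in RHS]expr_div_n s2; move: (enorm z) => Z.
by field; rewrite gt_eqF.
Qed.

Lemma enorm_triangle z w : enorm (z + w) <= enorm z + enorm w.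
Proof.
rewrite -(@ler_pXn2r _ 2)// ?nnegrE ?addr_ge0 ?enorm_ge0//.
rewrite enorm_sqrD sqrrD addrAC lerD2r lerD2l -[leRHS]mulr_natl ler_pM2l//.
rewrite (le_trans (ler_norm _))// (le_trans (Re_le_cabs _))//.
exact: herm_cauchy_schwarz.
Qed.

Lemma enormB_ge z w : `|enorm z - enorm w| <= enorm (z - w).
Proof.
have h x y : enorm x - enorm y <= enorm (x - y).
  by rewrite lerBlDr (le_trans _ (enorm_triangle _ _))// subrK.
by rewrite ler_norml h andbT lerNl opprB -(enormN (z - w)) opprB h.
Qed.

Lemma cabs_le_enorm z j : cabs (z 0 j) <= enorm z.
Proof.
rewrite -(@ler_pXn2r _ 2)// ?nnegrE ?cabs_ge0 ?enorm_ge0// enorm_sqr.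
by rewrite (bigD1 j)//= lerDl sumr_ge0// => i _; exact: sqr_ge0.
Qed.

Lemma enorm_le_sum z : enorm z <= \sum_j cabs (z 0 j).
Proof.
rewrite -(@ler_pXn2r _ 2)// ?nnegrE ?enorm_ge0 ?sumr_ge0//; last first.
  by move=> j _; exact: cabs_ge0.
rewrite enorm_sqr expr2 mulr_suml; apply: ler_sum => j _.
rewrite expr2 ler_wpM2l ?cabs_ge0//.
by rewrite (bigD1 j)//= lerDl sumr_ge0// => i _; exact: cabs_ge0.
Qed.

(** The denominators of the involution and of the Poisson-Szego kernel stay away
    from 0 as long as one of the two points is strictly inside the ball. *)
Lemma cabs_1herm_ge z w : 1 - enorm z * enorm w <= cabs (1 - herm z w).
Proof.
rewrite (le_trans _ (cabsB_ge _ _))// Normc.normc1 lerD2l lerN2.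
exact: herm_cauchy_schwarz.
Qed.

Lemma cabs_1herm_gt0 z w : enorm z * enorm w < 1 -> 0 < cabs (1 - herm z w).
Proof. by move=> h; rewrite (lt_le_trans _ (cabs_1herm_ge _ _))// subr_gt0. Qed.

Lemma cabs_1herm_le2 z w : enorm z <= 1 -> enorm w <= 1 -> cabs (1 - herm z w) <= 2.
Proof.
move=> z1 w1; rewrite (le_trans (cabs_triangle _ _))// Normc.normc1 cabsN.
rewrite (_ : 2 = 1 + 1)// lerD2l (le_trans (herm_cauchy_schwarz _ _))//.
by rewrite mulr_ile1 ?enorm_ge0.
Qed.

Lemma cabs_1hermC z w : cabs (1 - herm z w) = cabs (1 - herm w z).
Proof.
rewrite herm_conjC -[LHS]cabs_conj; congr cabs.
by case: (herm w z) => a b /=; simpc.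
Qed.

(** With the projection of z on the line of w written out, the numerator of the
    involution is a combination of w and z alone. *)
Lemma ball_involution_norm w z : enorm w < 1 -> enorm z < 1 ->
  1 - enorm (ball_involution w z) ^+ 2 =
  (1 - enorm w ^+ 2) * (1 - enorm z ^+ 2) / cabs (1 - herm z w) ^+ 2.
Proof.
move=> w1 z1; rewrite /ball_involution; case: ifPn => [/eqP ->|w0].
  by rewrite enormN enorm0 herm0r subr0 Normc.normc1 !expr1n divr1 expr0n/= subr0 mul1r.
have n0 : 0 < enorm w by rewrite lt_def enorm_eq0 w0 enorm_ge0.
rewrite -/(herm z w) enormZ.
have c0 : 0 < cabs (1 - herm z w).
  by rewrite cabs_1herm_gt0// mulr_ilt1 ?enorm_ge0.
set s := Num.sqrt _.
have s2 : s ^+ 2 = 1 - enorm w ^+ 2.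
  by rewrite sqr_sqrtr// subr_ge0 expr_le1// ?enorm_ge0 ?ltW.
rewrite exprMn cabsV exprVn.
set al : R[i] := herm z w / (enorm w ^+ 2)%:C.
have -> : w - al *: w - s%:C *: (z - al *: w) =
    (1 - al + s%:C * al) *: w + (- s%:C) *: z.
  rewrite scalerBr scalerDl scalerBl scale1r scaleNr opprB scalerA.
  by rewrite [RHS]addrAC !addrA [RHS]addrAC.
rewrite enorm_sqrD !enormZ hermZl hermZr cabsN cabsR ger0_norm ?sqrtr_ge0//.
rewrite !exprMn s2 (herm_conjC w z) mulrA /al.
have -> : cabs (1 - herm z w) ^+ 2 =
    1 - 2 * complex.Re (herm z w) + cabs (herm z w) ^+ 2.
  by rewrite !cabs_sqr; case: (herm z w) => a b /=; ring.
have : 1 - 2 * complex.Re (herm z w) + cabs (herm z w) ^+ 2 != 0.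
  have := sqr_ge0 (cabs (1 - herm z w)).
  have -> : 1 - 2 * complex.Re (herm z w) + cabs (herm z w) ^+ 2 =
    cabs (1 - herm z w) ^+ 2.
    by rewrite !cabs_sqr; case: (herm z w) => a b /=; ring.
  by rewrite sqrf_eq0 gt_eqF.
rewrite !cabs_sqr -fmorphV; case: (herm z w) => a b /=.
set n := enorm w in n0 s2 *; set Z := enorm z.
rewrite !(mulr0, mul0r, subr0, add0r, addr0, oppr0) => hden.
have -> : Z ^+ 2 = Z ^+ 2 by [].
have n2 : n ^+ 2 = 1 - s ^+ 2 by rewrite s2; ring.
have s2' : 1 - s ^+ 2 != 0 by rewrite -n2 sqrf_eq0 gt_eqF.
rewrite n2; field.
by rewrite hden s2'.
Qed.

End hermitian.

(** * Lebesgue measure and its symmetries *)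

Section lebesgue_tuple_integral.
Context {R : realType}.
Local Notation T := (measurableTypeR R).
Local Notation mu := (@lebesgue_measure R).
Local Open Scope ereal_scope.

Lemma integral_lebesgue_affine (t : R) (a : R) (F : T -> \bar R) : (0 < t)%R ->
  measurable_fun [set: T] F -> (forall x, 0 <= F x) ->
  t%:E * \int[mu]_x F (t * x + a)%R = \int[mu]_x F x.
Proof.
move=> t0 mF F0.
pose phi (x : T) : T := (t * x + a)%R.
have mphi : measurable_fun [set: T] phi.
  by apply: measurable_funD => //; exact: measurable_funM.
rewrite -[X in _ * X](@ge0_integral_pushforward _ _ T T R phi mphi mu setT F)//.
pose t' := NngNum (ltW t0).
rewrite (_ : \int[mu]_x F x =
    \int[mscale t' (measure_function_pushforward__canonical__measure_function_Measure
      mu mphi)]_x F x).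
  by rewrite ge0_integral_mscale.
apply: eq_measure_integral => A mA _; apply: lebesgue_measure_unique => //.
move=> _ [[u v] _ <-] /=; rewrite /mscale/= /pushforward.
rewrite (_ : phi @^-1` _ = `]((u - a) / t)%R, ((v - a) / t)%R]%classic); last first.
  apply/seteqP; split => x /=; rewrite !in_itv/= ltr_pdivrMr// ler_pdivlMr//;
  by rewrite ltrBlDr lerBrDr mulrC.
rewrite !lebesgue_measure_itv/= !lte_fin ltr_pM2r ?invr_gt0// ltrD2r.
case: ifPn => _; last by rewrite mule0.
rewrite -!EFinB -EFinM; congr (_%:E).
by rewrite -mulrBl opprB addrA subrK mulrC divfK// gt_eqF.
Qed.

Lemma integral_lebesgue_tuple0 (F : 0.-tuple T -> \bar R) :
  \int[lebesgue_tuple R 0]_u F u = F [tuple].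
Proof.
have mF : measurable_fun [set: 0.-tuple T] F.
  move=> _ Y _; rewrite setTI.
  have [h|h] := pselect (F [tuple] \in Y); last first.
    rewrite (_ : _ @^-1` _ = set0)//; apply/seteqP; split => // x /= Yx.
    by apply: h; rewrite inE; rewrite (tuple0 x) in Yx.
  rewrite (_ : _ @^-1` _ = setT)//; apply/seteqP; split => // x _ /=.
  by move: h; rewrite inE (tuple0 x).
by rewrite /= integral_dirac// diracT mul1e.
Qed.

Lemma integral_lebesgue_tuple_cons n (F : n.+1.-tuple T -> \bar R) :
  measurable_fun [set: n.+1.-tuple T] F -> (forall u, 0 <= F u) ->
  \int[lebesgue_tuple R n.+1]_u F u =
  \int[mu]_x \int[lebesgue_tuple R n]_u F [tuple of x :: u].
Proof.
move=> mF F0.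
pose c (p : T * n.-tuple T) : n.+1.-tuple T := [tuple of p.1 :: p.2].
have mc : measurable_fun [set: T * n.-tuple T] c by exact: measurable_cons.
transitivity (\int[pushforward (mu \x lebesgue_tuple R n) c]_u F u).
  exact: eq_measure_integral.
rewrite ge0_integral_pushforward// preimage_setT fubini_tonelli1//.
  exact: measurableT_comp.
by move=> p; exact: F0.
Qed.

Lemma measurable_cat_tuple m n : measurable_fun [set: m.-tuple T * n.-tuple T]
  (fun p => [tuple of p.1 ++ p.2]).
Proof.
elim: m => [|m ih].
  rewrite (_ : (fun p => _) = snd)//; apply/funext => -[a b] /=.
  by apply: val_inj => /=; rewrite (tuple0 a).
rewrite (_ : (fun p => _) = (fun p : m.+1.-tuple T * n.-tuple T =>
  [tuple of thead p.1 :: [tuple of [tuple of behead p.1] ++ p.2]])); last first.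
  by apply/funext => -[a b] /=; apply: val_inj => /=; case/tupleP : a.
apply: measurable_cons; first by apply: measurableT_comp => //; exact: measurable_tnth.
pose g (p : m.+1.-tuple T * n.-tuple T) := ([tuple of behead p.1], p.2).
have mg : measurable_fun setT g.
  apply: measurable_fun_pair => //.
  exact: (measurableT_comp (@measurable_behead _ _ _) measurable_fst).
exact: (measurableT_comp ih mg).
Qed.

Lemma integral_lebesgue_tuple_cat m n (F : (m + n).-tuple T -> \bar R) :
  measurable_fun [set: (m + n).-tuple T] F -> (forall u, 0 <= F u) ->
  \int[lebesgue_tuple R (m + n)]_u F u =
  \int[lebesgue_tuple R m]_a \int[lebesgue_tuple R n]_b F [tuple of a ++ b].
Proof.
elim: m F => [|m ih] F mF F0.
  rewrite integral_lebesgue_tuple0; apply: eq_integral => b _.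
  by congr F; exact: val_inj.
rewrite [LHS](@integral_lebesgue_tuple_cons (m + n))//.
rewrite integral_lebesgue_tuple_cons//; last first.
- by move=> a; exact: integral_ge0.
- apply: (measurable_fun_fubini_tonelli_F
    (fun p : m.+1.-tuple T * n.-tuple T => F [tuple of p.1 ++ p.2])) => //.
  exact: (measurableT_comp mF (@measurable_cat_tuple _ _)).
apply: eq_integral => x _.
transitivity (\int[lebesgue_tuple R m]_a \int[lebesgue_tuple R n]_b
    F [tuple of x :: [tuple of a ++ b]]).
  apply: (ih (fun u => F [tuple of x :: u])) => [|u]; last exact: F0.
  by apply: (measurableT_comp mF); exact: measurable_cons.
apply: eq_integral => a _; apply: eq_integral => b _.
by congr F; exact: val_inj.
Qed.

Let affine n (t : R) (a u : n.-tuple T) : n.-tuple T :=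
  [tuple (t * tnth u i + tnth a i)%R | i < n].

Let measurable_affine n t a : measurable_fun [set: n.-tuple T] (@affine n t a).
Proof.
apply/measurable_fun_tnthP => i.
rewrite (_ : _ \o _ = (fun u => t * tnth u i + tnth a i)%R); last first.
  by apply/funext => u /=; rewrite tnth_mktuple.
by apply: measurable_funD => //; apply: measurable_funM => //; exact: measurable_tnth.
Qed.

(** A translation followed by a dilation acts on each coordinate separately, so the
    one-dimensional substitution and Tonelli's theorem suffice. *)
Lemma integral_lebesgue_tuple_affine n (t : R) (a : n.-tuple T)
    (F : n.-tuple T -> \bar R) : (0 < t)%R ->
  measurable_fun [set: n.-tuple T] F -> (forall u, 0 <= F u) ->
  (t ^+ n)%:E * \int[lebesgue_tuple R n]_u F [tuple (t * tnth u i + tnth a i)%R | i < n]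
  = \int[lebesgue_tuple R n]_u F u.
Proof.
move=> t0; elim: n a F => [|n ih] a F mF F0.
  by rewrite !integral_lebesgue_tuple0 expr0 mul1e; congr F; apply/eq_from_tnth; case.
have mFa : measurable_fun [set: n.+1.-tuple T] (F \o @affine _ t a).
  by apply: measurableT_comp => //; exact: measurable_affine.
rewrite (integral_lebesgue_tuple_cons mFa)//; last by move=> u; exact: F0.
rewrite [RHS]integral_lebesgue_tuple_cons//.
case/tupleP : a mFa => a0 a mFa.
have mG : measurable_fun [set: T]
    (fun x => \int[lebesgue_tuple R n]_u F [tuple of x :: u]).
  apply: (measurable_fun_fubini_tonelli_F
    (fun p : T * n.-tuple T => F [tuple of p.1 :: p.2])) => //.
  by apply: (measurableT_comp mF); exact: measurable_cons.
rewrite -(integral_lebesgue_affine a0 t0 mG); last by move=> x; exact: integral_ge0.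
rewrite exprS EFinM -muleA; congr (_ * _).
rewrite -ge0_integralZl//; last 3 first.
- apply: (measurable_fun_fubini_tonelli_F
    (fun p : T * n.-tuple T => (F \o affine t [tuple of a0 :: a]) [tuple of p.1 :: p.2])) => //.
    by apply: (measurableT_comp mFa); exact: measurable_cons.
  by move=> p; exact: F0.
- by move=> x _; apply: integral_ge0 => u _; exact: F0.
- by rewrite lee_fin exprn_ge0// ltW.
apply: eq_integral => x _.
rewrite -(ih a (fun u => F [tuple of (t * x + a0)%R :: u])); last 2 first.
- by apply: (measurableT_comp mF); exact: measurable_cons.
- by move=> u; exact: F0.
congr (_ * _); apply: eq_integral => u _ /=; congr F.
apply: eq_from_tnth => i; rewrite tnth_mktuple.
case: (unliftP ord0 i) => [j ->|->]; last by rewrite !tnth0.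
by rewrite !tnthS tnth_mktuple.
Qed.

End lebesgue_tuple_integral.

Section measurability.
Context {R : realType} {d : nat}.
Local Notation V := 'rV[R[i]]_d.

Lemma measurable_Re_herm2 :
  measurable_fun [set: V * V] (fun p => complex.Re (herm p.1 p.2)).
Proof.
rewrite (_ : (fun p => _) = fun p : V * V => \sum_j
  (complex.Re (p.1 0 j) * complex.Re (p.2 0 j) +
   complex.Im (p.1 0 j) * complex.Im (p.2 0 j))); last first.
  apply/funext => p; rewrite hermE cRe_sum; apply: eq_bigr => j _.
  by rewrite cReM cRe_conj cIm_conj mulrN opprK.
apply: measurable_sum => j; apply: measurable_funD; apply: measurable_funM.
- exact: (measurableT_comp (measurable_Re_coord j) measurable_fst).
- exact: (measurableT_comp (measurable_Re_coord j) measurable_snd).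
- exact: (measurableT_comp (measurable_Im_coord j) measurable_fst).
- exact: (measurableT_comp (measurable_Im_coord j) measurable_snd).
Qed.

Lemma measurable_Im_herm2 :
  measurable_fun [set: V * V] (fun p => complex.Im (herm p.1 p.2)).
Proof.
rewrite (_ : (fun p => _) = fun p : V * V => \sum_j
  (complex.Im (p.1 0 j) * complex.Re (p.2 0 j) -
   complex.Re (p.1 0 j) * complex.Im (p.2 0 j))); last first.
  apply/funext => p; rewrite hermE cIm_sum; apply: eq_bigr => j _.
  by rewrite cImM cRe_conj cIm_conj mulrN addrC.
apply: measurable_sum => j; apply: measurable_funB; apply: measurable_funM.
- exact: (measurableT_comp (measurable_Im_coord j) measurable_fst).
- exact: (measurableT_comp (measurable_Re_coord j) measurable_snd).
- exact: (measurableT_comp (measurable_Re_coord j) measurable_fst).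
- exact: (measurableT_comp (measurable_Im_coord j) measurable_snd).
Qed.

Lemma measurable_sqrt : measurable_fun [set: R] (@Num.sqrt R).
Proof.
rewrite (_ : @Num.sqrt R = fun x => Num.max x 0 `^ 2^-1).
  apply: (measurableT_comp (measurable_powR _)).
  exact: measurable_maxr.
apply/funext => x; rewrite powR12_sqrt ?le_max ?lexx ?orbT//.
by case: (leP x 0) => // x0; rewrite ler0_sqrtr// sqrtr0.
Qed.

Lemma measurable_scale_shift (a : R[i]) (v : V) :
  measurable_fun [set: V] (fun w => a *: w + v).
Proof.
apply: measurable_to_row => j.
  rewrite [X in measurable_fun _ X](_ : _ = (fun t : V => (complex.Re a * complex.Re (t 0 j) -
    complex.Im a * complex.Im (t 0 j)) + complex.Re (v 0 j))).
    apply: measurable_funD => //; apply: measurable_funB; apply: measurable_funM => //;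
    by [exact: measurable_Re_coord|exact: measurable_Im_coord].
  by apply/funext => t; rewrite !mxE cReD cReM.
rewrite [X in measurable_fun _ X](_ : _ = (fun t : V => (complex.Re a * complex.Im (t 0 j) +
  complex.Im a * complex.Re (t 0 j)) + complex.Im (v 0 j))).
  apply: measurable_funD => //; apply: measurable_funD; apply: measurable_funM => //;
  by [exact: measurable_Re_coord|exact: measurable_Im_coord].
by apply/funext => t; rewrite !mxE cImD cImM.
Qed.

End measurability.

Section lebesgue_C_integral.
Context {R : realType} {d : nat}.
Local Notation V := 'rV[R[i]]_d.
Local Notation T := (measurableTypeR R).
Local Notation Leb := (@lebesgue_C R d).
Local Open Scope ereal_scope.
Implicit Types F : V -> \bar R.

Lemma integral_lebesgue_C F : measurable_fun [set: V] F -> (forall u, 0 <= F u) ->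
  \int[Leb]_w F w = \int[lebesgue_tuple R (d + d)]_u F (row_of_tuple u).
Proof.
move=> mF F0.
rewrite -[LHS]/(\int[pushforward (lebesgue_tuple R (d + d)) (@row_of_tuple R d)]_w F w).
by rewrite ge0_integral_pushforward//; exact: measurable_row_of_tuple.
Qed.

Lemma lebesgue_C_affine (t : R) (a : V) F : (0 < t)%R ->
  measurable_fun [set: V] F -> (forall u, 0 <= F u) ->
  (t ^+ (2 * d))%:E * \int[Leb]_w F (t%:C *: w + a)%R = \int[Leb]_w F w.
Proof.
move=> t0 mF F0; rewrite mul2n -addnn.
rewrite (@integral_lebesgue_C (fun w => F (t%:C *: w + a)%R)); last 2 first.
- by apply: (measurableT_comp mF); exact: measurable_scale_shift.
- by move=> u; exact: F0.
rewrite integral_lebesgue_C//.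
pose b : (d + d).-tuple T := [tuple match fintype.split i with
  | inl j => complex.Re (a 0%R j) | inr j => complex.Im (a 0%R j) end | i < d + d].
rewrite -(@integral_lebesgue_tuple_affine _ _ t b (F \o row_of_tuple))//.
- congr (_ * _); apply: eq_integral => u _ /=; congr F; apply/rowP => j.
  rewrite !mxE !tnth_mktuple; case: splitP => [k|k] /=.
    move/val_inj => <-; case: splitP => [l /= /eqP|l /= /eqP].
      by rewrite gtn_eqF// (leq_trans (ltn_ord l))// leq_addr.
    rewrite eqn_add2l => /eqP/val_inj <-.
    by case: (a 0%R j) => x y; complex_ring.
  by move=> /eqP; rewrite ltn_eqF// (leq_trans (ltn_ord j))// leq_addr.
- apply: (measurableT_comp mF); exact: measurable_row_of_tuple.
- by move=> u; exact: F0.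
Qed.

Let shear_re (k : R) (w : V) : V :=
  (\row_j ((complex.Re (w 0 j) + k * complex.Im (w 0 j)) +i* complex.Im (w 0 j)))%R.
Let shear_im (k : R) (w : V) : V :=
  (\row_j (complex.Re (w 0 j) +i* (complex.Im (w 0 j) + k * complex.Re (w 0 j))))%R.

Let measurable_shear_re k : measurable_fun [set: V] (shear_re k).
Proof.
apply: measurable_to_row => j; under eq_fun do rewrite mxE/=.
  apply: measurable_funD; first exact: measurable_Re_coord.
  by apply: measurable_funM => //; exact: measurable_Im_coord.
exact: measurable_Im_coord.
Qed.

Let measurable_shear_im k : measurable_fun [set: V] (shear_im k).
Proof.
apply: measurable_to_row => j; under eq_fun do rewrite mxE/=.
  exact: measurable_Re_coord.
apply: measurable_funD; first exact: measurable_Im_coord.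
by apply: measurable_funM => //; exact: measurable_Re_coord.
Qed.

Let row2 (p : d.-tuple T * d.-tuple T) : V := row_of_tuple [tuple of p.1 ++ p.2].

Let measurable_row2 : measurable_fun [set: d.-tuple T * d.-tuple T] row2.
Proof.
exact: (measurableT_comp measurable_row_of_tuple (@measurable_cat_tuple R d d)).
Qed.

Let row2E p j : row2 p 0%R j = (tnth p.1 j +i* tnth p.2 j)%C.
Proof.
rewrite mxE !(tnth_nth 0%R) /= !nth_cat /= !size_tuple ltn_ord.
by rewrite ltnNge leq_addr /= addKn.
Qed.

Let integral_row2 F : measurable_fun [set: V] F -> (forall u, 0 <= F u) ->
  \int[Leb]_w F w =
  \int[lebesgue_tuple R d]_a \int[lebesgue_tuple R d]_b F (row2 (a, b)).
Proof.
move=> mF F0; rewrite integral_lebesgue_C// integral_lebesgue_tuple_cat//.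
by apply: (measurableT_comp mF); exact: measurable_row_of_tuple.
Qed.

Let tuple_shift (k : R) (b : d.-tuple T) (G : d.-tuple T -> \bar R) :
  measurable_fun [set: d.-tuple T] G -> (forall u, 0 <= G u) ->
  \int[lebesgue_tuple R d]_a G [tuple (tnth a i + k * tnth b i)%R | i < d]
  = \int[lebesgue_tuple R d]_a G a.
Proof.
move=> mG G0.
pose c : d.-tuple T := [tuple (k * tnth b i)%R | i < d].
rewrite -(@integral_lebesgue_tuple_affine _ _ 1 c G)// expr1n mul1e.
apply: eq_integral => a _; congr G; apply: eq_from_tnth => i.
by rewrite !tnth_mktuple mul1r.
Qed.

(** For fixed imaginary parts this shear translates the real parts. *)
Lemma lebesgue_C_shear_re k F : measurable_fun [set: V] F -> (forall u, 0 <= F u) ->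
  \int[Leb]_w F (shear_re k w) = \int[Leb]_w F w.
Proof.
move=> mF F0; rewrite !integral_row2//; last first.
  exact: (measurableT_comp mF (measurable_shear_re k)).
have mFr : measurable_fun [set: d.-tuple T * d.-tuple T] (F \o row2).
  exact: (measurableT_comp mF measurable_row2).
have mFs : measurable_fun [set: d.-tuple T * d.-tuple T] (F \o shear_re k \o row2).
  exact: (measurableT_comp (measurableT_comp mF (measurable_shear_re k)) measurable_row2).
rewrite (fubini_tonelli (F \o shear_re k \o row2))//; last by move=> p; exact: F0.
rewrite (fubini_tonelli (F \o row2))//; last by move=> p; exact: F0.
apply: eq_integral => b _.
rewrite -(@tuple_shift k b (fun a => F (row2 (a, b)))) => [||u]; last 2 first.
- exact: (measurableT_comp mFr (measurable_pair2 b)).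
- exact: F0.
apply: eq_integral => a _ /=; congr F; apply/rowP => j.
by rewrite mxE !row2E/= tnth_mktuple.
Qed.

Lemma lebesgue_C_shear_im k F : measurable_fun [set: V] F -> (forall u, 0 <= F u) ->
  \int[Leb]_w F (shear_im k w) = \int[Leb]_w F w.
Proof.
move=> mF F0; rewrite !integral_row2//; last first.
  exact: (measurableT_comp mF (measurable_shear_im k)).
have mFr : measurable_fun [set: d.-tuple T * d.-tuple T] (F \o row2).
  exact: (measurableT_comp mF measurable_row2).
apply: eq_integral => a _.
rewrite -(@tuple_shift k a (fun b => F (row2 (a, b)))) => [||u]; last 2 first.
- exact: (measurableT_comp mFr (measurable_pair1 a)).
- exact: F0.
apply: eq_integral => b _ /=; congr F; apply/rowP => j.
by rewrite mxE !row2E/= tnth_mktuple.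
Qed.

Let rotation_gen (c : R[i]) F : (cabs c = 1)%R -> (complex.Im c != 0)%R ->
  measurable_fun [set: V] F -> (forall u, 0 <= F u) ->
  \int[Leb]_w F (c *: w)%R = \int[Leb]_w F w.
Proof.
case: c => p q /= pq q0 mF F0; pose m := ((p - 1) / q)%R.
have {}pq : (p ^+ 2 + q ^+ 2 = 1)%R.
  by rewrite -[LHS]sqr_sqrtr ?pq ?expr1n// addr_ge0 ?sqr_ge0.
have mF1 := measurableT_comp mF (measurable_shear_re m).
have mF2 := measurableT_comp mF1 (measurable_shear_im q).
have := lebesgue_C_shear_re m mF F0.
have := lebesgue_C_shear_im q mF1 (fun=> F0 _).
have := lebesgue_C_shear_re m mF2 (fun=> F0 _).
move=> /= h1 h2 h3; rewrite -h3 -h2 -h1.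
apply: eq_integral => w _ /=; congr F; apply/rowP => j; rewrite !mxE/=.
case: (w 0%R j) => x y /=; simpc.
have qm : (q * m = p - 1)%R by rewrite /m mulrCA divff// mulr1.
have mm : (m * (p + 1) = - q)%R.
  apply: (mulfI q0); rewrite mulrA qm.
  by transitivity (p ^+ 2 - 1)%R; [ring|rewrite -pq; ring].
apply/eqP; rewrite eq_complex /=; apply/andP; split; apply/eqP.
  transitivity (x + q * m * x + (m * (q * m + 2)) * y)%R; last by ring.
  have mm2 : (m * (p - 1 + 2) = - q)%R by rewrite -mm; ring.
  by rewrite qm mm2; ring.
transitivity (q * x + (q * m) * y + y)%R; last by ring.
by rewrite qm; ring.
Qed.

(** A rotation by a unit complex number is a product of three shears, each of
    which is a translation once the other half of the coordinates is fixed. *)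
Lemma lebesgue_C_rotation (c : R[i]) F : (cabs c = 1)%R ->
  measurable_fun [set: V] F -> (forall u, 0 <= F u) ->
  \int[Leb]_w F (c *: w)%R = \int[Leb]_w F w.
Proof.
move=> c1 mF F0; have [q0|] := eqVneq (complex.Im c) 0%R; last first.
  by move=> ?; exact: rotation_gen.
have : (complex.Re c ^+ 2 = 1)%R.
  by rewrite -[RHS](expr1n _ 2) -c1 cabs_sqr q0 expr0n addr0.
have mFc (b : R[i]) : measurable_fun [set: V] (fun w => F (b *: w)%R).
  apply: (measurableT_comp mF); have := measurable_scale_shift b (0%R : V).
  by under eq_fun do rewrite addr0.
have i1 : (cabs ('i : R[i]) = 1)%R by rewrite /= expr0n add0r expr1n sqrtr1.
move=> /eqP; rewrite sqrf_eq1 => /orP[] /eqP re.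
  apply: eq_integral => w _; rewrite (_ : c = 1%R) ?scale1r//.
  by apply/eqP; rewrite eq_complex re q0 /= !eqxx.
rewrite -[RHS](@rotation_gen 'i)//= ?oner_neq0//.
rewrite -[RHS](@rotation_gen 'i (fun w => F ('i *: w)%R))//= ?oner_neq0//.
apply: eq_integral => w _; rewrite scalerA (_ : c = 'i * 'i)%R//.
by apply/eqP; rewrite eq_complex re q0 /= !mul0r !mulr0 mul1r sub0r addr0 !eqxx.
Qed.

End lebesgue_C_integral.

(** * Volume of the ball *)

Section ball_volume.
Context {R : realType}.
Local Notation T := (measurableTypeR R).
Local Open Scope ereal_scope.

Let tuple_sqr n (u : n.-tuple T) : R := (\sum_(i < n) tnth u i ^+ 2)%R.

Let measurable_gauss n :
  measurable_fun [set: n.-tuple T] (fun u => (expR (- tuple_sqr u))%:E).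
Proof.
apply/measurable_EFinP; apply: measurableT_comp => //; apply: measurableT_comp => //.
apply: measurable_sum => i; apply: measurable_funX; exact: measurable_tnth.
Qed.

Let integral_tuple_gauss n :
  \int[lebesgue_tuple R n]_u (expR (- tuple_sqr u))%:E = (Num.sqrt pi ^+ n)%:E.
Proof.
elim: n => [|n ih].
  by rewrite integral_lebesgue_tuple0 /tuple_sqr big_ord0 oppr0 expR0 expr0.
rewrite integral_lebesgue_tuple_cons//.
transitivity (\int[@lebesgue_measure R]_x ((Num.sqrt pi ^+ n)%:E * (gauss_fun x)%:E)).
  apply: eq_integral => x _.
  transitivity (\int[lebesgue_tuple R n]_u
      ((gauss_fun x)%:E * (expR (- tuple_sqr u))%:E)).
    apply: eq_integral => u _; rewrite -EFinM /gauss_fun -expRD; congr (expR _)%:E.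
    rewrite /tuple_sqr big_ord_recl tnth0 opprD; congr (_ - _)%R.
    by apply: eq_bigr => i _; rewrite tnthS.
  rewrite ge0_integralZl//; last 2 first.
  - exact: measurable_gauss.
  - by rewrite lee_fin gauss_fun_ge0.
  by rewrite ih muleC.
rewrite ge0_integralZl//; last 2 first.
- by apply/measurable_EFinP; exact: measurable_gauss_fun.
- by move=> x _; rewrite lee_fin gauss_fun_ge0.
by rewrite integralT_gauss -EFinM -exprSr.
Qed.

Context {d : nat}.
Local Notation V := 'rV[R[i]]_d.
Local Notation Leb := (@lebesgue_C R d).

(** A product of 2d Gaussian integrals over the line. *)
Lemma integral_gauss :
  \int[Leb]_w (expR (- enorm w ^+ 2))%:E = (pi ^+ d)%:E.
Proof.
rewrite integral_lebesgue_C; last 2 first.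
- apply/measurable_EFinP; apply: measurableT_comp => //; apply: measurableT_comp => //.
  by apply: measurable_funX; exact: measurable_enorm.
- by move=> u; rewrite lee_fin expR_ge0.
rewrite -[RHS]/(((pi : R) ^+ d)%:E) -[in RHS](sqr_sqrtr (pi_ge0 R)) -exprM mul2n -addnn.
rewrite -integral_tuple_gauss; apply: eq_integral => u _; congr (expR (- _))%:E.
rewrite enorm_sqr /tuple_sqr [in RHS]big_split_ord /= -[RHS]big_split /=.
apply: eq_bigr => j _.
by rewrite mxE cabs_sqr.
Qed.

Lemma measurable_enorm_lt (t : R) : measurable [set w : V | (enorm w < t)%R].
Proof.
rewrite (_ : [set _ | _] = setT `&` @enorm R d @^-1` `]-oo, t[).
  by apply: measurable_enorm.
by apply/seteqP; split => w /=; rewrite in_itv/=; tauto.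
Qed.

Lemma measurable_enorm_le (t : R) : measurable [set w : V | (enorm w <= t)%R].
Proof.
rewrite (_ : [set _ | _] = setT `&` @enorm R d @^-1` `]-oo, t]).
  by apply: measurable_enorm.
by apply/seteqP; split => w /=; rewrite in_itv/=; tauto.
Qed.

Lemma sphere_projZ (t : R) (w : V) : (0 < t)%R -> sphere_proj (t%:C *: w) = sphere_proj w.
Proof.
move=> t0; rewrite /sphere_proj enormZ cabsR gtr0_norm// scalerA -rmorphM.
by rewrite invfM mulrAC mulVf ?gt_eqF// mul1r.
Qed.

(** The dilation by t maps the cone truncated at radius 1 onto the cone truncated at t. *)
Lemma lebesgue_cone (t : R) (A : set V) : (0 < t)%R -> measurable A ->
  Leb ([set w | (enorm w < t)%R] `&` sphere_proj @^-1` A) =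
  (t ^+ (2 * d))%:E * Leb (unit_ball `&` sphere_proj @^-1` A).
Proof.
move=> t0 mA.
have mpA : measurable (@sphere_proj R d @^-1` A).
  by rewrite -[X in measurable X]setTI; exact: measurable_sphere_proj.
have mcone (r : R) : measurable ([set w : V | (enorm w < r)%R] `&` sphere_proj @^-1` A).
  by apply: measurableI => //; exact: measurable_enorm_lt.
have mi (D : set V) : measurable D -> measurable_fun setT (fun w => (\1_D w : R)%:E).
  by move=> mD; apply/measurable_EFinP; exact: measurable_indic.
have iE (D : set V) : measurable D -> Leb D = \int[Leb]_w (\1_D w)%:E.
  by move=> mD; rewrite integral_indic// setIT.
rewrite (iE _ (mcone t)).
rewrite -(@lebesgue_C_affine R d t 0%R _ t0 (mi _ (mcone t)))//.
rewrite [in RHS](iE _ (mcone 1%R)).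
congr (_ * _); apply: eq_integral => w _; congr _%:E; rewrite !indicE; congr ((nat_of_bool _)%:R).
apply/idP/idP; rewrite !inE /= addr0 sphere_projZ// enormZ cabsR gtr0_norm//.
  by rewrite gtr_pMr.
by rewrite /unit_ball/= gtr_pMr.
Qed.

Lemma lebesgue_ball (t : R) : (0 < t)%R ->
  Leb [set w | (enorm w < t)%R] = (t ^+ (2 * d))%:E * Leb unit_ball.
Proof.
by move=> t0; have := lebesgue_cone t0 measurableT; rewrite preimage_setT !setIT.
Qed.

(** The Gaussian density is at least 1/e on the ball and has finite integral. *)
Lemma lebesgue_unit_ball_lty : Leb unit_ball < +oo.
Proof.
have h : (expR (-1))%:E * Leb unit_ball <= (pi ^+ d : R)%:E.
  rewrite -integral_gauss -integral_cst; last exact: measurable_unit_ball.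
  apply: (@le_trans _ _ (\int[Leb]_(w in unit_ball) (expR (- enorm w ^+ 2))%:E)).
    apply: ge0_le_integral => //.
    - exact: measurable_unit_ball.
    - by move=> w _; rewrite lee_fin expR_ge0.
    - apply/measurable_EFinP; apply: measurableT_comp => //; apply: measurableT_comp => //.
      by apply: measurable_funX; apply: measurable_funTS; exact: measurable_enorm.
    - move=> w; rewrite /unit_ball/= lee_fin ler_expR lerN2 => w1.
      by rewrite expr_le1// ?enorm_ge0// ltW.
  apply: ge0_subset_integral => //; first exact: measurable_unit_ball.
  apply/measurable_EFinP; apply: measurableT_comp => //; apply: measurableT_comp => //.
  by apply: measurable_funX; exact: measurable_enorm.
rewrite ltNge leye_eq; apply/negP => /eqP E; move: h; rewrite E.
by rewrite gt0_muley ?lte_fin ?expR_gt0// leye_eq.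
Qed.

Lemma lebesgue_unit_ball_gt0 : 0 < Leb unit_ball.
Proof.
rewrite lt0e measure_ge0 andbT; apply/eqP => B0.
have : Leb setT = 0.
  rewrite (_ : setT = \bigcup_n [set w : V | (enorm w < n.+1%:R)%R]).
    apply/negligibleP; first by apply: bigcupT_measurable => n; exact: measurable_enorm_lt.
    apply: negligible_bigcup => n; apply/negligibleP; first exact: measurable_enorm_lt.
    by rewrite [LHS]lebesgue_ball// B0 mule0.
  apply/seteqP; split => // w _; exists (Num.truncn (enorm w)) => //=.
  exact: truncnS_gt.
move=> L0; have := integral_gauss; rewrite (@eq_measure_integral _ _ _ _ mzero).
  by rewrite integral_measure_zero => -[] /esym/eqP; rewrite gt_eqF// exprn_gt0// pi_gt0.
move=> A mA _; apply/eqP; rewrite eq_le measure_ge0 andbT -[leRHS]/(0%E) -L0.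
by apply: le_measure; rewrite ?inE.
Qed.

Definition ball_volume : R := fine (Leb unit_ball).

Lemma ball_volumeE : ball_volume%:E = Leb unit_ball.
Proof. by rewrite fineK// ge0_fin_numE// lebesgue_unit_ball_lty. Qed.

Lemma ball_volume_gt0 : (0 < ball_volume)%R.
Proof. by rewrite -lte_fin ball_volumeE lebesgue_unit_ball_gt0. Qed.

Lemma normalized_lebesgueE (A : set V) :
  normalized_lebesgue A = (ball_volume^-1)%:E * Leb A.
Proof. by []. Qed.

Lemma normalized_lebesgue_unit_ball : normalized_lebesgue (@unit_ball R d) = 1.
Proof.
rewrite normalized_lebesgueE -ball_volumeE -EFinM mulVf//.
by rewrite gt_eqF// ball_volume_gt0.
Qed.

Lemma surface_measureE (A : set V) :
  surface_measure A = (ball_volume^-1)%:E * Leb (unit_ball `&` sphere_proj @^-1` A).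
Proof. by rewrite setIC. Qed.

Lemma surface_measureT : surface_measure [set: V] = 1.
Proof.
by rewrite surface_measureE preimage_setT setIT -normalized_lebesgue_unit_ball.
Qed.

HB.instance Definition _ :=
  Measure_isProbability.Build _ _ _ (@surface_measure R d) surface_measureT.

End ball_volume.

(** * Polar coordinates *)

Section polar_coordinates.
Context {R : realType} {d : nat}.
Hypothesis d_gt0 : (0 < d)%N.
Local Notation V := 'rV[R[i]]_d.
Local Notation T := (measurableTypeR R).
Local Notation Leb := (@lebesgue_C R d).
Local Notation sigma := (@surface_measure R d).
Local Open Scope ereal_scope.

Let half_line : measurable (`[0%R, +oo[%classic : set T).
Proof. exact: measurable_itv. Qed.

(** By homogeneity the law of the 2d-th power of the radius has constant density. *)
Definition radial_measure : set T -> \bar R :=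
  mscale (NngNum (ltW (@ball_volume_gt0 R d))) (mrestr lebesgue_measure half_line).

HB.instance Definition _ := Measure.copy radial_measure
  (mscale (NngNum (ltW (@ball_volume_gt0 R d))) (mrestr lebesgue_measure half_line)).

Lemma radial_measureE (A : set T) :
  radial_measure A = (@ball_volume R d)%:E * lebesgue_measure (A `&` `[0%R, +oo[).
Proof. by []. Qed.

Lemma radial_measure_lt (x : R) : (0 <= x)%R ->
  radial_measure `]-oo, x[ = (@ball_volume R d * x)%:E.
Proof.
move=> x0; rewrite radial_measureE.
rewrite (_ : _ `&` _ = `[0%R, x[%classic); last first.
  by apply/seteqP; split => y /=; rewrite !in_itv/= andbT;
    [move=> [-> ->]|move=> /andP[-> ->]].
rewrite lebesgue_measure_itv/= lte_fin; case: ltP => [_|]; first by rewrite oppr0 adde0.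
by move=> x0'; rewrite (@le_anti _ _ x 0%R) ?x0 ?x0'// mule0 mulr0.
Qed.

Let radial_measure_sigma_finite : sigma_finite [set: T] radial_measure.
Proof.
exists (fun n => `]-oo, n%:R[%classic).
  apply/esym/seteqP; split => // x _; exists (Num.truncn x).+1 => //=.
  by rewrite in_itv/= truncnS_gt.
by move=> n; split; [exact: measurable_itv|rewrite radial_measure_lt// ltry].
Qed.

HB.instance Definition _ := Measure_isSigmaFinite.Build _ _ _ radial_measure
  radial_measure_sigma_finite.

Lemma measurable_enormX n : measurable_fun [set: V] (fun w => enorm w ^+ n)%R.
Proof. by apply: measurable_funX; exact: measurable_enorm. Qed.

Let phi (w : V) : T * V := (enorm w ^+ (2 * d), sphere_proj w)%R.

Let measurable_phi : measurable_fun [set: V] phi.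
Proof.
apply: measurable_fun_pair; [exact: measurable_enormX|exact: measurable_sphere_proj].
Qed.

Let root_exists (x : R) : (0 < x)%R -> exists2 t : R, (0 < t)%R & (t ^+ (2 * d) = x)%R.
Proof.
move=> x0; exists (x `^ ((2 * d)%:R)^-1)%R; first exact: powR_gt0.
rewrite -powR_mulrn ?powR_ge0// -powRrM mulVf ?powRr1 ?ltW//.
by rewrite pnatr_eq0 muln_eq0 negb_or/= -lt0n.
Qed.

Lemma measurable_preimage_proj (A : set V) : measurable A ->
  measurable (@sphere_proj R d @^-1` A).
Proof.
by move=> mA; rewrite -[X in measurable X]setTI; exact: measurable_sphere_proj.
Qed.

Let radial_cone (A2 : set V) (A1 : set T) : measurable A2 -> measurable A1 ->
  Leb ((fun w => enorm w ^+ (2 * d))%R @^-1` A1 `&` sphere_proj @^-1` A2) =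
  radial_measure A1 * sigma A2.
Proof.
move=> mA2 mA1; have mp := measurable_preimage_proj mA2.
have sA2 : sigma A2 \is a fin_num by exact: fin_num_measure.
have mX : measurable_fun [set: V] (fun w => enorm w ^+ (2 * d) : T)%R.
  exact: measurable_enormX.
pose m1 : {measure set T -> \bar R} :=
  measure_function_pushforward__canonical__measure_function_Measure (mrestr Leb mp) mX.
have s0 : (0 <= fine (sigma A2))%R by rewrite fine_ge0.
pose m2 : {measure set T -> \bar R} := mscale (NngNum s0) radial_measure.
transitivity (m1 A1); first by [].
transitivity (m2 A1); last first.
  by rewrite -[LHS]/((fine (sigma A2))%:E * radial_measure A1) fineK// muleC.
apply: (@measure_unique _ R T (@RGenInftyO.G R) (fun k => `]-oo, k%:R[%classic)) => //.
- exact: RGenInftyO.measurableE.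
- move=> _ _ [x ->] [y ->]; exists (Order.min x y).
  by apply/seteqP; split => z /=; rewrite !in_itv/= lt_min => /andP.
- by move=> k; exists k%:R.
- apply/seteqP; split => // x _; exists (Num.truncn x).+1 => //=.
  by rewrite in_itv/= truncnS_gt.
- move=> _ [x ->]; 
  rewrite -[RHS]/((fine (sigma A2))%:E * radial_measure `]-oo, x[) fineK//.
  rewrite /m1/= /pushforward /mrestr/=.
  have [x0|x0] := leP x 0%R.
    rewrite (_ : _ `&` _ = set0) ?measure0; last first.
      apply/seteqP; split => // w [/=]; rewrite in_itv/= => + _.
      by rewrite ltNge (le_trans x0)// exprn_ge0// enorm_ge0.
    rewrite radial_measureE (_ : _ `&` _ = set0) ?measure0 ?mule0//.
    apply/seteqP; split => // y [/=]; rewrite !in_itv/= andbT => yx y0.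
    by have := lt_le_trans yx x0; rewrite ltNge y0.
  rewrite radial_measure_lt ?ltW//; have [t t0 <-] := root_exists x0.
  rewrite (_ : _ `&` _ = [set w | (enorm w < t)%R] `&` sphere_proj @^-1` A2); last first.
    rewrite /preimage/=; apply/seteqP; split => w /=;
    by rewrite in_itv/= ltr_pXn2r ?nnegrE ?enorm_ge0 ?ltW// muln_gt0.
  rewrite lebesgue_cone// surface_measureE [RHS]muleAC -EFinM mulrA.
  by rewrite mulVf ?mul1r// gt_eqF// ball_volume_gt0.
- move=> k; rewrite /m1/= /pushforward /mrestr/=.
  have kp : (0 < k.+1%:R :> R)%R by [].
  apply: (@le_lt_trans _ _ (Leb [set w | (enorm w < k.+1%:R)%R])).
    apply: le_measure; rewrite ?inE; [|exact: measurable_enorm_lt|].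
      apply: measurableI => //; rewrite -[X in measurable X]setTI.
      by apply: measurable_enormX => //; exact: measurable_itv.
    move=> w [/=]; rewrite in_itv/= => h _; rewrite ltNge; apply/negP => kw.
    have k1 : (1 <= k.+1%:R :> R)%R by rewrite ler1n.
    have kk : (k%:R <= k.+1%:R :> R)%R by rewrite ler_nat.
    have := lt_le_trans h kk; rewrite ltNge => /negP; apply; rewrite (le_trans kw)//.
    by rewrite ler_eXnr ?(le_trans k1)// muln_gt0.
  by rewrite lebesgue_ball// lte_mul_pinfty// ?lebesgue_unit_ball_lty.
Qed.

(** The two measures agree on products of a half-line and a set of directions, since
    the measure of a truncated cone is proportional to the 2d-th power of its radius. *)
Theorem integral_polar (F : T * V -> \bar R) :
  measurable_fun [set: T * V] F -> (forall p, 0 <= F p) ->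
  \int[Leb]_w F (enorm w ^+ (2 * d), sphere_proj w)%R =
  \int[radial_measure]_y \int[sigma]_xi F (y, xi).
Proof.
move=> mF F0.
transitivity (\int[pushforward Leb phi]_p F p).
  by rewrite [RHS](@ge0_integral_pushforward _ _ _ _ R phi measurable_phi Leb).
rewrite -[RHS](fubini_tonelli1 (m1 := radial_measure) (m2 := sigma) F)//.
pose m' := measure_function_pushforward__canonical__measure_function_Measure
  Leb measurable_phi.
apply: eq_measure_integral => A mA _.
apply/esym/(@product_measure_unique _ _ _ _ _ radial_measure sigma m') => //.
by move=> A1 A2 mA1 mA2; rewrite -radial_cone.
Qed.

(** Radius and direction are independent under Lebesgue measure. *)
Theorem integral_direction (f : V -> \bar R) :
  measurable_fun [set: V] f -> (forall w, 0 <= f w) ->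
  \int[Leb]_w f w = \int[Leb]_w \int[sigma]_xi f ((enorm w)%:C *: xi)%R.
Proof.
move=> mf f0; pose r (y : R) := (y `^ ((2 * d)%:R)^-1)%R.
have rK (w : V) : r (enorm w ^+ (2 * d))%R = enorm w.
  rewrite /r -powR_mulrn ?enorm_ge0// -powRrM mulfV ?powRr1 ?enorm_ge0//.
  by rewrite pnatr_eq0 muln_eq0 negb_or/= -lt0n.
have mr : measurable_fun [set: R] r by exact: measurable_powR.
pose F (p : T * V) := f ((r p.1)%:C *: p.2)%R.
have mF : measurable_fun [set: T * V] F.
  apply: (measurableT_comp mf); apply: measurable_to_row => j.
    rewrite [X in measurable_fun _ X](_ : _ = fun p : T * V =>
      (r p.1 * complex.Re (p.2 0%R j))%R); last first.
      by apply/funext => p; rewrite mxE cReM/= mul0r subr0.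
    apply: measurable_funM; first exact: measurableT_comp.
    exact: (measurableT_comp (measurable_Re_coord j) measurable_snd).
  rewrite [X in measurable_fun _ X](_ : _ = fun p : T * V =>
    (r p.1 * complex.Im (p.2 0%R j))%R); last first.
    by apply/funext => p; rewrite mxE cImM/= mul0r addr0.
  apply: measurable_funM; first exact: measurableT_comp.
  exact: (measurableT_comp (measurable_Im_coord j) measurable_snd).
transitivity (\int[Leb]_w F (enorm w ^+ (2 * d), sphere_proj w)%R).
  apply: eq_integral => w _; rewrite /F/= rK; congr f.
  rewrite /sphere_proj scalerA; have [->|w0] := eqVneq w 0%R; first by rewrite scaler0.
  by rewrite -rmorphM mulfV ?scale1r// enorm_eq0.
rewrite integral_polar//; last by move=> p; exact: f0.
pose G (p : T * V) := \int[sigma]_xi F (p.1, xi).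
have mG1 : measurable_fun [set: T] (fun y => \int[sigma]_xi F (y, xi)).
  by apply: (measurable_fun_fubini_tonelli_F (m2 := sigma) F) => // p; exact: f0.
transitivity (\int[Leb]_w G (enorm w ^+ (2 * d), sphere_proj w)%R).
  rewrite integral_polar/=; last 2 first.
  - exact: (measurableT_comp mG1 measurable_fst).
  - by move=> p; apply: integral_ge0 => xi _; exact: f0.
  apply: eq_integral => y _; rewrite /G/= integral_cst//= ?probability_setT ?mule1//.
by apply: eq_integral => w _; apply: eq_integral => xi _; rewrite /F/= rK.
Qed.

(** The integrand may blow up at 1, so [0, 1[ is exhausted by compact intervals. *)
Lemma integral_powR01 (a : R) : (0 < a)%R ->
  \int[@lebesgue_measure R]_(y in `[0%R, 1%R[) ((1 - y) `^ (a - 1))%:E = (a^-1)%:E.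
Proof.
move=> a0.
pose D n : set R := `[0%R, (1 - n.+2%:R^-1)%R]%classic.
have mD n : measurable (D n) by exact: measurable_itv.
have mf (A : set R) : measurable_fun A (fun y => ((1 - y) `^ (a - 1))%:E).
  apply/measurable_EFinP; apply: (measurableT_comp (measurable_powR _)).
  by apply: measurable_funB.
have n2 n : ((0 < n.+2%:R^-1 :> R) && (n.+2%:R^-1 < 1 :> R))%R.
  by rewrite invr_gt0 ltr0n/= invf_lt1 ?ltr0n// ltr1n.
have UD : `[0%R, 1%R[%classic = \bigcup_n D n.
  apply/seteqP; split => y /=; rewrite ?in_itv/=.
    move=> /andP[y0 y1]; pose n := Num.truncn (1 - y)^-1.
    exists n => //; rewrite /D/= in_itv/= y0/= lerBrDr -lerBrDl.
    have h : ((1 - y)^-1 < n.+2%:R)%R.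
      by rewrite (lt_trans (truncnS_gt _))// ltr_nat.
    by rewrite invf_ple ?posrE ?ltr0n ?subr_gt0// ltW.
  move=> [n _]; rewrite /D/= in_itv/= => /andP[-> /= h].
  by rewrite (le_lt_trans h)// ltrBlDr ltrDl; case/andP : (n2 n).
rewrite UD.
have DI n : \int[@lebesgue_measure R]_(y in D n) ((1 - y) `^ (a - 1))%:E =
    (a^-1 - n.+2%:R^-1 `^ a / a)%:E.
  pose F (y : R) := (- ((1 - y) `^ a / a))%R.
  have dF (y : R) : (y < 1)%R -> is_derive y 1%R F ((1 - y) `^ (a - 1))%R.
    move=> y1; have y1' : (0 < 1 - y)%R by rewrite subr_gt0.
    have d1 : is_derive y 1%R (fun y : R => 1 - y)%R (- 1)%R.
      by have := is_deriveB (is_derive_cst (1%R : R) y 1%R) (is_derive_id y 1%R); rewrite sub0r.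
    have d2 := is_derive1_powR a y1'.
    have d3 : is_derive y 1%R ((@powR R ^~ a) \o (fun y : R => 1 - y)%R)
        (a * (1 - y) `^ (a - 1) * -1)%R by exact: is_derive1_comp.
    rewrite (_ : F = (- a^-1) *: ((@powR R ^~ a) \o (fun y : R => 1 - y)))%R; last first.
      by apply/funext => x; rewrite /F/= fctE -[RHS]/(- a^-1 * _)%R mulNr mulrC.
    apply: is_derive_eq; rewrite -[LHS]/(- a^-1 * _)%R.
    by field; rewrite gt_eqF.
  have cp (y : R) : (y < 1)%R -> {for y, continuous (fun y : R => (1 - y) `^ (a - 1) : R)%R}.
    move=> y1; have y1' : (0 < 1 - y)%R by rewrite subr_gt0.
    have d2 := is_derive1_powR (a - 1) y1'.
    apply: (@continuous_comp _ _ _ (fun y : R => 1 - y)%R (fun x => x `^ (a - 1)))%R.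
      by apply: continuousB; [exact: cst_continuous|exact: cvg_id].
    by apply/differentiable_continuous/derivable1_diffP; case: d2.
  have cF (y : R) : (y < 1)%R -> {for y, continuous F}.
    by move=> /dF[h _]; apply/differentiable_continuous/derivable1_diffP.
  have [n0 n1] := andP (n2 n).
  rewrite /D (@continuous_FTC2 _ _ F).
  - rewrite /F subKr subr0 powR1 -EFinB; congr _%:E; by rewrite div1r opprK addrC.
  - by rewrite subr_gt0.
  - apply: continuous_in_subspaceT => y; rewrite inE/= in_itv/= => /andP[_ h].
    by apply: cp; rewrite (le_lt_trans h)// ltrBlDr ltrDl.
  - split.
    + move=> y; rewrite in_itv/= => /andP[_ h].
      have y1 : (y < 1)%R by rewrite (lt_trans h)// ltrBlDr ltrDl.
      by case: (dF y y1).
    + by apply: cvg_at_right_filter; exact: cF.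
    + by apply: cvg_at_left_filter; apply: cF; rewrite ltrBlDr ltrDl.
  - move=> y; rewrite in_itv/= => /andP[_ h].
    have y1 : (y < 1)%R by rewrite (lt_trans h)// ltrBlDr ltrDl.
    by have := dF y y1 => -[_]; rewrite derive1E.
have nD : nondecreasing_seq D.
  apply/nondecreasing_seqP => n; rewrite subsetEset => y; rewrite /D/= !in_itv/=.
  move=> /andP[-> /= h]; rewrite (le_trans h)// lerD2l lerN2.
  by rewrite lef_pV2 ?posrE ?ltr0n// ler_nat.
have f0 i y : D i y -> 0 <= ((1 - y) `^ (a - 1))%:E by rewrite lee_fin powR_ge0.
have h := ge0_nondecreasing_set_cvg_integral (mu := @lebesgue_measure R) nD mD (fun i => mf (D i)) f0.
rewrite -(cvg_lim (@ereal_hausdorff R) h); apply/cvg_lim => //.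
under eq_fun do rewrite DI.
apply: cvg_EFin; first by near=> n.
rewrite [X in _ --> X](_ : _ = a^-1 - 0 / a)%R; last by rewrite mul0r subr0.
apply: cvgB; first exact: cvg_cst.
apply: cvgM; last exact: cvg_cst.
have := @powR_cvg0 R a a0.
move=> /cvg_at_rightP/(_ (fun n => n.+2%:R^-1 : R)%R); apply; split.
  by move=> n; case/andP : (n2 n).
by have := @cvg_harmonic R; rewrite -(cvg_shiftS (harmonic : R^nat)).
Unshelve. all: end_near. Qed.

(** The weight is chosen so that its total mass against the Bergman measure is
    elementary: after normalisation the variable y = |x|^2d is uniform on [0, 1]. *)
Lemma integral_radial_weight (a : R) : (0 < a)%R ->
  \int[@normalized_lebesgue R d]_(x in unit_ball)
    ((1 - enorm x ^+ (2 * d)) `^ (a - 1))%:E = (a^-1)%:E.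
Proof.
move=> a0.
have mg : measurable_fun [set: R] (fun y : R => ((1 - y) `^ (a - 1) * \1_(`[0%R, 1%R[%classic) y)%R).
  apply: measurable_funM; last exact: measurable_indic.
  by apply: (measurableT_comp (measurable_powR _)); apply: measurable_funB.
rewrite ge0_integral_mscale//=; last 3 first.
- exact: measurable_unit_ball.
- apply/measurable_EFinP; apply: (measurableT_comp (measurable_powR _)).
  by apply: measurable_funB => //; apply: measurable_funTS; exact: measurable_enormX.
- by move=> x _; rewrite lee_fin powR_ge0.
rewrite integral_mkcond.
transitivity (((@ball_volume R d)^-1)%:E * \int[Leb]_w
    (((1 - enorm w ^+ (2 * d)) `^ (a - 1) *
     \1_(`[0%R, 1%R[%classic) (enorm w ^+ (2 * d)))%:E)).
  congr (_ * _); apply: eq_integral => w _.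
  rewrite patchE indicE; have -> : (enorm w ^+ (2 * d) \in (`[0%R, 1%R[%classic : set R))%R =
    (w \in unit_ball).
    apply/idP/idP; rewrite !inE/= /unit_ball/= in_itv/= exprn_ge0 ?enorm_ge0//=.
      by rewrite expr_lt1 ?enorm_ge0// muln_gt0.
    by rewrite expr_lt1 ?enorm_ge0// muln_gt0.
  by case: ifP => _; rewrite ?mulr1 ?mulr0.
rewrite (@integral_polar (fun p => ((1 - p.1) `^ (a - 1) * \1_(`[0%R, 1%R[%classic) p.1)%:E))//=.
- under eq_integral do rewrite integral_cst//= probability_setT mule1.
  transitivity (((@ball_volume R d)^-1)%:E *
      \int[radial_measure]_(y in `[0%R, 1%R[) ((1 - y) `^ (a - 1))%:E).
    congr (_ * _); rewrite [RHS]integral_mkcond; apply: eq_integral => y _.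
    by rewrite patchE indicE; case: ifP => _; rewrite ?mulr1 ?mulr0.
  rewrite ge0_integral_mscale//=.
  + rewrite muleA -EFinM mulVf ?mul1e ?gt_eqF ?ball_volume_gt0//.
    rewrite -integral_powR01//; apply: eq_measure_integral => A mA A01.
    rewrite -[LHS]/(lebesgue_measure (A `&` `[0%R, +oo[)) (_ : A `&` _ = A)//.
    by apply/setIidPl => y /A01 /=; rewrite !in_itv/= andbT => /andP[].
  + apply/measurable_EFinP; apply: (measurableT_comp (measurable_powR _)).
    by apply: measurable_funB.
  + by move=> y _; rewrite lee_fin powR_ge0.
- apply/measurable_EFinP; exact: (measurableT_comp mg measurable_fst).
- by move=> p; rewrite lee_fin mulr_ge0 ?powR_ge0.
Qed.

End polar_coordinates.

(** * Moments of the surface measure *)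

Section surface_integrals.
Context {R : realType} {d : nat}.
Hypothesis d_gt0 : (0 < d)%N.
Local Notation V := 'rV[R[i]]_d.
Local Notation Leb := (@lebesgue_C R d).
Local Notation sigma := (@surface_measure R d).
Local Notation S := (@unit_sphere R d).
Local Open Scope ereal_scope.

Lemma measurable_unit_sphere : measurable S.
Proof.
rewrite (_ : S = setT `&` @enorm R d @^-1` [set 1%R]); first exact: measurable_enorm.
by apply/seteqP; split => w //= -[].
Qed.

Lemma measurable_herm_l (z : V) :
  measurable_fun [set: V] (fun xi => complex.Re (herm xi z)) /\
  measurable_fun [set: V] (fun xi => complex.Im (herm xi z)).
Proof.
have mz : measurable_fun [set: V] (fun xi => (xi, z)) by exact: measurable_pair2.
split; first exact: (measurableT_comp measurable_Re_herm2 mz).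
exact: (measurableT_comp measurable_Im_herm2 mz).
Qed.

Let measurable_origin : measurable [set (0%R : V)].
Proof.
rewrite (_ : [set 0%R] = setT `&` @enorm R d @^-1` [set 0%R]); first exact: measurable_enorm.
apply/seteqP; split => w /= => [->|[_ /eqP]]; first by rewrite enorm0.
by rewrite enorm_eq0 => /eqP.
Qed.

(** The origin lies in balls of arbitrarily small volume. *)
Lemma lebesgue_C_origin : Leb [set 0%R] = 0.
Proof.
have h (t : R) : (0 < t)%R -> (t <= 1)%R -> Leb [set 0%R] <= (t * @ball_volume R d)%:E.
  move=> t0 t1; apply: (@le_trans _ _ (Leb [set w | (enorm w < t)%R])).
    apply: le_measure; rewrite ?inE//; first exact: measurable_enorm_lt.
    by move=> w /= ->; rewrite enorm0.
  rewrite lebesgue_ball// EFinM ball_volumeE lee_wpmul2r// lee_fin.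
  by rewrite ler_iXnr// ?muln_gt0// ltW.
have f0 : Leb [set 0%R] \is a fin_num.
  by rewrite ge0_fin_numE// (le_lt_trans (h 1%R _ _))// ltry.
apply/eqP; rewrite eq_le measure_ge0 andbT -(fineK f0) lee_fin.
have b0 := @ball_volume_gt0 R d.
rewrite leNgt; apply/negP => l0.
pose t := (Order.min 1 (fine (Leb [set 0%R]) / 2 / @ball_volume R d))%R.
have t0 : (0 < t)%R by rewrite lt_min ltr01/= !divr_gt0.
have := h t t0; rewrite ge_min lexx/= -(fineK f0) lee_fin => /(_ isT).
apply/negP; rewrite -ltNge (@le_lt_trans _ _ (fine (Leb [set 0%R]) / 2)%R)//.
  by rewrite -ler_pdivlMr// ge_min lexx orbT.
by rewrite ltr_pdivrMr// ltr_pMr// ltr1n.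
Qed.

Lemma surface_measure_sphere : sigma S = 1.
Proof.
have mB := @measurable_unit_ball R d.
rewrite surface_measureE.
suff -> : Leb (unit_ball `&` sphere_proj @^-1` S) = Leb unit_ball.
  exact: normalized_lebesgue_unit_ball.
rewrite (_ : _ `&` _ = unit_ball `\` [set 0%R]).
  rewrite measureD//= ?lebesgue_unit_ball_lty// [X in _ - X](_ : _ = 0) ?sube0//.
  apply/eqP; rewrite eq_le measure_ge0 andbT -[leRHS]lebesgue_C_origin.
  by apply: le_measure; rewrite ?inE//; first [exact: measurableI|exact: subIsetr].
apply/seteqP; split => w [wB] /=.
  move=> wS; split => // w0; move: wS; rewrite /unit_sphere/= w0 /sphere_proj scaler0 enorm0.
  by move/esym/eqP; rewrite oner_eq0.
move=> /eqP w0; split => //; rewrite /unit_sphere/= /sphere_proj enormZ cabsR.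
by rewrite ger0_norm ?invr_ge0 ?enorm_ge0// mulVf// enorm_eq0.
Qed.

Lemma surface_integral_sphere (F : V -> \bar R) :
  measurable_fun [set: V] F -> (forall w, 0 <= F w) ->
  \int[sigma]_xi F xi = \int[sigma]_(xi in S) F xi.
Proof.
move=> mF F0; have mS := measurable_unit_sphere.
have SC0 : sigma (~` S) = 0 
    by rewrite probability_setC// [X in _ - X]surface_measure_sphere subee.
rewrite (ge0_negligible_integral _ _ _ _ SC0)//; last exact: measurableC.
by rewrite setDE setCK setTI.
Qed.

Lemma measurable_rotation (c : R[i]) : measurable_fun [set: V] (fun w => c *: w)%R.
Proof.
by have := measurable_scale_shift c (0%R : V); under eq_fun do rewrite addr0.
Qed.

(** A rotation preserves Lebesgue measure and the ball and commutes with the projection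
    onto the sphere. *)
Lemma surface_rotation_ge0 (c : R[i]) (F : V -> \bar R) : (cabs c = 1)%R ->
  measurable_fun [set: V] F -> (forall w, 0 <= F w) ->
  \int[sigma]_xi F (c *: xi)%R = \int[sigma]_xi F xi.
Proof.
move=> c1 mF F0.
pose m' := measure_function_pushforward__canonical__measure_function_Measure
  sigma (measurable_rotation c).
transitivity (\int[m']_xi F xi).
  by rewrite [RHS](@ge0_integral_pushforward _ _ _ _ R _ (measurable_rotation c) sigma).
apply: eq_measure_integral => A mA _.
have mcA : measurable ((fun w : V => c *: w)%R @^-1` A).
  by rewrite -[X in measurable X]setTI; exact: measurable_rotation.
rewrite /m'/= /pushforward [LHS]surface_measureE [RHS]surface_measureE; congr (_ * _).
have mB (D : set V) : measurable D -> measurable (unit_ball `&` sphere_proj @^-1` D).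
  move=> mD; apply: measurableI; first exact: measurable_unit_ball.
  exact: measurable_preimage_proj.
have iE (D : set V) : measurable D -> Leb D = \int[Leb]_w (\1_D w)%:E.
  by move=> mD; rewrite integral_indic// setIT.
rewrite (iE _ (mB _ mcA)) (iE _ (mB _ mA)).
pose g w : \bar R := (\1_(unit_ball `&` sphere_proj @^-1` A) w)%:E.
have mg : measurable_fun [set: V] g.
  by apply/measurable_EFinP; apply: measurable_indic; exact: mB.
have g0 w : 0 <= g w by rewrite lee_fin.
rewrite -[RHS](lebesgue_C_rotation c1 mg g0).
apply: eq_integral => w _; rewrite /g !indicE; congr ((nat_of_bool _)%:R%:E).
by apply/idP/idP; rewrite !inE /unit_ball /= /sphere_proj enormZ c1 mul1r
  !scalerA mulrC.
Qed.

Lemma surface_rotation (c : R[i]) (f : V -> R) : (cabs c = 1)%R ->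
  measurable_fun [set: V] f ->
  \int[sigma]_(xi in S) (f (c *: xi)%R)%:E = \int[sigma]_(xi in S) (f xi)%:E.
Proof.
move=> c1 mf; have mS := measurable_unit_sphere.
have aux (g : V -> \bar R) : measurable_fun [set: V] g -> (forall w, 0 <= g w) ->
    \int[sigma]_(xi in S) g (c *: xi)%R = \int[sigma]_(xi in S) g xi.
  move=> mg g0; rewrite -surface_integral_sphere//; last first.
    exact: (measurableT_comp mg (measurable_rotation c)).
  by rewrite -surface_integral_sphere// surface_rotation_ge0.
have mf' : measurable_fun [set: V] (EFin \o f) by exact/measurable_EFinP.
rewrite integralE [RHS]integralE; congr (_ - _).
  have := aux _ (measurable_funepos mf') (fun=> funepos_ge0 _ _).
  by move=> <-; apply: eq_integral => xi _; rewrite !funeposE.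
have := aux _ (measurable_funeneg mf') (fun=> funeneg_ge0 _ _).
by move=> <-; apply: eq_integral => xi _; rewrite !funenegE.
Qed.

Lemma bounded_integrable (f : V -> R) (M : R) : measurable_fun [set: V] f ->
  (forall xi, S xi -> `|f xi| <= M)%R -> sigma.-integrable S (EFin \o f).
Proof.
move=> mf fM; apply: measurable_bounded_integrable.
- exact: measurable_unit_sphere.
- by rewrite [X in X < _]surface_measure_sphere ltry.
- exact: measurable_funTS.
- exists M; split; first exact: num_real.
  by move=> x Mx xi /fM /le_trans; apply; exact: ltW.
Qed.

Lemma bounded_convergence (f : (V -> R)^nat) (g : V -> R) (M : R) :
  (forall n, measurable_fun [set: V] (f n)) -> measurable_fun [set: V] g ->
  (forall n xi, S xi -> `|f n xi| <= M)%R ->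
  (forall xi, S xi -> f n xi @[n --> \oo] --> g xi) ->
  \int[sigma]_(xi in S) (f n xi)%:E @[n --> \oo] --> \int[sigma]_(xi in S) (g xi)%:E.
Proof.
move=> mf mg fM fg; have mS := measurable_unit_sphere.
have H1 n : measurable_fun S (EFin \o f n).
  by apply/measurable_EFinP; exact: measurable_funTS.
have H2 : measurable_fun S (EFin \o g).
  by apply/measurable_EFinP; exact: measurable_funTS.
have H3 : {ae sigma, forall xi, S xi -> (EFin \o f n) xi @[n --> \oo] --> (EFin \o g) xi}.
  by apply: aeW => xi Sxi; apply: cvg_EFin; [exact: nearW|exact: fg].
have H4 : sigma.-integrable S (cst M%:E) by apply: (@bounded_integrable (cst M) `|M|).
have H5 : {ae sigma, forall xi n, S xi -> `|(EFin \o f n) xi| <= cst M%:E xi}.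
  by apply: aeW => xi n Sxi /=; rewrite lee_fin fM.
by have [] := @dominated_convergence _ _ _ sigma S mS _ _ _ H1 H2 H3 H4 H5.
Qed.

Section powers.
Variable z : V.
Local Notation u xi := (herm xi z).

Definition herm_moment (j k : nat) (xi : V) : R :=
  complex.Re (u xi ^+ j * conjc (u xi) ^+ k)%R.

Lemma measurable_complex_power (n : nat) :
  measurable_fun [set: V] (fun xi => complex.Re (u xi ^+ n)%R) /\
  measurable_fun [set: V] (fun xi => complex.Im (u xi ^+ n)%R).
Proof.
have [mr mi] := measurable_herm_l z.
elim: n => [|n [ihr ihi]]; first by split; under eq_fun do rewrite expr0/=; exact: measurable_cst.
split.
  rewrite (_ : (fun xi => _) = (fun xi => complex.Re (u xi) * complex.Re (u xi ^+ n)
    - complex.Im (u xi) * complex.Im (u xi ^+ n))%R).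
    by apply: measurable_funB; exact: measurable_funM.
  by apply/funext => xi; rewrite exprS cReM.
rewrite (_ : (fun xi => _) = (fun xi => complex.Re (u xi) * complex.Im (u xi ^+ n)
  + complex.Im (u xi) * complex.Re (u xi ^+ n))%R).
  by apply: measurable_funD; exact: measurable_funM.
by apply/funext => xi; rewrite exprS cImM.
Qed.

Lemma conjcX (a : R[i]) n : (conjc a ^+ n = conjc (a ^+ n))%R.
Proof. by rewrite -(rmorphXn conjc). Qed.

Lemma measurable_herm_moment j k : measurable_fun [set: V] (herm_moment j k).
Proof.
have [jr ji] := measurable_complex_power j.
have [kr ki] := measurable_complex_power k.
rewrite (_ : herm_moment j k = (fun xi => complex.Re (u xi ^+ j) * complex.Re (u xi ^+ k)
    + complex.Im (u xi ^+ j) * complex.Im (u xi ^+ k))%R).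
  by apply: measurable_funD; exact: measurable_funM.
apply/funext => xi; rewrite /herm_moment conjcX cReM cRe_conj cIm_conj.
by rewrite mulrN opprK.
Qed.

Hypothesis z1 : (enorm z <= 1)%R.

Lemma herm_sphere_le xi : S xi -> (cabs (u xi) <= enorm z)%R.
Proof.
by move=> xiS; rewrite (le_trans (herm_cauchy_schwarz _ _))// xiS mul1r.
Qed.

Lemma herm_moment_le1 j k xi : S xi -> (`|herm_moment j k xi| <= 1)%R.
Proof.
move=> /herm_sphere_le h; rewrite (le_trans (Re_le_cabs _))// cabsM !cabsX cabs_conj.
rewrite mulr_ile1 ?exprn_ge0 ?cabs_ge0 ?exprn_ile1 ?cabs_ge0//; exact: le_trans h z1.
Qed.

Lemma herm_moment_integrable j k :
  sigma.-integrable S (EFin \o herm_moment j k).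
Proof.
apply: (@bounded_integrable _ 1%R); first exact: measurable_herm_moment.
exact: herm_moment_le1.
Qed.

Let de_moivre (a : R) n :
  ((cos a +i* sin a) ^+ n = cos (n%:R * a) +i* sin (n%:R * a))%R%C.
Proof.
elim: n => [|n ih]; first by rewrite mul0r cos0 sin0.
rewrite exprSr ih -[in RHS]addn1 natrD mulrDl mul1r cosD sinD.
by complex_ring.
Qed.

(** Rotating by an n-th root of -1, where n is the difference of the two exponents,
    changes the sign of a mixed moment. *)
Lemma herm_moment_orthogonal j k : j != k ->
  \int[sigma]_(xi in S) (herm_moment j k xi)%:E = 0.
Proof.
have sym l m : herm_moment l m = herm_moment m l.
  apply/funext => xi; rewrite /herm_moment !conjcX !cReM !cRe_conj !cIm_conj.
  by rewrite mulrC [X in (_ - X)%R]mulrC !mulNr !mulrN mulrC.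
wlog kj : j k / (k < j)%N => [hw jk|_].
  have [|] := ltnP k j; first by move/hw; apply.
  by rewrite leq_eqVlt (negbTE jk)/= => /hw; rewrite eq_sym sym; apply.
set n := (j - k)%N; pose c : R[i] := (cos (pi / n%:R) +i* sin (pi / n%:R))%C.
have n0 : (0 < n)%N by rewrite subn_gt0.
have c1 : (cabs c = 1)%R by rewrite /c/= cos2Dsin2 sqrtr1.
have cn : (c ^+ n = -1)%R.
  rewrite /c de_moivre mulrCA mulfV ?mulr1 ?cospi ?sinpi ?pnatr_eq0 -?lt0n//.
  by apply/eqP; rewrite eq_complex/= oppr0 !eqxx.
have cc : (c * conjc c = 1)%R.
  have := cos2Dsin2 (pi / n%:R : R); rewrite /c /=; move: (cos _) (sin _) => p q pq.
  by apply/eqP; rewrite eq_complex /=; apply/andP; split; apply/eqP; [rewrite -pq|]; ring.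
have rot xi : herm_moment j k (c *: xi)%R = (- herm_moment j k xi)%R.
  rewrite /herm_moment hermZl (rmorphM conjc) !exprMn -cReN; congr complex.Re.
  have -> : (c ^+ j = c ^+ n * c ^+ k)%R by rewrite -exprD subnK// ltnW.
  by rewrite cn mulN1r !mulNr mulrACA -exprMn cc expr1n mul1r.
have := surface_rotation c1 (measurable_herm_moment j k).
have := integrable_fin_num measurable_unit_sphere (herm_moment_integrable j k).
under [X in _ -> X = _ -> _]eq_integral do rewrite rot EFinN.
rewrite integralN/=; last first.
  exact: (integrable_add_def measurable_unit_sphere (herm_moment_integrable j k)).
move=> /fineK <-; rewrite -EFinN => -[] /eqP.
by rewrite -subr_eq0 -opprD oppr_eq0 -mulr2n mulrn_eq0/= => /eqP ->.
Qed.

Definition sphere_moment (k : nat) : R :=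
  fine (\int[sigma]_(xi in S) (cabs (u xi) ^+ (2 * k))%:E).

Lemma herm_moment_diag k xi : herm_moment k k xi = (cabs (u xi) ^+ (2 * k))%R.
Proof.
rewrite /herm_moment -exprMn exprM -[in RHS](ger0_norm (sqr_ge0 (cabs _))).
have -> : (u xi * conjc (u xi) = (cabs (u xi) ^+ 2)%:C)%R.
  by rewrite cabs_sqr; case: (u xi) => a b; complex_ring.
by rewrite -rmorphXn/= ger0_norm// sqr_ge0.
Qed.

Lemma sphere_momentE k :
  \int[sigma]_(xi in S) (herm_moment k k xi)%:E = (sphere_moment k)%:E.
Proof.
under eq_integral do rewrite herm_moment_diag.
rewrite fineK//.
have := integrable_fin_num measurable_unit_sphere (herm_moment_integrable k k).
by under eq_integral do rewrite /comp herm_moment_diag.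
Qed.

Lemma sphere_moment_ge0 k : (0 <= sphere_moment k)%R.
Proof.
by rewrite fine_ge0// integral_ge0// => xi _; rewrite lee_fin exprn_ge0// cabs_ge0.
Qed.

(** Orthogonality turns the integral of a quadratic expression in the powers of u
    into the sum of its diagonal terms. *)
Lemma integral_moment_sum (I : Type) (r : seq I) (a : I -> R) (j k : I -> nat) :
  \int[sigma]_(xi in S) (\sum_(i <- r) a i * herm_moment (j i) (k i) xi)%:E =
  (\sum_(i <- r | j i == k i) a i * sphere_moment (j i))%R%:E.
Proof.
have mS := measurable_unit_sphere.
under eq_integral do rewrite -sumEFin; rewrite integral_sum//=; last first.
  move=> i; under eq_fun do rewrite EFinM.
  by apply: integrableZl => //; exact: herm_moment_integrable.
rewrite -sumEFin [RHS]big_mkcond/=; apply: eq_bigr => i _.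
under eq_integral do rewrite EFinM.
rewrite integralZl//; last exact: herm_moment_integrable.
have [->|jk] := eqVneq; first by rewrite sphere_momentE EFinM.
by rewrite herm_moment_orthogonal// mule0.
Qed.

End powers.
End surface_integrals.

(** * Binomial series and Gaussian moments *)

Section binomial_series.

(** The truncated binomial series of (1 - u)^-(e + 1). *)
Definition bin_sum (F : comNzRingType) (e N : nat) (u : F) : F :=
  (\sum_(k < N) 'C(e + k, e)%:R * u ^+ k)%R.

Lemma bin_sum_step (F : comNzRingType) e N (u : F) :
  (1 - u) * bin_sum e.+1 N u = bin_sum e N u - 'C(e + N, e.+1)%:R * u ^+ N.
Proof.
elim: N => [|N ih].
  by rewrite /bin_sum !big_ord0 addn0 bin_small// mulr0 mul0r subr0.
rewrite /bin_sum !big_ord_recr/= mulrDr -/(bin_sum _ _ _) ih.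
rewrite -/(bin_sum _ _ _) addSn binS natrD addnS binS natrD exprS.
by ring.
Qed.

Context {R : realType}.

(** Multiplication by 1 - rho lowers e, up to a nonnegative remainder. *)
Lemma bin_sum_le e N (rho : R) : 0 <= rho < 1 -> bin_sum e N rho <= (1 - rho) ^- e.+1.
Proof.
move=> /andP[r0 r1]; have r1' : 0 < 1 - rho by rewrite subr_gt0.
elim: e => [|e ih].
  rewrite expr1 -[leRHS]mul1r ler_pdivlMr// /bin_sum.
  under eq_bigr do rewrite bin0 mul1r.
  by rewrite mulrC -opprB mulNr -subrX1 opprB gerBl exprn_ge0.
rewrite exprS invfM -ler_pdivrMl ?invr_gt0// invrK.
rewrite bin_sum_step (le_trans _ ih)// gerBl.
by rewrite mulr_ge0// exprn_ge0.
Qed.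

Lemma cabs_bin_sum_le e N (u : R[i]) : cabs (bin_sum e N u) <= bin_sum e N (cabs u).
Proof.
rewrite (le_trans (cabs_sum _ _ _))// ler_sum// => k _.
rewrite cabsM cabsX (_ : _%:R = ('C(e + k, e)%:R : R)%:C) ?cabsR ?normr_nat//.
by rewrite (rmorph_nat (real_complex R)).
Qed.

Lemma bin_coef_cvg0 e (rho : R) : 0 <= rho < 1 ->
  'C(e + n, e.+1)%:R * rho ^+ n @[n --> \oo] --> (0 : R).
Proof.
move=> /andP[r0 r1]; set q := Num.sqrt rho.
have q0 : 0 <= q by exact: sqrtr_ge0.
have q1 : q < 1 by rewrite -sqrtr1 ltr_sqrt.
have qq : rho = q * q by rewrite -expr2 sqr_sqrtr.
set K := (1 - q) ^- e.+2.
have bnd n : 'C(e + n, e.+1)%:R * q ^+ n <= K.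
  case: n => [|n].
    by rewrite addn0 bin_small// mul0r invr_ge0 exprn_ge0// subr_ge0 ltW.
  have := @bin_sum_le e.+1 n.+1 q; rewrite q0 q1 => /(_ isT); apply: le_trans.
  rewrite /bin_sum big_ord_recr/= addnS -addSn exprS mulrCA.
  apply: (@le_trans _ _ ('C(e.+1 + n, e.+1)%:R * q ^+ n)).
    by rewrite ler_piMl ?(ltW q1)// mulr_ge0// exprn_ge0.
  by rewrite lerDr sumr_ge0// => k _; rewrite mulr_ge0// exprn_ge0.
apply: (@squeeze_cvgr _ _ _ _ (cst 0) (fun n => K * q ^+ n)).
- apply: nearW => n; rewrite mulr_ge0 ?exprn_ge0//= qq exprMn mulrA.
  by rewrite ler_wpM2r ?exprn_ge0.
- exact: cvg_cst.
- rewrite -[X in _ --> X](mulr0 K); apply: cvgM; first exact: cvg_cst.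
  by apply: cvg_expr; rewrite ger0_norm.
Qed.

Lemma bin_sum_cvg e (u : R[i]) : cabs u < 1 ->
  cabs ((1 - u) ^+ e.+1 * bin_sum e n u - 1) @[n --> \oo] --> (0 : R).
Proof.
move=> u1; elim: e => [|e ih].
  have h n : cabs ((1 - u) ^+ 1 * bin_sum 0 n u - 1) = cabs u ^+ n.
    rewrite expr1 /bin_sum; under eq_bigr do rewrite bin0 mul1r.
    rewrite -[1 - u]opprB mulNr -subrX1 opprB -addrA [- _ - 1]addrC addrA subrr sub0r.
    by rewrite cabsN cabsX.
  by under eq_fun do rewrite h; apply: cvg_expr; rewrite ger0_norm ?cabs_ge0.
apply: (@squeeze_cvgr _ _ _ _ (cst 0) (fun n =>
    cabs ((1 - u) ^+ e.+1 * bin_sum e n u - 1) +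
    2 ^+ e.+1 * ('C(e + n, e.+1)%:R * cabs u ^+ n))).
- apply: nearW => n; rewrite cabs_ge0/= exprSr -mulrA bin_sum_step mulrBr addrAC.
  rewrite (le_trans (cabs_triangle _ _))// lerD2l cabsN !cabsM !cabsX.
  rewrite (_ : _%:R = ('C(e + n, e.+1)%:R : R)%:C) ?cabsR ?normr_nat; last first.
    by rewrite (rmorph_nat (real_complex R)).
  rewrite ler_wpM2r ?mulr_ge0 ?exprn_ge0 ?cabs_ge0// lerXn2r ?nnegrE ?cabs_ge0//.
  rewrite (le_trans (cabs_triangle _ _))// Normc.normc1 cabsN (_ : 2 = 1 + 1)//.
  by rewrite lerD2l ltW.
- exact: cvg_cst.
- rewrite -[X in _ --> X](addr0 0); apply: cvgD; first exact: ih.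
  rewrite -[X in _ --> X](mulr0 (2 ^+ e.+1)); apply: cvgM; first exact: cvg_cst.
  by apply: bin_coef_cvg0; rewrite cabs_ge0.
Qed.

End binomial_series.

Section gaussian_moments.
Context {R : realType} {d : nat}.
Hypothesis d_gt0 : (0 < d)%N.
Local Notation V := 'rV[R[i]]_d.
Local Notation Leb := (@lebesgue_C R d).
Local Open Scope ereal_scope.

Lemma measurable_gauss_weight (k : nat) (t : R) : measurable_fun [set: V]
  (fun w => (enorm w ^+ k * expR (- (t * enorm w ^+ 2)))%:E).
Proof.
apply/measurable_EFinP; apply: measurable_funM; first exact: measurable_enormX.
apply: measurableT_comp => //; apply: measurableT_comp => //.
by apply: measurable_funM => //; exact: measurable_enormX.
Qed.

Definition gauss_moment (k : nat) : \bar R :=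
  \int[Leb]_w (enorm w ^+ (2 * k) * expR (- enorm w ^+ 2))%:E.

Lemma gauss_moment_ge0 k : 0 <= gauss_moment k.
Proof.
by apply: integral_ge0 => w _; rewrite lee_fin mulr_ge0 ?exprn_ge0 ?enorm_ge0 ?expR_ge0.
Qed.

Lemma gauss_moment0 : gauss_moment 0 = (pi ^+ d)%:E.
Proof. by rewrite -integral_gauss; apply: eq_integral => w _; rewrite muln0 expr0 mul1r. Qed.

Lemma gauss_moment_scale (k : nat) (t : R) : (0 < t)%R ->
  \int[Leb]_w (enorm w ^+ (2 * k) * expR (- (t * enorm w ^+ 2)))%:E =
  (t ^- (d + k))%:E * gauss_moment k.
Proof.
move=> t0; set s := Num.sqrt t; have s0 : (0 < s)%R by rewrite sqrtr_gt0.
have s2 : (s ^+ 2 = t)%R by rewrite sqr_sqrtr// ltW.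
have mF := @measurable_gauss_weight (2 * k) 1.
have F0 (w : V) : 0 <= (enorm w ^+ (2 * k) * expR (- (1 * enorm w ^+ 2)))%:E.
  by rewrite lee_fin mulr_ge0 ?exprn_ge0 ?enorm_ge0 ?expR_ge0.
have := @lebesgue_C_affine R d s 0%R _ s0 mF F0.
set I := \int[Leb]_w (enorm w ^+ (2 * k) * expR (- (t * enorm w ^+ 2)))%:E.
rewrite (_ : \int[Leb]_w _ = (t ^+ k)%:E * I); last first.
  rewrite /I -ge0_integralZl//; last 3 first.
  - exact: measurable_gauss_weight.
  - by move=> w _; rewrite lee_fin mulr_ge0 ?exprn_ge0 ?enorm_ge0 ?expR_ge0.
  - by rewrite lee_fin exprn_ge0// ltW.
  apply: eq_integral => w _; rewrite addr0 enormZ cabsR gtr0_norm// mul1r.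
  by rewrite -EFinM !exprMn (exprM s) s2 -mulrA.
under eq_integral do rewrite mul1r; rewrite -/(gauss_moment k) => <-.
rewrite [X in _ = _ * X]muleA muleA -!EFinM exprM s2 -exprD mulVf ?mul1e//.
by rewrite expf_eq0 gt_eqF// andbF.
Qed.

Let le_expR_eps (m : nat) (x y : R) : (0 <= y)%R ->
  (forall e, 0 < e -> x <= y * expR (m%:R * e))%R -> (x <= y)%R.
Proof.
rewrite le_eqVlt => /predU1P[<-|y0] h.
  by have := h 1%R ltr01; rewrite mul0r.
rewrite leNgt; apply/negP => yx.
have r1 : (1 < x / y)%R by rewrite ltr_pdivlMr// mul1r.
have l0 : (0 < ln (x / y))%R by rewrite ln_gt0.
have := h (ln (x / y) / m.+1%:R)%R; rewrite divr_gt0// => /(_ isT); apply/negP.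
rewrite -ltNge -ltr_pdivlMl// [ltRHS]mulrC -[ltRHS]lnK ?posrE ?(lt_trans ltr01)//.
by rewrite ltr_expR mulrCA gtr_pMr// ltr_pdivrMr// mul1r ltr_nat.
Qed.

Let gauss_moment_step1 k (t : R) : (1 < t)%R ->
  gauss_moment k <= (t ^- (d + k))%:E * gauss_moment k + (t - 1)%:E * gauss_moment k.+1.
Proof.
move=> t1; have t0 : (0 < t)%R by rewrite (lt_trans ltr01).
have mW n : measurable_fun [set: V] (fun w => (enorm w ^+ (2 * n) * expR (- enorm w ^+ 2))%:E).
  by have := @measurable_gauss_weight (2 * n) 1; under eq_fun do rewrite mul1r.
have W0 n (w : V) : (0 <= enorm w ^+ (2 * n) * expR (- enorm w ^+ 2))%R.
  by rewrite mulr_ge0 ?exprn_ge0 ?enorm_ge0 ?expR_ge0.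
rewrite -gauss_moment_scale// /gauss_moment -ge0_integralZl//; last 2 first.
- by move=> w _; rewrite lee_fin.
- by rewrite lee_fin subr_ge0 ltW.
rewrite -ge0_integralD//; last 4 first.
- by move=> w _; rewrite lee_fin mulr_ge0 ?exprn_ge0 ?enorm_ge0 ?expR_ge0.
- exact: measurable_gauss_weight.
- by move=> w _; rewrite -EFinM lee_fin mulr_ge0// subr_ge0 ltW.
- exact: measurable_funeM.
apply: ge0_le_integral => //.
- by move=> w _; rewrite lee_fin.
- by apply: emeasurable_funD; [exact: measurable_gauss_weight|exact: measurable_funeM].
move=> w _; rewrite -EFinM -EFinD lee_fin mulnSr exprD.
set r := (enorm w ^+ 2)%R; set p := (enorm w ^+ (2 * k))%R.
have p0 : (0 <= p)%R by rewrite exprn_ge0// enorm_ge0.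
have -> : (- (t * r) = - r + - ((t - 1) * r))%R by ring.
rewrite expRD; have := expR_ge1Dx (- ((t - 1) * r))%R.
have := expR_ge0 (- r)%R; set E := expR (- r)%R; set E' := expR _ => E0 h.
rewrite -subr_ge0 (_ : _ - _ = p * (E * (E' - (1 + - ((t - 1) * r)))))%R; last by ring.
by rewrite mulr_ge0// mulr_ge0// subr_ge0.
Qed.

Let gauss_moment_step2 k (t : R) : (1 < t)%R ->
  (t ^- (d + k))%:E * gauss_moment k +
  (t - 1)%:E * ((t ^- (d + k.+1))%:E * gauss_moment k.+1) <= gauss_moment k.
Proof.
move=> t1; have t0 : (0 < t)%R by rewrite (lt_trans ltr01).
have mW n : measurable_fun [set: V] (fun w => (enorm w ^+ (2 * n) * expR (- enorm w ^+ 2))%:E).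
  by have := @measurable_gauss_weight (2 * n) 1; under eq_fun do rewrite mul1r.
have W0 n s (w : V) : (0 <= enorm w ^+ (2 * n) * expR (- (s * enorm w ^+ 2)))%R.
  by rewrite mulr_ge0 ?exprn_ge0 ?enorm_ge0 ?expR_ge0.
rewrite -!gauss_moment_scale// /gauss_moment -ge0_integralZl//; last 3 first.
- exact: measurable_gauss_weight.
- by move=> w _; rewrite lee_fin.
- by rewrite lee_fin subr_ge0 ltW.
rewrite -ge0_integralD//; last 4 first.
- by move=> w _; rewrite lee_fin.
- exact: measurable_gauss_weight.
- by move=> w _; rewrite -EFinM lee_fin mulr_ge0// subr_ge0 ltW.
- by apply: measurable_funeM; exact: measurable_gauss_weight.
apply: ge0_le_integral => //.
- by move=> w _; rewrite -EFinM -EFinD lee_fin addr_ge0// mulr_ge0// subr_ge0 ltW.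
- apply: emeasurable_funD; first exact: measurable_gauss_weight.
  by apply: measurable_funeM; exact: measurable_gauss_weight.
move=> w _; rewrite -EFinM -EFinD lee_fin mulnSr exprD.
set r := (enorm w ^+ 2)%R; set p := (enorm w ^+ (2 * k))%R.
have p0 : (0 <= p)%R by rewrite exprn_ge0// enorm_ge0.
have -> : (- r = - (t * r) + (t - 1) * r)%R by ring.
rewrite expRD; have := expR_ge1Dx ((t - 1) * r)%R.
have := expR_ge0 (- (t * r))%R; set E := expR (- _)%R; set E' := expR _ => E0 h.
rewrite -subr_ge0 (_ : _ - _ = p * (E * (E' - (1 + ((t - 1) * r)))))%R; last by ring.
by rewrite mulr_ge0// mulr_ge0// subr_ge0.
Qed.

(** The two exponential inequalities above differentiate the scaling law of the
    k-th moment at scale 1, without any exchange of limits. *)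
Lemma gauss_momentS k : gauss_moment k \is a fin_num ->
  gauss_moment k.+1 = (d + k)%:R%:E * gauss_moment k.
Proof.
move=> fk; set a := fine (gauss_moment k).
have aE : gauss_moment k = a%:E by rewrite fineK.
have a0 : (0 <= a)%R by rewrite -lee_fin -aE gauss_moment_ge0.
have fk1 : gauss_moment k.+1 \is a fin_num.
  rewrite ge0_fin_numE ?gauss_moment_ge0// ltNge leye_eq; apply/negP => /eqP E.
  have := @gauss_moment_step2 k 2 (ltr1n _ _); rewrite E aE -EFinM.
  by rewrite gt0_muley ?lte_fin ?invr_gt0 ?exprn_gt0// gt0_muley ?lte_fin ?subr_gt0 ?ltr1n// addey.
set b := fine (gauss_moment k.+1).
have bE : gauss_moment k.+1 = b%:E by rewrite fineK.
have b0 : (0 <= b)%R by rewrite -lee_fin -bE gauss_moment_ge0.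
set n := (d + k)%N.
have n0 : (0 < n)%N by rewrite addn_gt0 d_gt0.
rewrite aE bE -EFinM; congr _%:E.
have geo (t : R) : (1 <= t)%R -> (n%:R <= \sum_(j < n) t ^+ j <= n%:R * t ^+ n)%R.
  move=> t1; rewrite -[n in (n%:R <= _)%R]card_ord -[n in (_ <= n%:R * _)%R]card_ord.
  rewrite -!sum1_card natr_sum mulr_suml; apply/andP; split; apply: ler_sum => j _.
    exact: exprn_ege1.
  by rewrite mul1r ler_weXn2l// ltnW.
apply/eqP; rewrite eq_le; apply/andP; split.
  apply: (@le_expR_eps n.+1) => [|e e0]; first by rewrite mulr_ge0.
  set t := expR e; have t1 : (1 < t)%R by rewrite expR_gt1.
  have t0 : (0 < t)%R by rewrite expR_gt0.
  rewrite expRM_natl -/t.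
  have := @gauss_moment_step2 k t t1; rewrite aE bE -!EFinM -EFinD lee_fin addnS -/n.
  have := geo t (ltW t1) => /andP[_ g2] h.
  have t1' : (0 < t - 1)%R by rewrite subr_gt0.
  rewrite -(ler_pM2l t1') (le_trans (_ : _ <= t ^+ n.+1 * (a - t ^- n * a))%R)//.
    rewrite -ler_pdivrMl ?exprn_gt0// mulrCA lerBrDl (le_trans _ h)//.
  have -> : (t ^+ n.+1 * (a - t ^- n * a) = (t ^+ n - 1) * (t * a))%R.
    by rewrite exprS; field; rewrite expf_eq0 gt_eqF// andbF.
  rewrite subrX1 -mulrA ler_pM2l// (le_trans (ler_wpM2r _ g2))//.
    by rewrite mulr_ge0// ltW.
  by rewrite exprS le_eqVlt; apply/orP; left; apply/eqP; ring.
apply: (@le_expR_eps n) => // e e0.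
set t := expR e; have t1 : (1 < t)%R by rewrite expR_gt1.
have t0 : (0 < t)%R by rewrite expR_gt0.
rewrite expRM_natl -/t.
have := @gauss_moment_step1 k t t1; rewrite aE bE -!EFinM -EFinD lee_fin -/n => h.
have := geo t (ltW t1) => /andP[g1 _].
have t1' : (0 < t - 1)%R by rewrite subr_gt0.
rewrite (le_trans (ler_wpM2r a0 g1))// -(ler_pM2l t1') mulrA -subrX1.
have -> : ((t ^+ n - 1) * a = t ^+ n * (a - t ^- n * a))%R.
  by field; rewrite expf_eq0 gt_eqF// andbF.
rewrite mulrA [leRHS]mulrC ler_pM2l ?exprn_gt0// lerBlDl//.
Qed.

Lemma gauss_momentE k : gauss_moment k = (pi ^+ d * k`!%:R * 'C(d.-1 + k, d.-1)%:R)%:E.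
Proof.
elim: k => [|k ih]; first by rewrite gauss_moment0 addn0 binn fact0 !mulr1.
rewrite gauss_momentS ih// -EFinM; congr _%:E.
have dk : (d + k = (d.-1 + k).+1)%N by rewrite -addSn prednK.
have hb : (k.+1 * 'C(d.-1 + k.+1, d.-1) = (d + k) * 'C(d.-1 + k, d.-1))%N.
  have := mul_bin_down (d.-1 + k.+1) d.-1; rewrite addKn dk addnS /=.
  exact: esym.
rewrite factS natrM.
move/(congr1 (fun n => n%:R : R)) : hb; rewrite !natrM => hb.
transitivity ((d + k)%:R * 'C(d.-1 + k, d.-1)%:R * (pi ^+ d * k`!%:R) : R)%R.
  by move: (pi ^+ d)%R => p; ring.
by rewrite -hb; move: (pi ^+ d)%R => p; ring.
Qed.

End gaussian_moments.

(** * Mass of the Poisson-Szego kernel *)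

Section poisson_szego_mass.
Context {R : realType} {d : nat}.
Hypothesis d_gt0 : (0 < d)%N.
Local Notation V := 'rV[R[i]]_d.
Local Notation Leb := (@lebesgue_C R d).
Local Notation sigma := (@surface_measure R d).
Local Notation S := (@unit_sphere R d).
Local Open Scope ereal_scope.
Variable z : V.
Hypothesis z1 : (enorm z < 1)%R.
Local Notation u xi := (herm xi z).
Local Notation M k := (sphere_moment z k).
Local Notation C k := ('C(d.-1 + k, d.-1)%:R : R).

Let mS : measurable S := measurable_unit_sphere.

Let sphere_power n :
  \int[sigma]_(xi in S) ((2 * complex.Re (u xi)) ^+ n)%:E =
  (if odd n then 0 else 'C(n, n./2)%:R * M n./2)%R%:E.
Proof.
have E xi : ((2 * complex.Re (u xi)) ^+ n =
    \sum_(i < n.+1) 'C(n, i)%:R * herm_moment z (n - i) i xi)%R.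
  have -> : ((2 * complex.Re (u xi)) ^+ n = complex.Re ((u xi + conjc (u xi)) ^+ n))%R.
    have -> : (u xi + conjc (u xi) = (2 * complex.Re (u xi))%:C)%R.
      by case: (u xi) => a b; complex_ring.
    by rewrite -rmorphXn.
  rewrite exprDn cRe_sum; apply: eq_bigr => i _.
  by rewrite cRe_mulrn mulr_natl.
under eq_integral do rewrite E.
rewrite (integral_moment_sum d_gt0 (ltW z1)); congr _%:E.
case: ifPn => [on|en].
  rewrite big1// => i /eqP ni; have e : (n - i + i = n)%N by rewrite subnK// -ltnS.
  by have := odd_double i; rewrite -addnn -{1}ni e on.
have h : (n./2 < n.+1)%N by rewrite ltnS -{2}(odd_double_half n) -addnn addnA leq_addl.
have n2 : (n - n./2 = n./2)%N.
  by rewrite -{1}(even_halfK en) -addnn addnK.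
rewrite (bigD1 (Ordinal h))/= ?n2// big1 ?addr0// => i /andP[/eqP ni] /eqP ih.
exfalso; apply: ih; apply: val_inj => /=.
have e : n = (i.*2)%N by rewrite -addnn -{1}ni subnK// -ltnS.
by rewrite [in RHS]e doubleK.
Qed.

Let measurable_Re_u : measurable_fun [set: V] (fun xi => complex.Re (u xi)).
Proof. by case: (measurable_herm_l z). Qed.

Let Re_u_le1 xi : S xi -> (`|2 * complex.Re (u xi)| <= 2)%R.
Proof.
move=> xiS; rewrite normrM ger0_norm// ler_piMr// (le_trans (Re_le_cabs _))//.
by rewrite (le_trans (herm_sphere_le _ xiS))// ltW.
Qed.

(** Only the balanced terms of the exponential series survive the integration over
    the sphere. *)
Lemma integral_sphere_exp (b : R) : (0 <= b)%R ->
  \int[sigma]_(xi in S) (expR (2 * b * complex.Re (u xi)))%:E =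
  \sum_(k <oo) (b ^+ (2 * k) / k`!%:R ^+ 2 * M k)%:E.
Proof.
move=> b0; pose f n xi : R := (\sum_(0 <= i < n) exp_coeff (b * (2 * complex.Re (u xi))) i)%R.
have mf n : measurable_fun [set: V] (f n).
  apply: measurable_sum => i; rewrite /exp_coeff/=; apply: measurable_funM => //.
  by apply: measurable_funX; apply: measurable_funM => //; apply: measurable_funM.
have mg : measurable_fun [set: V] (fun xi => expR (2 * b * complex.Re (u xi))).
  by apply: measurableT_comp => //; apply: measurable_funM.
have fM n xi : S xi -> (`|f n xi| <= expR (b * 2))%R.
  move=> xiS; rewrite (le_trans (ler_norm_sum _ _ _))//.
  apply: (@le_trans _ _ (\sum_(0 <= i < n) exp_coeff (b * 2) i)%R).
    apply: ler_sum => i _; rewrite /exp_coeff/= normrM [X in (_ * X)%R]ger0_norm ?invr_ge0//.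
    rewrite normrX ler_wpM2r ?invr_ge0// lerXn2r ?nnegrE ?normr_ge0 ?mulr_ge0//.
    by rewrite normrM ger0_norm// ler_wpM2l// Re_u_le1.
  apply: (nondecreasing_cvgn_le _ (is_cvg_series_exp_coeff (b * 2))).
  apply/nondecreasing_seqP => m; rewrite seriesSr lerDl.
  by rewrite /exp_coeff/= divr_ge0// exprn_ge0// mulr_ge0.
have fg xi : S xi -> f n xi @[n --> \oo] --> expR (2 * b * complex.Re (u xi)).
  move=> _; rewrite (_ : 2 * b * _ = b * (2 * complex.Re (u xi)))%R; last by ring.
  exact: is_cvg_series_exp_coeff.
have := bounded_convergence d_gt0 mf mg fM fg.
have fint n : \int[sigma]_(xi in S) (f n xi)%:E =
    (\sum_(0 <= i < n) if odd i then 0 else b ^+ i / i`!%:R * ('C(i, i./2)%:R * M i./2))%R%:E.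
  rewrite /f; under eq_integral do rewrite -sumEFin.
  have E i xi : (exp_coeff (b * (2 * complex.Re (u xi))) i)%:E =
      (b ^+ i / i`!%:R)%:E * ((2 * complex.Re (u xi)) ^+ i)%:E.
    by rewrite /exp_coeff/= -EFinM exprMn; congr _%:E; ring.
  have ip i : sigma.-integrable S (EFin \o (fun xi => (2 * complex.Re (u xi)) ^+ i)%R).
    apply: (@bounded_integrable _ _ d_gt0 _ (2 ^+ i)%R).
      by apply: measurable_funX; exact: measurable_funM.
    by move=> xi xiS; rewrite normrX lerXn2r ?nnegrE// Re_u_le1.
  rewrite integral_sum//=; last first.
    by move=> i; under eq_fun do rewrite E; apply: integrableZl => //; exact: ip.
  rewrite -sumEFin; apply: eq_bigr => i _; under eq_integral do rewrite E.
  rewrite integralZl//; last exact: ip.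
  rewrite sphere_power -EFinM; case: ifP => _; first by rewrite mulr0.
  by rewrite mulrA.
under eq_fun do rewrite fint; move=> h.
have sub n : (\sum_(0 <= i < 2 * n) (if odd i then 0 else
      b ^+ i / i`!%:R * ('C(i, i./2)%:R * M i./2)))%R =
    (\sum_(0 <= k < n) b ^+ (2 * k) / k`!%:R ^+ 2 * M k)%R.
  elim: n => [|n ih]; first by rewrite muln0 !big_nil.
  rewrite mulnS !addSn add0n !big_nat_recr//= ih mul2n odd_double/= addr0.
  congr (_ + _)%R; rewrite doubleK mulrA; congr (_ * _)%R.
  have := @bin_fact n.*2 n; rewrite -addnn leq_addr addnK => /(_ isT).
  move/(congr1 (fun m => m%:R : R)); rewrite !natrM => e.
  have n0 : (n`!%:R != 0 :> R)%R by rewrite pnatr_eq0 -lt0n fact_gt0.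
  have nn0 : ((n + n)`!%:R != 0 :> R)%R by rewrite pnatr_eq0 -lt0n fact_gt0.
  apply: (mulIf nn0); rewrite mulrAC mulfVK//.
  by rewrite -e; field.
symmetry; apply/cvg_lim => //.
have h2 : (fun n : nat => (2 * n)%N) @ \oo --> \oo.
  move=> A [N _ NA]; exists N => // n /= Nn; apply: NA => /=.
  by rewrite (leq_trans Nn)// mul2n -addnn leq_addr.
have := cvg_comp _ _ h2 h.
apply: cvg_trans; apply: near_eq_cvg; near=> n => /=.
by rewrite sub -sumEFin.
Unshelve. all: end_near. Qed.

Let herm_dist (a : R) (w : V) :
  (enorm (w - a%:C *: z) ^+ 2 =
   enorm w ^+ 2 + a ^+ 2 * enorm z ^+ 2 - 2 * a * complex.Re (herm w z))%R.
Proof.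
rewrite enorm_sqrB enormZ cabsR exprMn hermZr cReM real_normK ?num_real//.
by rewrite cRe_conj cIm_conj/=; ring.
Qed.

(** Completing the square: the left side is the Gaussian integral translated by a z,
    and its polar decomposition is the series on the right. *)
Lemma sphere_moment_generating (a : R) : (0 <= a)%R ->
  (expR (a ^+ 2 * enorm z ^+ 2))%:E * (pi ^+ d)%:E =
  \sum_(k <oo) (a ^+ (2 * k) / k`!%:R ^+ 2 * M k)%:E * @gauss_moment R d k.
Proof.
move=> a0.
pose f (w : V) := (expR (2 * a * complex.Re (herm w z) - enorm w ^+ 2))%:E.
have mf : measurable_fun [set: V] f.
  apply/measurable_EFinP; apply: measurableT_comp => //.
  by apply: measurable_funB; [exact: measurable_funM|exact: measurable_enormX].
have f0 w : 0 <= f w by rewrite lee_fin expR_ge0.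
transitivity (\int[Leb]_w f w).
  pose g (w : V) := (expR (- enorm w ^+ 2))%:E.
  have mg : measurable_fun [set: V] g.
    have := @measurable_gauss_weight R d 0 1.
    by under eq_fun do rewrite expr0 !mul1r.
  have g0 w : 0 <= g w by rewrite lee_fin expR_ge0.
  rewrite -integral_gauss -(@lebesgue_C_affine R d 1 (- (a%:C *: z))%R g ltr01 mg g0).
  rewrite expr1n mul1e -ge0_integralZl//; last first.
    by apply: (measurableT_comp mg); exact: measurable_scale_shift.
  apply: eq_integral => w _; rewrite /f /g scale1r herm_dist -EFinM -expRD.
  by congr (expR _)%:E; ring.
rewrite (integral_direction d_gt0 mf f0).
pose c k : R := (a ^+ (2 * k) / k`!%:R ^+ 2 * M k)%R.
have c0 k : (0 <= c k)%R by rewrite !mulr_ge0 ?invr_ge0 ?exprn_ge0 ?sphere_moment_ge0.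
transitivity (\int[Leb]_w \sum_(k <oo)
    ((c k)%:E * (enorm w ^+ (2 * k) * expR (- enorm w ^+ 2))%:E)).
  apply: eq_integral => w _.
  have mfw : measurable_fun [set: V] (fun xi => f ((enorm w)%:C *: xi)%R).
    exact: (measurableT_comp mf (measurable_rotation _)).
  rewrite (surface_integral_sphere d_gt0)//.
  transitivity (\int[sigma]_(xi in S)
      ((expR (- enorm w ^+ 2))%:E * (expR (2 * (a * enorm w) * complex.Re (u xi)))%:E)).
    apply: eq_integral => xi /set_mem xiS; rewrite /f -EFinM -expRD enormZ cabsR.
    rewrite (ger0_norm (enorm_ge0 _)) xiS mulr1 hermZl cReM/= mul0r subr0.
    by congr (expR _)%:E; ring.
  rewrite ge0_integralZl//=; last first.
    apply/measurable_EFinP; apply: measurable_funTS; apply: measurableT_comp => //.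
    by apply: measurable_funM.
  rewrite integral_sphere_exp ?mulr_ge0 ?enorm_ge0//.
  rewrite -nneseriesZl; last first.
    move=> k _; rewrite lee_fin !mulr_ge0 ?invr_ge0 ?exprn_ge0 ?sphere_moment_ge0//.
    by rewrite mulr_ge0// enorm_ge0.
  apply: eq_eseriesr => k _; rewrite -!EFinM /c exprMn; congr _%:E.
  by ring.
have mw k : measurable_fun [set: V] (fun w => (enorm w ^+ (2 * k) * expR (- enorm w ^+ 2))%:E).
  by have := @measurable_gauss_weight R d (2 * k) 1; under eq_fun do rewrite mul1r.
have w0 k (w : V) : 0 <= (enorm w ^+ (2 * k) * expR (- enorm w ^+ 2))%:E.
  by rewrite lee_fin mulr_ge0 ?exprn_ge0 ?enorm_ge0 ?expR_ge0.
rewrite integral_nneseries//; last 2 first.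
- by move=> k; apply: measurable_funeM.
- by move=> k w _; rewrite mule_ge0// lee_fin.
by apply: eq_eseriesr => k _; rewrite ge0_integralZl// lee_fin.
Qed.

(** Integrating the generating function once more, with a replaced by the norm of an
    independent Gaussian vector, replaces the powers of a by moments. *)
Lemma sphere_moment_series :
  \sum_(k <oo) (C k ^+ 2 * M k)%:E = ((1 - enorm z ^+ 2) ^- d)%:E.
Proof.
set G : R := (pi ^+ d)%R.
have G0 : (0 < G)%R by rewrite exprn_gt0// pi_gt0.
have q0 : (0 < 1 - enorm z ^+ 2)%R by rewrite subr_gt0 expr_lt1// enorm_ge0.
have mw k : measurable_fun [set: V] (fun w => (enorm w ^+ (2 * k) * expR (- enorm w ^+ 2))%:E).
  by have := @measurable_gauss_weight R d (2 * k) 1; under eq_fun do rewrite mul1r.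
have w0 k (w : V) : 0 <= (enorm w ^+ (2 * k) * expR (- enorm w ^+ 2))%:E.
  by rewrite lee_fin mulr_ge0 ?exprn_ge0 ?enorm_ge0 ?expR_ge0.
have M0 k : (0 <= M k)%R by exact: sphere_moment_ge0.
have L : \int[Leb]_w ((expR (- enorm w ^+ 2))%:E *
    ((expR (enorm w ^+ 2 * enorm z ^+ 2))%:E * G%:E)) =
    (G ^+ 2)%:E * ((1 - enorm z ^+ 2) ^- d)%:E.
  transitivity (\int[Leb]_w (G%:E * (enorm w ^+ (2 * 0) *
      expR (- ((1 - enorm z ^+ 2) * enorm w ^+ 2)))%:E)).
    apply: eq_integral => w _; rewrite muln0 expr0 mul1r -!EFinM mulrA -expRD mulrC.
    by congr (_ * expR _)%:E; ring.
  rewrite ge0_integralZl//; last 3 first.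
  - exact: measurable_gauss_weight.
  - by move=> w _; rewrite lee_fin mulr_ge0 ?exprn_ge0 ?enorm_ge0 ?expR_ge0.
  - by rewrite lee_fin ltW.
  rewrite gauss_moment_scale// gauss_moment0 addn0 -!EFinM; congr _%:E.
  by rewrite -/G; ring.
have Gn0 : G%:E ^+ 2 != 0 by rewrite -EFin_expe eqe expf_eq0 gt_eqF// andbF.
suff K : (G ^+ 2)%:E * \sum_(k <oo) (C k ^+ 2 * M k)%:E =
    (G ^+ 2)%:E * ((1 - enorm z ^+ 2) ^- d)%:E.
  have e x : x = (G ^- 2)%:E * ((G ^+ 2)%:E * x).
    by rewrite muleA -EFinM mulVf ?mul1e// expf_eq0 gt_eqF// andbF.
  by rewrite [LHS]e K -e.
rewrite -L -nneseriesZl; last first.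
  by move=> k _; rewrite lee_fin mulr_ge0// sqr_ge0.
transitivity (\int[Leb]_w \sum_(k <oo) ((k`!%:R ^- 2 * M k)%:E * @gauss_moment R d k) *
    (enorm w ^+ (2 * k) * expR (- enorm w ^+ 2))%:E); last first.
  apply: eq_integral => w _; rewrite (sphere_moment_generating (enorm_ge0 w)).
  rewrite -nneseriesZl; last first.
    move=> k _; rewrite mule_ge0 ?gauss_moment_ge0// lee_fin.
    by rewrite !mulr_ge0 ?invr_ge0 ?exprn_ge0 ?enorm_ge0.
  apply: eq_eseriesr => k _; rewrite gauss_momentE// -!EFinM; congr _%:E.
  by ring.
rewrite integral_nneseries//; last 2 first.
- by move=> k; rewrite gauss_momentE// -EFinM; apply: measurable_funeM.
- move=> k w _; rewrite mule_ge0// mule_ge0 ?gauss_moment_ge0// lee_fin.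
  by rewrite mulr_ge0 ?invr_ge0 ?exprn_ge0.
apply: eq_eseriesr => k _; rewrite {1}gauss_momentE// -EFinM ge0_integralZl//; last first.
  by rewrite -EFinM lee_fin !mulr_ge0 ?invr_ge0 ?exprn_ge0 ?pi_ge0.
rewrite -/(@gauss_moment R d k) gauss_momentE// -!EFinM; congr _%:E.
rewrite -/G; have n0 : (k`!%:R != 0 :> R)%R by rewrite pnatr_eq0 -lt0n fact_gt0.
by field.
Qed.

(** The integrand is the limit of the squared moduli of truncated binomial series of
    (1 - u)^-d, whose mixed moments vanish. *)
Lemma integral_sphere_kernel :
  \int[sigma]_(xi in S) (cabs (1 - u xi) ^- (2 * d))%:E = ((1 - enorm z ^+ 2) ^- d)%:E.
Proof.
have u1 xi : S xi -> (cabs (u xi) < 1)%R.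
  by move=> xiS; rewrite (le_lt_trans (herm_sphere_le _ xiS)).
have v0 xi : S xi -> (0 < cabs (1 - u xi))%R.
  by move=> xiS; rewrite cabs_1herm_gt0// xiS mul1r.
pose f n xi : R := (\sum_(p : 'I_n * 'I_n) C p.1 * C p.2 * herm_moment z p.1 p.2 xi)%R.
have fE n xi : f n xi = (cabs (bin_sum d.-1 n (u xi)) ^+ 2)%R.
  have cc (a : R[i]) : (cabs a ^+ 2 = complex.Re (a * conjc a))%R.
    by rewrite cabs_sqr; case: a => x y /=; ring.
  rewrite cc /bin_sum (rmorph_sum conjc) mulr_suml cRe_sum /f.
  rewrite -(pair_bigA _ (fun i j : 'I_n => C i * C j * herm_moment z i j xi)%R)/=.
  apply: eq_bigr => i _; rewrite mulr_sumr cRe_sum; apply: eq_bigr => j _.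
  rewrite (rmorphM conjc) (rmorph_nat conjc) (rmorphXn conjc) mulrACA.
  by rewrite -!natrM !mulr_natl cRe_mulrn.
have mf n : measurable_fun [set: V] (f n).
  apply: measurable_sum => p; apply: measurable_funM => //.
  exact: measurable_herm_moment.
have mg : measurable_fun [set: V] (fun xi => cabs (1 - u xi) ^- (2 * d))%R.
  rewrite (_ : (fun xi => _) = (fun xi => ((1 - complex.Re (u xi)) ^+ 2 +
    complex.Im (u xi) ^+ 2) `^ (- d%:R))%R).
    apply: (measurableT_comp (measurable_powR _)); have [mr mi] := measurable_herm_l z.
    by apply: measurable_funD; apply: measurable_funX => //; apply: measurable_funB.
  apply/funext => xi; rewrite powR_invn ?addr_ge0 ?sqr_ge0// exprM cabs_sqr.
  by rewrite cReD cImD cReN cImN/= sub0r sqrrN.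
have fM n xi : S xi -> (`|f n xi| <= ((1 - enorm z) ^- d) ^+ 2)%R.
  move=> xiS; rewrite fE ger0_norm ?sqr_ge0// lerXn2r ?nnegrE ?cabs_ge0//.
    by rewrite invr_ge0 exprn_ge0// subr_ge0 ltW.
  rewrite (le_trans (cabs_bin_sum_le _ _ _))//.
  have uz := herm_sphere_le z xiS.
  apply: (@le_trans _ _ (bin_sum d.-1 n (enorm z))).
    apply: ler_sum => k _; rewrite ler_wpM2l// lerXn2r ?nnegrE ?cabs_ge0 ?enorm_ge0//.
  have := @bin_sum_le R d.-1 n (enorm z); rewrite prednK// enorm_ge0 z1.
  by apply.
have fg xi : S xi -> f n xi @[n --> \oo] --> (cabs (1 - u xi) ^- (2 * d))%R.
  move=> xiS; have vd : (cabs (1 - u xi) ^+ d != 0)%R by rewrite expf_eq0 gt_eqF ?v0// andbF.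
  have h := bin_sum_cvg d.-1 (u1 xi xiS).
  have h1 : (cabs (1 - u xi) ^+ d * cabs (bin_sum d.-1 n (u xi)))%R @[n --> \oo] --> (1 : R)%R.
    apply/cvgrPdist_le => /= e e0; move/cvgrPdist_le : h => /(_ e e0).
    apply: filterS => n; rewrite sub0r normrN ger0_norm ?cabs_ge0//; apply: le_trans.
    rewrite -cabsX -cabsM prednK// ler_norml; apply/andP; split.
      by rewrite lerNl opprB (le_trans _ (cabsB_ge _ _))// Normc.normc1.
    rewrite -[leRHS]cabsN opprB (le_trans _ (cabsB_ge _ _))// Normc.normc1//.
  have h2 : cabs (bin_sum d.-1 n (u xi)) @[n --> \oo] --> (cabs (1 - u xi) ^- d)%R.
    rewrite -[X in _ --> X]mulr1.
    rewrite (_ : (fun n => _) = (fun n => cabs (1 - u xi) ^- d *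
      (cabs (1 - u xi) ^+ d * cabs (bin_sum d.-1 n (u xi))))%R); last first.
      by apply/funext => n; rewrite mulKf.
    by apply: cvgM; [exact: cvg_cst|exact: h1].
  under eq_fun do rewrite fE.
  rewrite mulnC exprM -exprVn expr2; under eq_fun do rewrite expr2.
  by apply: cvgM.
have := bounded_convergence d_gt0 mf mg fM fg.
have fint n : \int[sigma]_(xi in S) (f n xi)%:E = \sum_(0 <= k < n) (C k ^+ 2 * M k)%:E.
  rewrite /f (integral_moment_sum d_gt0 (ltW z1)) sumEFin; congr _%:E.
  rewrite big_mkord -(pair_big_dep xpredT (fun i j : 'I_n => i == j :> nat)
    (fun i j => C i * C j * M i)%R)/=.
  by apply: eq_bigr => i _; rewrite (big_pred1 i) ?expr2.
under eq_fun do rewrite fint; move=> h.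
by rewrite -sphere_moment_series; apply/esym/cvg_lim.
Qed.

Lemma measurable_poisson_szego :
  measurable_fun [set: V * V] (fun p => poisson_szego p.1 p.2).
Proof.
rewrite (_ : (fun p => _) = (fun p : V * V => (1 - enorm p.1 ^+ 2) ^+ d *
    ((1 - complex.Re (herm p.2 p.1)) ^+ 2 + complex.Im (herm p.2 p.1) ^+ 2) `^ (- d%:R))%R).
  apply: measurable_funM.
    apply: measurable_funX; apply: measurable_funB => //.
    exact: (measurableT_comp (measurable_enormX 2) measurable_fst).
  have msw : measurable_fun [set: V * V] (fun p => (p.2, p.1)).
    by apply: measurable_fun_pair.
  apply: (measurableT_comp (measurable_powR _)); apply: measurable_funD.
    apply: measurable_funX; apply: measurable_funB => //.
    exact: (measurableT_comp measurable_Re_herm2 msw).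
  apply: measurable_funX; exact: (measurableT_comp measurable_Im_herm2 msw).
apply/funext => -[w xi] /=; rewrite /poisson_szego; congr (_ * _)%R.
rewrite powR_invn ?addr_ge0 ?sqr_ge0// exprM cabs_sqr -/(herm xi w).
by rewrite cReD cImD cReN cImN/= sub0r sqrrN.
Qed.

Lemma measurable_poisson_szego_r (w : V) : measurable_fun [set: V] (poisson_szego w).
Proof. exact: (measurableT_comp measurable_poisson_szego (measurable_pair1 w)). Qed.

Lemma measurable_poisson_szego_l (xi : V) :
  measurable_fun [set: V] (fun w => poisson_szego w xi).
Proof. exact: (measurableT_comp measurable_poisson_szego (measurable_pair2 xi)). Qed.

Theorem poisson_szego_mass : \int[sigma]_(xi in S) (poisson_szego z xi)%:E = 1.
Proof.
have q0 : (0 < 1 - enorm z ^+ 2)%R by rewrite subr_gt0 expr_lt1// enorm_ge0.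
transitivity (((1 - enorm z ^+ 2) ^+ d)%:E *
    \int[sigma]_(xi in S) (cabs (1 - u xi) ^- (2 * d))%:E).
  rewrite -ge0_integralZl//=; last 3 first.
  - have := measurable_poisson_szego_r z => mP.
    rewrite (_ : (fun xi => _) = (fun xi => ((1 - enorm z ^+ 2) ^- d * poisson_szego z xi)%:E)).
      by apply/measurable_EFinP; apply: measurable_funTS; exact: measurable_funM.
    apply/funext => xi; rewrite /poisson_szego mulrA mulVf ?mul1r//.
    by rewrite expf_eq0 gt_eqF// andbF.
  - by move=> xi _; rewrite lee_fin invr_ge0 exprn_ge0// cabs_ge0.
  - by rewrite lee_fin exprn_ge0// ltW.
by rewrite integral_sphere_kernel -EFinM mulfV// expf_eq0 gt_eqF// andbF.
Qed.

End poisson_szego_mass.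

(** * Topology of the ball and concentration of the kernel *)

Section topology.
Context {R : realType} {d : nat}.
Local Notation V := 'rV[R[i]]_d.
Local Notation cball := (@closed_unit_ball R d).

(** The topology of matrices is that of the sup norm, to which the Euclidean norm is
    equivalent. *)
Lemma enorm_nbhs (z : V) (A : set V) :
  nbhs z A <-> exists2 e : R, 0 < e & forall w, enorm (z - w) < e -> A w.
Proof.
split => [/nbhs_ballP[e /= e0 eA]|[e e0 eA]].
  have [e1 e1e e10] : exists2 e1 : R, e1%:C = e & 0 < e1.
    by case: e e0 {eA} => a b; rewrite ltcE/= => /andP[/eqP -> a0]; exists a.
  exists e1 => // w zw; apply: eA; split => // i j.
  rewrite ord1 /ball/= -e1e -[`| _ |]/((cabs _)%:C) ltcR.
  by rewrite (le_lt_trans _ zw)//; have := cabs_le_enorm (z - w) j; rewrite !mxE.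
have d1 : 0 < d.+1%:R :> R by [].
apply/nbhs_ballP; exists (e / d.+1%:R)%:C; first by rewrite /= ltcR divr_gt0.
move=> w; rewrite /ball/= /mx_ball => -[_ zw]; apply: eA.
apply: (le_lt_trans (enorm_le_sum _)).
apply: (@le_lt_trans _ _ (\sum_(j < d) e / d.+1%:R)).
  apply: ler_sum => j _; have := zw 0 j.
  by rewrite /ball/= -[`| _ |]/((cabs _)%:C) ltcR !mxE => /ltW.
rewrite sumr_const card_ord -[X in X < _]mulr_natr -mulrA gtr_pMr// mulrC ltr_pdivrMr// mul1r.
by rewrite ltr_nat.
Qed.

Lemma enorm_continuous : continuous (@enorm R d).
Proof.
move=> z A /nbhs_ballP[e /= e0 eA]; apply/enorm_nbhs; exists e => // w zw.
by apply: eA; exact: le_lt_trans (enormB_ge _ _) zw.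
Qed.

Let compact_square : compact [set a : R[i] | `|complex.Re a| <= 1 /\ `|complex.Im a| <= 1].
Proof.
pose f (p : R * R) : R[i] := p.1 +i* p.2.
have -> : [set a : R[i] | `|complex.Re a| <= 1 /\ `|complex.Im a| <= 1] =
    f @` (`[-1, 1] `*` `[-1, 1])%classic.
  apply/seteqP; split => [[a b]/= [ha hb]|_ [[a b] /= [ha hb] <-] /=].
    by exists (a, b) => //=; rewrite !in_itv/= -!ler_norml.
  by move: ha hb; rewrite !in_itv/= -!ler_norml.
apply: continuous_compact; last by apply: compact_setX; exact: segment_compact.
apply: continuous_subspaceT => -[a b] A /nbhs_ballP[e /= e0 eA].
have [e1 e1e e10] : exists2 e1 : R, e1%:C = e & 0 < e1.
  by case: e e0 {eA} => x y; rewrite ltcE/= => /andP[/eqP -> x0]; exists x.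
exists (ball a (e1 / 2), ball b (e1 / 2)).
  by split; apply: nbhsx_ballx; rewrite divr_gt0.
move=> -[x y] [/= ax bY]; apply: eA; rewrite /ball/= -e1e -[`| _ |]/((cabs _)%:C) ltcR.
rewrite (le_lt_trans (cabs_le_ReIm _))// (splitr e1) ltrD//.
Qed.

Lemma compact_enorm_le (r : R) : r <= 1 -> compact [set x : V | enorm x <= r].
Proof.
move=> r1; have := @rV_compact _ d _ (fun=> compact_square) => K.
apply: (subclosed_compact _ K).
  exact: (closed_comp (fun x _ => @enorm_continuous x) (@closed_le R r)).
move=> x /= xr j; have h := le_trans (cabs_le_enorm x j) (le_trans xr r1).
by split; apply: le_trans h; [exact: Re_le_cabs|exact: Im_le_cabs].
Qed.

Lemma compact_sphere : compact (@unit_sphere R d).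
Proof.
apply: subclosed_compact (compact_enorm_le (lexx 1)) _; last by move=> x /= ->.
exact: (closed_comp (fun x _ => @enorm_continuous x) (@closed_eq R 1)).
Qed.

Section ball_functions.
Variable h : V -> R.
Hypothesis ch : {within cball, continuous h}.

Let ch_near x e : cball x -> 0 < e ->
  exists2 dl : R, 0 < dl & forall y, cball y -> enorm (x - y) < dl -> `|h x - h y| < e.
Proof.
move=> Bx e0; move/subspace_continuousP : ch => /(_ x Bx) cx.
have /cx : nbhs (h x) (ball (h x) e) by exact: nbhsx_ballx.
rewrite /within/= => /enorm_nbhs[dl dl0 dlP]; exists dl => // y By xy.
exact: dlP.
Qed.

Lemma ball_function_bounded : exists2 M : R, 0 < M & forall x, cball x -> `|h x| <= M.
Proof.
have := compact_enorm_le (lexx 1).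
move/compact_near_coveringP/near_covering_withinP.
move=> /(_ R (pinfty_nbhs R) (fun M x => `|h x| <= M) _).
case.
  move=> x Bx; have [dl dl0 dlP] := ch_near Bx ltr01.
  exists ([set y | enorm (x - y) < dl], [set M | `|h x| + 1 <= M]).
    split; first by apply/enorm_nbhs; exists dl.
    by apply: nbhs_pinfty_ge; rewrite num_real.
  move=> [y M] [/= xy hM] By; apply: le_trans hM.
  rewrite -lerBlDl (le_trans (lerB_dist _ _))// distrC ltW//; exact: dlP.
move=> M [_ hM]; exists (Num.max M 0 + 1).
  by rewrite ltr_pwDr// le_max lexx orbT.
by move=> x Bx; apply: hM => //; rewrite (@le_lt_trans _ _ (Num.max M 0)) ?le_max ?lexx// ltrDl.
Qed.

(** Only one of the two points has to range over a compact set: the covering form of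
    compactness applied to the sphere. *)
Lemma sphere_uniform_continuity (e : R) : 0 < e -> exists2 dl : R, 0 < dl &
  forall zeta x, unit_sphere zeta -> cball x -> enorm (zeta - x) < dl ->
  `|h zeta - h x| <= e.
Proof.
move=> e0; have := compact_sphere.
move/compact_near_coveringP/near_covering_withinP.
move=> /(_ R (0^'+) (fun dl zeta => forall x, cball x -> enorm (zeta - x) < dl ->
  `|h zeta - h x| <= e) _).
have SB zeta : unit_sphere zeta -> cball zeta by rewrite /unit_sphere/closed_unit_ball/= => ->.
case.
  move=> z Sz; have e2 : 0 < e / 2 by rewrite divr_gt0.
  have [dl dl0 dlP] := ch_near (SB _ Sz) e2.
  have dl2 : 0 < dl / 2 by rewrite divr_gt0.
  exists ([set y | enorm (z - y) < dl / 2], [set t | t < dl / 2]).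
    split; first by apply/enorm_nbhs; exists (dl / 2).
    exact: nbhs_right_lt.
  move=> [y t] [/= zy tl] Sy x Bx yx; rewrite -(subrKA (h z)) (splitr e).
  rewrite (le_trans (ler_normD _ _))// lerD// ltW//.
    rewrite distrC; apply: dlP; first exact: SB.
    by rewrite (lt_trans zy)// ltr_pdivrMr// ltr_pMr// ltr1n.
  apply: dlP => //; rewrite -(subrKA y) (splitr dl).
  by rewrite (le_lt_trans (enorm_triangle _ _))// ltrD// (lt_trans yx).
move=> dl /= dl0 dlP; exists (dl / 2); first by rewrite divr_gt0.
move=> zeta x Sz Bx zx; apply: (dlP (dl / 2)) => //=.
  rewrite /ball/= sub0r normrN gtr0_norm ?divr_gt0//.
  by rewrite ltr_pdivrMr// ltr_pMr// ltr1n.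
by rewrite divr_gt0.
Qed.

(** Within-continuity only controls h on the closed ball, hence the truncation. *)
Lemma measurable_ball_function : measurable_fun [set: V] (h \_ cball).
Proof.
have mB : measurable cball by exact: measurable_enorm_le.
apply: (proj1 (measurable_restrictT _ mB)).
apply: (measurability _ (RGenOInfty.measurableE R)).
move=> _ [_ [a ->] <-]; set A := _ `&` _.
pose O : set V := [set x : V | nbhs x [set y | cball y -> a < h y]].
have -> : A = cball `&` O.
  apply/seteqP; split => x [Bx]; rewrite /= ?in_itv/= ?andbT => hx; split => //=.
    have ax : 0 < h x - a by rewrite subr_gt0.
    have [dl dl0 dlP] := ch_near Bx ax; apply/enorm_nbhs; exists dl => // y xy By.
    by have := dlP _ By xy; rewrite ltr_distlC => /andP[+ _]; rewrite opprB addrC subrK.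
  by rewrite in_itv/= andbT; exact: (nbhs_singleton hx).
apply: measurableI => //; apply: sub_sigma_algebra.
exact: open_interior.
Qed.

End ball_functions.

End topology.

Section poisson_bounds.
Context {R : realType} {d : nat}.
Hypothesis d_gt0 : (0 < d)%N.
Local Notation V := 'rV[R[i]]_d.
Local Notation S := (@unit_sphere R d).
Local Notation sigma := (@surface_measure R d).
Local Notation P := (@poisson_szego R d).

Lemma enorm_sphereZ (t : R) (xi : V) : 0 <= t -> S xi -> enorm (t%:C *: xi) = t.
Proof. by move=> t0 xiS; rewrite enormZ cabsR ger0_norm// xiS mulr1. Qed.

Lemma poisson_szego_sym (t : R) (xi zeta : V) : 0 <= t -> S xi -> S zeta ->
  P (t%:C *: xi) zeta = P (t%:C *: zeta) xi.
Proof.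
move=> t0 xiS zetaS; rewrite /poisson_szego !enorm_sphereZ// -/(herm _ _) -/(herm _ _).
congr (_ / _ ^+ _); rewrite cabs_1hermC hermZl hermZr (_ : conjc _ = t%:C)//.
by rewrite /conjc/= oppr0.
Qed.

Lemma poisson_szego_ge0 (x zeta : V) : enorm x <= 1 -> 0 <= P x zeta.
Proof.
move=> x1; rewrite divr_ge0 ?exprn_ge0 ?cabs_ge0// subr_ge0.
by rewrite exprn_ile1 ?enorm_ge0.
Qed.

(** Here |1 - <zeta, x>| >= 1 - |x| >= (1 - |x|^2) / 2. *)
Lemma poisson_szego_le (x zeta : V) : enorm x < 1 -> S zeta ->
  P x zeta <= 4 ^+ d / (1 - enorm x ^+ 2) ^+ d.
Proof.
move=> x1 zS; have x0 := enorm_ge0 x.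
have q0 : 0 < 1 - enorm x ^+ 2 by rewrite subr_gt0 expr_lt1.
have c0 : 0 < cabs (1 - herm zeta x) by rewrite cabs_1herm_gt0// zS mul1r.
have c1 : 1 - enorm x <= cabs (1 - herm zeta x).
  by rewrite (le_trans _ (cabs_1herm_ge _ _))// zS mul1r.
rewrite /poisson_szego -/(herm _ _) exprM ler_pdivrMr ?exprn_gt0//.
rewrite mulrAC ler_pdivlMr ?exprn_gt0// -!exprMn.
rewrite lerXn2r ?nnegrE ?mulr_ge0 ?exprn_ge0 ?cabs_ge0 ?(ltW q0)//.
rewrite (@le_trans _ _ (4 * (1 - enorm x) ^+ 2))//; last first.
  by rewrite ler_pM2l// lerXn2r ?nnegrE ?cabs_ge0// subr_ge0 ltW.
have -> : 1 - enorm x ^+ 2 = (1 - enorm x) * (1 + enorm x) by ring.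
rewrite -expr2 exprMn mulrC ler_wpM2r ?sqr_ge0//.
by nra.
Qed.

Lemma poisson_szego_bound (z x : V) : enorm z < 1 -> enorm x <= 1 ->
  P z x <= (1 - enorm z) ^- (2 * d).
Proof.
move=> z1 x1; have z0 := enorm_ge0 z.
have zx : enorm x * enorm z <= enorm z by rewrite ler_piMl.
have c0 : 0 < cabs (1 - herm x z) by rewrite cabs_1herm_gt0// (le_lt_trans zx).
rewrite /poisson_szego -/(herm _ _) ler_pdivrMr ?exprn_gt0//.
have q : 0 < (1 - enorm z) ^+ (2 * d) by rewrite exprn_gt0// subr_gt0.
rewrite mulrC ler_pdivlMr// -[leRHS]mul1r.
have qz : 0 <= 1 - enorm z ^+ 2 by rewrite subr_ge0 exprn_ile1// ltW.
apply: ler_pM; rewrite ?exprn_ge0 ?subr_ge0 ?(ltW z1)//.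
- by rewrite exprn_ile1// ltW.
- by rewrite exprn_ile1// gerBl exprn_ge0.
rewrite lerXn2r ?nnegrE ?cabs_ge0 ?subr_ge0 ?(ltW z1)//.
by rewrite (le_trans _ (cabs_1herm_ge _ _))// lerD2l lerN2.
Qed.

(** For unit vectors Re (1 - <xi, zeta>) is half the squared distance; the factor t
    costs at most another factor 2. *)
Lemma one_sub_herm_sphere (t : R) (xi zeta : V) : 1 / 2 <= t -> t <= 1 ->
  S xi -> S zeta -> enorm (zeta - xi) ^+ 2 / 4 <= cabs (1 - herm xi (t%:C *: zeta)).
Proof.
move=> t2 t1 xiS zS; rewrite (le_trans _ (Re_le_cabs _))// (le_trans _ (ler_norm _))//.
rewrite cReD cReN hermZr (_ : conjc _ = t%:C); last by rewrite /conjc/= oppr0.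
rewrite cReM/= mul0r subr0; have := enorm_sqrB zeta xi.
rewrite zS xiS (herm_conjC zeta xi) cRe_conj expr1n => e.
have := sqr_ge0 (enorm (zeta - xi)); rewrite e => h.
by nra.
Qed.

Section concentration.
Variables (h : V -> R) (M : R).
Hypothesis mh : measurable_fun [set: V] h.
Hypothesis M0 : 0 < M.
Hypothesis hM : forall x, enorm x <= 1 -> `|h x| <= M.
Hypothesis hS : forall e, 0 < e -> exists2 dl : R, 0 < dl &
  forall zeta x, S zeta -> enorm x <= 1 -> enorm (zeta - x) < dl ->
  `|h zeta - h x| <= e.

Lemma measurable_concentration t' (x zeta : V) :
  measurable_fun [set: V] (fun xi => P x xi * `|h (t'%:C *: xi) - h zeta|).
Proof.
apply: measurable_funM; first exact: measurable_poisson_szego_r.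
apply: measurableT_comp => //; apply: measurable_funB => //.
exact: (measurableT_comp mh (measurable_rotation _)).
Qed.

(** Away from zeta the denominator of the kernel is bounded below, so that there the
    kernel tends to 0 with 1 - t; near zeta the continuity of h takes over. *)
Lemma poisson_szego_concentration (e : R) : 0 < e ->
  exists r : R, [/\ 0 < r, r < 1 & forall t t' zeta, r < t -> t < 1 -> r < t' -> t' <= 1 ->
    S zeta -> (\int[sigma]_(xi in S) (P (t%:C *: zeta) xi *
      `|h (t'%:C *: xi) - h zeta|)%:E <= e%:E)%E].
Proof.
move=> e0; have e20 : 0 < e / 2 by rewrite divr_gt0.
have [dl dl0 dlP] := hS e20.
(* at distance at least dl / 2 from zeta the denominator is at least dl^2 / 16 *)
pose K : R := (dl ^+ 2 / 16) ^- (2 * d).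
have K0 : 0 < K by rewrite invr_gt0 exprn_gt0// divr_gt0// exprn_gt0.
pose th := Num.min (1 / 2) (Num.min (dl / 2) (e / (8 * M * K))).
have a1 : 0 < dl / 2 by rewrite divr_gt0.
have a2 : 0 < e / (8 * M * K) by rewrite divr_gt0// !mulr_gt0.
have th0 : 0 < th by rewrite /th !lt_min a1 a2 andbT divr_gt0.
have [th1 th2 th3] : [/\ th <= 1 / 2, th <= dl / 2 & th <= e / (8 * M * K)].
  by split; rewrite /th !ge_min ?lexx ?orbT.
exists (1 - th); split; [by lra|by lra|].
move=> t t' zeta t1 t1' t2 t2' zS.
have tt0 : 0 <= t by lra.
have t'0 : 0 <= t' by lra.
have ptw xi : S xi -> P (t%:C *: zeta) xi * `|h (t'%:C *: xi) - h zeta| <=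
    e / 2 * P (t%:C *: zeta) xi + e / 2.
  move=> xiS; have nx : enorm (t'%:C *: xi) = t' by rewrite enorm_sphereZ.
  have P0 : 0 <= P (t%:C *: zeta) xi by rewrite poisson_szego_ge0// enorm_sphereZ// ltW.
  have [near|far] := ltP (enorm (zeta - xi)) (dl / 2).
    rewrite -[leLHS]addr0 lerD ?(ltW e20)// mulrC ler_wpM2r// distrC dlP ?nx//.
    have -> : zeta - t'%:C *: xi = (zeta - xi) + (1 - t')%:C *: xi.
      by rewrite rmorphB scalerBl rmorph1 scale1r addrA subrK.
    rewrite (le_lt_trans (enorm_triangle _ _))// enorm_sphereZ ?subr_ge0//.
    by lra.
  have PK : P (t%:C *: zeta) xi <= (1 - t ^+ 2) * K.
    rewrite /poisson_szego -/(herm _ _) enorm_sphereZ//.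
    have q0 : 0 <= 1 - t ^+ 2 by rewrite subr_ge0 exprn_ile1// ltW.
    rewrite ler_pM ?exprn_ge0 ?invr_ge0 ?exprn_ge0 ?cabs_ge0//.
      rewrite -[leRHS]expr1 ler_wiXn2l//; first by rewrite gerBl sqr_ge0.
    rewrite lef_pV2 ?posrE ?exprn_gt0 ?divr_gt0 ?exprn_gt0//; last first.
      by rewrite cabs_1herm_gt0// enorm_sphereZ// xiS mul1r.
    rewrite lerXn2r ?nnegrE ?cabs_ge0//; first by rewrite divr_ge0// sqr_ge0.
    apply: le_trans (one_sub_herm_sphere _ _ xiS zS); [|by lra|by lra].
    have : (dl / 2) ^+ 2 <= enorm (zeta - xi) ^+ 2.
      by rewrite lerXn2r ?nnegrE ?enorm_ge0// divr_ge0// ltW.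
    by lra.
  have hh : `|h (t'%:C *: xi) - h zeta| <= 2 * M.
    rewrite (le_trans (ler_normB _ _))//.
    have := hM (_ : enorm (t'%:C *: xi) <= 1); rewrite nx => /(_ t2').
    have := hM (_ : enorm zeta <= 1); rewrite zS => /(_ (lexx _)).
    by lra.
  rewrite (@le_trans _ _ (e / 2))//; last by rewrite lerDr mulr_ge0// ltW.
  rewrite (le_trans (ler_pM P0 (normr_ge0 _) PK hh))//.
  have : 1 - t ^+ 2 <= 2 * th by nra.
  move: th3; rewrite ler_pdivlMr ?mulr_gt0// => th3 tt.
  have := ler_wpM2r (ltW (mulr_gt0 M0 K0)) tt.
  by lra.
have mS := @measurable_unit_sphere R d.
have tz1 : enorm (t%:C *: zeta) < 1 by rewrite enorm_sphereZ.
have mP : measurable_fun S (fun xi => (P (t%:C *: zeta) xi)%:E).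
  apply/measurable_EFinP; apply: measurable_funTS; exact: measurable_poisson_szego_r.
have P0 xi : 0 <= P (t%:C *: zeta) xi by rewrite poisson_szego_ge0// ltW.
apply: (@le_trans _ _ (\int[sigma]_(xi in S) ((e / 2)%:E * (P (t%:C *: zeta) xi)%:E + (e / 2)%:E)))%E.
  apply: ge0_le_integral => //.
  - by move=> xi _; rewrite lee_fin mulr_ge0.
  - apply/measurable_EFinP; apply: measurable_funTS; exact: measurable_concentration.
  - by apply: emeasurable_funD => //; apply: measurable_funeM.
rewrite ge0_integralD//=; last 3 first.
- by move=> xi _; rewrite -EFinM lee_fin mulr_ge0// ltW.
- by apply: measurable_funeM.
- by move=> xi _; rewrite lee_fin ltW.
rewrite ge0_integralZl//=; last 2 first.
- by move=> xi _; rewrite lee_fin.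
- by rewrite lee_fin ltW.
rewrite poisson_szego_mass// integral_cst// mule1.
set s := (X in (_ + _ * X <= _)%E); have -> : s = 1%E by exact: surface_measure_sphere.
by rewrite mule1 -EFinD lee_fin -splitr.
Qed.

End concentration.

End poisson_bounds.

(** * Sums over configurations and Campbell's formula *)

Section indicator_series.
Context {dT : measure_display} {T : measurableType dT} {R : realType}.
Variable f : T -> R.
Hypothesis mf : measurable_fun [set: T] f.
Hypothesis f0 : forall x, 0 <= f x.

Fixpoint greedy_sum (n : nat) (x : T) : R :=
  if n is m.+1 then
    greedy_sum m x + m.+1%:R^-1 * (greedy_sum m x + m.+1%:R^-1 <= f x)%R%:R
  else 0.

Definition greedy_set (n : nat) : set T :=
  [set x | greedy_sum n x + n.+1%:R^-1 <= f x].

Let greedy_sumS n x :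
  greedy_sum n.+1 x = greedy_sum n x + n.+1%:R^-1 * \1_(greedy_set n) x.
Proof. by rewrite indicE /= mem_setE. Qed.

Lemma measurable_greedy n :
  measurable_fun [set: T] (greedy_sum n) /\ measurable (greedy_set n).
Proof.
have h k : measurable_fun [set: T] (greedy_sum k) -> measurable (greedy_set k).
  move=> mk; have := measurable_fun_le measurableT
    (measurable_funD mk (@measurable_cst _ _ _ _ setT (k.+1%:R^-1 : R))) mf.
  by rewrite setTI.
elim: n => [|n [ih ihA]]; first by split; [exact: measurable_cst|apply: h; exact: measurable_cst].
suff: measurable_fun [set: T] (greedy_sum n.+1) by move=> m; split => //; exact: h.
rewrite (_ : greedy_sum n.+1 = fun x => greedy_sum n x + n.+1%:R^-1 * \1_(greedy_set n) x).
  by apply: measurable_funD => //; apply: measurable_funM.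
by apply/funext => x; rewrite greedy_sumS.
Qed.

(** The greedy expansion along the harmonic series: if it stopped short of f, the
    remaining terms would all be taken, and their sum diverges. *)
Lemma greedy_series x : (f x)%:E =
  (\sum_(n <oo) ((n.+1%:R^-1)%:E * (\1_(greedy_set n) x)%:E))%E.
Proof.
have le_f n : greedy_sum n x <= f x.
  elim: n => [|n ih] /=; first exact: f0.
  case: (boolP (greedy_sum n x + n.+1%:R^-1 <= f x)) => h; first by rewrite mulr1.
  by rewrite mulr0 addr0.
have nd : {homo (greedy_sum ^~ x) : m n / (m <= n)%N >-> m <= n}.
  apply/nondecreasing_seqP => n /=; rewrite lerDl mulr_ge0//.
have E n : (\sum_(0 <= i < n) ((i.+1%:R^-1)%:E * (\1_(greedy_set i) x)%:E))%E =
    (greedy_sum n x)%:E.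
  elim: n => [|n ih]; first by rewrite big_nil.
  by rewrite greedy_sumS big_nat_recr//= ih.
apply/esym/cvg_lim => //; under eq_fun do rewrite E.
apply: cvg_EFin; first exact: nearW.
apply/cvgrPdist_le => e e0.
suff [N hN] : exists N, f x - e <= greedy_sum N x.
  exists N => // n /= Nn; rewrite ger0_norm ?subr_ge0//.
  by rewrite lerBlDl -lerBlDr (le_trans hN)// nd.
apply: contrapT => /forallNP h.
have {}h n : greedy_sum n x < f x - e by rewrite ltNge; apply/negP/h.
apply: (@dvg_harmonic R); apply: nondecreasing_is_cvgn.
  by apply/nondecreasing_seqP => n; rewrite seriesSr lerDl invr_ge0.
have [n0 n0e] : exists n0 : nat, forall n, (n0 <= n)%N -> n.+1%:R^-1 <= e.
  have /cvgrPdist_le/(_ e e0)[N _ hN] := @cvg_harmonic R.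
  by exists N => n /hN; rewrite sub0r normrN ger0_norm// invr_ge0.
exists (series (@harmonic R) n0 + f x) => _ [n _ <-].
suff : series (@harmonic R) n <= series (@harmonic R) n0 + greedy_sum n x.
  by move/le_trans; apply; rewrite lerD2l.
elim: n => [|n ih].
  by rewrite /series/= big_geq// addr0 sumr_ge0.
rewrite seriesSr /=; have [n0n|nn0] := leqP n0 n.
  have -> : greedy_sum n x + n.+1%:R^-1 <= f x.
    by rewrite -lerBrDr (le_trans (ltW (h n)))// lerD2l lerN2 n0e.
  by rewrite mulr1 addrA lerD2r.
rewrite -seriesSr (@le_trans _ _ (series (@harmonic R) n0))//.
  have /nondecreasing_seqP : forall k, series (@harmonic R) k <= series (@harmonic R) k.+1.
    by move=> k; rewrite seriesSr lerDl invr_ge0.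
  by apply.
by rewrite lerDl addr_ge0 ?mulr_ge0//; elim: (n) => //= k ihk; rewrite addr_ge0// mulr_ge0.
Qed.

End indicator_series.

Section configuration_sums.
Context {R : realType} {d : nat}.
Local Notation V := 'rV[R[i]]_d.
Local Notation ball := (@unit_ball R d).
Local Notation Conf := (@Conf R d ball).
Implicit Types X : Conf.
Local Open Scope ereal_scope.

Lemma mult_out X x : ~ ball x -> X x = 0%N.
Proof. by case: X => m [mE mK] /= xB; apply: contrapT => /eqP /mE. Qed.

Lemma conf_finite X (r : R) : (r < 1)%R -> finite_set [set x | (enorm x <= r)%R /\ X x != 0%N].
Proof.
case: X => m [mE mK] /= r1; apply: (mK [set x | (enorm x <= r)%R]).
  exact: compact_enorm_le (ltW r1).
by move=> x /= xr; exact: le_lt_trans r1.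
Qed.

(** The ball is a countable union of smaller closed balls. *)
Lemma conf_countable X : countable [set x | X x != 0%N].
Proof.
pose r n : R := (1 - n.+1%:R^-1)%R.
apply: (@sub_countable _ _ _ (\bigcup_n [set x | (enorm x <= r n)%R /\ X x != 0%N])).
  apply: subset_card_le => x /= Xx.
  have x1 : (enorm x < 1)%R by apply: contrapT => /(@mult_out X) h; rewrite h in Xx.
  have /cvgrPdist_le/(_ (1 - enorm x)%R) := @cvg_harmonic R.
  rewrite subr_gt0 => /(_ x1)[N _ /(_ N (leqnn N))].
  rewrite sub0r normrN ger0_norm ?invr_ge0// => h; exists N => //; split => //.
  by rewrite /r lerBrDr -lerBrDl.
apply: bigcup_countable => // n _; apply/finite_set_countable/conf_finite.
by rewrite /r gtrDl oppr_lt0.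
Qed.

(** A point x is listed once for each pair (x, k) with k < X x. *)
Lemma conf_enumeration X : exists e, enumerates X e.
Proof.
pose A : set (V * nat) := [set p | (p.2 < X p.1)%N].
have : countable A.
  apply: (@sub_countable _ _ _ ([set x | X x != 0%N] `*` setT)).
    apply: subset_card_le => -[x k] /= kx; split => //=.
    by rewrite -lt0n (leq_ltn_trans _ kx).
  exact: countableX (conf_countable X) (countableP _).
move=> /countable_injP[f finj].
exists (fun n => if pselect (exists2 p, A p & f p = n) is left h
  then Some (projT1 (cid2 h)).1 else None) => x.
have E : [set n | (if pselect (exists2 p, A p & f p = n) is left h
    then Some (projT1 (cid2 h)).1 else None) = Some x] = (fun k => f (x, k)) @` `I_(X x).
  apply/seteqP; split => [n /=|_ [k kx <-]/=].
    case: pselect => // h; case: (cid2 h) => -[y k] /= Ay <- [<-].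
    by exists k.
  case: pselect => [h|]; last by case; exists (x, k).
  case: (cid2 h) => p Ap /= /finj pe; congr Some.
  by rewrite pe ?inE.
rewrite E; apply: inj_card_eq => k l kx lx /finj.
by move=> kl; have [] : (x, k) = (x, l) by apply: kl; rewrite inE; exact: set_mem.
Qed.

Definition enum_term (g : V -> \bar R) (e : nat -> option V) (n : nat) : \bar R :=
  oapp g 0 (e n).

(** The terms of the series are grouped by the point that they list. *)
Lemma conf_esum_series X e (g : V -> \bar R) : enumerates X e -> (forall x, 0 <= g x) ->
  conf_esum X g = \sum_(n <oo) enum_term g e n.
Proof.
move=> Xe g0; pose J x := [set n | e n = Some x].
have t0 n : 0 <= enum_term g e n by rewrite /enum_term; case: (e n).
rewrite nneseries_esumT//.
transitivity (\esum_(x in [set: V]) \esum_(n in J x) enum_term g e n).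
  apply: eq_esum => x _.
  transitivity (\esum_(n in J x) g x); last first.
    by apply: eq_esum => n; rewrite /J /enum_term/= => ->.
  have /card_set_bijP[f fb] : (`I_(X x) #= J x)%card by exact: card_esym (Xe x).
  rewrite (reindex_esum _ _ _ _ fb) esum_fset ?finite_II// -fsbig_ord/= sumr_const card_ord.
  by rewrite mule_natl.
pose Q := [set n | e n != None].
rewrite esum_esum//; transitivity (\esum_(n in Q) enum_term g e n).
  apply/esym/(reindex_esum _ _ (fun p : V * nat => p.2)); split.
  - by move=> [x n] [_ /= h]; rewrite /Q/= h.
  - move=> [x n] [y m] /set_mem[_ /= h1] /set_mem[_ /= h2] /= nm.
    by move: h1 h2; rewrite /J/= nm => -> -[->].
  - by move=> n /=; rewrite /Q/=; case E : (e n) => [x|]// _; exists (x, n).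
rewrite esum_mkcond; apply: eq_esum => n _.
case: ifPn => // /negP nQ; rewrite /enum_term; case E : (e n) => [x|]//=.
by exfalso; apply: nQ; rewrite inE /Q/= E.
Qed.

Lemma conf_esum_ge0 X (g : V -> \bar R) : (forall x, 0 <= g x) -> 0 <= conf_esum X g.
Proof. by move=> g0; apply: esum_ge0 => x _; rewrite mule_ge0// lee_fin. Qed.

(** A configuration has no points outside the ball. *)
Lemma le_conf_esum X (g1 g2 : V -> \bar R) : (forall x, ball x -> g1 x <= g2 x) ->
  conf_esum X g1 <= conf_esum X g2.
Proof.
move=> g12; apply: le_esum => x _; have [xB|xB] := pselect (ball x).
  by rewrite lee_wpmul2l// ?lee_fin// g12.
by rewrite mult_out// !mul0e.
Qed.

Lemma eq_conf_esum X (g1 g2 : V -> \bar R) : (forall x, ball x -> g1 x = g2 x) ->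
  conf_esum X g1 = conf_esum X g2.
Proof. by move=> g12; apply/eqP; rewrite eq_le !le_conf_esum// => x /g12 ->. Qed.

Lemma conf_esumD X (g1 g2 : V -> \bar R) : (forall x, 0 <= g1 x) -> (forall x, 0 <= g2 x) ->
  conf_esum X (fun x => g1 x + g2 x) = conf_esum X g1 + conf_esum X g2.
Proof.
move=> g10 g20; rewrite /conf_esum -esumD; last 2 first.
- by move=> x _; rewrite mule_ge0// lee_fin.
- by move=> x _; rewrite mule_ge0// lee_fin.
by apply: eq_esum => x _; rewrite ge0_muleDr.
Qed.

Lemma conf_esum_nneseries X (g : nat -> V -> \bar R) : (forall n x, 0 <= g n x) ->
  conf_esum X (fun x => \sum_(n <oo) g n x) = \sum_(n <oo) conf_esum X (g n).
Proof.
move=> g0; have [e Xe] := conf_enumeration X.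
rewrite (conf_esum_series Xe); last by move=> x; exact: nneseries_ge0.
under [RHS]eq_eseriesr do rewrite (conf_esum_series Xe)//.
rewrite [RHS]nneseries_interchange; last first.
  by move=> n k; rewrite /enum_term; case: (e k) => /=.
apply: eq_eseriesr => k _; rewrite /enum_term; case: (e k) => //=.
by rewrite eseries0.
Qed.

Lemma conf_esumZ X (c : R) (g : V -> \bar R) : (0 <= c)%R -> (forall x, 0 <= g x) ->
  conf_esum X (fun x => c%:E * g x) = c%:E * conf_esum X g.
Proof.
move=> c0 g0; have [e Xe] := conf_enumeration X.
rewrite !(conf_esum_series Xe)//; last by move=> x; rewrite mule_ge0.
rewrite -nneseriesZl; last by move=> n _; rewrite /enum_term; case: (e n).
by apply: eq_eseriesr => n _; rewrite /enum_term; case: (e n) => //=; rewrite mule0.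
Qed.

Lemma conf_countE X (A : set V) : conf_count X A = conf_esum X (fun x => (\1_A x)%:E).
Proof.
rewrite /conf_count esum_mkcond; apply: eq_esum => x _.
by rewrite indicE; case: (x \in A); rewrite ?mule1 ?mule0.
Qed.

Lemma conf_count_ball X (A : set V) : conf_count X A = conf_count X (A `&` ball).
Proof.
rewrite !conf_countE; apply: eq_conf_esum => x xB; rewrite !indicE in_setI.
by rewrite (mem_set xB) andbT.
Qed.

Let conf_count0 X : conf_count X set0 = 0.
Proof. exact: esum_set0. Qed.

Let conf_count_ge0 X A : 0 <= conf_count X A.
Proof. by apply: esum_ge0 => x _; rewrite lee_fin. Qed.

Let conf_count_sigma_additive X : semi_sigma_additive (conf_count X).
Proof.
move=> F mF tF mUF; rewrite /conf_count esum_bigcupT//.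
rewrite -nneseries_esumT; last by move=> n; exact: esum_ge0.
by apply: is_cvg_ereal_nneg_natsum => n _; exact: esum_ge0.
Qed.

HB.instance Definition _ X := isMeasure.Build _ _ _ (conf_count X)
  (conf_count0 X) (conf_count_ge0 X) (@conf_count_sigma_additive X).

Lemma conf_count_finite X (r : R) : (r < 1)%R ->
  conf_count X [set x | (enorm x <= r)%R] < +oo.
Proof.
move=> r1; rewrite /conf_count esum_mkcond.
pose F := [set x | (enorm x <= r)%R /\ X x != 0%N].
apply: (@le_lt_trans _ _ (\esum_(x in F) (X x)%:R%:E)); last first.
  rewrite esum_fset; [|exact: conf_finite|by move=> x _; rewrite lee_fin].
  by rewrite fsbig_finite/= ?sumEFin ?ltry//; exact: conf_finite.
rewrite [leRHS]esum_mkcond; apply: le_esum => x _.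
case: ifPn => [/set_mem xr|_]; last by case: ifPn => //; rewrite lee_fin.
by have [->|X0] := eqVneq (X x) 0%N; [case: ifPn|rewrite mem_set].
Qed.

Lemma measurable_conf_count (B : set V) : measurable B ->
  measurable_fun [set: Conf] (fun X : Conf => conf_count X B).
Proof.
move=> mB _ Y mY; rewrite setTI; apply: sub_sigma_algebra.
exists (B `&` ball).
  by split; [apply: measurableI => //; exact: measurable_unit_ball|exact: subIsetr].
exists Y => //; congr (_ @^-1` Y); apply/funext => X; exact: conf_count_ball.
Qed.

Lemma conf_esum_indicators X (f : V -> R) (mf : measurable_fun [set: V] f)
    (f0 : forall x, (0 <= f x)%R) :
  conf_esum X (EFin \o f) = \sum_(n <oo) ((n.+1%:R^-1)%:E * conf_count X (greedy_set f n)).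
Proof.
rewrite /comp; under [X in conf_esum _ X]eq_fun do rewrite (greedy_series f0).
rewrite conf_esum_nneseries; last by move=> n x; rewrite mule_ge0// lee_fin.
by apply: eq_eseriesr => n _; rewrite conf_esumZ// -conf_countE.
Qed.

(** The greedy series reduces the claim to counts of points in Borel sets. *)
Lemma measurable_conf_esum (f : V -> R) : measurable_fun [set: V] f ->
  (forall x, (0 <= f x)%R) ->
  measurable_fun [set: Conf] (fun X : Conf => conf_esum X (EFin \o f)).
Proof.
move=> mf f0; under eq_fun do rewrite conf_esum_indicators//.
apply: ge0_emeasurable_sum => [n X _ _|n _]; first by rewrite mule_ge0// lee_fin.
by apply: measurable_funeM; apply: measurable_conf_count; case: (measurable_greedy mf n).
Qed.

(** Only the restrictions of X to smaller balls are finite measures, so the sections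
    are first cut down to these. *)
Lemma measurable_conf_esum_pair (k : Conf * V * V -> R) :
  measurable_fun [set: Conf * V * V] k -> (forall p, (0 <= k p)%R) ->
  measurable_fun [set: Conf * V] (fun q : Conf * V => conf_esum q.1 (fun x => (k (q, x))%:E)).
Proof.
move=> mk k0.
have cE (q : Conf * V) : conf_esum q.1 (fun x => (k (q, x))%:E) =
    \sum_(n <oo) ((n.+1%:R^-1)%:E * conf_count q.1 (xsection (greedy_set k n) q)).
  under [X in conf_esum _ X]eq_fun do rewrite (greedy_series k0).
  rewrite conf_esum_nneseries; last by move=> n x; rewrite mule_ge0// lee_fin.
  apply: eq_eseriesr => n _; rewrite conf_esumZ// conf_countE; congr (_ * conf_esum _ _).
  by apply/funext => x; rewrite !indicE mem_xsection.
under eq_fun do rewrite cE.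
apply: ge0_emeasurable_sum => [n X _ _|n _]; first by rewrite mule_ge0// lee_fin.
apply: measurable_funeM; have [_ mA] := measurable_greedy mk n.
move: (greedy_set k n) mA => A mA {cE k0 mk}.
pose ck (q : Conf * V) : {measure set V -> \bar R} := conf_count q.1.
have mck U : measurable U -> measurable_fun [set: Conf * V] (ck ^~ U).
  by move=> mU; exact: (measurableT_comp (measurable_conf_count mU)).
pose K : R.-ker (Conf * V)%type ~> V := HB.pack ck (isKernel.Build _ _ _ _ R ck mck).
pose r m : R := (1 - m.+1%:R^-1)%R.
pose B m : set V := [set x | (enorm x <= r m)%R].
have mB m : measurable (B m) by exact: measurable_enorm_le.
have mm m : measurable_fun [set: Conf * V] (fun q => mrestr (K q) (mB m) (xsection A q)).
  have [] // := @measurable_prod_subset_xsection_kernel _ _ _ _ R K (B m) (mB m) _ A mA.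
  move=> q; exists (fine (conf_count q.1 (B m)) + 1)%R => U mU.
  have fB : conf_count q.1 (B m) < +oo.
    by apply: conf_count_finite; rewrite /r gtrDl oppr_lt0.
  rewrite EFinD fineK ?ge0_fin_numE//.
  apply: (@le_lt_trans _ _ (conf_count q.1 (B m))); last by rewrite lteDl// ge0_fin_numE.
  by rewrite /mrestr; apply: le_measure; rewrite ?inE//; exact: measurableI.
apply: (emeasurable_fun_cvg _ _ mm) => q _ /=.
have -> : conf_count q.1 (xsection A q) = conf_count q.1 (\bigcup_m (xsection A q `&` B m)).
  rewrite conf_count_ball -setI_bigcupr; congr (conf_count _ (_ `&` _)).
  apply/seteqP; split => [x /= x1|x [m _ /=]]; last first.
    by move/le_lt_trans; apply; rewrite /r gtrDl oppr_lt0.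
  have /cvgrPdist_le/(_ (1 - enorm x)%R) := @cvg_harmonic R.
  rewrite subr_gt0 => /(_ x1)[N _ /(_ N (leqnn N))].
  rewrite sub0r normrN ger0_norm ?invr_ge0// => h; exists N => //.
  by rewrite /B /r /= lerBrDr -lerBrDl.
have mAq : measurable (xsection A q) by exact: measurable_xsection.
apply: nondecreasing_cvg_mu.
- by move=> m; exact: measurableI.
- by apply: bigcup_measurable => m _; exact: measurableI.
- apply/nondecreasing_seqP => m; apply/subsetPset; apply: setIS => x /= /le_trans; apply.
  by rewrite lerD2l lerN2 lef_pV2 ?posrE// ler_nat.
Qed.

End configuration_sums.

Section campbell.
Context {R : realType} {d : nat}.
Local Notation V := 'rV[R[i]]_d.
Local Notation ball := (@unit_ball R d).
Local Notation nu := (@normalized_lebesgue R d).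
Local Open Scope ereal_scope.
Variable (Pi : probability (Conf ball) R) (lambda : R).
Hypothesis Pi_intensity : forall B : set V, measurable B -> B `<=` ball ->
  first_intensity Pi B = lambda%:E * bergman_measure B.

Lemma measurable_bergman_density :
  measurable_fun ball (fun x : V => ((1 - enorm x ^+ 2) ^+ d.+1)^-1)%R.
Proof.
apply: (@eq_measurable_fun _ _ _ _ _ (fun x : V => (1 - enorm x ^+ 2) `^ (- d.+1%:R))%R).
  move=> x /set_mem xB; rewrite powR_invn// subr_ge0 expr_le1 ?enorm_ge0//.
  exact: ltW.
apply: measurable_funTS; apply: (measurableT_comp (measurable_powR _)).
by apply: measurable_funB => //; exact: measurable_enormX.
Qed.

Lemma bergman_density_ge0 (x : V) : ball x -> (0 <= ((1 - enorm x ^+ 2) ^+ d.+1)^-1)%R.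
Proof.
by move=> xB; rewrite invr_ge0 exprn_ge0// subr_ge0 expr_le1 ?enorm_ge0// ltW.
Qed.

(** Campbell's formula: both sides are countably additive in f, and for indicators
    this is the definition of the intensity. *)
Theorem campbell (f : V -> R) : measurable_fun [set: V] f -> (forall x, (0 <= f x)%R) ->
  \int[Pi]_X conf_esum X (EFin \o f) =
  lambda%:E * \int[nu]_(x in ball) (f x * ((1 - enorm x ^+ 2) ^+ d.+1)^-1)%:E.
Proof.
move=> mf f0; have mB := @measurable_unit_ball R d.
have mA n : measurable (greedy_set f n) by case: (measurable_greedy mf n).
pose D (x : V) : R := ((1 - enorm x ^+ 2) ^+ d.+1)^-1%R.
under eq_integral do rewrite (conf_esum_indicators _ mf f0).
rewrite integral_nneseries//; last 2 first.
- by move=> n; apply: measurable_funeM; exact: measurable_conf_count.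
- by move=> n X _; rewrite mule_ge0// lee_fin.
transitivity (\sum_(n <oo) lambda%:E * ((n.+1%:R^-1)%:E *
    \int[nu]_(x in ball) ((\1_(greedy_set f n) x) * D x)%:E)).
  apply: eq_eseriesr => n _; rewrite ge0_integralZl//; last exact: measurable_conf_count.
  under eq_integral do rewrite conf_count_ball.
  rewrite -/(first_intensity Pi _) Pi_intensity; last 2 first.
  - exact: measurableI.
  - exact: subIsetr.
  rewrite muleCA; congr (_ * (_ * _)); rewrite /bergman_measure setIC integral_mkcondr.
  apply: eq_integral => x _; rewrite patchE indicE.
  by case: ifPn => _; rewrite ?mul1r ?mul0r.
have mD n : measurable_fun ball (fun x => ((\1_(greedy_set f n) x) * D x)%:E).
  apply/measurable_EFinP; apply: measurable_funM; last exact: measurable_bergman_density.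
  by apply: measurable_funTS; exact: measurable_indic.
have D0 n x : ball x -> 0 <= ((\1_(greedy_set f n) x) * D x)%:E.
  by move=> xB; rewrite lee_fin mulr_ge0//; exact: bergman_density_ge0.
rewrite nneseriesZl//; last first.
  by move=> n _; rewrite mule_ge0 ?lee_fin// integral_ge0// => x; exact: D0.
congr (_ * _); transitivity (\int[nu]_(x in ball) \sum_(n <oo)
    ((n.+1%:R^-1)%:E * ((\1_(greedy_set f n) x) * D x)%:E)).
  rewrite integral_nneseries//; last 2 first.
  - by move=> n; apply: measurable_funeM.
  - by move=> n x xB; rewrite mule_ge0 ?lee_fin// -lee_fin D0.
  by apply: eq_eseriesr => n _; rewrite ge0_integralZl// => x; exact: D0.
apply: eq_integral => x /set_mem xB.
rewrite [in RHS]mulrC EFinM (greedy_series f0) -nneseriesZl//.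
apply: eq_eseriesr => n _; rewrite -!EFinM; congr _%:E.
by rewrite mulrA mulrC.
Qed.

End campbell.

(** * Radial averages of the kernel *)

Section radial_averages.
Context {R : realType} {d : nat}.
Hypothesis d_gt0 : (0 < d)%N.
Local Notation V := 'rV[R[i]]_d.
Local Notation Leb := (@lebesgue_C R d).
Local Notation nu := (@normalized_lebesgue R d).
Local Notation sigma := (@surface_measure R d).
Local Notation S := (@unit_sphere R d).
Local Notation ball := (@unit_ball R d).
Local Notation P := (@poisson_szego R d).
Local Open Scope ereal_scope.

Let mS : measurable S := measurable_unit_sphere.
Let mB : measurable ball := measurable_unit_ball.

Let measurable_spin : measurable_fun [set: V * V] (fun p => (enorm p.1)%:C *: p.2)%R.
Proof.
have mn : measurable_fun [set: V * V] (fun p => enorm p.1).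
  exact: (measurableT_comp (@measurable_enorm R d) measurable_fst).
apply: measurable_to_row => j.
  rewrite [X in measurable_fun _ X](_ : _ = (fun p : V * V => enorm p.1 * complex.Re (p.2 0 j))%R).
    apply: measurable_funM => //.
    exact: (measurableT_comp (measurable_Re_coord j) measurable_snd).
  by apply/funext => p; rewrite mxE cReM/= mul0r subr0.
rewrite [X in measurable_fun _ X](_ : _ = (fun p : V * V => enorm p.1 * complex.Im (p.2 0 j))%R).
  apply: measurable_funM => //.
  exact: (measurableT_comp (measurable_Im_coord j) measurable_snd).
by apply/funext => p; rewrite mxE cImM/= mul0r addr0.
Qed.

Lemma integral_ball_direction (g : V -> \bar R) :
  measurable_fun [set: V] g -> (forall w, 0 <= g w) ->
  \int[nu]_w g w = \int[nu]_w \int[sigma]_(xi in S) g ((enorm w)%:C *: xi)%R.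
Proof.
move=> mg g0.
have E w : \int[sigma]_(xi in S) g ((enorm w)%:C *: xi)%R =
    \int[sigma]_xi g ((enorm w)%:C *: xi)%R.
  rewrite -(surface_integral_sphere d_gt0)//.
  exact: (measurableT_comp mg (measurable_rotation _)).
under [RHS]eq_integral do rewrite E.
rewrite !ge0_integral_mscale//=; last 2 first.
- have mgs : measurable_fun [set: V * V] (fun p => g ((enorm p.1)%:C *: p.2)%R).
    exact: (measurableT_comp mg measurable_spin).
  exact: (@measurable_fun_fubini_tonelli_F _ _ _ _ _ sigma _ mgs).
- by move=> w _; exact: integral_ge0.
by rewrite (integral_direction d_gt0 mg g0).
Qed.

Lemma measurable_radial_power (b : R) :
  measurable_fun [set: V] (fun x => (1 - enorm x ^+ (2 * d)) `^ b)%R.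
Proof.
apply: (measurableT_comp (measurable_powR _)).
by apply: measurable_funB => //; exact: measurable_enormX.
Qed.

(** Averaging over the sphere of radius |x| and the symmetry of the kernel turn the
    integral of g against P(., zeta) into Poisson integrals of g at |x| zeta. *)
Lemma poisson_radial_integral (b : R) (g : V -> R) (zeta : V) :
  measurable_fun [set: V] g -> (forall x, (0 <= g x)%R) -> S zeta ->
  \int[nu]_(x in ball) ((1 - enorm x ^+ (2 * d)) `^ b * (g x * P x zeta))%:E =
  \int[nu]_(x in ball) (((1 - enorm x ^+ (2 * d)) `^ b)%:E *
    \int[sigma]_(xi in S) (P ((enorm x)%:C *: zeta)%R xi * g ((enorm x)%:C *: xi)%R)%:E).
Proof.
move=> mg g0 zS; rewrite integral_mkcond [RHS]integral_mkcond.
have mu_ := measurable_radial_power b.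
have mP := measurable_poisson_szego_l zeta.
rewrite integral_ball_direction; last 2 first.
- apply/(measurable_restrictT _ mB); apply/measurable_EFinP; apply: measurable_funTS.
  by do 2 apply: measurable_funM => //.
- move=> w; rewrite patchE; case: ifPn => // /set_mem /ltW w1.
  by rewrite lee_fin mulr_ge0 ?powR_ge0// mulr_ge0// poisson_szego_ge0.
apply: eq_integral => w _; rewrite patchE; case: ifPn => [/set_mem|/negP] wB.
  rewrite -ge0_integralZl//=; last 3 first.
  - apply/measurable_EFinP; apply: measurable_funTS; apply: measurable_funM.
      exact: measurable_poisson_szego_r.
    exact: (measurableT_comp mg (measurable_rotation _)).
  - move=> xi xiS; rewrite lee_fin mulr_ge0// poisson_szego_ge0//.
    by rewrite (enorm_sphereZ (enorm_ge0 _) zS) ltW.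
  - by rewrite lee_fin powR_ge0.
  apply: eq_integral => xi /set_mem xiS.
  have nx := enorm_sphereZ (enorm_ge0 w) xiS.
  rewrite patchE mem_set ?nx//; last by rewrite /unit_ball/= nx.
  rewrite (poisson_szego_sym (enorm_ge0 _) xiS zS) -EFinM; congr _%:E.
  by rewrite (mulrC (P _ _)).
rewrite integral0_eq// => xi xiS; rewrite patchE memNset//.
by move=> h; apply: wB; rewrite inE; move: h; rewrite /unit_ball/= enorm_sphereZ ?enorm_ge0.
Qed.

Lemma poisson_radial_mass (a : R) (zeta : V) : (0 < a)%R -> S zeta ->
  \int[nu]_(x in ball) ((1 - enorm x ^+ (2 * d)) `^ (a - 1) * P x zeta)%:E = (a^-1)%:E.
Proof.
move=> a0 zS; have := @poisson_radial_integral (a - 1) (cst 1%R) zeta.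
move=> /(_ (measurable_cst _) (fun=> ler01) zS).
under eq_integral do rewrite mul1r; move=> ->.
rewrite -(integral_radial_weight d_gt0 a0); apply: eq_integral => x /set_mem xB.
under eq_integral do rewrite mulr1.
by rewrite (poisson_szego_mass d_gt0) ?mule1// enorm_sphereZ ?enorm_ge0.
Qed.

Section approximation.
Variables (h : V -> R) (H : R).
Hypothesis mh : measurable_fun [set: V] h.
Hypothesis H0 : (0 < H)%R.
Hypothesis h0 : forall x, (0 <= h x)%R.
Hypothesis hH : forall x, (enorm x <= 1)%R -> (h x <= H)%R.
Hypothesis hS : forall e, (0 < e)%R -> exists2 dl : R, (0 < dl)%R &
  forall zeta x, S zeta -> (enorm x <= 1)%R -> (enorm (zeta - x) < dl)%R ->
  (`|h zeta - h x| <= e)%R.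

Let I a zeta := \int[nu]_(x in ball) ((1 - enorm x ^+ (2 * d)) `^ (a - 1) * (h x * P x zeta))%:E.

Let average t zeta := \int[sigma]_(xi in S)
  (P ((t)%:C *: zeta)%R xi * h (t%:C *: xi)%R)%:E.

Let mP (t : R) zeta : measurable_fun S (fun xi => (P (t%:C *: zeta)%R xi)%:E).
Proof. by apply/measurable_EFinP; apply: measurable_funTS; exact: measurable_poisson_szego_r. Qed.

Let mPh (t : R) zeta : measurable_fun S (fun xi => (P (t%:C *: zeta)%R xi * h (t%:C *: xi)%R)%:E).
Proof.
apply/measurable_EFinP; apply: measurable_funTS; apply: measurable_funM.
  exact: measurable_poisson_szego_r.
exact: (measurableT_comp mh (measurable_rotation _)).
Qed.

Let P0 (t : R) zeta xi : (0 <= t)%R -> (t < 1)%R -> S zeta -> (0 <= P (t%:C *: zeta)%R xi)%R.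
Proof. by move=> t0 t1 zS; rewrite poisson_szego_ge0// enorm_sphereZ// ltW. Qed.

Let average_le t zeta : (0 <= t)%R -> (t < 1)%R -> S zeta -> average t zeta <= H%:E.
Proof.
move=> t0 t1 zS; rewrite -[leRHS]mule1 -(@poisson_szego_mass R d d_gt0 (t%:C *: zeta)%R) ?enorm_sphereZ//.
rewrite -ge0_integralZl//=; last 2 first.
- by move=> xi _; rewrite lee_fin P0.
- by rewrite lee_fin ltW.
apply: ge0_le_integral => //=.
- by move=> xi _; rewrite lee_fin mulr_ge0 ?P0.
- by apply: measurable_funeM.
- move=> xi xiS; rewrite -EFinM lee_fin mulrC ler_wpM2r ?P0// hH//.
  by rewrite enorm_sphereZ// ltW.
Qed.

Let measurable_average zeta : S zeta -> measurable_fun ball (fun x => average (enorm x) zeta).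
Proof.
move=> zS; pose G (p : V * V) : \bar R :=
  (`|P ((enorm p.1)%:C *: zeta)%R p.2| * h ((enorm p.1)%:C *: p.2)%R * \1_S p.2)%:E.
have mG : measurable_fun [set: V * V] G.
  apply/measurable_EFinP; apply: measurable_funM; last first.
    have m1 : measurable_fun [set: V] (\1_S : V -> R) by exact: measurable_indic.
    exact: (measurableT_comp m1 measurable_snd).
  apply: measurable_funM; last exact: (measurableT_comp mh measurable_spin).
  apply: measurableT_comp => //.
  have mz : measurable_fun [set: V * V] (fun p => ((enorm p.1)%:C *: zeta, p.2)%R).
    apply: measurable_fun_pair => //.
    exact: (measurableT_comp measurable_spin (measurable_fun_pair measurable_fst (measurable_cst zeta))).
  exact: (measurableT_comp measurable_poisson_szego mz).
have G0 p : 0 <= G p by rewrite lee_fin !mulr_ge0.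
have := @measurable_fun_fubini_tonelli_F _ _ _ _ _ sigma _ mG.
move=> /(_ G0)/(measurable_funS measurableT (@subsetT _ ball)); apply: eq_measurable_fun => x /set_mem xB.
rewrite /fubini_F /average [RHS]integral_mkcond; apply: eq_integral => xi _.
rewrite patchE /G/= indicE; case: ifPn => _; last by rewrite mulr0.
by rewrite mulr1 ger0_norm// P0// enorm_ge0.
Qed.

(** Concentration makes the Poisson-Szego averages of h close to h(zeta) near the
    sphere. The rest of the ball contributes a bounded amount, while the total mass is
    1 / a. *)
Lemma radial_poisson_approx (e : R) : (0 < e)%R -> exists2 K : R, (0 <= K)%R &
  forall a zeta, (0 < a)%R -> S zeta ->
  I a zeta <= (a^-1 * (h zeta + e) + K)%:E /\
  (a^-1 * h zeta)%:E <= I a zeta + (a^-1 * e + K)%:E.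
Proof.
move=> e0.
have hM x : (enorm x <= 1)%R -> (`|h x| <= H)%R by move=> x1; rewrite ger0_norm// hH.
have [r [r0 r1 rP]] := poisson_szego_concentration d_gt0 mh H0 hM hS e0.
have q0 : (0 < 1 - r ^+ (2 * d))%R by rewrite subr_gt0 expr_lt1 ?muln_gt0// ltW.
exists (H / (1 - r ^+ (2 * d)))%R; first by rewrite divr_ge0// ltW.
move=> a zeta a0 zS.
pose u (x : V) : R := ((1 - enorm x ^+ (2 * d)) `^ (a - 1))%R.
have u0 x : (0 <= u x)%R by exact: powR_ge0.
have uK x : (enorm x <= r)%R -> (u x <= (1 - r ^+ (2 * d))^-1)%R.
  move=> xr; have xr2 : (enorm x ^+ (2 * d) <= r ^+ (2 * d))%R.
    by rewrite lerXn2r ?nnegrE ?enorm_ge0// ltW.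
  have x0 : (0 < 1 - enorm x ^+ (2 * d))%R by rewrite (lt_le_trans q0)// lerD2l lerN2.
  rewrite (@le_trans _ _ (1 - enorm x ^+ (2 * d))^-1%R)//; last first.
    by rewrite lef_pV2 ?posrE// lerD2l lerN2.
  rewrite -powR_inv1 ?(ltW x0)//; apply: ger_powR; last by rewrite lerBrDl subrr ltW.
  by rewrite x0 gerBl exprn_ge0// enorm_ge0.
have mu_ : measurable_fun ball (fun x => (u x)%:E).
  by apply/measurable_EFinP; apply: measurable_funTS; exact: measurable_radial_power.
have near x : ball x -> (r < enorm x)%R -> average (enorm x) zeta <= (h zeta + e)%:E /\
    (h zeta)%:E <= average (enorm x) zeta + e%:E.
  move=> x1 rx; have t0 := enorm_ge0 x.
  have con := rP _ _ _ rx x1 rx (ltW x1) zS.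
  have mc : measurable_fun S (fun xi => (P ((enorm x)%:C *: zeta)%R xi *
      `|h ((enorm x)%:C *: xi)%R - h zeta|)%:E).
    apply/measurable_EFinP; apply: measurable_funTS; exact: measurable_concentration.
  have mass : (h zeta)%:E = \int[sigma]_(xi in S) ((h zeta)%:E * (P ((enorm x)%:C *: zeta)%R xi)%:E).
    rewrite ge0_integralZl//=; last 2 first.
    - by move=> xi _; rewrite lee_fin P0.
    - by rewrite lee_fin.
    by rewrite (poisson_szego_mass d_gt0) ?mule1// enorm_sphereZ.
  have c0 xi : S xi -> 0 <= (P ((enorm x)%:C *: zeta)%R xi *
      `|h ((enorm x)%:C *: xi)%R - h zeta|)%:E by move=> _; rewrite lee_fin mulr_ge0 ?P0.
  have p0 xi : S xi -> 0 <= (h zeta)%:E * (P ((enorm x)%:C *: zeta)%R xi)%:E.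
    by move=> _; rewrite -EFinM lee_fin mulr_ge0 ?P0.
  have ph0 xi : S xi -> 0 <= (P ((enorm x)%:C *: zeta)%R xi * h ((enorm x)%:C *: xi)%R)%:E.
    by move=> _; rewrite lee_fin mulr_ge0 ?P0.
  split.
    rewrite EFinD (le_trans _ (leeD2l _ con))// mass -ge0_integralD//=; last first.
      by apply: measurable_funeM.
    apply: ge0_le_integral => //=.
    - by apply: emeasurable_funD => //; apply: measurable_funeM.
    - move=> xi xiS; rewrite -EFinM -EFinD lee_fin (mulrC (h zeta)) -mulrDr ler_wpM2l ?P0//.
      by rewrite -lerBlDl ler_norm.
  rewrite (le_trans _ (leeD2l _ con))// -ge0_integralD//= mass.
  apply: ge0_le_integral => //=.
  - by apply: measurable_funeM.
  - by apply: emeasurable_funD.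
  - move=> xi xiS; rewrite -EFinM -EFinD lee_fin -mulrDr mulrC ler_wpM2l ?P0//.
    by rewrite -lerBlDl distrC ler_norm.
have av0 x : ball x -> 0 <= average (enorm x) zeta.
  move=> x1; apply: integral_ge0 => xi xiS.
  by rewrite lee_fin mulr_ge0 ?P0 ?enorm_ge0.
have nuB : nu ball = 1 by exact: normalized_lebesgue_unit_ball.
set K := (H / _)%R; have K0 : (0 <= K)%R by rewrite divr_ge0// ltW.
have cK : \int[nu]_(x in ball) (cst K%:E) x = K%:E by rewrite integral_cst//= nuB mule1.
have mav : measurable_fun ball (fun x => average (enorm x) zeta).
  exact: measurable_average.
have mm : measurable_fun ball (fun x => (u x)%:E * average (enorm x) zeta).
  exact: emeasurable_funM.
have uav0 x : ball x -> 0 <= (u x)%:E * average (enorm x) zeta.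
  by move=> xB; rewrite mule_ge0 ?lee_fin// av0.
rewrite /I poisson_radial_integral//; split.
  have e1 : 0 <= (h zeta + e)%:E by rewrite lee_fin addr_ge0// ltW.
  rewrite EFinD mulrC EFinM -(integral_radial_weight d_gt0 a0) -ge0_integralZl//=; last first.
    by move=> x _; rewrite lee_fin powR_ge0.
  rewrite -cK -ge0_integralD//=; last 2 first.
  - by move=> x _; rewrite -EFinM lee_fin mulr_ge0 ?powR_ge0// addr_ge0// ltW.
  - by apply: measurable_funeM.
  apply: ge0_le_integral => //=.
  - by apply: emeasurable_funD => //; apply: measurable_funeM.
  - move=> x xB; rewrite -/(u x) -/(average _ _); have [rx|xr] := ltP r (enorm x).
      apply: (@le_trans _ _ ((h zeta + e)%:E * (u x)%:E)).
        by rewrite muleC lee_wpmul2r ?lee_fin//; case: (near x xB rx).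
      by rewrite leeDl// lee_fin.
    apply: (@le_trans _ _ K%:E); last first.
      by rewrite leeDr// -EFinM lee_fin mulr_ge0// addr_ge0// ltW.
    rewrite /K mulrC EFinM lee_pmul ?lee_fin ?av0// ?uK// average_le// enorm_ge0//.
have h0' : 0 <= (h zeta)%:E by rewrite lee_fin.
rewrite mulrC EFinM -(integral_radial_weight d_gt0 a0) -ge0_integralZl//=; last first.
  by move=> x _; rewrite lee_fin powR_ge0.
rewrite EFinD mulrC EFinM -(integral_radial_weight d_gt0 a0) -ge0_integralZl//=; last 2 first.
- by move=> x _; rewrite lee_fin powR_ge0.
- by rewrite lee_fin ltW.
have ee x : 0 <= e%:E * (u x)%:E by rewrite -EFinM lee_fin mulr_ge0// ltW.
rewrite -cK -ge0_integralD//=; last 2 first.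
- by move=> x _; exact: ee.
- by apply: measurable_funeM.
rewrite -ge0_integralD//=; last 2 first.
- by move=> x _; rewrite adde_ge0 ?lee_fin// -lee_fin; exact: ee.
- by apply: emeasurable_funD => //; apply: measurable_funeM.
apply: ge0_le_integral => //=.
- by move=> x _; rewrite mule_ge0 ?lee_fin// powR_ge0.
- by apply: measurable_funeM.
- by apply: emeasurable_funD => //; apply: emeasurable_funD => //; apply: measurable_funeM.
- move=> x xB; rewrite -/(u x) -/(average _ _); have ua0 := uav0 x xB.
  have [rx|xr] := ltP r (enorm x).
    have [_ nx] := near x xB rx.
    apply: (@le_trans _ _ ((u x)%:E * (average (enorm x) zeta + e%:E))).
      by rewrite muleC lee_wpmul2l// lee_fin.
    rewrite ge0_muleDr; [|exact: av0|by rewrite lee_fin ltW].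
    by apply: leeD2l; rewrite muleC; apply: leeDl; rewrite lee_fin.
  rewrite -[leLHS]add0e leeD// -[leLHS]add0e leeD//.
  by rewrite -EFinM lee_fin /K ler_pM// ?uK// hH// zS.
Qed.

End approximation.

End radial_averages.

(** * Mean and variance of the weighted sums *)

Section real_configuration_sums.
Context {R : realType} {d : nat}.
Local Notation V := 'rV[R[i]]_d.
Local Notation ball := (@unit_ball R d).
Implicit Types X : Conf ball.

Lemma conf_esum0 X : conf_esum X (fun=> 0%E : \bar R) = 0%E.
Proof. by rewrite /conf_esum esum1// => x _; rewrite mule0. Qed.

Lemma conf_rsum_ge0 X (g : V -> R) : (forall x, ball x -> 0 <= g x) ->
  conf_rsum X g = fine (conf_esum X (EFin \o g)).
Proof.
move=> g0; rewrite /conf_rsum.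
rewrite (@eq_conf_esum _ _ X (EFin \o g^\+) (EFin \o g)); last first.
  by move=> x xB; rewrite /= /funrpos max_l// g0.
rewrite (@eq_conf_esum _ _ X (EFin \o g^\-) (fun=> 0%E)); last first.
  by move=> x xB; rewrite /= /funrneg max_r// oppr_le0 g0.
by rewrite conf_esum0 subr0.
Qed.

Lemma conf_csum_real X (g : V -> R) : (forall x, ball x -> 0 <= g x) ->
  conf_csum X (fun x => (g x)%:C) = (fine (conf_esum X (EFin \o g)))%:C.
Proof.
move=> g0; rewrite /conf_csum/= conf_rsum_ge0//; congr (_ +i* _).
by rewrite (@conf_rsum_ge0 _ (fun=> 0))// [conf_esum _ _]conf_esum0.
Qed.

End real_configuration_sums.

Section integral_fine.
Context {dT : measure_display} {T : measurableType dT} {R : realType}.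
Variables (m : {measure set T -> \bar R}) (f : T -> \bar R).
Hypothesis mf : measurable_fun [set: T] f.
Hypothesis f0 : forall x, (0 <= f x)%E.
Hypothesis foo : (\int[m]_x f x < +oo)%E.

Lemma ge0_integrable : m.-integrable [set: T] f.
Proof.
by apply/integrableP; split => //; under eq_integral do rewrite gee0_abs//.
Qed.

Lemma integral_fine : (\int[m]_x (fine (f x))%:E = \int[m]_x f x)%E.
Proof.
apply: ae_eq_integral => //; first exact/measurable_EFinP/measurableT_comp.
have := integrable_ae measurableT ge0_integrable.
by apply: filterS => x xf _; rewrite fineK//; exact: xf.
Qed.

End integral_fine.

Section variance.
Context {R : realType} {d : nat}.
Hypothesis d_gt0 : (0 < d)%N.
Local Notation V := 'rV[R[i]]_d.
Local Notation nu := (@normalized_lebesgue R d).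
Local Notation S := (@unit_sphere R d).
Local Notation ball := (@unit_ball R d).
Local Notation Conf := (@Conf R d ball).
Local Notation P := (@poisson_szego R d).

(** A substitute for (1 - |x|^2)^(d + a), to which it is comparable up to a power of the
    ratio (1 - |x|^2d) / (1 - |x|^2); its integrals against the Bergman measure are
    elementary. *)
Definition radial_weight (a : R) (x : V) : R :=
  (1 - enorm x ^+ 2) ^+ d.+1 * (1 - enorm x ^+ (2 * d)) `^ (a - 1).

Definition poisson_sum (X : Conf) (u : V -> R) (zeta : V) : \bar R :=
  conf_esum X (fun x => (u x * P x zeta)%:E).

Variables (h : V -> R) (H : R).
Hypothesis mh : measurable_fun [set: V] h.
Hypothesis H0 : 0 < H.
Hypothesis h0 : forall x, 0 <= h x.
Hypothesis hH : forall x, enorm x <= 1 -> h x <= H.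

(** The indicator makes the terms nonnegative and measurable on the whole space. *)
Definition core_term (a : R) (zeta x : V) : R :=
  \1_ball x * (radial_weight a x * h x * P x zeta).

Let mB : measurable ball := measurable_unit_ball.

Lemma radial_weight_ge0 a x : ball x -> 0 <= radial_weight a x.
Proof.
move=> xB; rewrite mulr_ge0 ?powR_ge0// exprn_ge0// subr_ge0.
by rewrite expr_le1 ?enorm_ge0// ltW.
Qed.

Lemma measurable_radial_weight a : measurable_fun [set: V] (radial_weight a).
Proof.
apply: measurable_funM; last exact: measurable_radial_power.
by apply: measurable_funX; apply: measurable_funB => //; exact: measurable_enormX.
Qed.

Lemma core_term_ge0 a zeta x : 0 <= core_term a zeta x.
Proof.
rewrite /core_term indicE; case: (boolP (x \in ball)) => [/set_mem xB|_].
  rewrite mul1r mulr_ge0 ?poisson_szego_ge0 ?(ltW xB)//.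
  by rewrite mulr_ge0// radial_weight_ge0.
by rewrite mul0r.
Qed.

Lemma core_termE a zeta x : ball x -> core_term a zeta x = radial_weight a x * h x * P x zeta.
Proof. by move=> xB; rewrite /core_term indicE mem_set// mul1r. Qed.

Lemma measurable_core_term_pair a :
  measurable_fun [set: V * V] (fun p => core_term a p.1 p.2).
Proof.
have msw : measurable_fun [set: V * V] (fun p => (p.2, p.1)) by exact: measurable_fun_pair.
have c2 (f : V -> R) : measurable_fun [set: V] f -> measurable_fun [set: V * V] (fun p => f p.2).
  by move=> mf; exact: (measurableT_comp mf measurable_snd).
apply: measurable_funM; first by apply: c2; exact: measurable_indic.
apply: measurable_funM; first last.
  exact: (measurableT_comp measurable_poisson_szego msw).
apply: (c2 (fun x => radial_weight a x * h x)); apply: measurable_funM => //.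
exact: measurable_radial_weight.
Qed.

Lemma measurable_core_term a zeta : measurable_fun [set: V] (core_term a zeta).
Proof. exact: (measurableT_comp (measurable_core_term_pair a) (measurable_pair1 zeta)). Qed.

Lemma poisson_sum_core a X zeta :
  poisson_sum X (fun x => radial_weight a x * h x) zeta = conf_esum X (EFin \o core_term a zeta).
Proof. by apply: eq_conf_esum => x xB; rewrite /= core_termE. Qed.

Variables (Pi : probability Conf R) (lambda : R).
Hypothesis lambda_gt0 : 0 < lambda.
Hypothesis Pi_intensity : forall B : set V, measurable B -> B `<=` ball ->
  (first_intensity Pi B = lambda%:E * bergman_measure B)%E.

Definition core_mean (a : R) (zeta : V) : \bar R :=
  (\int[Pi]_X conf_esum X (EFin \o core_term a zeta))%E.

(** By Campbell's formula; the first factor of the radial weight cancels the density of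
    the Bergman measure. *)
Lemma core_meanE a zeta : core_mean a zeta = (lambda%:E *
  \int[nu]_(x in ball) ((1 - enorm x ^+ (2 * d)) `^ (a - 1) * (h x * P x zeta))%:E)%E.
Proof.
rewrite /core_mean (campbell Pi_intensity (measurable_core_term a zeta)); last first.
  exact: core_term_ge0.
congr (_ * _)%E; apply: eq_integral => x /set_mem xB; congr _%:E.
have q0 : (1 - enorm x ^+ 2) ^+ d.+1 != 0.
  by rewrite expf_neq0// subr_eq0 eq_sym lt_eqF// expr_lt1 ?enorm_ge0.
rewrite core_termE// /radial_weight.
by move: (_ ^+ d.+1) q0 => Q q0; field.
Qed.

(** One of the two kernels in the square is bounded by 4^d / (1 - |x|^2)^d, after which
    the square is at most a constant times the term with exponent 2 a. *)
Lemma core_second_moment a zeta : 0 < a -> S zeta ->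
  (\int[Pi]_X conf_esum X (fun x => (core_term a zeta x ^+ 2)%:E) <=
   (lambda * (H ^+ 2 * 4 ^+ d) / (2 * a))%:E)%E.
Proof.
move=> a0 zS.
rewrite (campbell Pi_intensity (f := fun x => core_term a zeta x ^+ 2)); last 2 first.
- by apply: measurable_funX; exact: measurable_core_term.
- by move=> x; exact: sqr_ge0.
rewrite -mulrA EFinM lee_wpmul2l// ?lee_fin ?(ltW lambda_gt0)//.
have a20 : 0 < 2 * a by rewrite mulr_gt0.
rewrite EFinM -(poisson_radial_mass d_gt0 a20 zS) -ge0_integralZl//=; last 3 first.
- apply/measurable_EFinP; apply: measurable_funTS; apply: measurable_funM.
    exact: measurable_radial_power.
  exact: measurable_poisson_szego_l.
- by move=> x xB; rewrite lee_fin mulr_ge0 ?powR_ge0 ?poisson_szego_ge0// ltW.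
- by rewrite lee_fin mulr_ge0// ?exprn_ge0// ltW.
apply: ge0_le_integral => //=.
- by move=> x xB; rewrite lee_fin mulr_ge0 ?sqr_ge0//; exact: bergman_density_ge0.
- apply/measurable_EFinP; apply: measurable_funM; last exact: measurable_bergman_density.
  by apply: measurable_funTS; apply: measurable_funX; exact: measurable_core_term.
- apply: measurable_funeM; apply/measurable_EFinP; apply: measurable_funTS; apply: measurable_funM.
    exact: measurable_radial_power.
  exact: measurable_poisson_szego_l.
move=> x xB; rewrite -EFinM lee_fin core_termE// /radial_weight.
have x0 := enorm_ge0 x; have x1 : enorm x < 1 by [].
set q := 1 - enorm x ^+ 2; set y := 1 - enorm x ^+ (2 * d).
have q0 : 0 < q by rewrite subr_gt0 expr_lt1.
have y0 : 0 < y by rewrite subr_gt0 expr_lt1// muln_gt0.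
have qy : q <= y.
  rewrite lerD2l lerN2 exprM -[leRHS]expr1 ler_wiXn2l ?sqr_ge0//.
  by rewrite expr_le1// ltW.
have p0 : 0 <= P x zeta by rewrite poisson_szego_ge0// ltW.
have pq : P x zeta * q ^+ d <= 4 ^+ d.
  by rewrite -ler_pdivlMr ?exprn_gt0//; exact: poisson_szego_le.
have yy : y `^ (2 * a - 1) = y * (y `^ (a - 1)) ^+ 2.
  rewrite -powR_mulrn ?powR_ge0// -powRrM -{2}(powRr1 (ltW y0)) -powRD.
    by congr (_ `^ _); ring.
  by rewrite (gt_eqF y0) implybT.
rewrite yy; set t := (y `^ (a - 1)) ^+ 2; have t0 : 0 <= t by exact: sqr_ge0.
have -> : (q ^+ d.+1 * y `^ (a - 1) * h x * P x zeta) ^+ 2 / q ^+ d.+1 =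
    (h x ^+ 2 * (P x zeta * q ^+ d)) * (q * t * P x zeta).
  rewrite /t; have qn : q != 0 by rewrite gt_eqF.
  rewrite !exprS; have wn : q ^+ d != 0 by rewrite expf_neq0.
  by move: (q ^+ d) wn => w wn; field; rewrite qn wn.
have -> : H ^+ 2 * 4 ^+ d * (y * t * P x zeta) = (H ^+ 2 * 4 ^+ d) * (y * t * P x zeta) by [].
apply: ler_pM.
- by rewrite mulr_ge0 ?sqr_ge0// mulr_ge0// exprn_ge0// ltW.
- by rewrite mulr_ge0// mulr_ge0// ltW.
- apply: ler_pM => //; first exact: sqr_ge0.
    by rewrite mulr_ge0// exprn_ge0// ltW.
  by rewrite lerXn2r ?nnegrE ?(ltW H0)// hH// ltW.
- by rewrite ler_wpM2r// ler_wpM2r.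
Qed.

Variable (C : R).
Hypothesis C0 : 0 < C.
Hypothesis Pi_var : forall f : V -> R[i], cmeasurable_fun ball f ->
  (\int[Pi]_X conf_esum X (fun x => (cabs (f x) + cabs (f x) ^+ 2)%:E) < +oo)%E ->
  (cvariance Pi (fun X => conf_csum X f) <=
    C%:E * \int[Pi]_X conf_esum X (fun x => (cabs (f x) ^+ 2)%:E))%E.

Lemma measurable_core_sum a zeta :
  measurable_fun [set: Conf] (fun X : Conf => conf_esum X (EFin \o core_term a zeta)).
Proof. apply: measurable_conf_esum; [exact: measurable_core_term|exact: core_term_ge0]. Qed.

(** The small variance assumption, applied to the terms at a fixed boundary point. *)
Lemma core_variance a zeta : 0 < a -> S zeta -> (core_mean a zeta < +oo)%E ->
  (\int[Pi]_X ((fine (conf_esum X (EFin \o core_term a zeta)) -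
     fine (core_mean a zeta)) ^+ 2)%:E <= (C * (lambda * (H ^+ 2 * 4 ^+ d)) / 2 / a)%:E)%E.
Proof.
move=> a0 zS moo; pose f x : R[i] := (core_term a zeta x)%:C.
have cf x : cabs (f x) = core_term a zeta x by rewrite cabsR ger0_norm// core_term_ge0.
have mf : cmeasurable_fun ball f.
  split; apply: measurable_funTS => /=; last exact: measurable_cst.
  exact: measurable_core_term.
have soo := core_second_moment a0 zS.
have e2 : (\int[Pi]_X conf_esum X (fun x => (cabs (f x) ^+ 2)%:E) =
    \int[Pi]_X conf_esum X (fun x => (core_term a zeta x ^+ 2)%:E))%E.
  by apply: eq_integral => X _; apply: eq_conf_esum => x _; rewrite cf.
have e1 : (\int[Pi]_X conf_esum X (fun x => (cabs (f x) + cabs (f x) ^+ 2)%:E) < +oo)%E.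
  have -> : (\int[Pi]_X conf_esum X (fun x => (cabs (f x) + cabs (f x) ^+ 2)%:E) =
    core_mean a zeta + \int[Pi]_X conf_esum X (fun x => (core_term a zeta x ^+ 2)%:E))%E.
    rewrite /core_mean -ge0_integralD//; last 4 first.
    - by move=> X _; apply: conf_esum_ge0 => x; rewrite lee_fin core_term_ge0.
    - exact: measurable_core_sum.
    - by move=> X _; apply: conf_esum_ge0 => x; rewrite lee_fin sqr_ge0.
    - apply: (@measurable_conf_esum _ _ (fun x => core_term a zeta x ^+ 2)).
        by apply: measurable_funX; exact: measurable_core_term.
      by move=> x; exact: sqr_ge0.
    apply: eq_integral => X _; rewrite -conf_esumD; last 2 first.
    - by move=> x; rewrite lee_fin core_term_ge0.
    - by move=> x; rewrite lee_fin sqr_ge0.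
    by apply: eq_conf_esum => x _; rewrite cf EFinD.
  by apply: lte_add_pinfty => //; apply: le_lt_trans soo _; rewrite ltry.
have := Pi_var mf e1; rewrite e2 => /le_trans/(_ (lee_wpmul2l _ soo)).
rewrite lee_fin ltW// => /(_ isT).
have -> : (C%:E * (lambda * (H ^+ 2 * 4 ^+ d) / (2 * a))%:E =
    (C * (lambda * (H ^+ 2 * 4 ^+ d)) / 2 / a)%:E)%E.
  by rewrite -EFinM; congr _%:E; rewrite invfM !mulrA.
apply: le_trans; rewrite le_eqVlt; apply/orP; left; apply/eqP.
rewrite /cvariance.
have cs (X : Conf) : conf_csum X f = (fine (conf_esum X (EFin \o core_term a zeta)))%:C.
  by rewrite conf_csum_real// => x _; exact: core_term_ge0.
have -> : cintegral Pi setT (fun X : Conf => conf_csum X f) = (fine (core_mean a zeta))%:C.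
  rewrite /cintegral /Rintegral; congr (_ +i* _).
    under eq_integral do rewrite cs/=.
    rewrite integral_fine//; first exact: measurable_core_sum.
    by move=> X; apply: conf_esum_ge0 => x; rewrite lee_fin core_term_ge0.
  under eq_integral do rewrite cs/=.
  by rewrite integral0.
apply: eq_integral => X _; rewrite cs -rmorphB cabsR.
by rewrite -normrX ger0_norm// sqr_ge0.
Qed.

End variance.

(** * Square distance and almost sure convergence *)

Section square_distance.
Context {dT : measure_display} {T : measurableType dT} {R : realType}.
Variables (m : {measure set T -> \bar R}) (D : set T).
Hypothesis mD : measurable D.
Implicit Types F G H L U : T -> R.

Definition sqdist F G : \bar R := (\int[m]_(t in D) ((F t - G t) ^+ 2)%:E)%E.

Lemma measurable_sqdist F G : measurable_fun D F -> measurable_fun D G ->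
  measurable_fun D (fun t => ((F t - G t) ^+ 2)%:E).
Proof.
by move=> mF mG; apply/measurable_EFinP; apply: measurable_funX; exact: measurable_funB.
Qed.

Lemma sqdist_ge0 F G : (0 <= sqdist F G)%E.
Proof. by apply: integral_ge0 => t _; rewrite lee_fin sqr_ge0. Qed.

Lemma sqdist_triangle G F H : measurable_fun D F -> measurable_fun D G -> measurable_fun D H ->
  (sqdist F H <= 2%:E * sqdist F G + 2%:E * sqdist G H)%E.
Proof.
move=> mF mG mH; have mFG := measurable_sqdist mF mG; have mGH := measurable_sqdist mG mH.
rewrite /sqdist -!ge0_integralZl//=; last 2 first.
- by move=> t _; rewrite lee_fin sqr_ge0.
- by move=> t _; rewrite lee_fin sqr_ge0.
rewrite -ge0_integralD//=; last 4 first.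
- by move=> t _; rewrite -EFinM lee_fin mulr_ge0// sqr_ge0.
- exact: measurable_funeM.
- by move=> t _; rewrite -EFinM lee_fin mulr_ge0// sqr_ge0.
- exact: measurable_funeM.
apply: ge0_le_integral => //=.
- by move=> t _; rewrite lee_fin sqr_ge0.
- exact: measurable_sqdist.
- by apply: emeasurable_funD; exact: measurable_funeM.
- move=> t _; rewrite -!EFinM -EFinD lee_fin.
  by have := sqr_ge0 ((F t - G t) - (G t - H t)); nra.
Qed.

Lemma sqdist_squeeze L U F H : measurable_fun D L -> measurable_fun D U ->
  measurable_fun D F -> measurable_fun D H ->
  (forall t, D t -> L t <= F t <= U t) ->
  (sqdist F H <= sqdist L H + sqdist U H)%E.
Proof.
move=> mL mU mF mH LFU; have mLH := measurable_sqdist mL mH.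
have mUH := measurable_sqdist mU mH.
rewrite /sqdist -ge0_integralD//=; last 2 first.
- by move=> t _; rewrite lee_fin sqr_ge0.
- by move=> t _; rewrite lee_fin sqr_ge0.
apply: ge0_le_integral => //=.
- by move=> t _; rewrite lee_fin sqr_ge0.
- exact: measurable_sqdist.
- exact: emeasurable_funD.
- move=> t /LFU /andP[LF FU]; rewrite -EFinD lee_fin.
  have [h|h] := leP (H t) (F t).
    rewrite (@le_trans _ _ ((U t - H t) ^+ 2)) ?lerDr ?sqr_ge0//.
    by rewrite lerXn2r ?nnegrE ?subr_ge0 ?lerD2r// (le_trans h).
  rewrite (@le_trans _ _ ((L t - H t) ^+ 2)) ?lerDl ?sqr_ge0//.
  rewrite -sqrrN -[leRHS]sqrrN !opprB lerXn2r ?nnegrE ?subr_ge0 ?lerD2l ?lerN2//.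
    exact: ltW.
  by rewrite (le_trans LF)// ltW.
Qed.

Lemma sqdist_bound F G c : (m D <= 1)%E -> measurable_fun D F -> measurable_fun D G ->
  (forall t, D t -> `|F t - G t| <= c) -> (sqdist F G <= (c ^+ 2)%:E)%E.
Proof.
move=> m1 mF mG FG; apply: (@le_trans _ _ (\int[m]_(t in D) (c ^+ 2)%:E)%E).
  apply: ge0_le_integral => //=.
  - by move=> t _; rewrite lee_fin sqr_ge0.
  - exact: measurable_sqdist.
  - move=> t Dt; rewrite lee_fin -real_normK ?num_real// lerXn2r ?nnegrE ?FG//.
    exact: le_trans (FG t Dt).
rewrite integral_cst// -[leRHS]mule1 lee_wpmul2l// lee_fin sqr_ge0.
by [].
Qed.

Lemma sqdistZ c F G : measurable_fun D F -> measurable_fun D G ->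
  sqdist (fun t => c * F t) (fun t => c * G t) = ((c ^+ 2)%:E * sqdist F G)%E.
Proof.
move=> mF mG; rewrite /sqdist -ge0_integralZl//=; last 3 first.
- exact: measurable_sqdist.
- by move=> t _; rewrite lee_fin sqr_ge0.
- by rewrite lee_fin sqr_ge0.
by apply: eq_integral => t _; rewrite -EFinM -exprMn mulrBr.
Qed.

End square_distance.

Section tonelli_on.
Context {d1 d2 : measure_display} {T1 : measurableType d1} {T2 : measurableType d2}.
Context {R : realType}.
Variables (m1 : {sigma_finite_measure set T1 -> \bar R})
          (m2 : {sigma_finite_measure set T2 -> \bar R}) (D : set T2).
Hypothesis mD : measurable D.

Lemma tonelli_on (g : T1 * T2 -> \bar R) :
  measurable_fun [set: T1 * T2] g -> (forall q, 0 <= g q)%E ->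
  measurable_fun [set: T1] (fun x => \int[m2]_(y in D) g (x, y))%E /\
  measurable_fun [set: T2] (fun y => \int[m1]_x g (x, y))%E /\
  (\int[m1]_x (\int[m2]_(y in D) g (x, y)) = \int[m2]_(y in D) (\int[m1]_x g (x, y)))%E.
Proof.
move=> mg g0; have mi : measurable_fun [set: T2] (\1_D : T2 -> R) by exact: measurable_indic.
pose G q := (g q * (\1_D q.2)%:E)%E.
have mG : measurable_fun [set: T1 * T2] G.
  apply: emeasurable_funM => //.
  by apply/measurable_EFinP; exact: (measurableT_comp mi measurable_snd).
have G0 q : (0 <= G q)%E by rewrite mule_ge0// lee_fin.
have GE x : (\int[m2]_(y in D) g (x, y) = \int[m2]_y G (x, y))%E.
  rewrite integral_mkcond; apply: eq_integral => y _.
  by rewrite patchE /G /= indicE; case: ifPn => _; rewrite ?mule1 ?mule0.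
split.
  under eq_fun do rewrite GE.
  exact: (@measurable_fun_fubini_tonelli_F _ _ _ _ _ m2 _ mG G0).
split; first exact: (@measurable_fun_fubini_tonelli_G _ _ _ _ _ m1 _ mg g0).
under eq_integral do rewrite GE.
rewrite (fubini_tonelli G mG G0) [RHS]integral_mkcond; apply: eq_integral => y _.
rewrite patchE /G /= indicE; case: ifPn => _.
  by apply: eq_integral => x _; rewrite mule1.
by rewrite integral0_eq// => x _; rewrite mule0.
Qed.

End tonelli_on.

(** Convergence of a nonnegative quantity to 0, in the form that composes with
    inequalities. *)
Definition vanishes {I : Type} {R : realType} (F : set_system I) (u : I -> \bar R) :=
  forall e : R, 0 < e -> \forall i \near F, (u i <= e%:E)%E.

Section vanishing.
Context {I : Type} {R : realType} (F : set_system I) {FF : Filter F}.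
Implicit Types u v : I -> \bar R.

Lemma vanishes_cvg u : (forall i, (0 <= u i)%E) -> vanishes F u -> u i @[i --> F] --> 0%E.
Proof.
move=> u0 uF; apply/fine_cvgP; split.
  apply: filterS (uF 1 ltr01) => i ui; rewrite ge0_fin_numE//.
  by rewrite (le_lt_trans ui)// ltry.
apply/cvgrPdist_le => e e0; apply: filterS (uF e e0) => i ui /=.
rewrite sub0r normrN ger0_norm ?fine_ge0// -lee_fin fineK// ge0_fin_numE//.
by rewrite (le_lt_trans ui)// ltry.
Qed.

Lemma vanishes_le u v : (\forall i \near F, (u i <= v i)%E) -> vanishes F v -> vanishes F u.
Proof.
by move=> uv vF e /vF; apply: filterS2 uv => i; exact: le_trans.
Qed.

Lemma vanishesD u v : vanishes F u -> vanishes F v -> vanishes F (fun i => u i + v i)%E.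
Proof.
move=> uF vF e e0; have e2 : 0 < e / 2 by rewrite divr_gt0.
apply: filterS2 (uF _ e2) (vF _ e2) => i ui vi.
by rewrite (splitr e) EFinD leeD.
Qed.

Lemma vanishesZ u (c : R) : 0 <= c -> vanishes F u -> vanishes F (fun i => c%:E * u i)%E.
Proof.
move=> c0 uF e e0; have c1 : 0 < c + 1 by rewrite ltr_wpDl.
have ec : 0 < e / (c + 1) by rewrite divr_gt0.
apply: filterS (uF _ ec) => i ui.
apply: (@le_trans _ _ (c%:E * (e / (c + 1))%:E)%E); first by rewrite lee_wpmul2l// lee_fin.
by rewrite -EFinM lee_fin mulrCA ger_pMr// ler_pdivrMr// mul1r lerDl.
Qed.

End vanishing.

Section almost_sure_convergence.
Context {R : realType} {d : nat}.
Hypothesis d_gt0 : (0 < d)%N.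
Local Notation V := 'rV[R[i]]_d.
Local Notation nu := (@normalized_lebesgue R d).
Local Notation S := (@unit_sphere R d).
Local Notation ball := (@unit_ball R d).
Local Notation Conf := (@Conf R d ball).
Local Notation P := (@poisson_szego R d).

Variables (h : V -> R) (H : R).
Hypothesis mh : measurable_fun [set: V] h.
Hypothesis H0 : 0 < H.
Hypothesis h0 : forall x, 0 <= h x.
Hypothesis hH : forall x, enorm x <= 1 -> h x <= H.
Hypothesis hS : forall e, (0 < e)%R -> exists2 dl : R, (0 < dl)%R &
  forall zeta x, S zeta -> (enorm x <= 1)%R -> (enorm (zeta - x) < dl)%R ->
  (`|h zeta - h x| <= e)%R.
Variables (Pi : probability Conf R) (lambda C : R).
Hypothesis lambda_gt0 : 0 < lambda.
Hypothesis Pi_intensity : forall B : set V, measurable B -> B `<=` ball ->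
  (first_intensity Pi B = lambda%:E * bergman_measure B)%E.
Hypothesis C0 : 0 < C.
Hypothesis Pi_var : forall f : V -> R[i], cmeasurable_fun ball f ->
  (\int[Pi]_X conf_esum X (fun x => (cabs (f x) + cabs (f x) ^+ 2)%:E) < +oo)%E ->
  (cvariance Pi (fun X => conf_csum X f) <=
    C%:E * \int[Pi]_X conf_esum X (fun x => (cabs (f x) ^+ 2)%:E))%E.
Variable mu : probability V R.
Hypothesis mu_sphere : mu S = 1%E.

Let mS : measurable S := measurable_unit_sphere.
Let mB : measurable ball := measurable_unit_ball.
Let mean := core_mean h Pi.
Let sum a (X : Conf) zeta : \bar R := conf_esum X (EFin \o core_term h a zeta).

Lemma core_mean_approx (e : R) : 0 < e -> exists2 K : R, 0 <= K &
  forall a zeta, 0 < a -> S zeta -> (mean a zeta < +oo)%E /\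
  `|a * fine (mean a zeta) - lambda * h zeta| <= lambda * (e + a * K).
Proof.
move=> e0; have [K K0 hK] := radial_poisson_approx d_gt0 mh H0 h0 hH hS e0.
exists K => // a zeta a0 zS; have [] := hK a zeta a0 zS.
rewrite /mean (core_meanE mh h0 Pi_intensity).
set I := (\int[_]_(x in _) _)%E => I1 I2.
have I0 : (0 <= I)%E.
  apply: integral_ge0 => x xB; rewrite lee_fin mulr_ge0 ?powR_ge0// mulr_ge0//.
  by rewrite poisson_szego_ge0// ltW.
have Ifin : I \is a fin_num by rewrite ge0_fin_numE// (le_lt_trans I1)// ltry.
rewrite fineM//= -[in X in X /\ _](fineK Ifin) -EFinM ltry; split => //.
move: I1 I2; rewrite -(fineK Ifin) /= -EFinD !lee_fin; set J := fine I => J1 J2.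
have -> : a * (lambda * J) - lambda * h zeta = lambda * (a * J - h zeta) by ring.
rewrite normrM gtr0_norm// ler_wpM2l ?(ltW lambda_gt0)//.
rewrite ler_norml; apply/andP; split.
  have := ler_wpM2l (ltW a0) J2; rewrite mulrDr mulrDr !mulrA mulfV ?gt_eqF// !mul1r.
  by lra.
have := ler_wpM2l (ltW a0) J1; rewrite mulrDr !mulrA mulfV ?gt_eqF// !mul1r.
by lra.
Qed.

Let measurable_sum_pair a : measurable_fun [set: Conf * V] (fun q : Conf * V => sum a q.1 q.2).
Proof.
have := @measurable_conf_esum_pair R d (fun p => core_term h a p.1.2 p.2).
apply; last by move=> p; exact: core_term_ge0.
have mm : measurable_fun [set: Conf * V * V] (fun p : Conf * V * V => (p.1.2, p.2)).
  apply: measurable_fun_pair => //.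
  exact: (measurableT_comp measurable_snd measurable_fst).
exact: (measurableT_comp (measurable_core_term_pair mh a) mm).
Qed.

Let sum_ge0 a X zeta : (0 <= sum a X zeta)%E.
Proof. by apply: conf_esum_ge0 => x; rewrite lee_fin core_term_ge0. Qed.

Let measurable_mean a : measurable_fun [set: V] (mean a).
Proof.
have := @measurable_fun_fubini_tonelli_G _ _ _ _ _ Pi _ (measurable_sum_pair a).
by apply => q; exact: sum_ge0.
Qed.

Lemma measurable_core_sum_r a (X : Conf) : measurable_fun [set: V] (sum a X).
Proof. exact: (measurableT_comp (measurable_sum_pair a) (measurable_pair1 X)). Qed.

(** Summable, so that the expected deviations, which are of the order of the exponent,
    add up; and with consecutive ratios tending to 1, so that monotonicity fills the
    gaps. *)
Definition sample (n : nat) : R := (n.+1%:R * n.+2%:R)^-1.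

Lemma sample_gt0 n : 0 < sample n.
Proof. by rewrite invr_gt0 mulr_gt0. Qed.

Lemma sample_cvg0 : sample n @[n --> \oo] --> (0 : R).
Proof.
apply/cvgrPdist_le => e e0; move/cvgrPdist_le : (@cvg_harmonic R) => /(_ e e0).
apply: filterS => n; rewrite !sub0r !normrN !gtr0_norm ?sample_gt0 ?invr_gt0//.
apply: le_trans; rewrite /sample invfM ler_piMr ?invr_ge0// invf_le1//.
by rewrite ler1n.
Qed.

Let deviation n (X : Conf) := sqdist mu S (fun zeta => sample n * fine (sum (sample n) X zeta))
  (fun zeta => sample n * fine (mean (sample n) zeta)).

Let Kv := C * (lambda * (H ^+ 2 * 4 ^+ d)) / 2.

Let Kv_ge0 : 0 <= Kv.
Proof. by rewrite divr_ge0// !mulr_ge0 ?exprn_ge0// ltW. Qed.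

Let gap n (q : Conf * V) : \bar R := ((sample n * fine (sum (sample n) q.1 q.2) -
  sample n * fine (mean (sample n) q.2)) ^+ 2)%:E.

Let measurable_gap n : measurable_fun [set: Conf * V] (gap n).
Proof.
apply/measurable_EFinP; apply: measurable_funX; apply: measurable_funB;
  apply: measurable_funM => //.
  exact: (measurableT_comp (fine_measurable measurableT) (measurable_sum_pair _)).
apply: (measurableT_comp (fine_measurable measurableT)).
exact: (measurableT_comp (measurable_mean _) measurable_snd).
Qed.

Let gap_ge0 n q : (0 <= gap n q)%E.
Proof. by rewrite lee_fin sqr_ge0. Qed.

Let measurable_deviation n : measurable_fun [set: Conf] (deviation n).
Proof. by have [] := tonelli_on Pi mu mS (@measurable_gap n) (@gap_ge0 n). Qed.

Let mu_cst (c : R) : (\int[mu]_(zeta in S) c%:E = c%:E)%E.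
Proof.
rewrite integral_cst//; set s := (X in (_ * X)%E).
by have -> : s = 1%E by []; rewrite mule1.
Qed.

Let integral_deviation n : (\int[Pi]_X deviation n X <= (Kv * sample n)%:E)%E.
Proof.
have s0 := sample_gt0 n; have [K K0 hK] := core_mean_approx ltr01.
have [_ [mg e]] := tonelli_on Pi mu mS (@measurable_gap n) (@gap_ge0 n).
rewrite [leLHS]e -mu_cst; apply: ge0_le_integral => //.
- by move=> zeta _; exact: integral_ge0.
- exact: measurable_funTS.
move=> zeta zS; have [moo _] := hK _ _ s0 zS.
have := core_variance d_gt0 mh H0 h0 hH lambda_gt0 Pi_intensity C0 Pi_var s0 zS moo.
rewrite -/Kv => hv; apply: (@le_trans _ _ ((sample n ^+ 2)%:E * (Kv / sample n)%:E)%E).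
  apply: le_trans (lee_wpmul2l _ hv); last by rewrite lee_fin sqr_ge0.
  rewrite -ge0_integralZl//; last 3 first.
  - apply/measurable_EFinP; apply: measurable_funX; apply: measurable_funB => //.
    apply: (measurableT_comp (fine_measurable measurableT)); exact: measurable_core_sum.
  - by move=> X _; rewrite lee_fin sqr_ge0.
  - by rewrite lee_fin sqr_ge0.
  rewrite le_eqVlt; apply/orP; left; apply/eqP; apply: eq_integral => X _.
  by rewrite /gap/= -EFinM -exprMn mulrBr.
by rewrite -EFinM lee_fin expr2 -mulrA (mulrCA _ Kv) mulfV ?gt_eqF// mulr1 mulrC.
Qed.

Lemma sum_sample n : \sum_(0 <= k < n) sample k = 1 - n.+1%:R^-1.
Proof.
elim: n => [|n ih]; first by rewrite big_nil invr1 subrr.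
rewrite big_nat_recr//= ih /sample.
rewrite -[n.+2%:R]natr1 -[n.+1%:R]natr1; field.
by rewrite !natr1 !pnatr_eq0.
Qed.

(** Their expectations being summable, the deviations are almost surely summable. *)
Lemma deviation_vanishes_ae : {ae Pi, forall X, vanishes \oo (deviation ^~ X)}.
Proof.
have dev0 n X : (0 <= deviation n X)%E by exact: sqdist_ge0.
have tot : (\int[Pi]_X (\sum_(n <oo) deviation n X) < +oo)%E.
  rewrite integral_nneseries//.
  apply: (@le_lt_trans _ _ Kv%:E); last by rewrite ltry.
  apply: lime_le; first by apply: is_cvg_nneseries => n _ _; exact: integral_ge0.
  apply: nearW => n; apply: (@le_trans _ _ (\sum_(0 <= k < n) (Kv * sample k)%:E)%E).
    by apply: lee_sum => k _; exact: integral_deviation.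
  rewrite sumEFin lee_fin -mulr_sumr sum_sample ler_piMr//.
have msum : measurable_fun [set: Conf] (fun X => \sum_(n <oo) deviation n X)%E.
  by apply: ge0_emeasurable_sum => n *; [exact: dev0|exact: measurable_deviation].
have := integrable_ae measurableT (ge0_integrable msum _ tot).
have s0 X : (0 <= \sum_(n <oo) deviation n X)%E by exact: nneseries_ge0.
move=> /(_ s0); apply: filterS => X /(_ I) Xfin e e0.
have foo : (\sum_(n <oo) deviation n X < +oo)%E by rewrite -ge0_fin_numE.
have /fine_cvgP[_] := nneseries_tail_cvg foo (fun n _ => dev0 n X).
move/cvgrPdist_le => /(_ e e0) [N _ hN]; exists N => // n /= Nn.
have tail_le : (deviation n X <= \sum_(n <= k <oo) deviation k X)%E.
  rewrite (@nneseries_split _ (deviation ^~ X) n 1)// addn1 big_nat1.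
  by rewrite leeDl// nneseries_ge0.
apply: (le_trans tail_le).
have tf : (\sum_(n <= k <oo) deviation k X)%E \is a fin_num.
  rewrite ge0_fin_numE ?nneseries_ge0//; apply: le_lt_trans foo.
  rewrite (@nneseries_split _ (deviation ^~ X) 0 n)// add0n leeDr// sume_ge0//.
have := hN n Nn; rewrite sub0r normrN ger0_norm ?fine_ge0 ?nneseries_ge0//=.
by rewrite -lee_fin fineK.
Qed.

Let total_finite_ae n :
  {ae Pi, forall X, (\int[mu]_(zeta in S) sum (sample n) X zeta < +oo)%E}.
Proof.
have s0 := sample_gt0 n; have [K K0 hK] := core_mean_approx ltr01.
have [mt [mm e]] := tonelli_on Pi mu mS (measurable_sum_pair (sample n))
  (fun q => sum_ge0 (sample n) q.1 q.2).
pose B := (lambda * H + lambda * (1 + sample n * K)) / sample n.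
have fin : (\int[Pi]_X (\int[mu]_(zeta in S) sum (sample n) X zeta) < +oo)%E.
  apply: (@le_lt_trans _ _ B%:E); last by rewrite ltry.
  rewrite [leLHS]e -mu_cst; apply: ge0_le_integral => //.
  - by move=> zeta _; exact: integral_ge0.
  - exact: measurable_funTS.
  move=> zeta zS; have [moo] := hK _ _ s0 zS.
  have m0 : (0 <= mean (sample n) zeta)%E by apply: integral_ge0 => X _; exact: sum_ge0.
  have -> : (\int[Pi]_X sum (sample n) X zeta = (fine (mean (sample n) zeta))%:E)%E.
    by rewrite fineK// ge0_fin_numE.
  rewrite lee_fin ler_pdivlMr// mulrC => /ler_normlP[_].
  have : lambda * h zeta <= lambda * H by rewrite ler_wpM2l ?(ltW lambda_gt0)// hH// zS.
  by lra.
have t0 (X : Conf) : (0 <= \int[mu]_(zeta in S) sum (sample n) X zeta)%E.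
  by apply: integral_ge0 => zeta _; exact: sum_ge0.
have := integrable_ae measurableT (ge0_integrable mt t0 fin).
by apply: filterS => X /(_ I) Xf; rewrite -(ge0_fin_numE (t0 X)); exact: Xf.
Qed.

(** The squared deviations from the mean are summable along the sampled exponents, and
    the means converge uniformly. *)
Theorem core_sums_converge_ae : {ae Pi, forall X,
  (forall n, \int[mu]_(zeta in S) poisson_sum X (fun x => (radial_weight (sample n) x * h x)%R) zeta
     < +oo)%E /\
  vanishes \oo (fun n => sqdist mu S
    (fun zeta => sample n * fine (poisson_sum X (fun x => radial_weight (sample n) x * h x) zeta))
    (fun zeta => lambda * h zeta))}.
Proof.
have sE n X zeta : poisson_sum X (fun x => radial_weight (sample n) x * h x) zeta =
  sum (sample n) X zeta by exact: poisson_sum_core.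
apply: filterS2 (ae_foralln total_finite_ae) deviation_vanishes_ae => X tX dX.
split; first by move=> n; under eq_integral do rewrite sE; exact: tX.
have mfine f : measurable_fun [set: V] f -> measurable_fun S (fun zeta => fine (f zeta)).
  move=> mf; apply: measurable_funTS.
  exact: (measurableT_comp (fine_measurable measurableT) mf).
have m1 n : measurable_fun S (fun zeta => sample n * fine (sum (sample n) X zeta)).
  by apply: measurable_funM => //; apply: mfine; exact: measurable_core_sum_r.
have m2 n : measurable_fun S (fun zeta => sample n * fine (mean (sample n) zeta)).
  by apply: measurable_funM => //; apply: mfine.
have m3 : measurable_fun S (fun zeta => lambda * h zeta).
  by apply: measurable_funTS; exact: measurable_funM.
have van : vanishes \oo (fun n => sqdist mu S
    (fun zeta => sample n * fine (mean (sample n) zeta)) (fun zeta => lambda * h zeta)).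
  move=> e e0; pose e1 := Num.min 1 e.
  have e10 : 0 < e1 by rewrite lt_min ltr01.
  have e11 : e1 ^+ 2 <= e.
    rewrite (@le_trans _ _ e1)//; last by rewrite ge_min lexx orbT.
    by rewrite -[leRHS]expr1 ler_wiXn2l ?(ltW e10)// ge_min lexx.
  pose e2 := e1 / (2 * lambda); have e20 : 0 < e2 by rewrite divr_gt0// mulr_gt0.
  have [K K0 hK] := core_mean_approx e20.
  have eK : 0 < e2 / (K + 1) by rewrite divr_gt0// ltr_wpDl.
  move/cvgrPdist_le : sample_cvg0 => /(_ _ eK); apply: filterS => n; rewrite sub0r normrN.
  rewrite gtr0_norm ?sample_gt0// => sK.
  apply: (@le_trans _ _ (e1 ^+ 2)%:E); last by rewrite lee_fin.
  apply: sqdist_bound => //; first exact: probability_le1.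
  move=> zeta zS; have [_] := hK _ _ (sample_gt0 n) zS; move/le_trans; apply.
  move: sK; rewrite ler_pdivlMr ?ltr_wpDl// => sK.
  have -> : e1 = lambda * (e2 + e2).
    by rewrite /e2; field; rewrite gt_eqF.
  rewrite ler_wpM2l ?(ltW lambda_gt0)// lerD2l (le_trans _ sK)//.
  by rewrite ler_wpM2l ?(ltW (sample_gt0 _))// lerDl.
pose w n := sqdist mu S
  (fun zeta => sample n * fine (mean (sample n) zeta)) (fun zeta => lambda * h zeta).
apply: (@vanishes_le _ _ _ _ _ (fun n => 2%:E * deviation n X + 2%:E * w n)%E).
  apply: nearW => n; have -> : (fun zeta => sample n *
      fine (poisson_sum X (fun x => radial_weight (sample n) x * h x) zeta)) =
      (fun zeta => sample n * fine (sum (sample n) X zeta)).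
    by apply/funext => zeta; rewrite sE.
  exact: sqdist_triangle.
by apply: vanishesD; apply: vanishesZ.
Qed.

End almost_sure_convergence.

(** * From sampled exponents to all exponents *)

Lemma vanishes_shift {R : realType} (u : nat -> \bar R) :
  vanishes \oo u -> vanishes \oo (fun n => u n.+1).
Proof.
move=> uF e e0; have [N _ hN] := uF e e0; exists N => // n /= Nn.
exact: (hN n.+1 (leqW Nn)).
Qed.

Section scaled_distance.
Context {dT : measure_display} {T : measurableType dT} {R : realType}.
Variables (m : {measure set T -> \bar R}) (D : set T).
Hypothesis mD : measurable D.
Hypothesis m1 : (m D <= 1)%E.

(** Boundedness of the limit B absorbs the change of the factor. *)
Lemma sqdist_scaled_vanishes {I : Type} (F : set_system I) {FF : Filter F}
    (c : I -> R) (c0 H : R) (A : I -> T -> R) (B : T -> R) :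
  c i @[i --> F] --> c0 -> (forall i, measurable_fun D (A i)) -> measurable_fun D B ->
  (forall t, D t -> `|B t| <= H) -> 0 < H ->
  vanishes F (fun i => sqdist m D (A i) B) ->
  vanishes F (fun i => sqdist m D (fun t => c i * A i t) (fun t => c0 * B t)).
Proof.
move=> cc0 mA mB BH H0 AB.
pose v i := (2%:E * ((`|c0| + 1) ^+ 2)%:E * sqdist m D (A i) B
  + 2%:E * (((c i - c0) * H) ^+ 2)%:E)%E.
apply: (@vanishes_le _ _ _ _ _ v).
  move/cvgrPdist_le : cc0 => /(_ 1 ltr01); apply: filterS => i ci.
  have mc (k : R) G : measurable_fun D G -> measurable_fun D (fun t => k * G t).
    by move=> mG; exact: measurable_funM.
  apply: (le_trans (@sqdist_triangle _ _ _ m D mD (fun t => c i * B t) _ _ _ _ _)); try exact: mc.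
  rewrite sqdistZ// /v -muleA leeD// lee_wpmul2l// ?lee_fin//.
    rewrite lee_wpmul2r ?sqdist_ge0// lee_fin -[leLHS]real_normK ?num_real//.
    rewrite lerXn2r ?nnegrE ?addr_ge0// -[c i](subrK c0) addrC (le_trans (ler_normD _ _))//.
    by rewrite lerD2l distrC.
  apply: le_trans (sqdist_bound (c := `|c i - c0| * H) mD m1 _ _ _) _; try exact: mc.
    by move=> t Dt; rewrite -mulrBl normrM ler_wpM2l// BH.
  by rewrite lee_fin !exprMn real_normK ?num_real.
apply: vanishesD.
  rewrite /v; under eq_fun do rewrite -EFinM.
  by apply: vanishesZ => //; rewrite mulr_ge0// sqr_ge0.
apply: vanishesZ => // e e0.
pose e1 := Num.min 1 e; have e10 : 0 < e1 by rewrite lt_min ltr01.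
have e11 : e1 ^+ 2 <= e.
  rewrite (@le_trans _ _ e1)//; last by rewrite ge_min lexx orbT.
  by rewrite -[leRHS]expr1 ler_wiXn2l ?(ltW e10)// ge_min lexx.
have eH : 0 < e1 / H by rewrite divr_gt0.
move/cvgrPdist_le : cc0 => /(_ _ eH); apply: filterS => i.
rewrite ler_pdivlMr// distrC => ci; rewrite lee_fin (le_trans _ e11)//.
rewrite -[leLHS]real_normK ?num_real// lerXn2r ?nnegrE ?(ltW e10)//.
by rewrite normrM (gtr0_norm H0).
Qed.

End scaled_distance.

Section monotone_limit.
Context {R : realType} {d : nat}.
Hypothesis d_gt0 : (0 < d)%N.
Local Notation V := 'rV[R[i]]_d.
Local Notation S := (@unit_sphere R d).
Local Notation ball := (@unit_ball R d).
Local Notation Conf := (@Conf R d ball).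
Local Notation P := (@poisson_szego R d).

Lemma poisson_sum_ge0 (X : Conf) (u : V -> R) zeta :
  (forall x, ball x -> 0 <= u x) -> (0 <= poisson_sum X u zeta)%E.
Proof.
move=> u0; rewrite /poisson_sum -(conf_esum0 X); apply: le_conf_esum => x xB.
by rewrite lee_fin mulr_ge0 ?u0// poisson_szego_ge0// ltW.
Qed.

Lemma le_poisson_sum (X : Conf) (u v : V -> R) zeta :
  (forall x, ball x -> u x <= v x) -> (poisson_sum X u zeta <= poisson_sum X v zeta)%E.
Proof.
move=> uv; apply: le_conf_esum => x xB.
by rewrite lee_fin ler_wpM2r ?uv// poisson_szego_ge0// ltW.
Qed.

Lemma measurable_poisson_sum (X : Conf) (u : V -> R) :
  measurable_fun [set: V] u -> (forall x, ball x -> 0 <= u x) ->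
  measurable_fun [set: V] (poisson_sum X u).
Proof.
move=> mu_ u0; have mB := @measurable_unit_ball R d.
pose k (q : Conf * V * V) : R := \1_ball q.2 * (u q.2 * P q.2 q.1.2).
have mk : measurable_fun [set: Conf * V * V] k.
  have c2 (f : V -> R) : measurable_fun [set: V] f ->
      measurable_fun [set: Conf * V * V] (fun q => f q.2).
    by move=> mf; exact: (measurableT_comp mf measurable_snd).
  apply: measurable_funM; first by apply: c2; exact: measurable_indic.
  apply: measurable_funM; first exact: c2.
  have mm : measurable_fun [set: Conf * V * V] (fun q : Conf * V * V => (q.2, q.1.2)).
    by apply: measurable_fun_pair => //; exact: (measurableT_comp measurable_snd measurable_fst).
  exact: (measurableT_comp measurable_poisson_szego mm).
have k0 q : 0 <= k q.
  rewrite /k indicE; case: (boolP (q.2 \in ball)) => [/set_mem xB|_]; last by rewrite mul0r.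
  by rewrite mul1r mulr_ge0 ?u0// poisson_szego_ge0// ltW.
have := measurableT_comp (measurable_conf_esum_pair mk k0) (measurable_pair1 X).
apply: eq_measurable_fun => zeta _; apply: eq_conf_esum => x xB.
by rewrite /k/= indicE mem_set// mul1r.
Qed.

Lemma radial_weight_antitone (a b : R) (x : V) : a <= b -> ball x ->
  radial_weight b x <= radial_weight a x.
Proof.
move=> ab xB; rewrite ler_wpM2l//.
  by rewrite exprn_ge0// subr_ge0 expr_le1 ?enorm_ge0// ltW.
apply: ger_powR; last by rewrite lerD2r.
by rewrite subr_gt0 expr_lt1 ?enorm_ge0 ?muln_gt0// xB/= gerBl exprn_ge0// enorm_ge0.
Qed.

Lemma sample_decreasing n : @sample R n.+1 <= @sample R n.
Proof.
rewrite /sample lef_pV2 ?posrE ?mulr_gt0//.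
by rewrite mulrC ler_pM2l// ler_nat ltnS (leq_trans (leqnSn n)).
Qed.

Lemma sample_bracket (N : nat) (a : R) : 0 < a -> a <= @sample R N ->
  exists2 n, (N <= n)%N & @sample R n.+1 <= a <= @sample R n.
Proof.
move=> a0 aN; have ex : exists k, @sample R k < a.
  move/cvgrPdist_lt : (@sample_cvg0 R) => /(_ _ a0)[k _ /(_ k (leqnn k))].
  by rewrite sub0r normrN gtr0_norm ?sample_gt0// => h; exists k.
case: (ex_minnP ex) => k ka kmin.
have [kN|Nk] := leqP k N.
  suff : @sample R N <= @sample R k by move=> h; have := le_lt_trans (le_trans aN h) ka; rewrite ltxx.
  by apply: (nonincreasing_seqP _).1 kN; exact: sample_decreasing.
exists k.-1; first by rewrite -ltnS prednK// (leq_ltn_trans _ Nk).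
rewrite prednK ?(leq_ltn_trans _ Nk)// (ltW ka)/= leNgt; apply/negP => /kmin.
by rewrite leqNgt prednK ?leqnn// (leq_ltn_trans _ Nk).
Qed.

Lemma sample_ratio n : @sample R n.+1 / @sample R n = 1 - 2 / n.+3%:R.
Proof.
rewrite /sample invrK -[n.+3%:R]natr1 -[n.+2%:R]natr1 -[n.+1%:R]natr1; field.
by rewrite !natr1 !pnatr_eq0.
Qed.

Lemma sample_ratio_cvg : @sample R n.+1 / @sample R n @[n --> \oo] --> (1 : R).
Proof.
apply/cvgrPdist_le => e e0; have e2 : 0 < e / 2 by rewrite divr_gt0.
move/cvgrPdist_le : (@cvg_harmonic R) => /(_ _ e2); apply: filterS => n.
rewrite sample_ratio subKr sub0r normrN !gtr0_norm ?divr_gt0 ?invr_gt0//.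
rewrite ler_pdivlMr// mulrC; apply: le_trans; rewrite ler_pM2l//.
by rewrite lef_pV2 ?posrE// ler_nat ltnS (leq_trans (leqnSn n)).
Qed.

Variables (X : Conf) (mu : probability V R) (h : V -> R) (lambda H : R).
Hypothesis mh : measurable_fun [set: V] h.
Hypothesis H0 : 0 < H.
Hypothesis h0 : forall x, 0 <= h x.
Hypothesis hH : forall x, enorm x <= 1 -> h x <= H.
Hypothesis lambda_gt0 : 0 < lambda.

Let G a zeta := poisson_sum X (fun x => radial_weight a x * h x) zeta.

Let weight_ge0 a x : ball x -> 0 <= radial_weight a x * h x.
Proof. by move=> xB; rewrite mulr_ge0// radial_weight_ge0. Qed.

Lemma core_sum_antitone a b zeta : a <= b -> (G b zeta <= G a zeta)%E.
Proof.
by move=> ab; apply: le_poisson_sum => x xB; rewrite ler_wpM2r// radial_weight_antitone.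
Qed.

Lemma measurable_weighted_sum a : measurable_fun [set: V] (G a).
Proof.
apply: measurable_poisson_sum; last exact: weight_ge0.
by apply: measurable_funM => //; exact: measurable_radial_weight.
Qed.

Variable D : set V.
Hypothesis mD : measurable D.
Hypothesis DS : D `<=` S.
Hypothesis Dfin : forall n zeta, D zeta -> (G (@sample R n) zeta < +oo)%E.
Hypothesis samples : vanishes \oo (fun n => sqdist mu D
  (fun zeta => @sample R n * fine (G (@sample R n) zeta)) (fun zeta => lambda * h zeta)).

Lemma core_sum_finite a zeta : 0 < a -> D zeta -> (G a zeta < +oo)%E.
Proof.
move=> a0 Dz; move/cvgrPdist_lt : (@sample_cvg0 R) => /(_ _ a0)[k _ /(_ k (leqnn k))].
rewrite sub0r normrN gtr0_norm ?sample_gt0// => ka.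
exact: le_lt_trans (core_sum_antitone _ (ltW ka)) (Dfin k Dz).
Qed.

(** The sums decrease with the exponent and consecutive samples have ratio tending
    to 1, so the samples control all small exponents. *)
Theorem core_sum_limit : vanishes (0^'+) (fun a => sqdist mu D
  (fun zeta => a * fine (G a zeta)) (fun zeta => lambda * h zeta)).
Proof.
have mfine a : measurable_fun D (fun zeta => fine (G a zeta)).
  apply: measurable_funTS.
  exact: (measurableT_comp (fine_measurable measurableT) (measurable_weighted_sum a)).
have mM (k : R) f : measurable_fun D f -> measurable_fun D (fun zeta => k * f zeta).
  by move=> mf; exact: measurable_funM.
have mlh : measurable_fun D (fun zeta => lambda * h zeta).
  by apply: mM; exact: measurable_funTS.
have m1 : (mu D <= 1)%E by exact: probability_le1.
have lH : 0 < lambda * H by rewrite mulr_gt0.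
have lhH zeta : D zeta -> `|lambda * h zeta| <= lambda * H.
  move=> /DS zS; rewrite ger0_norm ?mulr_ge0 ?(ltW lambda_gt0)//.
  by rewrite ler_wpM2l ?(ltW lambda_gt0)// hH// zS.
pose r n := @sample R n.+1 / @sample R n.
have r0 n : 0 < r n by rewrite divr_gt0// sample_gt0.
have mA n : measurable_fun D (fun zeta => @sample R n * fine (G (@sample R n) zeta)).
  exact: mM.
have low := sqdist_scaled_vanishes mD m1 sample_ratio_cvg mA mlh lhH lH samples.
have rV : (r n)^-1 @[n --> \oo] --> (1 : R)^-1.
  by apply: cvgV; [exact: oner_neq0|exact: sample_ratio_cvg].
have samples1 := vanishes_shift samples.
have upp := sqdist_scaled_vanishes mD m1 rV (fun n => mA n.+1) mlh lhH lH samples1.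
rewrite invr1 in upp.
have {}low := vanishesD (low _) (upp _).
move=> e e0; have [N _ hN] := low _ _ _ e e0.
near=> a.
have a0 : 0 < a by near: a; exact: nbhs_right_gt.
have aN : a <= @sample R N by near: a; apply: nbhs_right_le; exact: sample_gt0.
have [n Nn /andP[na an]] := sample_bracket a0 aN.
apply: (le_trans _ (hN n Nn)); cbv beta.
have -> : (fun zeta => lambda * h zeta) = (fun zeta => 1 * (lambda * h zeta)).
  by apply/funext => zeta; rewrite mul1r.
apply: sqdist_squeeze => //.
- exact: mM.
- exact: mM.
- exact: mM.
- exact: mM.
move=> zeta Dz.
have fin b : 0 < b -> G b zeta \is a fin_num.
  by move=> b0; rewrite ge0_fin_numE ?core_sum_finite//; exact: poisson_sum_ge0 (@weight_ge0 b).
have le_fine b c : 0 < b -> b <= c -> fine (G c zeta) <= fine (G b zeta).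
  move=> b0 bc; rewrite fine_le ?fin//; first exact: lt_le_trans bc.
  exact: core_sum_antitone.
have g0 b : 0 <= fine (G b zeta) by rewrite fine_ge0//; exact: poisson_sum_ge0 (@weight_ge0 b).
rewrite /r invf_div !mulrA !mulfVK ?gt_eqF ?sample_gt0//; apply/andP; split.
  by rewrite ler_pM// ?(ltW (sample_gt0 _))// le_fine.
by rewrite ler_pM// ?(ltW a0)// le_fine// sample_gt0.
Unshelve. all: end_near. Qed.

End monotone_limit.

(** * Logarithmic comparison of the weights *)

Section weight_comparison.
Context {R : realType} {d : nat}.
Hypothesis d_gt0 : (0 < d)%N.
Local Notation V := 'rV[R[i]]_d.
Local Notation S := (@unit_sphere R d).
Local Notation ball := (@unit_ball R d).
Local Notation P := (@poisson_szego R d).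

Lemma ln_dist (m u v : R) : 0 < m -> m <= u -> m <= v -> `|ln u - ln v| <= `|u - v| / m.
Proof.
move=> m0; wlog vu : u v / v <= u => [hw|].
  by case/orP : (le_total v u) => h mu mv; [|rewrite distrC [X in _ <= X / _]distrC]; exact: hw.
move=> mu mv; have v0 : 0 < v by exact: lt_le_trans mv.
have u0 : 0 < u by exact: lt_le_trans mu.
rewrite -ln_div ?posrE// !ger0_norm ?subr_ge0//; last by rewrite ln_ge0// ler_pdivlMr// mul1r.
have -> : u / v = 1 + (u - v) / v by rewrite mulrBl divff ?gt_eqF// addrC subrK.
rewrite (le_trans (le_ln1Dx _))//.
  by rewrite (lt_le_trans _ (_ : 0 <= _))// ?divr_ge0// ?subr_ge0// ltW.
by rewrite ler_wpM2l ?subr_ge0// lef_pV2 ?posrE.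
Qed.

Lemma poisson_szego_gt0 (z x : V) : enorm z < 1 -> enorm x <= 1 -> 0 < P z x.
Proof.
move=> z1 x1; rewrite divr_gt0// exprn_gt0//.
  by rewrite subr_gt0 expr_lt1 ?enorm_ge0.
by rewrite cabs_1herm_gt0// (le_lt_trans _ z1)// ler_piMl ?enorm_ge0.
Qed.

Let cabs_1herm_lower (z x : V) : enorm x <= 1 -> 1 - enorm z <= cabs (1 - herm x z).
Proof.
move=> x1; rewrite (le_trans _ (cabs_1herm_ge _ _))// lerD2l lerN2.
by rewrite ler_piMl ?enorm_ge0.
Qed.

Lemma ln_poisson_szego (z x : V) : enorm z < 1 -> enorm x <= 1 ->
  ln (P z x) = d%:R * (ln (1 - enorm z ^+ 2) - 2 * ln (cabs (1 - herm x z))).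
Proof.
move=> z1 x1; have c0 : 0 < cabs (1 - herm x z).
  by rewrite (lt_le_trans _ (cabs_1herm_lower _ _))// subr_gt0.
have q0 : 0 < 1 - enorm z ^+ 2 by rewrite subr_gt0 expr_lt1 ?enorm_ge0.
rewrite /poisson_szego -/(herm _ _) ln_div ?posrE ?exprn_gt0// !lnXn//.
by rewrite mulrBr mulrA -[in LHS]mulr_natl -[X in _ - X]mulr_natl natrM (mulrC 2).
Qed.

Lemma near_point_lt1 (z z' : V) (theta : R) : enorm z < 1 -> theta <= 1 / 2 ->
  enorm (z - z') <= theta * (1 - enorm z) -> (1 - enorm z) / 2 <= 1 - enorm z'.
Proof.
move=> z1 t2 zz; have := enormB_ge z z'; rewrite ler_norml => /andP[h _].
have : theta * (1 - enorm z) <= 1 / 2 * (1 - enorm z) by rewrite ler_wpM2r// subr_ge0 ltW.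
by lra.
Qed.

(** The denominator 1 - <x, z> is Lipschitz in z and at least 1 - |z| in modulus, uniformly
    in x, so that its logarithm is Lipschitz. *)
Lemma ln_poisson_szego_dist (z z' x : V) (theta : R) : enorm z < 1 -> 0 <= theta ->
  theta <= 1 / 2 -> enorm (z - z') <= theta * (1 - enorm z) -> enorm x <= 1 ->
  `|ln (P z x) - ln (P z' x)| <= 8 * d%:R * theta.
Proof.
move=> z1 t0 t2 zz x1; have m2 := near_point_lt1 z1 t2 zz.
set m := (1 - enorm z) / 2 in m2; have m0 : 0 < m by rewrite divr_gt0 ?subr_gt0.
have z'1 : enorm z' < 1 by rewrite -subr_gt0 (lt_le_trans m0).
have n0 := enorm_ge0 z; have n0' := enorm_ge0 z'.
have mz : m <= 1 - enorm z by rewrite /m; lra.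
have zzm : enorm (z - z') <= 2 * theta * m by rewrite /m; lra.
have sq (w : V) : enorm w < 1 -> 1 - enorm w <= 1 - enorm w ^+ 2.
  by move=> w1; have := enorm_ge0 w; nra.
rewrite !ln_poisson_szego// -mulrBr normrM ger0_norm//.
have -> : 8 * d%:R * theta = d%:R * (8 * theta) by ring.
rewrite ler_wpM2l//.
have h1 : `|ln (1 - enorm z ^+ 2) - ln (1 - enorm z' ^+ 2)| <= 4 * theta.
  have := @ln_dist m (1 - enorm z ^+ 2) (1 - enorm z' ^+ 2) m0.
  move=> /(_ (le_trans mz (sq _ z1)) (le_trans m2 (sq _ z'1)))/le_trans; apply.
  rewrite ler_pdivrMr// (@le_trans _ _ (2 * enorm (z - z')))//; last by lra.
  have -> : 1 - enorm z ^+ 2 - (1 - enorm z' ^+ 2) =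
    (enorm z' + enorm z) * (enorm z' - enorm z) by ring.
  rewrite normrM ger0_norm ?addr_ge0// ler_pM ?addr_ge0//; first by lra.
  by rewrite distrC enormB_ge.
have h2 : `|ln (cabs (1 - herm x z)) - ln (cabs (1 - herm x z'))| <= 2 * theta.
  have := @ln_dist m (cabs (1 - herm x z)) (cabs (1 - herm x z')) m0.
  move=> /(_ (le_trans mz (cabs_1herm_lower _ x1)) (le_trans m2 (cabs_1herm_lower _ x1))).
  move/le_trans; apply; rewrite ler_pdivrMr// (le_trans _ zzm)//.
  have hz : cabs (1 - herm x z - (1 - herm x z')) <= enorm (z - z').
    have -> : 1 - herm x z - (1 - herm x z') = herm x (z' - z).
      by rewrite hermDr hermNr; ring.
    rewrite (le_trans (herm_cauchy_schwarz _ _))// -(enormN (z - z')) opprB.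
    by rewrite ler_piMl ?enorm_ge0.
  have b1 := cabsB_ge (1 - herm x z) (1 - herm x z').
  have b2 := cabsB_ge (1 - herm x z') (1 - herm x z).
  rewrite ler_norml; apply/andP; split; last exact: le_trans b1 hz.
  rewrite lerNl opprB (le_trans b2)// -cabsN opprB.
  by rewrite (_ : 1 - _ - _ = (1 - herm x z) - (1 - herm x z')).
move: h1 h2; rewrite !ler_norml => /andP[? ?] /andP[? ?].
by apply/andP; split; lra.
Qed.

(** Here (1 - |phi|) / (1 + |phi|) = (1 - |phi|^2) / (1 + |phi|)^2, and the numerator is
    explicit. *)
Lemma ps_weightE (s : R) (z x : V) : enorm z < 1 -> enorm x < 1 ->
  ps_weight s z x = expR (s * (ln (1 - enorm z ^+ 2) + ln (1 - enorm x ^+ 2)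
    - 2 * ln (cabs (1 - herm x z)) - 2 * ln (1 + enorm (ball_involution z x)))).
Proof.
move=> z1 x1; rewrite /ps_weight /bergman_dist; congr expR.
rewrite mulNr -mulrN; congr (_ * _).
have c0 : 0 < cabs (1 - herm x z).
  by rewrite (lt_le_trans _ (cabs_1herm_lower _ (ltW x1)))// subr_gt0.
have := ball_involution_norm z1 x1; set f := enorm (ball_involution z x) => e.
have f0 : 0 <= f by exact: enorm_ge0.
have z0 : 0 < 1 - enorm z ^+ 2 by rewrite subr_gt0 expr_lt1 ?enorm_ge0.
have x0 : 0 < 1 - enorm x ^+ 2 by rewrite subr_gt0 expr_lt1 ?enorm_ge0.
have f2 : 0 < 1 - f ^+ 2 by rewrite e divr_gt0 ?exprn_gt0// mulr_gt0.
have f1 : f < 1 by rewrite -(@expr_lt1 _ 2)// -subr_gt0.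
have p0 : 0 < 1 + f by rewrite ltr_wpDr.
have m0 : 0 < 1 - f by rewrite subr_gt0.
rewrite ln_div ?posrE//.
have : ln (1 - f ^+ 2) = ln (1 - f) + ln (1 + f).
  by rewrite -lnM ?posrE//; congr ln; ring.
rewrite e ln_div ?posrE ?exprn_gt0 ?mulr_gt0// lnM ?posrE// lnXn// -mulr_natl.
by lra.
Qed.

(** The ratio is the geometric sum 1 + |x|^2 + ... + |x|^(2d - 2), which tends to d at the
    boundary. *)
Lemma ln_ratio_bounds (x : V) : enorm x < 1 ->
  let L := ln (1 - enorm x ^+ (2 * d)) - ln (1 - enorm x ^+ 2) in
  [/\ 0 <= L, L <= ln d%:R & ln d%:R - L <= d%:R * (1 - enorm x ^+ 2)].
Proof.
move=> x1 L; have x0 := enorm_ge0 x.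
set q := 1 - enorm x ^+ 2; pose t := enorm x ^+ 2.
have t0 : 0 <= t by exact: sqr_ge0.
have t1 : t < 1 by rewrite expr_lt1.
have tq : t = 1 - q by rewrite /q /t; ring.
have q0 : 0 < q by rewrite subr_gt0.
have d0 : 0 < d%:R :> R by rewrite ltr0n.
have bern (u : R) n : -1 <= u -> 1 + n%:R * u <= (1 + u) ^+ n.
  move=> u1; elim: n => [|n ih]; first by rewrite mul0r addr0 expr0.
  rewrite exprS; apply: (@le_trans _ _ ((1 + u) * (1 + n%:R * u))).
    have -> : (1 + u) * (1 + n%:R * u) = (1 + n.+1%:R * u) + n%:R * u ^+ 2.
      by rewrite -natr1; ring.
    by rewrite lerDl mulr_ge0 ?sqr_ge0.
  by apply: ler_wpM2l => //; lra.
have yE : 1 - enorm x ^+ (2 * d) = 1 - t ^+ d by rewrite exprM.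
have td1 : t ^+ d <= t by rewrite -[leRHS]expr1 ler_wiXn2l// ltW.
have y0 : 0 < 1 - t ^+ d by rewrite subr_gt0 (le_lt_trans td1).
rewrite /L yE; split.
- rewrite subr_ge0 ler_ln ?posrE//; rewrite /q -/t; lra.
- rewrite lerBlDr -lnM ?posrE// ler_ln ?posrE ?mulr_gt0//.
  have := bern (- q) d; rewrite -tq; have -> : -1 <= - q by lra.
  by move=> /(_ isT); rewrite -/q; lra.
have dq0 : 0 < 1 + d%:R * q by rewrite addr_gt0// mulr_gt0.
have key : d%:R * q <= (1 - t ^+ d) * (1 + d%:R * q).
  have h1 : 1 + d%:R * q <= (1 + q) ^+ d by apply: bern; lra.
  have h2 : t ^+ d * (1 + q) ^+ d <= 1.
    by rewrite -exprMn exprn_ile1// ?mulr_ge0//; [lra|rewrite tq; nra].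
  have : t ^+ d * (1 + d%:R * q) <= t ^+ d * (1 + q) ^+ d.
    by rewrite ler_wpM2l// exprn_ge0.
  by lra.
have : ln (d%:R * q) <= ln ((1 - t ^+ d) * (1 + d%:R * q)).
  by rewrite ler_ln ?posrE ?mulr_gt0.
rewrite !lnM ?posrE//.
have : ln (1 + d%:R * q) <= d%:R * q by apply: le_ln1Dx; have := mulr_gt0 d0 q0; lra.
by lra.
Qed.

(** At the boundary the radial weight accounts for the factor d and (1 + |phi|)^2d for
    4^d. *)
Definition limit_density : R := d%:R / 4 ^+ d.

Lemma limit_density_gt0 : 0 < limit_density.
Proof. by rewrite divr_gt0 ?ltr0n. Qed.

(** With s = d + a, the weight e^(-s d_B(x, z)) is the radial weight times P(z, x)
    times d / 4^d, up to a factor that tends to 1 at the boundary as a tends to 0. *)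
Lemma ln_ps_weight_dist (z : V) : enorm z < 1 -> exists2 K : R, 0 <= K &
  forall (a : R) x, 0 < a -> enorm x < 1 ->
  `|ln (ps_weight (d%:R + a) z x) - ln (limit_density * (radial_weight a x * P z x))| <=
    K * (1 - enorm x ^+ 2) + a * K.
Proof.
move=> z1; pose m := 1 - enorm z; have m0 : 0 < m by rewrite subr_gt0.
have d0 : 0 < d%:R :> R by rewrite ltr0n.
have ld : 0 <= ln d%:R :> R by rewrite ln_ge0// ler1n.
have l2 : 0 <= ln 2 :> R by rewrite ln_ge0// ler1n.
set Z := ln (1 - enorm z ^+ 2).
pose K1 := 2 * d%:R * m ^- 2 + d%:R; pose K2 := `|Z| + 2 * (`|ln m| + ln 2) + 2 * ln 2 + ln d%:R.
have K10 : 0 <= K1 by rewrite addr_ge0 ?mulr_ge0 ?invr_ge0 ?sqr_ge0.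
have K20 : 0 <= K2.
  by have := normr_ge0 Z; have := normr_ge0 (ln m); rewrite /K2; lra.
exists (K1 + K2) => [|a x a0 x1]; first by rewrite addr_ge0.
have x0 := enorm_ge0 x; have [L0 L1 L2] := ln_ratio_bounds x1.
set q := 1 - enorm x ^+ 2; have q0 : 0 < q by rewrite subr_gt0 expr_lt1.
have y0 : 0 < 1 - enorm x ^+ (2 * d) by rewrite subr_gt0 expr_lt1// muln_gt0.
have c1 := cabs_1herm_lower z (ltW x1); have c2 := cabs_1herm_le2 (ltW x1) (ltW z1).
set c := cabs _ in c1 c2; have c0 : 0 < c by rewrite (lt_le_trans m0).
have e := ball_involution_norm z1 x1.
rewrite ps_weightE// expRK; set f := enorm (ball_involution z x) in e *.
have f0 : 0 <= f by exact: enorm_ge0.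
have f2 : 0 < 1 - f ^+ 2.
  rewrite e divr_gt0 ?exprn_gt0// mulr_gt0// subr_gt0 expr_lt1 ?enorm_ge0//.
have f1 : f < 1 by rewrite -(@expr_lt1 _ 2)// -subr_gt0.
rewrite lnM ?posrE ?limit_density_gt0//; last first.
  by rewrite mulr_gt0 ?poisson_szego_gt0// ?(ltW x1)// mulr_gt0 ?exprn_gt0 ?powR_gt0.
rewrite lnM ?posrE ?poisson_szego_gt0// ?(ltW x1)//; last first.
  by rewrite mulr_gt0 ?exprn_gt0 ?powR_gt0.
have -> : ln (radial_weight a x) =
    d.+1%:R * ln q + (a - 1) * ln (1 - enorm x ^+ (2 * d)).
  by rewrite lnM ?posrE ?exprn_gt0 ?powR_gt0// ln_powR lnXn// -[ln _ *+ _]mulr_natl.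
have -> : ln limit_density = ln d%:R - d%:R * ln (4 : R).
  by rewrite ln_div ?posrE ?exprn_gt0// lnXn// -[ln _ *+ _]mulr_natl.
rewrite ln_poisson_szego// ?(ltW x1)//.
have -> : ln 4 = 2 * ln 2 :> R.
  by rewrite (_ : 4 = 2 ^+ 2 :> R) ?lnXn// -?[ln _ *+ _]mulr_natl//; ring.
rewrite -/Z -/q -/c -[d.+1%:R]natr1.
set Q := ln q; set Y := ln (1 - enorm x ^+ (2 * d)); set C := ln c.
set F := ln (1 + f); set D := d%:R : R; set LD := ln D; set T := ln 2.
rewrite -/Y -/q -/Q in L0 L1 L2.
have F1 : 0 <= F by rewrite ln_ge0// lerDl.
have F2 : F <= T by rewrite ler_ln ?posrE ?ltr_wpDr//; lra.
have F3 : T - F <= m ^- 2 * q.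
  have := @ln_dist 1 2 (1 + f) ltr01; have -> : 1 <= 2 :> R by lra.
  have -> : 1 <= 1 + f by lra.
  move=> /(_ isT isT); rewrite -/T -/F divr1 => h.
  rewrite (le_trans (ler_norm _))// (le_trans h)// ger0_norm; last by lra.
  rewrite (@le_trans _ _ (1 - f ^+ 2))//; first by nra.
  rewrite e -/q -/c mulrC mulrA mulrAC -[leRHS]mulr1; apply: ler_pM => //.
  - by rewrite mulr_ge0 ?invr_ge0 ?sqr_ge0// ltW.
  - by rewrite subr_ge0 exprn_ile1 ?enorm_ge0// ltW.
  - rewrite ler_wpM2r ?(ltW q0)// lef_pV2 ?posrE ?exprn_gt0//.
    by rewrite lerXn2r ?nnegrE ?(ltW m0) ?(ltW c0).
  - by rewrite gerBl sqr_ge0.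
have C1 : `|C| <= `|ln m| + T.
  have h1 : ln m <= C by rewrite ler_ln ?posrE.
  have h2 : C <= T by rewrite ler_ln ?posrE.
  have := normr_ge0 (ln m); have := ler_norm (- ln m); rewrite normrN => h3 h4.
  by rewrite ler_norml; apply/andP; split; [move: l2|]; rewrite -/T; lra.
set B := (X in `|X| <= _).
have -> : B = 2 * D * (T - F) + ((Y - Q) - LD) + a * ((Z - 2 * C - 2 * F) - (Y - Q)).
  by rewrite /B; ring.
have t1 : `|2 * D * (T - F)| <= 2 * D * m ^- 2 * q.
  rewrite ger0_norm; last by rewrite !mulr_ge0// subr_ge0.
  by rewrite -[leRHS]mulrA ler_wpM2l// mulr_ge0.
have t2 : `|(Y - Q) - LD| <= D * q by rewrite distrC ger0_norm ?subr_ge0.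
have t3 : `|a * ((Z - 2 * C - 2 * F) - (Y - Q))| <= a * K2.
  rewrite normrM gtr0_norm// ler_wpM2l ?(ltW a0)//.
  have z2 := ler_norm Z; have z3 := ler_norm (- Z); rewrite normrN in z3.
  move: C1; rewrite ler_norml => /andP[c3 c4]; rewrite /K2 -/T -/LD.
  rewrite -/LD in L1; rewrite ler_norml; apply/andP; split; lra.
rewrite (le_trans (ler_normD _ _))// (le_trans (lerD (ler_normD _ _) (lexx _)))//.
rewrite (le_trans (lerD (lerD t1 t2) t3))//.
have : 0 <= K2 * q by rewrite mulr_ge0// ltW.
have : 0 <= a * K1 by rewrite mulr_ge0// ltW.
rewrite /K1 -/D; lra.
Qed.

(** In the kernel z may be replaced by any nearby point z', so countably many points
    suffice. *)
Lemma ps_weight_comparison (z : V) : enorm z < 1 -> exists2 K : R, 0 <= K &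
  forall theta z', 0 <= theta -> theta <= 1 / 2 -> enorm (z - z') <= theta * (1 - enorm z) ->
  forall (a : R) x, 0 < a -> enorm x < 1 ->
  let eta := 8 * d%:R * theta + K * (1 - enorm x ^+ 2) + a * K in
  ps_weight (d%:R + a) z x <= expR eta * (limit_density * (radial_weight a x * P z' x)) /\
  limit_density * (radial_weight a x * P z' x) <= expR eta * ps_weight (d%:R + a) z x.
Proof.
move=> z1; have [K K0 hK] := ln_ps_weight_dist z1; exists K => //.
move=> theta z' t0 t2 zz a x a0 x1 eta.
have z'1 : enorm z' < 1.
  rewrite -subr_gt0 (lt_le_trans _ (near_point_lt1 z1 t2 zz))// divr_gt0// subr_gt0.
  exact: z1.
have w0 : 0 < radial_weight a x.
  rewrite mulr_gt0 ?exprn_gt0 ?powR_gt0// subr_gt0 expr_lt1 ?enorm_ge0//.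
  by rewrite muln_gt0.
have W0 : 0 < ps_weight (d%:R + a) z x by exact: expR_gt0.
have p0 := poisson_szego_gt0 z1 (ltW x1); have p0' := poisson_szego_gt0 z'1 (ltW x1).
have k0 := limit_density_gt0.
have pd := ln_poisson_szego_dist z1 t0 t2 zz (ltW x1).
have := hK a x a0 x1; set U := limit_density * _; set U' := limit_density * (_ * P z' x).
have U0 : 0 < U by rewrite mulr_gt0// mulr_gt0.
have U0' : 0 < U' by rewrite mulr_gt0// mulr_gt0.
have UU : ln U - ln U' = ln (P z x) - ln (P z' x).
  have lnU w : 0 < w -> ln (limit_density * (radial_weight a x * w)) =
      ln limit_density + (ln (radial_weight a x) + ln w).
    move=> w0'; have rw : 0 < radial_weight a x * w by rewrite mulr_gt0.
    rewrite (@lnM _ limit_density (radial_weight a x * w)) ?posrE//; congr (_ + _).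
    by rewrite lnM ?posrE.
  by rewrite !lnU//; ring.
move=> hW; have {hW pd UU} : `|ln (ps_weight (d%:R + a) z x) - ln U'| <= eta.
  rewrite -(subrKA (ln U)) (le_trans (ler_normD _ _))//.
  rewrite (le_trans (lerD hW (lexx _)))// UU (le_trans (lerD (lexx _) pd))//.
  by rewrite /eta; lra.
rewrite ler_norml => /andP[h1 h2]; split.
  rewrite -[leLHS]lnK ?posrE// -[X in _ * X]lnK ?posrE// -expRD ler_expR; lra.
rewrite -[leLHS]lnK ?posrE// -[X in _ * X]lnK ?posrE// -expRD ler_expR; lra.
Qed.

End weight_comparison.

(** * Convergence of the weighted sums in L2 *)

Section perturbation.
Context {dT : measure_display} {T : measurableType dT} {R : realType}.
Variables (m : {measure set T -> \bar R}) (D : set T).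
Hypothesis mD : measurable D.
Hypothesis m1 : (m D <= 1)%E.

(** Up to bounded errors F - H is c (A - B), and (x + y)^2 <= 2 x^2 + 2 y^2. *)
Lemma sqdist_perturb (c b1 b2 : R) (F H A B : T -> R) :
  measurable_fun D F -> measurable_fun D H -> measurable_fun D A -> measurable_fun D B ->
  (forall t, D t -> `|F t - c * A t| <= b1) -> (forall t, D t -> `|H t - c * B t| <= b2) ->
  (sqdist m D F H <= (2 * c ^+ 2)%:E * sqdist m D A B + (2 * (b1 + b2) ^+ 2)%:E)%E.
Proof.
move=> mF mH mA mB Fb Hb; have mAB := measurable_sqdist mA mB.
apply: (@le_trans _ _ (\int[m]_(t in D) ((2 * c ^+ 2)%:E * ((A t - B t) ^+ 2)%:E +
    (2 * (b1 + b2) ^+ 2)%:E))%E).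
  apply: ge0_le_integral => //=.
  - by move=> t _; rewrite lee_fin sqr_ge0.
  - exact: measurable_sqdist.
  - by apply: emeasurable_funD => //; exact: measurable_funeM.
  - move=> t Dt; rewrite -EFinM -EFinD lee_fin.
    have rest : `|(F t - H t) - c * (A t - B t)| <= b1 + b2.
      have -> : (F t - H t) - c * (A t - B t) = (F t - c * A t) - (H t - c * B t) by ring.
      by rewrite (le_trans (ler_normB _ _))// lerD ?Fb ?Hb.
    have : ((F t - H t) - c * (A t - B t)) ^+ 2 <= (b1 + b2) ^+ 2.
      rewrite -[leLHS]real_normK ?num_real// lerXn2r ?nnegrE//.
      exact: le_trans rest.
    by have := sqr_ge0 ((F t - H t) - 2 * (c * (A t - B t))); nra.
rewrite ge0_integralD//=; last 3 first.
- by move=> t _; rewrite -EFinM lee_fin mulr_ge0 ?sqr_ge0// mulr_ge0 ?sqr_ge0.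
- exact: measurable_funeM.
- by move=> t _; rewrite lee_fin mulr_ge0 ?sqr_ge0.
rewrite ge0_integralZl//=; last 2 first.
- by move=> t _; rewrite lee_fin sqr_ge0.
- by rewrite lee_fin mulr_ge0 ?sqr_ge0.
rewrite leeD2l// integral_cst// -[leRHS]mule1 lee_wpmul2l//.
by rewrite lee_fin mulr_ge0 ?sqr_ge0.
Qed.

End perturbation.

Section kernel_regularity.
Context {R : realType} {d : nat}.
Hypothesis d_gt0 : (0 < d)%N.
Local Notation V := 'rV[R[i]]_d.
Local Notation S := (@unit_sphere R d).
Local Notation P := (@poisson_szego R d).

Lemma expR_dist (L u v : R) : u <= L -> v <= L -> `|expR u - expR v| <= expR L * `|u - v|.
Proof.
wlog vu : u v / v <= u => [hw|] uL vL.
  by case/orP : (le_total v u) => h; [|rewrite distrC [X in _ * X]distrC]; exact: hw.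
rewrite !ger0_norm ?subr_ge0 ?ler_expR//.
have -> : expR u - expR v = expR u * (1 - expR (v - u)).
  by rewrite mulrBr mulr1 -expRD addrCA subrr addr0.
rewrite (@le_trans _ _ (expR u * (u - v)))//.
  by rewrite ler_pM2l ?expR_gt0// lerBlDr -lerBlDl (le_trans _ (expR_ge1Dx _))//; lra.
by rewrite ler_wpM2r ?subr_ge0// ler_expR.
Qed.

(** Through the logarithm, as 1 - <x, z> is at least 1 - |z| in modulus. *)
Lemma poisson_szego_equicontinuous (z : V) (e : R) : enorm z < 1 -> 0 < e ->
  exists2 dl : R, 0 < dl & forall x y : V, enorm x <= 1 -> enorm y <= 1 ->
    enorm (x - y) < dl -> `|P z x - P z y| <= e.
Proof.
move=> z1 e0; have m0 : 0 < 1 - enorm z by rewrite subr_gt0.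
pose H := (1 - enorm z) ^- (2 * d); have H0 : 0 < H by rewrite invr_gt0 exprn_gt0.
have d0 : 0 < d%:R :> R by rewrite ltr0n.
pose k := H * (2 * d%:R / (1 - enorm z)).
have k0 : 0 < k by rewrite mulr_gt0// divr_gt0// mulr_gt0.
exists (e / k) => [|x y x1 y1 xy]; first by rewrite divr_gt0.
have px := poisson_szego_gt0 z1 x1; have py := poisson_szego_gt0 z1 y1.
rewrite -(lnK px) -(lnK py).
have lnH (w : V) : enorm w <= 1 -> ln (P z w) <= ln H.
  by move=> w1; rewrite ler_ln ?posrE ?poisson_szego_gt0//; exact: poisson_szego_bound.
rewrite (le_trans (expR_dist (lnH x x1) (lnH y y1)))// lnK ?posrE//.
rewrite !ln_poisson_szego// -mulrBr.
have cl (w : V) : enorm w <= 1 -> 1 - enorm z <= cabs (1 - herm w z).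
  move=> w1; rewrite (le_trans _ (cabs_1herm_ge _ _))// lerD2l lerN2.
  by rewrite ler_piMl ?enorm_ge0.
have lc := ln_dist m0 (cl _ y1) (cl _ x1).
have hc : `|cabs (1 - herm y z) - cabs (1 - herm x z)| <= enorm (x - y).
  have h (u v : V) : cabs (1 - herm u z) - cabs (1 - herm v z) <= enorm (u - v).
    rewrite (le_trans (cabsB_ge _ _))//.
    have -> : 1 - herm u z - (1 - herm v z) = herm (v - u) z by rewrite hermDl hermNl; ring.
    rewrite (le_trans (herm_cauchy_schwarz _ _))// -(enormN (u - v)) opprB.
    by rewrite ler_piMr ?enorm_ge0// ltW.
  by rewrite ler_norml lerNl opprB h -(enormN (x - y)) opprB h.
rewrite (_ : _ - _ - (_ - _) = 2 * (ln (cabs (1 - herm y z)) - ln (cabs (1 - herm x z)))); last by ring.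
rewrite !normrM ger0_norm// ger0_norm//.
have := le_trans lc (ler_wpM2r _ hc); rewrite invr_ge0 (ltW m0) => /(_ isT) hl.
rewrite (@le_trans _ _ (H * (d%:R * (2 * (enorm (x - y) / (1 - enorm z))))))//.
  by rewrite ler_wpM2l ?(ltW H0)// ler_wpM2l ?(ltW d0)// ler_wpM2l.
move: xy; rewrite ltr_pdivlMr// => /ltW; apply: le_trans.
rewrite le_eqVlt; apply/orP; left; apply/eqP.
by rewrite /k; move: (_^-1) => w; ring.
Qed.

Definition rational_point (t : d.-tuple (rat * rat)) : V :=
  \row_j (ratr (tnth t j).1 +i* ratr (tnth t j).2).

Lemma rational_point_dense (z : V) (e : R) : 0 < e ->
  exists t, enorm (z - rational_point t) <= e.
Proof.
move=> e0; have d0 : 0 < d%:R :> R by rewrite ltr0n.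
pose r : R := e / (2 * d%:R); have r0 : 0 < r by rewrite divr_gt0// mulr_gt0.
have app (x : R) : exists q : rat, `|x - ratr q| < r.
  have /rat_in_itvoo[q] : x - r < x + r by rewrite ltrD2l gtrN.
  by rewrite in_itv/= => qx; exists q; rewrite distrC ltr_distl.
pose q j := (sval (cid (app (complex.Re (z 0 j)))), sval (cid (app (complex.Im (z 0 j))))).
exists [tuple q j | j < d]; rewrite (le_trans (enorm_le_sum _))//.
apply: (@le_trans _ _ (\sum_(j < d) (2 * r))).
  apply: ler_sum => j _; rewrite (le_trans (cabs_le_ReIm _))// mulr_natl mulr2n.
  rewrite !mxE tnth_mktuple cReD cImD cReN cImN/=.
  by rewrite lerD// ltW//; case: cid.
rewrite sumr_const card_ord -mulr_natr /r le_eqVlt; apply/orP; left; apply/eqP.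
by field; rewrite gt_eqF.
Qed.

End kernel_regularity.

Section weighted_sum_limit.
Context {R : realType} {d : nat}.
Hypothesis d_gt0 : (0 < d)%N.
Local Notation V := 'rV[R[i]]_d.
Local Notation S := (@unit_sphere R d).
Local Notation ball := (@unit_ball R d).
Local Notation Conf := (@Conf R d ball).
Local Notation P := (@poisson_szego R d).

(** The property of a configuration that holds almost surely and from which all the
    conclusions follow deterministically. *)
Definition core_converges (X : Conf) (mu : probability V R) (lambda : R) : Prop :=
  forall t, enorm (@rational_point R d t) < 1 ->
  (forall n, (\int[mu]_(zeta in S) poisson_sum X
     (fun x => (radial_weight (sample n) x * P (rational_point t) x)%R) zeta < +oo)%E) /\
  vanishes \oo (fun n => sqdist mu S
    (fun zeta => sample n * fine (poisson_sum X
       (fun x => radial_weight (sample n) x * P (rational_point t) x) zeta))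
    (fun zeta => lambda * P (rational_point t) zeta)).

Variables (X : Conf) (mu : probability V R) (lambda : R).
Hypothesis lambda_gt0 : 0 < lambda.
Hypothesis good : core_converges X mu lambda.

Let mS : measurable S := measurable_unit_sphere.
Let Q t := P (@rational_point R d t).
Let G t a zeta := poisson_sum X (fun x => radial_weight a x * Q t x) zeta.

Let mQ t : measurable_fun [set: V] (Q t) := measurable_poisson_szego_r _.

Let Q0 t x : enorm (@rational_point R d t) < 1 -> 0 <= Q t x.
Proof. by move=> t1; rewrite /Q poisson_szego_ge0// ltW. Qed.

Let mG t a : enorm (@rational_point R d t) < 1 -> measurable_fun [set: V] (G t a).
Proof. by move=> t1; apply: measurable_weighted_sum => // x; exact: Q0. Qed.

(** A sum with finite integral is finite almost everywhere, and there are countably many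
    sums. *)
Lemma exceptional_set : exists N, [/\ measurable N, mu N = 0%E & forall zeta, S zeta -> ~ N zeta ->
  forall t n, enorm (@rational_point R d t) < 1 -> (G t (sample n) zeta < +oo)%E].
Proof.
have h (k : nat) : {ae mu, forall zeta, S zeta -> forall t n, unpickle k = Some (t, n) ->
    enorm (@rational_point R d t) < 1 -> (G t (sample n) zeta < +oo)%E}.
  case E : (unpickle k) => [[t n]|]; last by apply: aeW => zeta _ t n.
  have [t1|t1] := pselect (enorm (@rational_point R d t) < 1); last first.
    by apply: aeW => zeta _ t' n' [<- _] /t1.
  have G0 zeta : S zeta -> (0 <= G t (sample n) zeta)%E.
    by move=> _; apply: poisson_sum_ge0 => x xB; rewrite mulr_ge0 ?radial_weight_ge0 ?Q0.
  have int : mu.-integrable S (G t (sample n)).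
    apply/integrableP; split; first by apply: measurable_funTS; exact: mG.
    under eq_integral => zeta /set_mem zS do rewrite gee0_abs ?G0//.
    exact: (good t1).1.
  have := integrable_ae mS int; apply: filterS => zeta zf zS t' n' [<- <-] _.
  by rewrite -ge0_fin_numE ?G0// zf.
have [N [mN N0 NP]] := ae_foralln h; exists N; split => // zeta zS Nz t n t1.
apply: contrapT => Gz; apply: Nz; apply: NP => /= hz.
by apply: Gz; apply: (hz (pickle (t, n)) zS); rewrite ?pickleK.
Qed.

Variable N : set V.
Hypothesis mN : measurable N.
Hypothesis N0 : mu N = 0%E.
Hypothesis Nfin : forall zeta, S zeta -> ~ N zeta ->
  forall t n, enorm (@rational_point R d t) < 1 -> (G t (sample n) zeta < +oo)%E.

Local Notation D := (S `\` N).

Let mD : measurable D. Proof. exact: measurableD. Qed.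
Let DS : D `<=` S. Proof. exact: subDsetl. Qed.

Lemma sqdist_exceptional (F H : V -> R) : measurable_fun S F -> measurable_fun S H ->
  sqdist mu S F H = sqdist mu D F H.
Proof.
move=> mF mH; rewrite /sqdist; apply: ge0_negligible_integral => //.
- exact: measurable_sqdist.
- by move=> zeta _; rewrite lee_fin sqr_ge0.
Qed.

Let core_limit t : enorm (@rational_point R d t) < 1 -> vanishes (0^'+) (fun a => sqdist mu D
  (fun zeta => a * fine (G t a zeta)) (fun zeta => lambda * Q t zeta)).
Proof.
move=> t1; have [_ van] := good t1.
apply: (@core_sum_limit _ _ d_gt0 X mu (Q t) lambda ((1 - enorm (rational_point t)) ^- (2 * d))) => //.
- by rewrite invr_gt0 exprn_gt0// subr_gt0.
- by move=> x; exact: Q0.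
- by move=> x x1; exact: poisson_szego_bound.
- by move=> n zeta [zS Nz]; exact: Nfin.
have E n : sqdist mu D (fun zeta => sample n * fine (G t (sample n) zeta))
    (fun zeta => lambda * Q t zeta) = sqdist mu S
    (fun zeta => sample n * fine (G t (sample n) zeta)) (fun zeta => lambda * Q t zeta).
  rewrite sqdist_exceptional//; apply: measurable_funTS; apply: measurable_funM => //.
  exact: (measurableT_comp (fine_measurable measurableT) (mG _ t1)).
by move: van; congr vanishes; apply/funext => n; rewrite E.
Qed.

Definition weighted_sum (a : R) (z zeta : V) : \bar R :=
  poisson_sum X (ps_weight (d%:R + a) z) zeta.

Lemma ps_weight_ge0 s (z x : V) : 0 <= ps_weight s z x.
Proof. exact: expR_ge0. Qed.

Lemma weighted_sum_ge0 a z zeta : (0 <= weighted_sum a z zeta)%E.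
Proof. by apply: poisson_sum_ge0 => x _; exact: ps_weight_ge0. Qed.

Lemma measurable_ps_weight s (z : V) : enorm z < 1 -> measurable_fun ball (ps_weight s z).
Proof.
move=> z1; have [mr mi] := measurable_herm_l z.
pose c2 (x : V) := (1 - complex.Re (herm x z)) ^+ 2 + complex.Im (herm x z) ^+ 2.
have c2E x : c2 x = cabs (1 - herm x z) ^+ 2.
  by rewrite cabs_sqr cReD cImD cReN cImN/= sub0r sqrrN.
have mc2 : measurable_fun [set: V] c2.
  by apply: measurable_funD; apply: measurable_funX => //; exact: measurable_funB.
have mq : measurable_fun [set: V] (fun x : V => 1 - enorm x ^+ 2).
  by apply: measurable_funB => //; exact: measurable_enormX.
have mc : measurable_fun [set: V] (fun x => cabs (1 - herm x z)).
  rewrite (_ : (fun x => _) = fun x => Num.sqrt (c2 x)).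
    exact: (measurableT_comp measurable_sqrt mc2).
  by apply/funext => x; rewrite c2E sqrtr_sqr ger0_norm ?cabs_ge0.
pose f (x : V) := Num.sqrt (1 - (1 - enorm z ^+ 2) * (1 - enorm x ^+ 2) * (c2 x `^ (- 1))).
have mf : measurable_fun [set: V] f.
  apply: (measurableT_comp measurable_sqrt); apply: measurable_funB => //.
  apply: measurable_funM; first exact: measurable_funM.
  exact: (measurableT_comp (measurable_powR _) mc2).
have ml g : measurable_fun [set: V] g -> measurable_fun [set: V] (fun x => @ln R (g x)).
  by move=> mg; exact: (measurableT_comp (@measurable_ln R) mg).
apply: (@eq_measurable_fun _ _ _ _ _ (fun x => expR (s * (ln (1 - enorm z ^+ 2) +
    ln (1 - enorm x ^+ 2) - 2 * ln (cabs (1 - herm x z)) - 2 * ln (1 + f x))))).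
  move=> x /set_mem x1; rewrite ps_weightE//; congr (expR (_ * (_ - _ * ln (1 + _)))).
  rewrite /f powR_inv1 ?addr_ge0 ?sqr_ge0// c2E -(ball_involution_norm z1 x1).
  by rewrite subKr sqrtr_sqr ger0_norm ?enorm_ge0.
apply: measurable_funTS; apply: measurableT_comp => //; apply: measurable_funM => //.
apply: measurable_funB; last by apply: measurable_funM => //; apply: ml; exact: measurable_funD.
apply: measurable_funB; last by apply: measurable_funM => //; exact: ml.
by apply: measurable_funD => //; exact: ml.
Qed.

Lemma measurable_weighted a (z : V) : enorm z < 1 -> measurable_fun [set: V] (weighted_sum a z).
Proof.
move=> z1; have mB := @measurable_unit_ball R d.
rewrite (_ : weighted_sum a z = poisson_sum X (ps_weight (d%:R + a) z \_ ball)).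
  apply: measurable_poisson_sum.
    by apply: (proj1 (measurable_restrictT _ mB)); exact: measurable_ps_weight.
  by move=> x xB; rewrite patchE mem_set// ps_weight_ge0.
by apply/funext => zeta; apply: eq_conf_esum => x xB; rewrite patchE mem_set.
Qed.

Let poisson_sumD (u v : V -> R) zeta : (forall x, ball x -> 0 <= u x) ->
  (forall x, ball x -> 0 <= v x) ->
  (poisson_sum X (fun x => u x + v x)%R zeta = poisson_sum X u zeta + poisson_sum X v zeta)%E.
Proof.
move=> u0 v0; pose r (w : V -> R) x := (((w x * P x zeta) * \1_ball x)%R%:E : \bar R).
have rE w : poisson_sum X w zeta = conf_esum X (r w).
  by apply: eq_conf_esum => x xB; rewrite /r indicE mem_set// mulr1.
have r0 w x : (forall x, ball x -> 0 <= w x) -> (0 <= r w x)%E.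
  move=> w0; rewrite /r indicE; case: (boolP (x \in ball)) => [/set_mem xB|_]; last by rewrite mulr0.
  by rewrite mulr1 lee_fin mulr_ge0 ?w0// poisson_szego_ge0// ltW.
rewrite !rE -conf_esumD; [|by move=> x; exact: r0|by move=> x; exact: r0].
by apply: eq_conf_esum => x _; rewrite /r mulrDl mulrDl EFinD.
Qed.

Let poisson_sumZ (c : R) (u : V -> R) zeta : 0 <= c -> (forall x, ball x -> 0 <= u x) ->
  (poisson_sum X (fun x => c * u x)%R zeta = c%:E * poisson_sum X u zeta)%E.
Proof.
move=> c0 u0; pose r (w : V -> R) x := (((w x * P x zeta) * \1_ball x)%R%:E : \bar R).
have rE w : poisson_sum X w zeta = conf_esum X (r w).
  by apply: eq_conf_esum => x xB; rewrite /r indicE mem_set// mulr1.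
rewrite !rE -conf_esumZ//; first by apply: eq_conf_esum => x _; rewrite /r -EFinM !mulrA.
move=> x; rewrite /r indicE; case: (boolP (x \in ball)) => [/set_mem xB|_]; last by rewrite mulr0.
by rewrite mulr1 lee_fin mulr_ge0 ?u0// poisson_szego_ge0// ltW.
Qed.

(** There are finitely many points in a smaller ball, where the kernel is bounded. *)
Lemma inner_sum_bounded (r : R) : r < 1 -> exists2 B : R, 0 <= B &
  forall zeta, S zeta -> (poisson_sum X (\1_[set x | enorm x <= r]%R) zeta <= B%:E)%E.
Proof.
move=> r1; pose A := [set x : V | enorm x <= r].
pose K : R := 4 ^+ d / (1 - r ^+ 2) ^+ d.
have [r0|r0] := ltP r 0.
  exists 0 => // zeta _; rewrite (_ : \1_ _ = fun=> 0); last first.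
    apply/funext => x; rewrite indicE memNset//= => h.
    by have := lt_le_trans r0 (enorm_ge0 x); rewrite ltNge h.
  apply: (@le_trans _ _ (conf_esum X (fun=> 0%E))); last by rewrite conf_esum0.
  by apply: le_conf_esum => x _; rewrite mul0r.
have q0 : 0 < 1 - r ^+ 2 by rewrite subr_gt0 expr_lt1.
have K0 : 0 <= K by rewrite divr_ge0// exprn_ge0// ltW.
have fin : conf_count X A \is a fin_num.
  by rewrite ge0_fin_numE ?measure_ge0//; exact: conf_count_finite.
exists (K * fine (conf_count X A)) => [|zeta zS]; first by rewrite mulr_ge0// fine_ge0// measure_ge0.
rewrite EFinM fineK// conf_countE -conf_esumZ//.
apply: le_conf_esum => x xB; rewrite -EFinM lee_fin mulrC indicE.
case: (boolP (x \in A)) => [/set_mem /= xr|_]; last by rewrite !mulr0.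
rewrite !mulr1 (le_trans (poisson_szego_le xB zS))// /K ler_wpM2l ?exprn_ge0//.
have qx : 1 - r ^+ 2 <= 1 - enorm x ^+ 2.
  by rewrite lerD2l lerN2 lerXn2r ?nnegrE ?enorm_ge0.
have qx0 := lt_le_trans q0 qx.
by rewrite lef_pV2 ?posrE ?exprn_gt0// lerXn2r ?nnegrE// ltW.
Qed.

Let kl := @limit_density R d * lambda.

Let kl0 : 0 < kl. Proof. by rewrite mulr_gt0 ?limit_density_gt0. Qed.

Lemma ps_weight_le1 s (z x : V) : 0 <= s -> enorm z < 1 -> enorm x < 1 -> ps_weight s z x <= 1.
Proof.
move=> s0 z1 x1; rewrite /ps_weight -[leRHS]expR0 ler_expR mulNr oppr_le0 mulr_ge0//.
rewrite /bergman_dist ln_ge0//; set f := enorm _.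
have f0 : 0 <= f by exact: enorm_ge0.
have := ball_involution_norm z1 x1; rewrite -/f => e.
have f2 : 0 < 1 - f ^+ 2.
  have c0 : 0 < cabs (1 - herm x z).
    by rewrite cabs_1herm_gt0// (le_lt_trans _ z1)// ler_piMl ?enorm_ge0// ltW.
  by rewrite e divr_gt0 ?exprn_gt0// mulr_gt0// subr_gt0 expr_lt1 ?enorm_ge0.
have f1 : f < 1 by rewrite -(@expr_lt1 _ 2)// -subr_gt0.
by rewrite ler_pdivlMr ?subr_gt0// mul1r; lra.
Qed.

Lemma radial_weight_le1 a (x : V) : 0 < a -> enorm x < 1 -> radial_weight a x <= 1.
Proof.
move=> a0 x1; have x0 := enorm_ge0 x; rewrite /radial_weight.
set q := 1 - enorm x ^+ 2; set y := 1 - enorm x ^+ (2 * d).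
have q0 : 0 < q by rewrite subr_gt0 expr_lt1.
have q1 : q <= 1 by rewrite gerBl sqr_ge0.
have y0 : 0 < y by rewrite subr_gt0 expr_lt1// muln_gt0.
have y1 : y <= 1 by rewrite gerBl exprn_ge0.
have qy : q <= y.
  rewrite lerD2l lerN2 exprM -[leRHS]expr1 ler_wiXn2l ?sqr_ge0//.
  by rewrite expr_le1// ltW.
rewrite (@le_trans _ _ (y * y^-1))//; last by rewrite mulfV// gt_eqF.
apply: ler_pM; rewrite ?exprn_ge0 ?powR_ge0 ?(ltW q0)//.
  by rewrite (le_trans _ qy)// exprS ler_piMr ?exprn_ile1// ltW.
rewrite -powR_inv1 ?(ltW y0)//; apply: ger_powR; first by rewrite y0.
by rewrite lerBrDl subrr ltW.
Qed.

Lemma weighted_sum_bound (z : V) a : enorm z < 1 -> 0 < a -> exists2 C : R, 0 <= C &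
  exists2 t, enorm (@rational_point R d t) < 1 &
  forall zeta, (weighted_sum a z zeta <= C%:E * G t a zeta)%E.
Proof.
move=> z1 a0; have m0 : 0 < 1 - enorm z by rewrite subr_gt0.
have h2 : 0 < 1 / 2 * (1 - enorm z) by rewrite mulr_gt0.
have [t ht] := rational_point_dense d_gt0 z h2.
have [K K0 hK] := ps_weight_comparison d_gt0 z1.
have t1 : enorm (@rational_point R d t) < 1.
  rewrite -subr_gt0 (lt_le_trans _ (near_point_lt1 z1 (lexx _) ht))//.
  by rewrite divr_gt0.
exists (expR (8 * d%:R * (1 / 2) + K + a * K) * @limit_density R d).
  by rewrite mulr_ge0 ?expR_ge0// ltW ?limit_density_gt0.
exists t => // zeta; rewrite -poisson_sumZ; last 2 first.
- by rewrite mulr_ge0 ?expR_ge0// ltW ?limit_density_gt0.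
- by move=> x xB; rewrite mulr_ge0 ?radial_weight_ge0 ?Q0.
apply: le_poisson_sum => x xB; have half0 : 0 <= 1 / 2 :> R by [].
have [h _] := hK _ _ half0 (lexx _) ht a x a0 xB.
have w0 : 0 <= radial_weight a x * Q t x.
  by apply: mulr_ge0; [exact: radial_weight_ge0|exact: Q0].
rewrite (le_trans h)// mulrA ler_wpM2r// ler_wpM2r ?(ltW (limit_density_gt0 _))// ler_expR lerD2r lerD2l ler_piMr//.
by rewrite gerBl sqr_ge0.
Qed.

Let Gfin t a zeta : enorm (@rational_point R d t) < 1 -> 0 < a -> D zeta -> (G t a zeta < +oo)%E.
Proof.
move=> t1 a0 Dz; apply: (@core_sum_finite _ _ d_gt0 X (Q t) _ D) => //.
- by move=> x; exact: Q0.
- by move=> n ze [zS Nz]; exact: Nfin.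
Qed.

Lemma weighted_sum_finite (z zeta : V) a : enorm z < 1 -> 0 < a -> D zeta ->
  (weighted_sum a z zeta < +oo)%E.
Proof.
move=> z1 a0 Dz; have [C C0 [t t1 hC]] := weighted_sum_bound z1 a0.
apply: le_lt_trans (hC zeta) _; apply: lte_mul_pinfty; rewrite ?lee_fin//.
exact: Gfin.
Qed.

Let small_exponent (c b : R) : 0 < c -> 0 < b -> exists2 eta : R, 0 < eta &
  c * (expR eta ^+ 2 - 1) <= b.
Proof.
move=> c0 b0; pose eta := Num.min (1 / 4) (b / (4 * c)).
have e1 : 0 < b / (4 * c) by rewrite divr_gt0// mulr_gt0.
have eta0 : 0 < eta by rewrite /eta lt_min e1 andbT.
have [h1 h2] : eta <= 1 / 4 /\ eta <= b / (4 * c).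
  by split; rewrite /eta ge_min lexx ?orbT.
exists eta => //; set E := expR eta ^+ 2.
have EE : E * (1 - 2 * eta) <= 1.
  have : 1 + - (2 * eta) <= expR (- (2 * eta)) by exact: expR_ge1Dx.
  have E0 : 0 <= E by exact: sqr_ge0.
  move/(ler_wpM2l E0)/le_trans; apply; rewrite /E expr2 -!expRD.
  by rewrite (_ : eta + eta - 2 * eta = 0) ?expR0//; ring.
have E1 : 1 <= E by rewrite /E exprn_ege1// -expR0 ler_expR ltW.
have {}h2 : 4 * (c * eta) <= b by move: h2; rewrite ler_pdivlMr ?mulr_gt0//; lra.
have : E - 1 <= 4 * eta by nra.
by move=> /(ler_wpM2l (ltW c0))/le_trans; apply; lra.
Qed.

Let ratio_distance (E p q : R) : 1 <= E -> 0 <= p -> p <= E * q -> q <= E * p ->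
  `|p - E^-1 * q| <= (E ^+ 2 - 1) * p /\ `|p - E * q| <= (E ^+ 2 - 1) * p.
Proof.
move=> E1 p0 pq qp; have E0 : 0 < E by lra.
have v0 : 0 < E^-1 by rewrite invr_gt0.
have Ev : E * E^-1 = 1 by rewrite mulfV// gt_eqF.
move: (E^-1) v0 Ev => v v0 Ev.
have q1 : v * q <= p by have := ler_wpM2l (ltW v0) qp; rewrite mulrA (mulrC v E) Ev mul1r.
have q2 : v * p <= q by have := ler_wpM2l (ltW v0) pq; rewrite mulrA (mulrC v E) Ev mul1r.
have q3 : v * (v * p) <= v * q by rewrite ler_wpM2l// ltW.
split.
  rewrite ger0_norm ?subr_ge0//.
  have : 0 <= (E - v) ^+ 2 * p by rewrite mulr_ge0 ?sqr_ge0.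
  rewrite sqrrB Ev; lra.
rewrite distrC ger0_norm ?subr_ge0//.
have := ler_wpM2l (ltW E0) qp; lra.
Qed.

Let sandwich_constants (x y u b e : R) (q : \bar R) : 0 < x + y -> (0 <= q)%E ->
  (q <= (e / (2 * (2 * x + 2 * y)))%:E)%E -> 0 <= u -> u <= b -> 16 * b ^+ 2 <= e / 2 ->
  ((2 * x)%:E * q + (2 * (u + b) ^+ 2)%:E +
   ((2 * y)%:E * q + (2 * (u + b) ^+ 2)%:E) <= e%:E)%E.
Proof.
move=> xy q0 qe u0 ub be.
have qf : q \is a fin_num by rewrite ge0_fin_numE// (le_lt_trans qe)// ltry.
move: q0 qe; rewrite -(fineK qf) !lee_fin => q0 qe.
have c0 : 0 < 2 * (2 * x + 2 * y) by lra.
move: qe; rewrite ler_pdivlMr// => qe.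
have ab : (u + b) ^+ 2 <= 4 * b ^+ 2 by nra.
by lra.
Qed.

(** Outside a smaller ball the two weights agree up to a factor e^eta, and the points
    inside it contribute at most a constant. *)
Let core_bounds (z : V) (eta : R) : enorm z < 1 -> 0 < eta -> exists t B,
  [/\ enorm (@rational_point R d t) < 1, 0 <= B,
    forall zeta, S zeta -> P z zeta <= expR eta * Q t zeta /\ Q t zeta <= expR eta * P z zeta &
    \forall a \near (0 : R)^'+, forall zeta, D zeta ->
      fine (weighted_sum a z zeta) <= expR eta * @limit_density R d * fine (G t a zeta) + B /\
      @limit_density R d * fine (G t a zeta) <= expR eta * fine (weighted_sum a z zeta) + B].
Proof.
move=> z1 eta0; have m0 : 0 < 1 - enorm z by rewrite subr_gt0.
have d0 : 0 < d%:R :> R by rewrite ltr0n.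
have k0 := @limit_density_gt0 R d d_gt0; set k := @limit_density R d in k0 *.
set E := expR eta; have E0 : 0 < E by exact: expR_gt0.
(* theta bounds the distance from z to the rational point t in units of 1 - |z|, w is the
   width of the layer of outer points, and a is small: each uses a part of eta *)
pose theta := Num.min (1 / 2) (eta / (16 * d%:R)).
have th0 : 0 < theta by rewrite lt_min !divr_gt0 ?mulr_gt0.
have [th1 th2] : theta <= 1 / 2 /\ theta <= eta / (16 * d%:R).
  by split; rewrite /theta ge_min lexx ?orbT.
have thd : 8 * d%:R * theta <= eta / 2.
  by move: th2; rewrite ler_pdivlMr ?mulr_gt0//; lra.
have thm : 0 < theta * (1 - enorm z) by rewrite mulr_gt0.
have [t ht] := rational_point_dense d_gt0 z thm.
have t1 : enorm (@rational_point R d t) < 1.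
  by rewrite -subr_gt0 (lt_le_trans _ (near_point_lt1 z1 th1 ht))// divr_gt0.
have [K K0 hK] := ps_weight_comparison d_gt0 z1.
have K1 : 0 < K + 1 by rewrite ltr_wpDl.
pose w := Num.min (1 / 2) (eta / (8 * (K + 1))).
have w0 : 0 < w by rewrite lt_min !divr_gt0 ?mulr_gt0.
have wK : K * w <= eta / 8.
  have w2 : w <= eta / (8 * (K + 1)) by rewrite /w ge_min lexx ?orbT.
  by move: w2; rewrite ler_pdivlMr ?mulr_gt0//; lra.
pose r := 1 - w; have r1 : r < 1 by rewrite /r; lra.
pose A := [set x : V | enorm x <= r].
have [B B0 hB] := inner_sum_bounded r1.
pose Hq := (1 - enorm (@rational_point R d t)) ^- (2 * d).
have Hq0 : 0 < Hq by rewrite invr_gt0 exprn_gt0// subr_gt0.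
pose B' := B + k * Hq * B.
have kHB : 0 <= k * Hq * B by rewrite mulr_ge0// mulr_ge0 ?(ltW k0) ?(ltW Hq0).
have B'1 : B <= B' by rewrite /B' lerDl.
have B'2 : k * Hq * B <= B' by rewrite /B' lerDr.
exists t, B'; split => //.
- exact: le_trans B'1.
- move=> zeta zS; have ze1 : enorm zeta <= 1 by rewrite zS.
  have p0 := poisson_szego_gt0 z1 ze1; have p0' := poisson_szego_gt0 t1 ze1.
  have := ln_poisson_szego_dist z1 (ltW th0) th1 ht ze1.
  rewrite ler_norml => /andP[h1 h2]; split.
    rewrite -[leLHS]lnK ?posrE// /Q -[X in _ * X]lnK ?posrE// -expRD ler_expR; lra.
  rewrite /Q -[leLHS]lnK ?posrE// -[X in _ * X]lnK ?posrE// -expRD ler_expR; lra.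
near=> a.
have a0 : 0 < a by near: a; exact: nbhs_right_gt.
have aK : a * K <= eta / 4.
  have : a <= eta / (4 * (K + 1)).
    by near: a; apply: nbhs_right_le; rewrite divr_gt0// mulr_gt0.
  by rewrite ler_pdivlMr ?mulr_gt0//; lra.
have rwQ0 x : ball x -> 0 <= radial_weight a x * Q t x.
  by move=> xB; apply: mulr_ge0; [exact: radial_weight_ge0|exact: Q0].
have A0 x : ball x -> 0 <= (\1_A x : R) by move=> _; rewrite indicE.
have rwQH x : ball x -> radial_weight a x * Q t x <= Hq.
  move=> xB; rewrite -[leRHS]mul1r ler_pM ?radial_weight_ge0 ?Q0 ?radial_weight_le1//.
  by apply: poisson_szego_bound => //; exact: ltW.
have cmp x : ball x ->
    ps_weight (d%:R + a) z x <= E * k * (radial_weight a x * Q t x) + \1_A x /\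
    k * (radial_weight a x * Q t x) <= E * ps_weight (d%:R + a) z x + k * Hq * \1_A x.
  move=> xB; have := hK _ _ (ltW th0) th1 ht a x a0 xB.
  set et := (X in let eta := X in _) => -[h1 h2].
  rewrite indicE; case: (boolP (x \in A)) => [/set_mem xA|/negP xA] /=.
    split.
      rewrite (@le_trans _ _ 1)//; first by rewrite ps_weight_le1// addr_ge0// ltW.
      by rewrite lerDr mulr_ge0 ?rwQ0// mulr_ge0// ltW.
    rewrite mulr1 (@le_trans _ _ (k * Hq))//; first by rewrite ler_wpM2l ?rwQH// ltW.
    by rewrite lerDr; exact: (mulr_ge0 (ltW E0) (ps_weight_ge0 _ _ _)).
  have xr : r < enorm x by rewrite ltNge; apply/negP => xr; apply: xA; rewrite inE.
  have etE : expR et <= E.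
    rewrite ler_expR /et; have qx : 1 - enorm x ^+ 2 <= 2 * w.
      by have x0 := enorm_ge0 x; have x1 : enorm x < 1 by []; rewrite /r in xr; nra.
    have := ler_wpM2l K0 qx; lra.
  rewrite mulr0 !addr0; split.
    by rewrite (le_trans h1)// -mulrA ler_wpM2r// mulr_ge0 ?rwQ0// ltW.
  by rewrite (le_trans h2)// ler_wpM2r// ps_weight_ge0.
have Gf zeta : D zeta -> G t a zeta \is a fin_num.
  by move=> Dz; rewrite ge0_fin_numE ?Gfin//; exact: poisson_sum_ge0.
have Wf zeta : D zeta -> weighted_sum a z zeta \is a fin_num.
  by move=> Dz; rewrite ge0_fin_numE ?weighted_sum_finite// weighted_sum_ge0.
have inner zeta : D zeta -> (poisson_sum X (\1_A) zeta <= B%:E)%E.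
  by move=> [zS _]; exact: hB.
have up zeta : D zeta -> fine (weighted_sum a z zeta) <= E * k * fine (G t a zeta) + B.
  move=> Dz; rewrite -lee_fin EFinD EFinM fineK ?Wf// fineK ?Gf//.
  rewrite (le_trans _ (leeD2l _ (inner _ Dz)))// -poisson_sumZ ?mulr_ge0 ?(ltW E0) ?(ltW k0)//.
  rewrite -poisson_sumD//; last by move=> x xB; rewrite mulr_ge0 ?rwQ0// mulr_ge0// ltW.
  by apply: le_poisson_sum => x xB; case: (cmp x xB).
have lo zeta : D zeta -> k * fine (G t a zeta) <= E * fine (weighted_sum a z zeta) + k * Hq * B.
  move=> Dz; rewrite -lee_fin EFinD (EFinM k) (EFinM E) (EFinM (k * Hq)) (fineK (Wf _ Dz)) (fineK (Gf _ Dz)).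
  have kH : 0 <= k * Hq by rewrite mulr_ge0// ltW.
  rewrite (le_trans _ (leeD2l _ (lee_wpmul2l _ (inner _ Dz))))//.
  rewrite -!poisson_sumZ ?(ltW E0) ?(ltW k0)//; last by move=> x _; exact: ps_weight_ge0.
  rewrite -poisson_sumD//; last 2 first.
  - by move=> x _; exact: (mulr_ge0 (ltW E0) (ps_weight_ge0 _ _ _)).
  - by move=> x xB; rewrite mulr_ge0 ?A0.
  by apply: le_poisson_sum => x xB; case: (cmp x xB).
move=> zeta Dz; split; first by rewrite (le_trans (up zeta Dz))// lerD2l.
by rewrite (le_trans (lo zeta Dz))// lerD2l.
Unshelve. all: end_near. Qed.

(** The sum for z is squeezed between multiples close to 1 of the sum for a rational point,
    whose limit is known, up to a bounded contribution that the factor a removes. *)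
Theorem weighted_sum_limit (z : V) : enorm z < 1 -> vanishes (0^'+) (fun a => sqdist mu D
  (fun zeta => a * fine (weighted_sum a z zeta)) (fun zeta => kl * P z zeta)).
Proof.
move=> z1 e e0; pose H := (1 - enorm z) ^- (2 * d).
have m0 : 0 < 1 - enorm z by rewrite subr_gt0.
have d0 : 0 < d%:R :> R by rewrite ltr0n.
have k0 := @limit_density_gt0 R d d_gt0; set k := @limit_density R d in k0.
have H0 : 0 < H by rewrite invr_gt0 exprn_gt0.
(* b bounds the errors that come from the inner points and, by the choice of eta, from
   the replacement of P z by a multiple of P t; their squares add up to at most e / 2 *)
pose b := Num.min 1 e / 8.
have b0 : 0 < b by rewrite divr_gt0// lt_min ltr01.
have bb : 16 * b ^+ 2 <= e / 2.
  have [h1 h2] : Num.min 1 e <= 1 /\ Num.min 1 e <= e by split; rewrite ge_min lexx ?orbT.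
  have h3 : 0 < Num.min 1 e by rewrite lt_min ltr01.
  by rewrite /b; move: (Num.min 1 e) h1 h2 h3 => v h1 h2 h3; nra.
have klH : 0 < kl * H by rewrite mulr_gt0.
have [eta eta0 heta] := small_exponent klH b0; set E := expR eta in heta.
have E0 : 0 < E by exact: expR_gt0.
have E1 : 1 <= E by rewrite -expR0 ler_expR ltW.
have [t [B' [t1 B'0 hP hB]]] := core_bounds z1 eta0.
pose c1 := 2 * (E^-1 * k) ^+ 2 + 2 * (E * k) ^+ 2.
have c10 : 0 < c1.
  have h1 : 0 < (E * k) ^+ 2 by rewrite exprn_gt0// mulr_gt0.
  by have := sqr_ge0 (E^-1 * k); rewrite /c1; lra.
have ec : 0 < e / (2 * c1) by rewrite divr_gt0// mulr_gt0.
have hlim := core_limit t1 ec.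
near=> a.
have a0 : 0 < a by near: a; exact: nbhs_right_gt.
have aB : a * B' <= b.
  have : a <= b / (B' + 1) by near: a; apply: nbhs_right_le; rewrite divr_gt0// ltr_wpDl.
  by rewrite ler_pdivlMr ?ltr_wpDl//; lra.
have ha : (sqdist mu D (fun zeta => (a * fine (G t a zeta))%R)
    (fun zeta => (lambda * Q t zeta)%R) <= (e / (2 * c1))%:E)%E by near: a.
have hBa : forall zeta, D zeta -> fine (weighted_sum a z zeta) <= E * k * fine (G t a zeta) + B' /\
    k * fine (G t a zeta) <= E * fine (weighted_sum a z zeta) + B' by near: a.
have Pcmp zeta : D zeta -> P z zeta <= E * Q t zeta /\ Q t zeta <= E * P z zeta.
  by move=> [/hP].
have PH zeta : D zeta -> P z zeta <= H.
  by move=> [zS _]; apply: poisson_szego_bound => //; rewrite zS.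
have P0 zeta : 0 <= P z zeta by rewrite poisson_szego_ge0// ltW.
have mfine f : measurable_fun [set: V] f -> measurable_fun D (fun zeta => fine (f zeta) : R).
  by move=> mf; apply: measurable_funTS; exact: (measurableT_comp (fine_measurable measurableT) mf).
have mM (c : R) f : measurable_fun D f -> measurable_fun D (fun zeta => c * f zeta).
  by move=> mf; exact: measurable_funM.
have mag : measurable_fun D (fun zeta => a * fine (G t a zeta)).
  by apply: mM; apply: mfine; exact: mG.
have maw : measurable_fun D (fun zeta => a * fine (weighted_sum a z zeta)).
  by apply: mM; apply: mfine; exact: measurable_weighted.
have mkp : measurable_fun D (fun zeta => kl * P z zeta).
  by apply: mM; apply: measurable_funTS; exact: measurable_poisson_szego_r.
have mlq : measurable_fun D (fun zeta => lambda * Q t zeta).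
  by apply: mM; exact: measurable_funTS.
have mD1 : (mu D <= 1)%E by exact: probability_le1.
pose U zeta := E * k * (a * fine (G t a zeta)) + a * B'.
pose L zeta := E^-1 * k * (a * fine (G t a zeta)) - E^-1 * (a * B').
have mU : measurable_fun D U by apply: measurable_funD => //; exact: mM.
have mL : measurable_fun D L by apply: measurable_funB => //; exact: mM.
have LU zeta : D zeta -> L zeta <= a * fine (weighted_sum a z zeta) <= U zeta.
  move=> Dz; apply/andP; split.
    have := ler_wpM2l (ltW a0) (hBa zeta Dz).2.
    have -> : L zeta = (a * (k * fine (G t a zeta)) - a * B') / E.
      by rewrite /L; move: (E^-1) => v; ring.
    by rewrite ler_pdivrMr//; lra.
  by have := ler_wpM2l (ltW a0) (hBa zeta Dz).1; rewrite /U; lra.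
have EV0 : 0 < E^-1 by rewrite invr_gt0.
have EV1 : E^-1 <= 1 by rewrite invf_le1.
have EEV : E * E^-1 = 1 by rewrite mulfV// gt_eqF.
have sq := @sqdist_squeeze _ _ _ mu D mD L U (fun zeta => a * fine (weighted_sum a z zeta))
  (fun zeta => kl * P z zeta) mL mU maw mkp LU.
apply: le_trans sq _.
have Lb := @sqdist_perturb _ _ _ mu D mD mD1 (E^-1 * k) (a * B') b L
  (fun zeta => kl * P z zeta) (fun zeta => a * fine (G t a zeta))
  (fun zeta => lambda * Q t zeta) mL mkp mag mlq.
have Ub := @sqdist_perturb _ _ _ mu D mD mD1 (E * k) (a * B') b U
  (fun zeta => kl * P z zeta) (fun zeta => a * fine (G t a zeta))
  (fun zeta => lambda * Q t zeta) mU mkp mag mlq.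
have bound zeta : D zeta -> kl * (E ^+ 2 - 1) * P z zeta <= b.
  move=> Dz; apply: le_trans heta; rewrite -mulrA [leRHS]mulrAC -mulrA.
  rewrite ler_wpM2l ?(ltW kl0)// ler_wpM2l ?PH// subr_ge0.
  by rewrite exprn_ege1.
have kE : kl = k * lambda by [].
apply: (le_trans (leeD (Lb _ _) (Ub _ _))).
- move=> zeta Dz; rewrite /L addrAC subrr sub0r normrN ger0_norm; last first.
    by rewrite mulr_ge0 ?(ltW EV0)// mulr_ge0 ?(ltW a0).
  by rewrite mulrCA ler_wpM2l ?(ltW a0)// ler_piMl.
- move=> zeta Dz; have [p1 p2] := Pcmp zeta Dz.
  have -> : kl * P z zeta - E^-1 * k * (lambda * Q t zeta) = kl * (P z zeta - E^-1 * Q t zeta).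
    by rewrite kE; ring.
  apply: le_trans (bound zeta Dz); rewrite normrM (gtr0_norm kl0) -mulrA ler_wpM2l ?(ltW kl0)//.
  by have [] := ratio_distance E1 (P0 zeta) p1 p2.
- by move=> zeta Dz; rewrite /U addrAC subrr add0r ger0_norm ?mulr_ge0 ?(ltW a0)// ler_wpM2l ?(ltW a0).
- move=> zeta Dz; have [p1 p2] := Pcmp zeta Dz.
  have -> : kl * P z zeta - E * k * (lambda * Q t zeta) = - (kl * (E * Q t zeta - P z zeta)).
    by rewrite kE; ring.
  apply: le_trans (bound zeta Dz).
  rewrite normrN normrM (gtr0_norm kl0) -mulrA ler_wpM2l ?(ltW kl0)//.
  by rewrite distrC; have [] := ratio_distance E1 (P0 zeta) p1 p2.
apply: (sandwich_constants _ _ ha _ aB bb).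
- by rewrite /c1 in c10; lra.
- exact: sqdist_ge0.
- by rewrite mulr_ge0 ?(ltW a0).
Unshelve. all: end_near. Qed.

End weighted_sum_limit.

(** * The square norm and sums along enumerations *)

Section square_norm.
Context {dT : measure_display} {T : measurableType dT} {R : realType}.
Variables (m : {measure set T -> \bar R}) (D : set T).
Hypothesis mD : measurable D.
Implicit Types F : T -> R[i].

Definition sqnorm F : \bar R := (\int[m]_(t in D) (cabs (F t) ^+ 2)%:E)%E.

Lemma sqnorm_ge0 F : (0 <= sqnorm F)%E.
Proof. by apply: integral_ge0 => t _; rewrite lee_fin sqr_ge0. Qed.

Lemma L2norm_ge0 F : (0 <= L2norm m D F)%E.
Proof. exact: Lnorm_ge0. Qed.

Lemma L2norm_sqr F : (L2norm m D F * L2norm m D F)%E = sqnorm F.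
Proof.
have h : (L2norm m D F `^ 2)%E = sqnorm F.
  rewrite /L2norm powR_Lnorm// /sqnorm [RHS]integral_mkcond.
  apply: eq_integral => t _; rewrite !patchE; case: ifP => _ /=.
    by rewrite ger0_norm ?cabs_ge0// powR_mulrn ?cabs_ge0.
  by rewrite normr0 powR0.
rewrite -h; have := L2norm_ge0 F; case: (L2norm m D F) => [r|_|//].
  by rewrite lee_fin => r0; rewrite poweR_EFin -EFinM powR_mulrn// expr2.
by rewrite mulyy /= pnatr_eq0.
Qed.

Lemma L2norm_le F (e : R) : 0 <= e -> (L2norm m D F <= e%:E)%E = (sqnorm F <= (e ^+ 2)%:E)%E.
Proof.
move=> e0; rewrite -L2norm_sqr; have := L2norm_ge0 F.
case: (L2norm m D F) => [r|_|//]; last by rewrite mulyy.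
by rewrite lee_fin => r0; rewrite -EFinM !lee_fin -expr2 ler_sqr.
Qed.

Lemma L2norm_lty F : (L2norm m D F < +oo)%E = (sqnorm F < +oo)%E.
Proof.
rewrite -L2norm_sqr; have := L2norm_ge0 F.
by case: (L2norm m D F) => [r|_|//]; rewrite ?mulyy// -EFinM !ltry.
Qed.

Lemma L2norm_cvg0 {I : Type} (G : set_system I) {FG : Filter G} (F : I -> T -> R[i]) :
  (L2norm m D (F i) @[i --> G] --> 0%E) <-> vanishes G (fun i => sqnorm (F i)).
Proof.
split=> [|v].
  move/fine_cvgP => [fin c] e e0; have s0 : 0 < Num.sqrt e by rewrite sqrtr_gt0.
  move/cvgrPdist_le : c => /(_ _ s0); apply: filterS2 fin => i fi /=.
  rewrite sub0r normrN ger0_norm ?fine_ge0 ?L2norm_ge0// -lee_fin fineK//.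
  by rewrite L2norm_le ?sqrtr_ge0// sqr_sqrtr// ltW.
apply: vanishes_cvg => [i|e e0]; first exact: L2norm_ge0.
have e2 : 0 < e ^+ 2 by rewrite exprn_gt0.
by apply: filterS (v _ e2) => i; rewrite L2norm_le// ltW.
Qed.

Lemma sqnorm_real (F G : T -> R) : sqnorm (fun t => (F t)%:C - (G t)%:C) = sqdist m D F G.
Proof.
apply: eq_integral => t _; congr EFin.
by rewrite -rmorphB/= expr0n/= addr0 sqr_sqrtr ?sqr_ge0.
Qed.

Lemma measurable_cabs_sqr F : cmeasurable_fun D F -> measurable_fun D (fun t => (cabs (F t) ^+ 2)%:E).
Proof.
move=> [mr mi]; apply/measurable_EFinP; under eq_fun do rewrite cabs_sqr.
by apply: measurable_funD; apply: measurable_funX.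
Qed.

Lemma cmeasurableB F G : cmeasurable_fun D F -> cmeasurable_fun D G ->
  cmeasurable_fun D (fun t => F t - G t).
Proof.
move=> [fr fi] [gr gi]; split; under eq_fun do rewrite ?cReD ?cImD ?cReN ?cImN.
  exact: measurable_funB.
exact: measurable_funB.
Qed.

Lemma cabs_sqr_triangle (u v w : R[i]) :
  cabs (u - w) ^+ 2 <= 2 * cabs (u - v) ^+ 2 + 2 * cabs (v - w) ^+ 2.
Proof.
rewrite !cabs_sqr !cReD !cImD !cReN !cImN.
move: (complex.Re u) (complex.Re v) (complex.Re w) => a b c.
move: (complex.Im u) (complex.Im v) (complex.Im w) => a' b' c'.
by have := sqr_ge0 (a - b - (b - c)); have := sqr_ge0 (a' - b' - (b' - c')); nra.
Qed.

Lemma sqnorm_triangle F G H : cmeasurable_fun D F -> cmeasurable_fun D G -> cmeasurable_fun D H ->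
  (sqnorm (fun t => F t - H t)%R <=
   2%:E * sqnorm (fun t => F t - G t)%R + 2%:E * sqnorm (fun t => G t - H t)%R)%E.
Proof.
move=> mF mG mH; have mFG := measurable_cabs_sqr (cmeasurableB mF mG).
have mGH := measurable_cabs_sqr (cmeasurableB mG mH).
rewrite /sqnorm -!ge0_integralZl//=; last 2 first.
- by move=> t _; rewrite lee_fin sqr_ge0.
- by move=> t _; rewrite lee_fin sqr_ge0.
rewrite -ge0_integralD//=; last 4 first.
- by move=> t _; rewrite -EFinM lee_fin mulr_ge0 ?sqr_ge0.
- exact: measurable_funeM.
- by move=> t _; rewrite -EFinM lee_fin mulr_ge0 ?sqr_ge0.
- exact: measurable_funeM.
apply: ge0_le_integral => //=.
- by move=> t _; rewrite lee_fin sqr_ge0.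
- exact: measurable_cabs_sqr (cmeasurableB mF mH).
- by apply: emeasurable_funD; exact: measurable_funeM.
- by move=> t _; rewrite -!EFinM -EFinD lee_fin cabs_sqr_triangle.
Qed.

(** A form of the Cauchy-Schwarz inequality: (F - G) u is at most
    (F - G)^2 / (2 e) + e u^2 / 2, and both terms integrate to the order of e. *)
Lemma integral_le_sqdist (F G u : T -> R) (e K : R) :
  measurable_fun D F -> measurable_fun D G -> measurable_fun D u ->
  (forall t, D t -> 0 <= F t) -> (forall t, D t -> 0 <= G t) -> (forall t, D t -> 0 <= u t) ->
  0 < e -> (\int[m]_(t in D) (u t ^+ 2)%:E <= K%:E)%E -> (sqdist m D F G <= (e ^+ 2)%:E)%E ->
  (\int[m]_(t in D) (F t * u t)%:E <=
   \int[m]_(t in D) (G t * u t)%:E + (e * (1 + K) / 2)%:E)%E.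
Proof.
move=> mF mG mu F0 G0 u0 e0 uK FG.
have mGu : measurable_fun D (fun t => (G t * u t)%:E).
  by apply/measurable_EFinP; exact: measurable_funM.
have mu2 : measurable_fun D (fun t => (u t ^+ 2)%:E).
  by apply/measurable_EFinP; exact: measurable_funX.
have mFG := measurable_sqdist mF mG.
have c1 : 0 <= (2 * e)^-1 by rewrite invr_ge0 mulr_ge0// ltW.
have c2 : 0 <= e / 2 by rewrite divr_ge0// ltW.
apply: (@le_trans _ _ (\int[m]_(t in D) ((G t * u t)%:E +
    (((2 * e)^-1)%:E * ((F t - G t) ^+ 2)%:E + (e / 2)%:E * (u t ^+ 2)%:E)))%E).
  apply: ge0_le_integral => //=.
  - by move=> t Dt; rewrite lee_fin mulr_ge0 ?F0 ?u0.
  - by apply/measurable_EFinP; exact: measurable_funM.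
  - by do 2?apply: emeasurable_funD => //; exact: measurable_funeM.
  - move=> t Dt; rewrite -!EFinM -!EFinD lee_fin.
    have h : (F t - G t) * u t <= (2 * e)^-1 * (F t - G t) ^+ 2 + e / 2 * u t ^+ 2.
      move: (F t - G t) (u t) => x y.
      have -> : (2 * e)^-1 * x ^+ 2 + e / 2 * y ^+ 2 = x * y + (2 * e)^-1 * (x - e * y) ^+ 2.
        by field; rewrite gt_eqF.
      by rewrite lerDl mulr_ge0 ?sqr_ge0.
    by lra.
rewrite ge0_integralD//=; last 3 first.
- by move=> t Dt; rewrite lee_fin mulr_ge0 ?G0 ?u0.
- by move=> t _; rewrite -!EFinM -EFinD lee_fin addr_ge0// mulr_ge0 ?sqr_ge0.
- by apply: emeasurable_funD; exact: measurable_funeM.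
rewrite leeD2l// ge0_integralD//=; last 4 first.
- by move=> t _; rewrite -EFinM lee_fin mulr_ge0 ?sqr_ge0.
- exact: measurable_funeM.
- by move=> t _; rewrite -EFinM lee_fin mulr_ge0 ?sqr_ge0.
- exact: measurable_funeM.
rewrite !ge0_integralZl//=; last 2 first.
- by move=> t _; rewrite lee_fin sqr_ge0.
- by move=> t _; rewrite lee_fin sqr_ge0.
have -> : e * (1 + K) / 2 = (2 * e)^-1 * e ^+ 2 + e / 2 * K by field; rewrite gt_eqF.
by rewrite EFinD !EFinM leeD// lee_wpmul2l// lee_fin.
Qed.

End square_norm.

Section enumerated_sums.
Context {R : realType} {d : nat}.
Local Notation V := 'rV[R[i]]_d.
Local Notation S := (@unit_sphere R d).
Local Notation ball := (@unit_ball R d).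
Local Notation Conf := (@Conf R d ball).
Local Notation P := (@poisson_szego R d).
Variable X : Conf.

Lemma enumerates_ball e n x : enumerates X e -> e n = Some x -> ball x.
Proof.
move=> Xe ex; apply: contrapT => /(@mult_out _ _ X) X0; have := Xe x.
rewrite X0 II0 card_eq0 => /eqP h.
by have : [set n | e n = Some x] n by []; rewrite h.
Qed.

Lemma conf_esum_series_ball e (g : V -> \bar R) : enumerates X e ->
  (forall x, ball x -> (0 <= g x)%E) ->
  conf_esum X g = (\sum_(0 <= n <oo) enum_term g e n)%E.
Proof.
move=> Xe g0; rewrite (@eq_conf_esum _ _ X _ (g \_ ball)); last first.
  by move=> x xB; rewrite patchE mem_set.
rewrite (conf_esum_series Xe); last first.
  by move=> x; rewrite patchE; case: ifP => // /set_mem; exact: g0.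
apply: eq_eseriesr => n _; rewrite /enum_term; case E : (e n) => [x|//] /=.
by rewrite patchE mem_set//; exact: enumerates_ball E.
Qed.

Lemma conf_esum_ball_ge0 (g : V -> \bar R) : (forall x, ball x -> (0 <= g x)%E) ->
  (0 <= conf_esum X g)%E.
Proof.
move=> g0; have [e Xe] := conf_enumeration X; rewrite (conf_esum_series_ball Xe g0).
apply: nneseries_ge0 => n _ _; rewrite /enum_term; case E : (e n) => [x|//] /=.
by apply: g0; exact: enumerates_ball E.
Qed.

Lemma conf_esumD_ball (g h : V -> \bar R) : (forall x, ball x -> (0 <= g x)%E) ->
  (forall x, ball x -> (0 <= h x)%E) ->
  (conf_esum X (fun x => g x + h x) = conf_esum X g + conf_esum X h)%E.
Proof.
move=> g0 h0; have [e Xe] := conf_enumeration X.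
have gh0 x : ball x -> (0 <= g x + h x)%E by move=> xB; rewrite adde_ge0 ?g0 ?h0.
rewrite !(conf_esum_series_ball Xe)// -nneseriesD; last 2 first.
- move=> n _ _; rewrite /enum_term; case E : (e n) => [x|//] /=.
  by apply: g0; exact: enumerates_ball E.
- move=> n _ _; rewrite /enum_term; case E : (e n) => [x|//] /=.
  by apply: h0; exact: enumerates_ball E.
by apply: eq_eseriesr => n _; rewrite /enum_term; case: (e n) => [x|]//=; rewrite adde0.
Qed.

Lemma conf_esumZ_ball (c : R) (g : V -> \bar R) : 0 <= c ->
  (forall x, ball x -> (0 <= g x)%E) ->
  (conf_esum X (fun x => c%:E * g x) = c%:E * conf_esum X g)%E.
Proof.
move=> c0 g0; have [e Xe] := conf_enumeration X.
have cg0 x : ball x -> (0 <= c%:E * g x)%E by move=> xB; rewrite mule_ge0 ?g0 ?lee_fin.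
rewrite !(conf_esum_series_ball Xe)// -nneseriesZl; last first.
  move=> n _; rewrite /enum_term; case E : (e n) => [x|//] /=.
  by apply: g0; exact: enumerates_ball E.
by apply: eq_eseriesr => n _; rewrite /enum_term; case: (e n) => [x|]//=; rewrite mule0.
Qed.

(** Along an enumeration the sum is a series of nonnegative functions. *)
Lemma poisson_sum_tonelli (m : {measure set V -> \bar R}) (u v : V -> R) :
  (forall x, ball x -> 0 <= u x) -> measurable_fun S v -> (forall zeta, S zeta -> 0 <= v zeta) ->
  (\int[m]_(zeta in S) (poisson_sum X u zeta * (v zeta)%:E) =
   conf_esum X (fun x => (u x)%:E * \int[m]_(zeta in S) (P x zeta * v zeta)%:E))%E.
Proof.
move=> u0 mv v0; have [e Xe] := conf_enumeration X.
have mS : measurable S := measurable_unit_sphere.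
have P0 x zeta : ball x -> 0 <= P x zeta by move=> xB; rewrite poisson_szego_ge0// ltW.
have mPv x : measurable_fun S (fun zeta => (P x zeta * v zeta)%:E).
  apply/measurable_EFinP; apply: measurable_funM => //; apply: measurable_funTS.
  exact: measurable_poisson_szego_r.
rewrite (conf_esum_series_ball Xe); last first.
  move=> x xB; rewrite mule_ge0// ?lee_fin ?u0//; apply: integral_ge0 => zeta zS.
  by rewrite lee_fin mulr_ge0 ?v0 ?P0.
pose T n zeta := (if e n is Some x then (u x)%:E * (P x zeta * v zeta)%:E else 0 : \bar R)%E.
have -> : (\int[m]_(zeta in S) (poisson_sum X u zeta * (v zeta)%:E) =
    \int[m]_(zeta in S) \sum_(0 <= n <oo) T n zeta)%E.
  apply: eq_integral => zeta /set_mem zS.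
  rewrite /poisson_sum (conf_esum_series_ball Xe); last first.
    by move=> x xB; rewrite lee_fin mulr_ge0 ?u0 ?P0.
  rewrite muleC -nneseriesZl; last first.
    move=> n _; rewrite /enum_term; case E : (e n) => [x|//] /=.
    by rewrite lee_fin mulr_ge0 ?u0 ?P0//; exact: enumerates_ball E.
  apply: eq_eseriesr => n _; rewrite /enum_term /T; case: (e n) => [x|]/=; last by rewrite mule0.
  by rewrite -EFinM -[RHS]EFinM; congr EFin; ring.
rewrite integral_nneseries//; last 2 first.
- by move=> n; rewrite /T; case: (e n) => [x|]//; exact: measurable_funeM.
- move=> n zeta zS; rewrite /T; case E : (e n) => [x|//].
  have xB := enumerates_ball Xe E.
  by rewrite -EFinM lee_fin mulr_ge0 ?u0// mulr_ge0 ?P0 ?v0.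
apply: eq_eseriesr => n _; rewrite /T /enum_term; case E : (e n) => [x|]/=; last first.
  by rewrite integral0.
have xB := enumerates_ball Xe E.
rewrite ge0_integralZl ?lee_fin ?u0//.
by move=> zeta zS; rewrite lee_fin mulr_ge0 ?P0 ?v0.
Qed.

Lemma poisson_sum_mass (d_gt0 : (0 < d)%N) (u : V -> R) : (forall x, ball x -> 0 <= u x) ->
  (\int[@surface_measure R d]_(zeta in S) poisson_sum X u zeta = conf_esum X (EFin \o u))%E.
Proof.
move=> u0; have := @poisson_sum_tonelli (@surface_measure R d) u (cst 1) u0.
move=> /(_ (measurable_cst _) (fun _ _ => ler01)) h.
rewrite (_ : (\int[_]_(zeta in S) poisson_sum X u zeta)%E =
    (\int[@surface_measure R d]_(zeta in S) (poisson_sum X u zeta * 1%:E))%E); last first.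
  by apply: eq_integral => zeta _; rewrite mule1.
rewrite h; apply: eq_conf_esum => x xB /=.
under eq_integral do rewrite mulr1.
by rewrite poisson_szego_mass// mule1.
Qed.

End enumerated_sums.

(** * Total mass and normalised sums *)

Lemma sqdistC {dT : measure_display} {T : measurableType dT} {R : realType}
    (m : {measure set T -> \bar R}) (D : set T) (F G : T -> R) :
  sqdist m D F G = sqdist m D G F.
Proof. by apply: eq_integral => t _; rewrite -sqrrN opprB. Qed.

Section mean_convergence.
Context {R : realType} {d : nat}.
Hypothesis d_gt0 : (0 < d)%N.
Local Notation V := 'rV[R[i]]_d.
Local Notation S := (@unit_sphere R d).
Local Notation ball := (@unit_ball R d).
Local Notation Conf := (@Conf R d ball).
Local Notation P := (@poisson_szego R d).
Variables (X : Conf) (mu : probability V R) (lambda : R).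
Hypothesis lambda_gt0 : 0 < lambda.
Hypothesis good : core_converges X mu lambda.
Variable N : set V.
Hypothesis mN : measurable N.
Hypothesis N0 : mu N = 0%E.
Hypothesis Nfin : forall zeta, S zeta -> ~ N zeta -> forall t n,
  enorm (@rational_point R d t) < 1 ->
  (poisson_sum X (fun x => radial_weight (sample n) x * P (rational_point t) x)%R zeta < +oo)%E.

Local Notation D := (S `\` N).
Local Notation W := (weighted_sum X).
Local Notation kl := (@limit_density R d * lambda).

Let mS : measurable S := measurable_unit_sphere.
Let mD : measurable D. Proof. exact: measurableD. Qed.
Let DS : D `<=` S. Proof. exact: subDsetl. Qed.
Let mD1 : (mu D <= 1)%E. Proof. exact: probability_le1. Qed.
Let kl0 : 0 < kl. Proof. by rewrite mulr_gt0 ?limit_density_gt0. Qed.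

Variable z : V.
Hypothesis z1 : enorm z < 1.

Let H := (1 - enorm z) ^- (2 * d).
Let H0 : 0 < H. Proof. by rewrite invr_gt0 exprn_gt0// subr_gt0. Qed.

Let P0 zeta : 0 <= P z zeta. Proof. by rewrite poisson_szego_ge0// ltW. Qed.
Let PH zeta : D zeta -> P z zeta <= H.
Proof. by move=> [zS _]; apply: poisson_szego_bound => //; rewrite zS. Qed.
Let mP : measurable_fun D (P z).
Proof. by apply: measurable_funTS; exact: measurable_poisson_szego_r. Qed.

Let mW a : measurable_fun D (fun zeta => fine (W a z zeta)).
Proof.
apply: measurable_funTS; apply: (measurableT_comp (fine_measurable measurableT)).
exact: measurable_weighted.
Qed.

Let W0 a zeta : 0 <= fine (W a z zeta).
Proof. by rewrite fine_ge0// weighted_sum_ge0. Qed.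

Let Wfin a zeta : 0 < a -> D zeta -> W a z zeta \is a fin_num.
Proof.
move=> a0 Dz; rewrite ge0_fin_numE ?weighted_sum_ge0//.
exact: (weighted_sum_finite d_gt0 Nfin).
Qed.

Lemma weighted_sum_antitone a b zeta : b <= a -> (W a z zeta <= W b z zeta)%E.
Proof.
move=> ba; apply: le_poisson_sum => x xB; rewrite /ps_weight ler_expR.
have : 0 <= bergman_dist x z.
  have := ps_weight_le1 ler01 z1 xB; rewrite /ps_weight -[leRHS]expR0 ler_expR.
  by rewrite mulN1r oppr_le0.
by move=> h; rewrite ler_wpM2r// lerN2 lerD2l.
Qed.

(** For some smaller exponent the sum is at finite distance from a bounded function, and
    the sums decrease with the exponent. *)
Lemma weighted_sum_square_integrable a : 0 < a ->
  exists2 C : R, 0 < C & (\int[mu]_(zeta in D) (fine (W a z zeta) ^+ 2)%:E <= (C ^+ 2)%:E)%E.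
Proof.
move=> a0; have v := weighted_sum_limit d_gt0 lambda_gt0 good mN N0 Nfin z1 ltr01.
have [b [b0 ba hb]] : exists b, [/\ 0 < b, b <= a &
    (sqdist mu D (fun zeta => (b * fine (W b z zeta))%R) (fun zeta => (kl * P z zeta)%R) <= 1%:E)%E].
  near (0 : R)^'+ => b; exists b; split.
  - by near: b; exact: nbhs_right_gt.
  - by near: b; exact: nbhs_right_le.
  - by near: b; exact: v.
have mbW : measurable_fun D (fun zeta => b * fine (W b z zeta)) by exact: measurable_funM.
have mkP : measurable_fun D (fun zeta => kl * P z zeta) by exact: measurable_funM.
have m0 : measurable_fun D (cst 0 : V -> R) by exact: measurable_cst.
have tr := sqdist_triangle mu mD mbW mkP m0.
have kP0 : (sqdist mu D (fun zeta => (kl * P z zeta)%R) (cst 0%R) <= ((kl * H) ^+ 2)%:E)%E.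
  apply: sqdist_bound => // zeta Dz.
  by rewrite subr0 (ger0_norm (mulr_ge0 (ltW kl0) (P0 zeta))) ler_pM2l// PH.
pose K := 2 * 1 + 2 * (kl * H) ^+ 2.
have K0 : 0 < K by rewrite ltr_pwDl// mulr_ge0 ?sqr_ge0.
have hK : (sqdist mu D (fun zeta => (b * fine (W b z zeta))%R) (cst 0%R) <= K%:E)%E.
  apply: (le_trans tr).
  have -> : (K%:E = 2%:E * 1%:E + 2%:E * ((kl * H) ^+ 2)%R%:E)%E by rewrite /K EFinD EFinM.
  by apply: leeD; apply: lee_wpmul2l.
exists (Num.sqrt (b ^- 2 * K)); first by rewrite sqrtr_gt0 mulr_gt0// invr_gt0 exprn_gt0.
rewrite sqr_sqrtr; last by rewrite mulr_ge0 ?(ltW K0)// invr_ge0 exprn_ge0// ltW.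
have b2 : 0 <= b ^- 2 by rewrite invr_ge0 exprn_ge0// ltW.
rewrite EFinM (le_trans _ (lee_wpmul2l _ hK)) ?lee_fin//.
have mb := measurable_sqdist mbW m0.
rewrite /sqdist -ge0_integralZl//=; last by move=> t _; rewrite lee_fin sqr_ge0.
apply: ge0_le_integral => //=.
- by move=> t _; rewrite lee_fin sqr_ge0.
- by apply/measurable_EFinP; exact: measurable_funX.
- exact: measurable_funeM.
- move=> zeta Dz; rewrite -EFinM lee_fin subr0 exprMn mulKf ?expf_eq0 ?gt_eqF//.
  rewrite lerXn2r ?nnegrE ?W0//; apply: fine_le; rewrite ?Wfin//.
  exact: weighted_sum_antitone.
Unshelve. all: end_near. Qed.

Variable u : V -> R.
Hypothesis mu_u : measurable_fun S u.
Hypothesis u0 : forall zeta, S zeta -> 0 <= u zeta.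
Variable K : R.
Hypothesis uK : (\int[mu]_(zeta in S) (u zeta ^+ 2)%:E <= K%:E)%E.

Let mu_uD : measurable_fun D u. Proof. exact: measurable_funS mu_u. Qed.
Let u0D zeta : D zeta -> 0 <= u zeta. Proof. by move=> [/u0]. Qed.
Let uKD : (\int[mu]_(zeta in D) (u zeta ^+ 2)%:E <= K%:E)%E.
Proof.
apply: le_trans uK; apply: ge0_subset_integral => //.
by apply/measurable_EFinP; exact: measurable_funX.
by move=> zeta _; rewrite lee_fin sqr_ge0.
Qed.
Let K0 : 0 <= K.
Proof.
by rewrite -lee_fin (le_trans _ uKD)//; apply: integral_ge0 => zeta _; rewrite lee_fin sqr_ge0.
Qed.

Lemma weighted_integral_finite a : 0 < a ->
  (\int[mu]_(zeta in D) (fine (W a z zeta) * u zeta)%:E < +oo)%E.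
Proof.
move=> a0; have [C C0 hC] := weighted_sum_square_integrable a0.
have hC' : (sqdist mu D (fun zeta => fine (W a z zeta)) (cst 0%R) <= (C ^+ 2)%:E)%E.
  by rewrite /sqdist; under eq_integral do rewrite subr0.
have := @integral_le_sqdist _ _ _ mu D mD (fun zeta => fine (W a z zeta)) (cst 0) u C K
  (mW a) (measurable_cst _) mu_uD (fun t _ => W0 a t) (fun t _ => lexx 0) u0D C0 uKD hC'.
move/le_lt_trans; apply.
under eq_integral do rewrite mul0r.
by rewrite integral0 add0e ltry.
Qed.

Lemma weighted_integral_sphere a : 0 < a ->
  (\int[mu]_(zeta in D) (fine (W a z zeta) * u zeta)%:E =
   \int[mu]_(zeta in S) (W a z zeta * (u zeta)%:E))%E.
Proof.
move=> a0; rewrite [RHS](_ : _ = \int[mu]_(zeta in D) (W a z zeta * (u zeta)%:E))%E.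
  by apply: eq_integral => zeta /set_mem Dz; rewrite EFinM fineK ?Wfin.
apply: ge0_negligible_integral => //.
- apply: emeasurable_funM; last exact/measurable_EFinP.
  by apply: measurable_funTS; exact: measurable_weighted.
- by move=> zeta zS; rewrite mule_ge0 ?weighted_sum_ge0// lee_fin u0.
Qed.

Variable M : R -> R.
Hypothesis M0 : forall a, 0 < a -> 0 < M a.
Hypothesis M_limit : a * M a @[a --> (0 : R)^'+] --> kl.

(** The factor a M a that relates the two normalisations tends to a nonzero limit. *)
Lemma normalized_sum_limit : vanishes (0^'+) (fun a => sqdist mu D
  (fun zeta => fine (W a z zeta) / M a) (P z)).
Proof.
have v := weighted_sum_limit d_gt0 lambda_gt0 good mN N0 Nfin z1.
have c1 : (a * M a)^-1 @[a --> (0 : R)^'+] --> kl^-1 by apply: cvgV => //; rewrite gt_eqF.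
have mA a : measurable_fun D (fun zeta => a * fine (W a z zeta)) by exact: measurable_funM.
have mkP : measurable_fun D (fun zeta => kl * P z zeta) by exact: measurable_funM.
have BH zeta : D zeta -> `|kl * P z zeta| <= kl * H.
  by move=> Dz; rewrite (ger0_norm (mulr_ge0 (ltW kl0) (P0 zeta))) ler_pM2l// PH.
have klH : 0 < kl * H by rewrite mulr_gt0.
have w := sqdist_scaled_vanishes mD mD1 c1 mA mkP BH klH v.
have FF : Filter (0 : R)^'+ by typeclasses eauto.
apply: (vanishes_le _ (w FF)); near=> a.
have a0 : 0 < a by near: a; exact: nbhs_right_gt.
rewrite le_eqVlt; apply/orP; left; apply/eqP; apply: eq_integral => zeta _.
congr (((_ - _) ^+ 2)%:E); last by rewrite mulKf// gt_eqF.
by rewrite invfM mulrACA mulVf ?gt_eqF// mul1r mulrC.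
Unshelve. all: end_near. Qed.

Lemma weighted_mean_limit :
  fine (\int[mu]_(zeta in D) (fine (W a z zeta) * u zeta)%:E)%E / M a @[a --> (0 : R)^'+] -->
  fine (\int[mu]_(zeta in D) (P z zeta * u zeta)%:E)%E.
Proof.
apply/cvgrPdist_le => e e0; have K1 : 0 < 1 + K by rewrite ltr_pwDl.
pose e' := e / (1 + K); have e'0 : 0 < e' by rewrite divr_gt0.
have e2 : 0 < e' ^+ 2 by rewrite exprn_gt0.
have v := normalized_sum_limit e2.
near=> a.
have a0 : 0 < a by near: a; exact: nbhs_right_gt.
have ha : (sqdist mu D (fun zeta => (fine (W a z zeta) / M a)%R) (P z) <= (e' ^+ 2)%:E)%E.
  by near: a.
have Ma := M0 a0.
have mF : measurable_fun D (fun zeta => fine (W a z zeta) / M a) by exact: measurable_funM.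
have F0 zeta : D zeta -> 0 <= fine (W a z zeta) / M a by rewrite divr_ge0 ?W0// ltW.
have h1 := integral_le_sqdist mD mF mP mu_uD F0 (fun t _ => P0 t) u0D e'0 uKD ha.
have h2 : (sqdist mu D (P z) (fun zeta => (fine (W a z zeta) / M a)%R) <= (e' ^+ 2)%:E)%E.
  by rewrite sqdistC.
have {}h2 := integral_le_sqdist mD mP mF mu_uD (fun t _ => P0 t) F0 u0D e'0 uKD h2.
have ee : e' * (1 + K) / 2 <= e by rewrite /e' divfK ?gt_eqF//; lra.
have I0 : (0 <= \int[mu]_(zeta in D) (fine (W a z zeta) * u zeta)%:E)%E.
  by apply: integral_ge0 => zeta Dz; rewrite lee_fin mulr_ge0 ?W0 ?u0D.
have If : (\int[mu]_(zeta in D) (fine (W a z zeta) * u zeta)%:E)%E \is a fin_num.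
  by rewrite ge0_fin_numE// weighted_integral_finite.
have E : (\int[mu]_(zeta in D) (fine (W a z zeta) / M a * u zeta)%:E)%E =
    (fine (\int[mu]_(zeta in D) (fine (W a z zeta) * u zeta)%:E)%E / M a)%:E.
  rewrite mulrC EFinM fineK// -ge0_integralZl//=.
  - by apply: eq_integral => zeta _; rewrite -EFinM mulrA (mulrC (M a)^-1).
  - by apply/measurable_EFinP; exact: measurable_funM.
  - by move=> zeta Dz; rewrite lee_fin mulr_ge0 ?W0 ?u0D.
  - by rewrite lee_fin invr_ge0 ltW.
rewrite E in h1 h2.
have J0 : (0 <= \int[mu]_(zeta in D) (P z zeta * u zeta)%:E)%E.
  by apply: integral_ge0 => zeta Dz; rewrite lee_fin mulr_ge0 ?P0 ?u0D.
have Jf : (\int[mu]_(zeta in D) (P z zeta * u zeta)%:E)%E \is a fin_num.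
  by rewrite ge0_fin_numE// (le_lt_trans h2)// -EFinD ltry.
move: h1 h2; rewrite -(fineK Jf) -!EFinD !lee_fin fineK// => h1 h2.
by rewrite ler_distl; apply/andP; split; lra.
Unshelve. all: end_near. Qed.

End mean_convergence.

Section mass_limit.
Context {R : realType} {d : nat}.
Hypothesis d_gt0 : (0 < d)%N.
Local Notation V := 'rV[R[i]]_d.
Local Notation S := (@unit_sphere R d).
Local Notation ball := (@unit_ball R d).
Local Notation Conf := (@Conf R d ball).
Local Notation P := (@poisson_szego R d).
Local Notation sigma := (@surface_measure R d).
Variables (X : Conf) (lambda : R).
Hypothesis lambda_gt0 : 0 < lambda.
Hypothesis good : core_converges X sigma lambda.
Variable z : V.
Hypothesis z1 : enorm z < 1.
Local Notation kl := (@limit_density R d * lambda).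
Local Notation W := (weighted_sum X).

Let mS : measurable S := measurable_unit_sphere.

Let one_square : (\int[sigma]_(zeta in S) ((cst 1 zeta : R) ^+ 2)%:E <= 1%:E)%E.
Proof.
under eq_integral do rewrite /= expr1n.
by rewrite integral_cst// mul1e; exact: probability_le1.
Qed.

Let mass_integral a : (\int[sigma]_(zeta in S) W a z zeta = ps_mass X (d%:R + a) z)%E.
Proof. by apply: poisson_sum_mass => // x _; exact: ps_weight_ge0. Qed.

Let mass_core N a : measurable N -> sigma N = 0%E -> (forall zeta, S zeta -> ~ N zeta -> forall t n,
  enorm (@rational_point R d t) < 1 ->
  (poisson_sum X (fun x => radial_weight (sample n) x * P (rational_point t) x)%R zeta < +oo)%E) ->
  0 < a -> (\int[sigma]_(zeta in S `\` N) (fine (W a z zeta) * cst 1 zeta)%:E = ps_mass X (d%:R + a) z)%E.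
Proof.
move=> mN N0 Nf a0; rewrite (@weighted_integral_sphere _ _ d_gt0 X sigma N mN N0 Nf z z1 (cst 1))//.
by rewrite -mass_integral; apply: eq_integral => zeta _; rewrite mule1.
Qed.

Lemma ps_mass_finite a : 0 < a -> (ps_mass X (d%:R + a) z < +oo)%E.
Proof.
move=> a0; have [N [mN N0 Nf]] := exceptional_set good.
rewrite -(mass_core mN N0 Nf a0).
exact: (weighted_integral_finite d_gt0 lambda_gt0 good mN N0 Nf z1 _ _ one_square).
Qed.

Lemma ps_mass_ge0 s : (0 <= ps_mass X s z)%E.
Proof. by apply: conf_esum_ball_ge0 => x _; rewrite lee_fin ps_weight_ge0. Qed.

Lemma ps_mass_fin_num a : 0 < a -> ps_mass X (d%:R + a) z \is a fin_num.
Proof. by move=> a0; rewrite ge0_fin_numE ?ps_mass_ge0 ?ps_mass_finite. Qed.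

(** The kernel has mass one, so the total mass is the integral of the weighted sum against
    the surface measure, and convergence in L2 implies convergence of integrals. *)
Lemma mass_limit : a * fine (ps_mass X (d%:R + a) z) @[a --> (0 : R)^'+] --> kl.
Proof.
have [N [mN N0 Nf]] := exceptional_set good.
have mD : measurable (S `\` N) by exact: measurableD.
have kl0 : 0 < kl by rewrite mulr_gt0 ?limit_density_gt0.
have v := weighted_sum_limit d_gt0 lambda_gt0 good mN N0 Nf z1.
have mP : measurable_fun (S `\` N) (fun zeta => kl * P z zeta).
  by apply: measurable_funM => //; apply: measurable_funTS; exact: measurable_poisson_szego_r.
have P0 zeta : 0 <= P z zeta by rewrite poisson_szego_ge0// ltW.
have kP0 zeta : (S `\` N) zeta -> 0 <= kl * P z zeta by rewrite mulr_ge0// ltW.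
have oneD : (\int[sigma]_(zeta in S `\` N) ((cst 1 zeta : R) ^+ 2)%:E <= 1%:E)%E.
  under eq_integral do rewrite /= expr1n.
  by rewrite integral_cst// mul1e; exact: probability_le1.
have kPE : (\int[sigma]_(zeta in S `\` N) (kl * P z zeta * cst 1 zeta)%:E = kl%:E)%E.
  rewrite -[RHS]mule1 -(poisson_szego_mass d_gt0 z1) -ge0_integralZl//=; last 3 first.
  - by apply/measurable_EFinP; apply: measurable_funTS; exact: measurable_poisson_szego_r.
  - by move=> zeta _; rewrite lee_fin.
  - by rewrite lee_fin ltW.
  rewrite [RHS](@ge0_negligible_integral _ _ _ sigma S N)//.
  - by apply: eq_integral => zeta _; rewrite mulr1 EFinM.
  - by apply: measurable_funeM; apply/measurable_EFinP; apply: measurable_funTS; exact: measurable_poisson_szego_r.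
  - by move=> zeta _; rewrite -EFinM lee_fin mulr_ge0// ltW.
apply/cvgrPdist_le => e e0; have e2 : 0 < e ^+ 2 by rewrite exprn_gt0.
near=> a.
have a0 : 0 < a by near: a; exact: nbhs_right_gt.
have ha : (sqdist sigma (S `\` N) (fun zeta => (a * fine (W a z zeta))%R)
    (fun zeta => (kl * P z zeta)%R) <= (e ^+ 2)%:E)%E by near: a; exact: v.
have mF : measurable_fun (S `\` N) (fun zeta => a * fine (W a z zeta)).
  apply: measurable_funM => //; apply: measurable_funTS.
  by apply: (measurableT_comp (fine_measurable measurableT)); exact: measurable_weighted.
have W0 zeta : 0 <= fine (W a z zeta) by rewrite fine_ge0// weighted_sum_ge0.
have F0 zeta : (S `\` N) zeta -> 0 <= a * fine (W a z zeta) by rewrite mulr_ge0// ltW.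
have FE : (\int[sigma]_(zeta in S `\` N) (a * fine (W a z zeta) * cst 1 zeta)%:E =
    (a * fine (ps_mass X (d%:R + a) z))%:E)%E.
  rewrite EFinM fineK ?ps_mass_fin_num// -(mass_core mN N0 Nf a0) -ge0_integralZl//=.
  - by apply: eq_integral => zeta _; rewrite -EFinM mulrA.
  - apply/measurable_EFinP; apply: measurable_funM => //; apply: measurable_funTS.
    by apply: (measurableT_comp (fine_measurable measurableT)); exact: measurable_weighted.
  - by move=> zeta _; rewrite lee_fin mulr1.
  - by rewrite lee_fin ltW.
have m1 : measurable_fun (S `\` N) (cst 1 : V -> R) by exact: measurable_cst.
have h1 := integral_le_sqdist mD mF mP m1 F0 kP0 (fun _ _ => ler01) e0 oneD ha.
have h2 : (sqdist sigma (S `\` N) (fun zeta => (kl * P z zeta)%R)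
    (fun zeta => (a * fine (W a z zeta))%R) <= (e ^+ 2)%:E)%E by rewrite sqdistC.
have {}h2 := integral_le_sqdist mD mP mF m1 kP0 F0 (fun _ _ => ler01) e0 oneD h2.
move: h1 h2; rewrite FE kPE -!EFinD !lee_fin => h1 h2.
by rewrite ler_distl; apply/andP; split; lra.
Unshelve. all: end_near. Qed.

(** For an empty configuration the mass would vanish for all exponents, against its
    asymptotics. *)
Lemma ps_mass_gt0 a : 0 < a -> 0 < fine (ps_mass X (d%:R + a) z).
Proof.
move=> a0; have kl0 : 0 < kl by rewrite mulr_gt0 ?limit_density_gt0.
have [x Xx] : exists x, X x != 0%N.
  apply: contrapT => noX.
  have X0 x : X x = 0%N by apply/eqP/negPn/negP => h; apply: noX; exists x.
  have E b : ps_mass X (d%:R + b) z = 0%E.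
    by rewrite /ps_mass /conf_esum esum1// => x _; rewrite X0 mul0e.
  have := mass_limit; under eq_fun do rewrite E /= mulr0.
  move/cvgrPdist_lt/(_ _ kl0); rewrite subr0 gtr0_norm// => h.
  by have [b] := filter_ex h; rewrite ltxx.
have xB : ball x by apply: contrapT => /(@mult_out _ _ X) h; rewrite h in Xx.
rewrite -lte_fin fineK ?ps_mass_fin_num// (@lt_le_trans _ _ (ps_weight (d%:R + a) z x)%:E)//.
  by rewrite lte_fin expR_gt0.
have [e Xe] := conf_enumeration X.
have [n en] : exists n, e n = Some x.
  apply: contrapT => noe; have := Xe x.
  rewrite (_ : [set n | _] = set0); last by apply/seteqP; split=> // n en; apply: noe; exists n.
  rewrite card_eq_sym card_eq0 => /eqP h.
  by have : `I_(X x) 0%N; [rewrite /= lt0n|rewrite h].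
rewrite /ps_mass (conf_esum_series_ball Xe); last by move=> y _; rewrite lee_fin ps_weight_ge0.
have T0 k : (0 <= enum_term (fun x => (ps_weight (d%:R + a) z x)%:E) e k)%E.
  by rewrite /enum_term; case: (e k) => [y|]//=; rewrite lee_fin ps_weight_ge0.
apply: (@le_trans _ _ (\sum_(0 <= k < n.+1) enum_term (fun x => (ps_weight (d%:R + a) z x)%:E) e k)%E).
  by rewrite big_nat_recr//= {2}/enum_term en /= leeDr// sume_ge0.
by apply: nneseries_lim_ge.
Qed.

End mass_limit.

(** * Unconditional convergence and the Hardy space *)

Section unconditional_sums.
Context {R : realType} {d : nat}.
Local Notation V := 'rV[R[i]]_d.
Local Notation S := (@unit_sphere R d).
Local Notation ball := (@unit_ball R d).
Local Notation Conf := (@Conf R d ball).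
Local Notation P := (@poisson_szego R d).

Lemma cmeasurable_partial_sum {dT} {T : measurableType dT} (D : set T) (F : V -> T -> R[i]) e n :
  (forall x, cmeasurable_fun D (F x)) -> cmeasurable_fun D (partial_sum F e n).
Proof.
move=> mF; split; rewrite /partial_sum.
  under eq_fun do rewrite raddf_sum.
  apply: measurable_sum => k; case: (e k) => [x|]; [exact: (mF x).1|exact: measurable_cst].
under eq_fun do rewrite raddf_sum.
apply: measurable_sum => k; case: (e k) => [x|]; [exact: (mF x).2|exact: measurable_cst].
Qed.

(** Both functions are L2 limits of the partial sums along one enumeration. *)
Lemma L2_unconditional_sum_unique {dT} {T : measurableType dT} (X : Conf)
    (m : {measure set T -> \bar R}) (D : set T) (F : V -> T -> R[i]) (S1 S2 : T -> R[i]) :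
  measurable D -> (forall x, cmeasurable_fun D (F x)) ->
  L2_unconditional_sum X m D F S1 -> L2_unconditional_sum X m D F S2 ->
  sqnorm m D (fun t => S1 t - S2 t) = 0%E.
Proof.
move=> mD mF [[m1 _] [e Xe] h1] [[m2 _] _ h2].
have /L2norm_cvg0 v1 := h1 e Xe; have /L2norm_cvg0 v2 := h2 e Xe.
apply/eqP; rewrite eq_le sqnorm_ge0 andbT; apply/lee_addgt0Pr => r r0; rewrite add0e.
have r4 : 0 < r / 4 by rewrite divr_gt0.
have [n [n1 n2]] := filter_ex (filterI (v1 _ r4) (v2 _ r4)).
have mp := @cmeasurable_partial_sum _ _ D F e n mF.
apply: (le_trans (sqnorm_triangle m mD m1 mp m2)).
have -> : sqnorm m D (fun t => S1 t - partial_sum F e n t) =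
    sqnorm m D (fun t => partial_sum F e n t - S1 t).
  by apply: eq_integral => t _; rewrite -cabsN opprB.
rewrite (le_trans (leeD (lee_wpmul2l _ n1) (lee_wpmul2l _ n2)))// -!EFinM -EFinD lee_fin.
by lra.
Qed.

End unconditional_sums.

Section poisson_series.
Context {R : realType} {d : nat}.
Hypothesis d_gt0 : (0 < d)%N.
Local Notation V := 'rV[R[i]]_d.
Local Notation S := (@unit_sphere R d).
Local Notation ball := (@unit_ball R d).
Local Notation Conf := (@Conf R d ball).
Local Notation P := (@poisson_szego R d).
Local Notation sigma := (@surface_measure R d).
Variables (X : Conf) (mu : probability V R) (lambda : R).
Hypothesis lambda_gt0 : 0 < lambda.
Hypothesis good : core_converges X mu lambda.
Hypothesis good_sigma : core_converges X sigma lambda.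
Variable z : V.
Hypothesis z1 : enorm z < 1.
Local Notation kl := (@limit_density R d * lambda).
Local Notation W := (weighted_sum X).
Local Notation M a := (fine (ps_mass X (d%:R + a) z)).

Let mS : measurable S := measurable_unit_sphere.

Let W0 a zeta : 0 <= fine (W a z zeta).
Proof. by rewrite fine_ge0// weighted_sum_ge0. Qed.

Let mW a : measurable_fun [set: V] (fun zeta => fine (W a z zeta)).
Proof.
by apply: (measurableT_comp (fine_measurable measurableT)); exact: measurable_weighted.
Qed.

Let mP x : measurable_fun [set: V] (P x). Proof. exact: measurable_poisson_szego_r. Qed.

Let M0 a : 0 < a -> 0 < M a.
Proof. exact: (ps_mass_gt0 d_gt0 lambda_gt0 good_sigma z1). Qed.

Let Mlim := mass_limit d_gt0 lambda_gt0 good_sigma z1.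

Let term a (x zeta : V) : R[i] := (ps_weight (d%:R + a) z x * P x zeta)%:C.

Let cmeasurable_real (D : set V) (g : V -> R) : measurable_fun D g ->
  cmeasurable_fun D (fun zeta => (g zeta)%:C).
Proof. by move=> mg; split => //=; exact: measurable_cst. Qed.

Let cmeasurable_term a x : cmeasurable_fun S (term a x).
Proof. by apply: cmeasurable_real; apply: measurable_funM => //; exact: measurable_funTS. Qed.

(** The partial sums increase to W pointwise and W is square integrable. *)
Lemma partial_sums_converge N a e : measurable N -> mu N = 0%E ->
  (forall zeta, S zeta -> ~ N zeta -> forall t n, enorm (@rational_point R d t) < 1 ->
  (poisson_sum X (fun x => radial_weight (sample n) x * P (rational_point t) x)%R zeta < +oo)%E) ->
  0 < a -> enumerates X e ->
  vanishes \oo (fun n => sqdist mu (S `\` N) (fun zeta => \sum_(k < n) oapp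
    (fun x => ps_weight (d%:R + a) z x * P x zeta) 0 (e k)) (fun zeta => fine (W a z zeta))).
Proof.
move=> mN N0 Nf a0 Xe; set D := S `\` N; have mD : measurable D by exact: measurableD.
pose t zeta k : R := oapp (fun x => ps_weight (d%:R + a) z x * P x zeta) 0 (e k).
have t0 zeta k : 0 <= t zeta k.
  rewrite /t; case E : (e k) => [x|//] /=; have xB := enumerates_ball Xe E.
  by rewrite mulr_ge0 ?ps_weight_ge0// poisson_szego_ge0// ltW.
have WE zeta : W a z zeta = (\sum_(0 <= k <oo) (t zeta k)%:E)%E.
  rewrite /weighted_sum /poisson_sum (conf_esum_series_ball Xe); last first.
    by move=> x xB; rewrite lee_fin mulr_ge0 ?ps_weight_ge0// poisson_szego_ge0// ltW.
  by apply: eq_eseriesr => k _; rewrite /enum_term /t; case: (e k).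
have Wf zeta : D zeta -> W a z zeta \is a fin_num.
  by move=> Dz; rewrite ge0_fin_numE ?weighted_sum_ge0//; exact: (weighted_sum_finite d_gt0 Nf).
have pE zeta n : ((\sum_(k < n) t zeta k)%:E = \sum_(0 <= k < n) (t zeta k)%:E)%E.
  by rewrite big_mkord sumEFin.
have plim zeta : D zeta -> \sum_(k < n) t zeta k @[n --> \oo] --> fine (W a z zeta).
  move=> Dz; have h : (\sum_(0 <= k < n) (t zeta k)%:E)%E @[n --> \oo] --> (fine (W a z zeta))%:E.
    by rewrite fineK ?Wf// WE; apply: is_cvg_nneseries => n _ _; rewrite lee_fin.
  have -> : (fun n => \sum_(k < n) t zeta k) = fine \o (fun n => \sum_(0 <= k < n) (t zeta k)%:E)%E.
    by apply/funext => n /=; rewrite -pE.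
  exact: fine_cvg h.
have ple zeta n : D zeta -> \sum_(k < n) t zeta k <= fine (W a z zeta).
  move=> Dz; rewrite -lee_fin fineK ?Wf// WE pE; apply: nneseries_lim_ge => k _.
  by rewrite lee_fin.
have [C C0 hC] := weighted_sum_square_integrable d_gt0 lambda_gt0 good mN N0 Nf z1 a0.
have mp n : measurable_fun D (fun zeta => \sum_(k < n) t zeta k).
  apply: measurable_sum => k; rewrite /t; case: (e k) => [x|] /=; last exact: measurable_cst.
  by apply: measurable_funM => //; exact: measurable_funTS.
have mWD : measurable_fun D (fun zeta => fine (W a z zeta)) by exact: measurable_funTS.
have mW2 : measurable_fun D (fun zeta => (fine (W a z zeta) ^+ 2)%:E).
  by apply/measurable_EFinP; exact: measurable_funX.
have [] := @dominated_convergence _ _ _ mu D mD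
  (fun n zeta => ((\sum_(k < n) t zeta k - fine (W a z zeta)) ^+ 2)%:E) (cst 0%E)
  (fun zeta => (fine (W a z zeta) ^+ 2)%:E).
- by move=> n; exact: measurable_sqdist.
- exact: measurable_cst.
- apply: aeW => zeta Dz; apply: cvg_EFin; first exact: nearW.
  have h : \sum_(k < n) t zeta k - fine (W a z zeta) @[n --> \oo] -->
      fine (W a z zeta) - fine (W a z zeta).
    by apply: cvgB; [exact: plim|exact: cvg_cst].
  rewrite subrr in h; have h2 : (\sum_(k < n) t zeta k - fine (W a z zeta)) *
      (\sum_(k < n) t zeta k - fine (W a z zeta)) @[n --> \oo] --> (0 * 0 : R) by exact: cvgM.
  rewrite mul0r in h2; apply: cvg_trans h2; apply: near_eq_cvg; apply: nearW => n /=.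
  by rewrite expr2.
- apply/integrableP; split => //; apply: le_lt_trans (ltry (C ^+ 2)).
  apply: le_trans hC; rewrite le_eqVlt; apply/orP; left; apply/eqP.
  by apply: eq_integral => zeta _; rewrite gee0_abs// lee_fin sqr_ge0.
- apply: aeW => zeta n Dz; rewrite gee0_abs ?lee_fin ?sqr_ge0//.
  rewrite -sqrrN opprB lerXn2r ?nnegrE ?W0 ?subr_ge0 ?ple// gerBl.
  by apply: sumr_ge0 => k _; exact: t0.
move=> _ _; rewrite integral_cst// mul0e => h r r0.
have [fin c] := (fine_cvgP _ _).1 h.
move/cvgrPdist_le : c => /(_ _ r0); apply: filterS2 fin => n fi /=.
rewrite sub0r normrN ger0_norm ?fine_ge0//; last first.
  by apply: integral_ge0 => zeta _; rewrite lee_fin sqr_ge0.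
by rewrite -lee_fin fineK.
Qed.

Lemma poisson_series_unconditional a : 0 < a ->
  L2_unconditional_sum X mu S (term a) (fun zeta => (fine (W a z zeta))%:C).
Proof.
move=> a0; have [N [mN N0 Nf]] := exceptional_set good.
have mWS : measurable_fun S (fun zeta => fine (W a z zeta)) by exact: measurable_funTS.
split.
- split; first exact: cmeasurable_real.
  rewrite L2norm_lty//; have [C C0 hC] := weighted_sum_square_integrable d_gt0 lambda_gt0 good mN N0 Nf z1 a0.
  have -> : sqnorm mu S (fun zeta => (fine (W a z zeta))%:C) =
      sqdist mu S (fun zeta => fine (W a z zeta)) (cst 0).
    by apply: eq_integral => zeta _; rewrite cabsR subr0 real_normK ?num_real.
  rewrite (sqdist_exceptional mN N0)//.
  apply: le_lt_trans (ltry (C ^+ 2)); apply: le_trans hC.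
  by rewrite /sqdist; under eq_integral do rewrite subr0.
- exact: conf_enumeration.
move=> e Xe; apply/L2norm_cvg0.
have v := partial_sums_converge mN N0 Nf a0 Xe.
have E n : sqnorm mu S (fun zeta => partial_sum (term a) e n zeta - (fine (W a z zeta))%:C) =
    sqdist mu (S `\` N) (fun zeta => \sum_(k < n) oapp
    (fun x => ps_weight (d%:R + a) z x * P x zeta) 0 (e k)) (fun zeta => fine (W a z zeta)).
  rewrite -(sqdist_exceptional mN N0)//; last first.
    apply: measurable_sum => k; case: (e k) => [x|] /=; last exact: measurable_cst.
    by apply: measurable_funM => //; exact: measurable_funTS.
  rewrite -sqnorm_real; apply: eq_integral => zeta _; congr ((cabs (_ - _) ^+ 2)%:E).
  rewrite /partial_sum rmorph_sum; apply: eq_bigr => k _.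
  by case: (e k).
by move=> r r0; have := v r r0; apply: filterS => n; rewrite E.
Qed.

(** Any sum of the series agrees almost everywhere with the pointwise one. *)
Lemma normalized_poisson_series (Sa : R -> V -> R[i]) :
  (forall a, 0 < a -> L2_unconditional_sum X mu S (term a) (Sa a)) ->
  vanishes (0^'+) (fun a => sqnorm mu S
    (fun zeta => Sa a zeta / (M a)%:C - (P z zeta)%:C)).
Proof.
move=> hS; have [N [mN N0 Nf]] := exceptional_set good.
have v := normalized_sum_limit d_gt0 lambda_gt0 good mN N0 Nf z1 Mlim.
have two : (0 : R) <= 2 by [].
apply: (vanishes_le _ (vanishesZ two v)); near=> a.
have a0 : 0 < a by near: a; exact: nbhs_right_gt.
have mWa : measurable_fun S (fun zeta => fine (W a z zeta) / M a).
  by apply: measurable_funM => //; exact: measurable_funTS.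
have mPS : measurable_fun S (P z) by exact: measurable_funTS.
have [[mSa _] _ _] := hS a a0; have [mr mi] := mSa.
have mc : cmeasurable_fun S (fun zeta => Sa a zeta / (M a)%:C).
  split.
    rewrite (_ : (fun _ => _) = fun zeta => complex.Re (Sa a zeta) * (M a)^-1).
      exact: measurable_funM.
    by apply/funext => zeta; rewrite -fmorphV cReM/= mulr0 subr0.
  rewrite (_ : (fun _ => _) = fun zeta => complex.Im (Sa a zeta) * (M a)^-1).
    exact: measurable_funM.
  by apply/funext => zeta; rewrite -fmorphV cImM/= mulr0 add0r.
have tr := sqnorm_triangle mu mS mc (cmeasurable_real mWa) (cmeasurable_real mPS).
apply: (le_trans tr).
have -> : sqnorm mu S (fun zeta => Sa a zeta / (M a)%:C - (fine (W a z zeta) / M a)%:C) = 0%E.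
  have u := L2_unconditional_sum_unique mS (cmeasurable_term a) (hS a a0)
    (poisson_series_unconditional a0).
  rewrite (_ : sqnorm _ _ _ = ((M a ^- 2)%:E * sqnorm mu S (fun zeta => Sa a zeta - (fine (W a z zeta))%:C)%R)%E).
    by rewrite u mule0.
  rewrite /sqnorm -ge0_integralZl//=.
  - apply: eq_integral => zeta _; rewrite -EFinM; congr EFin.
    rewrite rmorphM/= fmorphV -mulrBl cabsM cabsV cabsR exprMn mulrC; congr (_ * _).
    by rewrite exprVn real_normK ?num_real.
  - exact: measurable_cabs_sqr (cmeasurableB mSa (cmeasurable_real (measurable_funTS (mW a)))).
  - by move=> zeta _; rewrite lee_fin sqr_ge0.
  - by rewrite lee_fin invr_ge0 exprn_ge0// ltW// M0.
rewrite mule0 add0e sqnorm_real (sqdist_exceptional mN N0)//.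
Unshelve. all: end_near. Qed.

End poisson_series.

Section hardy_functions.
Context {R : realType} {d : nat}.
Hypothesis d_gt0 : (0 < d)%N.
Local Notation V := 'rV[R[i]]_d.
Local Notation S := (@unit_sphere R d).
Local Notation ball := (@unit_ball R d).
Local Notation Conf := (@Conf R d ball).
Local Notation P := (@poisson_szego R d).
Local Notation sigma := (@surface_measure R d).
Variables (X : Conf) (lambda : R).
Hypothesis lambda_gt0 : 0 < lambda.
Hypothesis good_sigma : core_converges X sigma lambda.

Let mS : measurable S := measurable_unit_sphere.

Lemma eq_conf_rsum (u v : V -> R) : (forall x, ball x -> u x = v x) -> conf_rsum X u = conf_rsum X v.
Proof.
move=> uv; rewrite /conf_rsum; congr (fine _ - fine _); apply: eq_conf_esum => x xB /=.
  by rewrite /funrpos uv.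
by rewrite /funrneg uv.
Qed.

(** With w = u - v one has w^+ + v = u + w^-, where all four sums are finite. *)
Lemma conf_rsumB (u v : V -> R) : (forall x, ball x -> 0 <= u x) -> (forall x, ball x -> 0 <= v x) ->
  (conf_esum X (EFin \o u) < +oo)%E -> (conf_esum X (EFin \o v) < +oo)%E ->
  conf_rsum X (fun x => u x - v x) = fine (conf_esum X (EFin \o u)) - fine (conf_esum X (EFin \o v)).
Proof.
move=> u0 v0 uoo voo; pose w x := u x - v x.
have e0 (g : V -> R) : (forall x, ball x -> 0 <= g x) -> (0 <= conf_esum X (EFin \o g))%E.
  by move=> g0; apply: conf_esum_ball_ge0 => x xB; rewrite lee_fin g0.
have fin (g h : V -> R) : (forall x, ball x -> 0 <= g x) -> (forall x, ball x -> g x <= h x) ->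
    (conf_esum X (EFin \o h) < +oo)%E -> conf_esum X (EFin \o g) \is a fin_num.
  move=> g0 gh hoo; rewrite ge0_fin_numE ?e0//; apply: le_lt_trans hoo.
  by apply: le_conf_esum => x xB; rewrite lee_fin gh.
have p0 x : 0 <= w^\+ x by rewrite /funrpos le_max lexx orbT.
have n0 x : 0 <= w^\- x by rewrite /funrneg le_max lexx orbT.
have pu x : ball x -> w^\+ x <= u x.
  by move=> xB; rewrite /funrpos ge_max u0// andbT gerBl v0.
have nv x : ball x -> w^\- x <= v x.
  by move=> xB; rewrite /funrneg ge_max v0// andbT /w opprB gerBl u0.
have pf := fin _ _ (fun x _ => p0 x) pu uoo; have nf := fin _ _ (fun x _ => n0 x) nv voo.
have uf := fin _ _ u0 (fun x _ => lexx (u x)) uoo.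
have vf := fin _ _ v0 (fun x _ => lexx (v x)) voo.
have E : (conf_esum X (EFin \o w^\+%R) + conf_esum X (EFin \o v) =
    conf_esum X (EFin \o u) + conf_esum X (EFin \o w^\-%R))%E.
  rewrite -!conf_esumD_ball//; last 2 first.
  - by move=> x _; rewrite lee_fin n0.
  - by move=> x _; rewrite lee_fin p0.
  apply: eq_conf_esum => x _; rewrite /= -!EFinD; congr EFin.
  rewrite /funrpos /funrneg /w; case: (leP (u x) (v x)) => h.
    by rewrite max_r ?subr_le0// max_l ?oppr_ge0 ?subr_le0//; lra.
  have {}h := ltW h; rewrite max_l ?subr_ge0// max_r ?oppr_le0 ?subr_ge0//; lra.
rewrite /conf_rsum -/w; move: E.
rewrite -(fineK pf) -(fineK nf) -(fineK uf) -(fineK vf) -!EFinD => -[E] /=; lra.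
Qed.

Variable mu : probability V R.
Hypothesis good : core_converges X mu lambda.
Variable z : V.
Hypothesis z1 : enorm z < 1.
Local Notation kl := (@limit_density R d * lambda).
Local Notation W := (weighted_sum X).
Local Notation M a := (fine (ps_mass X (d%:R + a) z)).

Let M0 a : 0 < a -> 0 < M a.
Proof. exact: (ps_mass_gt0 d_gt0 lambda_gt0 good_sigma z1). Qed.

Let Mlim := mass_limit d_gt0 lambda_gt0 good_sigma z1.

Section nonnegative_boundary_values.
Variable u : V -> R.
Hypothesis mu_u : measurable_fun S u.
Hypothesis u0 : forall zeta, S zeta -> 0 <= u zeta.
Variable K : R.
Hypothesis uK : (\int[mu]_(zeta in S) (u zeta ^+ 2)%:E <= K%:E)%E.

Let P0 x zeta : ball x -> 0 <= P x zeta.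
Proof. by move=> xB; rewrite poisson_szego_ge0// ltW. Qed.

Let mPu x : measurable_fun S (fun zeta => (P x zeta * u zeta)%:E).
Proof.
apply/measurable_EFinP; apply: measurable_funM => //; apply: measurable_funTS.
exact: measurable_poisson_szego_r.
Qed.

Lemma poisson_integral_ge0 x : ball x -> (0 <= \int[mu]_(zeta in S) (P x zeta * u zeta)%:E)%E.
Proof. by move=> xB; apply: integral_ge0 => zeta zS; rewrite lee_fin mulr_ge0 ?u0 ?P0. Qed.

Lemma poisson_integral_fin x : ball x ->
  (\int[mu]_(zeta in S) (P x zeta * u zeta)%:E)%E \is a fin_num.
Proof.
move=> xB; rewrite ge0_fin_numE ?poisson_integral_ge0//.
pose H := (1 - enorm x) ^- (2 * d); have H0 : 0 <= H by rewrite invr_ge0 exprn_ge0// subr_ge0 ltW.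
have mu2 : measurable_fun S (fun zeta => (u zeta ^+ 2)%:E).
  by apply/measurable_EFinP; exact: measurable_funX.
apply: (@le_lt_trans _ _ (\int[mu]_(zeta in S) (H%:E + H%:E * (u zeta ^+ 2)%:E))%E).
  apply: ge0_le_integral => //=.
  - by move=> zeta zS; rewrite lee_fin mulr_ge0 ?u0 ?P0.
  - by apply: emeasurable_funD; [exact: measurable_cst|exact: measurable_funeM].
  - move=> zeta zS; rewrite -EFinM -EFinD lee_fin -[X in _ <= X + _]mulr1 -mulrDr.
    apply: ler_pM; rewrite ?P0 ?u0//; first by apply: poisson_szego_bound => //; rewrite zS.
    by have := sqr_ge0 (u zeta - 1); have := u0 zS; nra.
rewrite ge0_integralD//=; last 2 first.
- by move=> zeta _; rewrite -EFinM lee_fin mulr_ge0 ?sqr_ge0.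
- exact: measurable_funeM.
rewrite integral_cst// ge0_integralZl//=; last by move=> zeta _; rewrite lee_fin sqr_ge0.
apply: lte_add_pinfty.
  by rewrite lte_mul_pinfty ?lee_fin// (le_lt_trans (probability_le1 _ _))// ltry.
by rewrite lte_mul_pinfty ?lee_fin// (le_lt_trans uK)// ltry.
Qed.

Local Notation Q x := (fine (\int[mu]_(zeta in S) (P x zeta * u zeta)%:E)%E).

(** By Tonelli's theorem the sum of the Poisson-Szego integrals is the integral of the sum. *)
Lemma poisson_integral_esum a : 0 < a ->
  (conf_esum X (fun x => (ps_weight (d%:R + a) z x * Q x)%:E) =
   \int[mu]_(zeta in S) (W a z zeta * (u zeta)%:E))%E.
Proof.
move=> a0; rewrite /weighted_sum poisson_sum_tonelli//; last by move=> x _; exact: ps_weight_ge0.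
by apply: eq_conf_esum => x xB; rewrite EFinM fineK// poisson_integral_fin.
Qed.

Lemma poisson_integral_esum_finite a : 0 < a ->
  (conf_esum X (fun x => (ps_weight (d%:R + a) z x * Q x)%:E) < +oo)%E.
Proof.
move=> a0; have [N [mN N0 Nf]] := exceptional_set good.
rewrite poisson_integral_esum// -(weighted_integral_sphere d_gt0 mN N0 Nf z1 mu_u u0 a0).
exact: (weighted_integral_finite d_gt0 lambda_gt0 good mN N0 Nf z1 mu_u u0 uK a0).
Qed.

Lemma poisson_integral_limit :
  fine (conf_esum X (fun x => (ps_weight (d%:R + a) z x * Q x)%:E)) / M a @[a --> (0 : R)^'+] --> Q z.
Proof.
have [N [mN N0 Nf]] := exceptional_set good.
have := weighted_mean_limit d_gt0 lambda_gt0 good mN N0 Nf z1 mu_u u0 uK M0 Mlim.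
rewrite -(@ge0_negligible_integral _ _ _ mu S N)//; last first.
  by move=> zeta zS; rewrite lee_fin mulr_ge0 ?P0 ?u0.
apply: cvg_trans; apply: near_eq_cvg; near=> a.
have a0 : 0 < a by near: a; exact: nbhs_right_gt.
by rewrite poisson_integral_esum// -(weighted_integral_sphere d_gt0 mN N0 Nf z1 mu_u u0 a0).
Unshelve. all: end_near. Qed.

End nonnegative_boundary_values.

Section real_boundary_values.
Variable r : V -> R.
Hypothesis mr : measurable_fun S r.
Variable K : R.
Hypothesis rK : (\int[mu]_(zeta in S) (r zeta ^+ 2)%:E <= K%:E)%E.

Local Notation Q x := (\int[mu]_(zeta in S) (P x zeta * r zeta))%R.

Let part (p : V -> R) x : R := fine (\int[mu]_(zeta in S) (P x zeta * p zeta)%:E)%E.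

Let mp : measurable_fun S r^\+. Proof. exact: measurable_funrpos. Qed.
Let mn : measurable_fun S r^\-. Proof. exact: measurable_funrneg. Qed.
Let p0 zeta : S zeta -> 0 <= r^\+ zeta. Proof. by move=> _; rewrite /funrpos le_max lexx orbT. Qed.
Let n0 zeta : S zeta -> 0 <= r^\- zeta. Proof. by move=> _; rewrite /funrneg le_max lexx orbT. Qed.

Let pK : (\int[mu]_(zeta in S) (r^\+ zeta ^+ 2)%:E <= K%:E)%E.
Proof.
apply: le_trans rK; apply: ge0_le_integral => //=.
- by move=> zeta _; rewrite lee_fin sqr_ge0.
- by apply/measurable_EFinP; exact: measurable_funX.
- by apply/measurable_EFinP; exact: measurable_funX.
- move=> zeta zS; rewrite lee_fin /funrpos; case: (leP (r zeta) 0) => h.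
    by rewrite expr0n sqr_ge0.
  exact: lexx.
Qed.

Let nK : (\int[mu]_(zeta in S) (r^\- zeta ^+ 2)%:E <= K%:E)%E.
Proof.
apply: le_trans rK; apply: ge0_le_integral => //=.
- by move=> zeta _; rewrite lee_fin sqr_ge0.
- by apply/measurable_EFinP; exact: measurable_funX.
- by apply/measurable_EFinP; exact: measurable_funX.
- move=> zeta zS; rewrite lee_fin /funrneg; case: (leP (- r zeta) 0) => h.
    by rewrite expr0n sqr_ge0.
  by rewrite sqrrN.
Qed.

Lemma poisson_integral_parts x : ball x -> Q x = part r^\+ x - part r^\- x.
Proof.
move=> xB; have P0 zeta : 0 <= P x zeta by rewrite poisson_szego_ge0// ltW.
rewrite /Rintegral integralE.
have -> : (\int[mu]_(zeta in S) ((fun t => (P x t * r t)%:E)^\+ zeta) =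
    \int[mu]_(zeta in S) (P x zeta * r^\+ zeta)%:E)%E.
  apply: eq_integral => zeta _; rewrite funeposE /funrpos -EFin_max maxr_pMr ?P0// mulr0.
  by rewrite maxC.
have -> : (\int[mu]_(zeta in S) ((fun t => (P x t * r t)%:E)^\- zeta) =
    \int[mu]_(zeta in S) (P x zeta * r^\- zeta)%:E)%E.
  by apply: eq_integral => zeta _; rewrite funenegE /funrneg -EFinN -EFin_max maxr_pMr ?P0// mulr0 mulrN.
by rewrite fineB ?(poisson_integral_fin mp p0 pK)// (poisson_integral_fin mn n0 nK).
Qed.

Let w a := ps_weight (d%:R + a) z.

Let part_ge0 p x : (forall zeta, S zeta -> 0 <= p zeta) -> ball x -> 0 <= part p x.
Proof. by move=> h xB; rewrite fine_ge0// poisson_integral_ge0. Qed.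

Lemma real_poisson_integral_summable a : 0 < a ->
  (conf_esum X (fun x => (w a x * `|Q x|)%:E) < +oo)%E.
Proof.
move=> a0; have h1 := poisson_integral_esum_finite mp p0 pK a0.
have h2 := poisson_integral_esum_finite mn n0 nK a0.
apply: (@le_lt_trans _ _ (conf_esum X (fun x => (w a x * part r^\+ x)%:E + (w a x * part r^\- x)%:E)%E)).
  apply: le_conf_esum => x xB; rewrite -EFinD lee_fin -mulrDr ler_wpM2l ?ps_weight_ge0//.
  rewrite poisson_integral_parts// (le_trans (ler_normB _ _))//.
  by rewrite !ger0_norm ?part_ge0.
rewrite conf_esumD_ball ?lte_add_pinfty//.
  by move=> x xB; rewrite lee_fin mulr_ge0 ?ps_weight_ge0 ?part_ge0.
by move=> x xB; rewrite lee_fin mulr_ge0 ?ps_weight_ge0 ?part_ge0.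
Qed.

Lemma real_poisson_integral_limit (q : V -> R) : (forall x, ball x -> q x = Q x) ->
  conf_rsum X (fun x => w a x * q x) / M a @[a --> (0 : R)^'+] --> Q z.
Proof.
move=> qE; rewrite poisson_integral_parts//.
have l1 := poisson_integral_limit mp p0 pK; have l2 := poisson_integral_limit mn n0 nK.
apply: cvg_trans (cvgB l1 l2); apply: near_eq_cvg; near=> a.
have a0 : 0 < a by near: a; exact: nbhs_right_gt.
rewrite [LHS]/= (@eq_conf_rsum _ (fun x => w a x * part r^\+ x - w a x * part r^\- x)); last first.
  by move=> x xB; rewrite qE// poisson_integral_parts// mulrBr.
rewrite conf_rsumB ?mulrBl//.
- by move=> x xB; rewrite mulr_ge0 ?ps_weight_ge0 ?part_ge0.
- by move=> x xB; rewrite mulr_ge0 ?ps_weight_ge0 ?part_ge0.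
- exact: (poisson_integral_esum_finite mp p0 pK a0).
- exact: (poisson_integral_esum_finite mn n0 nK a0).
Unshelve. all: end_near. Qed.

End real_boundary_values.

Lemma complex_cvg {I : Type} (G : set_system I) {FG : Filter G} (u v : I -> R) (a b : R) :
  u i @[i --> G] --> a -> v i @[i --> G] --> b -> (u i +i* v i) @[i --> G] --> (a +i* b : R[i]).
Proof.
move=> /cvgrPdist_lt ua /cvgrPdist_lt vb; apply/cvgrPdist_lt => e e0.
have [e1 e1e e10] : exists2 e1 : R, e1%:C = e & 0 < e1.
  by case: e e0 => x y; rewrite ltcE/= => /andP[/eqP -> x0]; exists x.
have e2 : 0 < e1 / 2 by rewrite divr_gt0.
apply: filterS2 (ua _ e2) (vb _ e2) => i ui vi.
rewrite -e1e -[`| _ |]/((cabs _)%:C) ltcR (le_lt_trans (cabs_le_ReIm _))//.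
by rewrite cReD cImD cReN cImN/= (splitr e1) ltrD.
Qed.

Variable f : V -> R[i].
Hypothesis f_hardy : hardy2 mu f.

Let boundary_values : exists (g1 g2 : V -> R) (K : R), [/\ measurable_fun S g1 /\ measurable_fun S g2,
  (\int[mu]_(zeta in S) (g1 zeta ^+ 2)%:E <= K%:E)%E, (\int[mu]_(zeta in S) (g2 zeta ^+ 2)%:E <= K%:E)%E &
  forall x, ball x -> complex.Re (f x) = (\int[mu]_(zeta in S) (P x zeta * g1 zeta))%R /\
                      complex.Im (f x) = (\int[mu]_(zeta in S) (P x zeta * g2 zeta))%R].
Proof.
case: f_hardy => g [[gr gi] gL] fE; rewrite L2norm_lty// in gL.
have mg2 : measurable_fun S (fun zeta => (cabs (g zeta) ^+ 2)%:E) by exact: measurable_cabs_sqr.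
have gf : sqnorm mu S g \is a fin_num by rewrite ge0_fin_numE// sqnorm_ge0.
exists (fun zeta => complex.Re (g zeta)), (fun zeta => complex.Im (g zeta)), (fine (sqnorm mu S g)).
rewrite fineK//; split.
- by [].
- apply: ge0_le_integral => //=.
  + by move=> zeta _; rewrite lee_fin sqr_ge0.
  + by apply/measurable_EFinP; exact: measurable_funX.
  + by move=> zeta _; rewrite lee_fin cabs_sqr lerDl sqr_ge0.
- apply: ge0_le_integral => //=.
  + by move=> zeta _; rewrite lee_fin sqr_ge0.
  + by apply/measurable_EFinP; exact: measurable_funX.
  + by move=> zeta _; rewrite lee_fin cabs_sqr lerDr sqr_ge0.
- move=> x xB; rewrite fE// /cintegral/=; split; apply: eq_Rintegral => zeta _.
    by rewrite cReM/= mul0r subr0.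
  by rewrite cImM/= mul0r addr0.
Qed.

Theorem hardy_summable a : 0 < a ->
  (conf_esum X (fun x => (cabs ((ps_weight (d%:R + a) z x)%:C * f x))%:E) < +oo)%E.
Proof.
move=> a0; have [g1 [g2 [K [[m1 m2] K1 K2 fE]]]] := boundary_values.
have h1 := real_poisson_integral_summable m1 K1 a0.
have h2 := real_poisson_integral_summable m2 K2 a0.
apply: le_lt_trans (lte_add_pinfty h1 h2); rewrite -conf_esumD_ball; last 2 first.
- by move=> x xB; rewrite lee_fin mulr_ge0 ?ps_weight_ge0.
- by move=> x xB; rewrite lee_fin mulr_ge0 ?ps_weight_ge0.
apply: le_conf_esum => x xB; have [<- <-] := fE x xB.
rewrite -EFinD lee_fin cabsM cabsR (ger0_norm (ps_weight_ge0 _ _ _)).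
have := ler_wpM2l (ps_weight_ge0 (d%:R + a) z x) (cabs_le_ReIm (f x)); lra.
Qed.

Theorem hardy_limit :
  conf_csum X (fun x => (ps_weight (d%:R + a) z x)%:C * f x) / (M a)%:C @[a --> (0 : R)^'+] --> f z.
Proof.
have [g1 [g2 [K [[m1 m2] K1 K2 fE]]]] := boundary_values.
have l1 := real_poisson_integral_limit m1 K1 (fun x xB => (fE x xB).1).
have l2 := real_poisson_integral_limit m2 K2 (fun x xB => (fE x xB).2).
have -> : f z = (complex.Re (f z) +i* complex.Im (f z)) by case: (f z).
have [-> ->] := fE z z1.
apply: cvg_trans (complex_cvg l1 l2); apply: near_eq_cvg; apply: nearW => a.
rewrite -fmorphV /conf_csum; apply/eqP; rewrite eq_complex; apply/andP; split; apply/eqP.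
  rewrite cReM/= mulr0 subr0; congr (_ * _); apply: eq_conf_rsum => x _.
  by rewrite cReM/= mul0r subr0.
rewrite cImM/= mulr0 add0r; congr (_ * _); apply: eq_conf_rsum => x _.
by rewrite cImM/= mul0r addr0.
Qed.

End hardy_functions.

(** * Weak convergence *)

Section weighted_point_measure.
Context {R : realType} {d : nat}.
Hypothesis d_gt0 : (0 < d)%N.
Local Notation V := 'rV[R[i]]_d.
Local Notation S := (@unit_sphere R d).
Local Notation ball := (@unit_ball R d).
Local Notation cball := (@closed_unit_ball R d).
Local Notation Conf := (@Conf R d ball).
Local Notation P := (@poisson_szego R d).
Local Notation sigma := (@surface_measure R d).
Variables (X : Conf) (z : V).

Let mS : measurable S := measurable_unit_sphere.

Lemma measurable_closed_unit_ball : measurable cball.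
Proof.
have := @measurable_enorm R d measurableT _ (measurable_itv `]-oo, (1 : R)]).
by rewrite setTI; congr measurable; apply/seteqP; split => x /=; rewrite in_itv.
Qed.

Let mB := measurable_closed_unit_ball.

(** The measure is a series of weighted Dirac masses along an enumeration. *)
Lemma integral_ps_sum_measure s (h : V -> R) : measurable_fun cball h ->
  (forall x, cball x -> 0 <= h x) ->
  (\int[ps_sum_measure X s z]_(x in cball) (h x)%:E =
   conf_esum X (fun x => (ps_weight s z x * h x)%:E))%E.
Proof.
move=> mh h0; have [e Xe] := conf_enumeration X.
have bc x : ball x -> cball x by exact: ltW.
have mEh : measurable_fun cball (fun x => (h x)%:E) by exact/measurable_EFinP.
pose atom x : {measure set V -> \bar R} := mscale (NngNum (ps_weight_ge0 s z x)) (\d_x).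
pose m n : {measure set V -> \bar R} := if e n is Some x then atom x else mzero.
rewrite (@eq_measure_integral _ _ _ cball (mseries m 0)); last first.
  move=> A mA _; transitivity (\esum_(x in A) ((X x)%:R * ps_weight s z x)%:E)%E; first by [].
  rewrite esum_mkcond.
  have -> : (\esum_(x in [set: V]) (if x \in A then ((X x)%:R * ps_weight s z x)%:E else 0) =
      conf_esum X (fun x => (ps_weight s z x * \1_A x)%:E))%E.
    apply: eq_esum => x _; rewrite indicE; case: (x \in A); first by rewrite mulr1 EFinM.
    by rewrite mulr0 mule0.
  rewrite (conf_esum_series_ball Xe); last by move=> x _; rewrite lee_fin mulr_ge0 ?ps_weight_ge0.
  rewrite /mseries; apply: eq_eseriesr => n _; rewrite /enum_term /m.
  by case: (e n) => [x|//] /=; rewrite /mscale/= diracE -EFinM indicE.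
rewrite ge0_integral_measure_series//.
rewrite (conf_esum_series_ball Xe); last first.
  by move=> x xB; rewrite lee_fin mulr_ge0 ?ps_weight_ge0 ?h0//; exact: bc.
apply: eq_eseriesr => n _; rewrite /enum_term /m; case E : (e n) => [x|] /=; last first.
  by rewrite integral_measure_zero.
have xB := enumerates_ball Xe E.
rewrite ge0_integral_mscale// integral_dirac//.
by rewrite diracE mem_set ?mul1e -?EFinM//; exact: bc.
Qed.

Lemma integral_ps_measure s (h : V -> R) : measurable_fun cball h ->
  (forall x, cball x -> 0 <= h x) ->
  (\int[ps_measure X s z]_(x in cball) (h x)%:E =
   ((fine (ps_mass X s z))^-1)%:E * conf_esum X (fun x => (ps_weight s z x * h x)%:E))%E.
Proof.
move=> mh h0; rewrite -integral_ps_sum_measure// /ps_measure ge0_integral_mscale//.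
exact/measurable_EFinP.
Qed.

End weighted_point_measure.

Section weak_convergence.
Context {R : realType} {d : nat}.
Hypothesis d_gt0 : (0 < d)%N.
Local Notation V := 'rV[R[i]]_d.
Local Notation S := (@unit_sphere R d).
Local Notation ball := (@unit_ball R d).
Local Notation cball := (@closed_unit_ball R d).
Local Notation Conf := (@Conf R d ball).
Local Notation P := (@poisson_szego R d).
Local Notation sigma := (@surface_measure R d).
Variables (X : Conf) (lambda : R).
Hypothesis lambda_gt0 : 0 < lambda.
Hypothesis good_sigma : core_converges X sigma lambda.
Variable z : V.
Hypothesis z1 : enorm z < 1.
Local Notation kl := (@limit_density R d * lambda).
Local Notation M a := (fine (ps_mass X (d%:R + a) z)).
Local Notation w a := (ps_weight (d%:R + a) z).

Let mS : measurable S := measurable_unit_sphere.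
Let mB : measurable cball := measurable_closed_unit_ball.

Let M0 a : 0 < a -> 0 < M a.
Proof. exact: (ps_mass_gt0 d_gt0 lambda_gt0 good_sigma z1). Qed.

Let Mlim := mass_limit d_gt0 lambda_gt0 good_sigma z1.

Lemma ps_measure_closed_ball a : 0 < a -> ps_measure X (d%:R + a) z cball = 1%E.
Proof.
move=> a0; have E : (\int[ps_measure X (d%:R + a) z]_(x in cball) (1 : R)%:E =
    ps_measure X (d%:R + a) z cball)%E by rewrite integral_cst// mul1e.
rewrite -E; transitivity (((M a)^-1)%:E * conf_esum X (fun x => (w a x * cst 1 x)%:E))%E.
  by apply: (@integral_ps_measure _ _ X z _ (cst 1)).
have -> : conf_esum X (fun x => (w a x * cst 1 x)%:E) = ps_mass X (d%:R + a) z.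
  by apply: eq_conf_esum => x _; rewrite mulr1.
rewrite -[X in (_ * X)%E](fineK (ps_mass_fin_num d_gt0 lambda_gt0 good_sigma z1 a0)).
by rewrite -EFinM mulVf// gt_eqF// M0.
Qed.

Section nonnegative_function.
Variable h : V -> R.
Hypothesis h_cont : {within cball, continuous h}.
Hypothesis h0 : forall x, cball x -> 0 <= h x.

Let h1 := h \_ cball.
Let mh : measurable_fun [set: V] h1 := measurable_ball_function h_cont.
Let h1_ge0 x : 0 <= h1 x.
Proof. by rewrite /h1 patchE; case: ifP => // /set_mem; exact: h0. Qed.
Let h1E x : cball x -> h1 x = h x. Proof. by move=> xB; rewrite /h1 patchE mem_set. Qed.
Let sc x : S x -> cball x. Proof. by rewrite /unit_sphere/closed_unit_ball/= => ->. Qed.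

Local Notation Q x := (fine (\int[sigma]_(zeta in S) (P x zeta * h1 zeta)%:E)%E).

Variable B : R.
Hypothesis B_gt0 : 0 < B.
Hypothesis hB : forall x, cball x -> `|h x| <= B.

Let h1B x : h1 x <= B.
Proof.
rewrite /h1 patchE; case: ifP => [/set_mem xB|_]; last exact: ltW.
by rewrite (le_trans (ler_norm _))// hB.
Qed.

Let mhS : measurable_fun S h1. Proof. exact: measurable_funTS. Qed.

Let square_bound : (\int[sigma]_(zeta in S) (h1 zeta ^+ 2)%:E <= (B ^+ 2)%:E)%E.
Proof.
apply: (@le_trans _ _ (\int[sigma]_(zeta in S) (B ^+ 2)%:E)%E).
  apply: ge0_le_integral => //=.
  - by move=> zeta _; rewrite lee_fin sqr_ge0.
  - by apply/measurable_EFinP; exact: measurable_funX.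
  - by move=> zeta _; rewrite lee_fin lerXn2r ?nnegrE ?h1_ge0 ?h1B// ltW.
rewrite integral_cst// -[leRHS]mule1 lee_wpmul2l ?lee_fin ?sqr_ge0//.
exact: probability_le1.
Qed.

Let P0 x zeta : ball x -> 0 <= P x zeta.
Proof. by move=> xB; rewrite poisson_szego_ge0// ltW. Qed.

Let mPh x : measurable_fun S (fun zeta => (P x zeta * h1 zeta)%:E).
Proof.
apply/measurable_EFinP; apply: measurable_funM => //; apply: measurable_funTS.
exact: measurable_poisson_szego_r.
Qed.

Let mPc x c : measurable_fun S (fun zeta => (P x zeta * c)%:E).
Proof.
apply/measurable_EFinP; apply: measurable_funM => //; apply: measurable_funTS.
exact: measurable_poisson_szego_r.
Qed.

Let poisson_cst x c : ball x -> 0 <= c -> (\int[sigma]_(zeta in S) (P x zeta * c)%:E = c%:E)%E.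
Proof.
move=> xB c0; rewrite -[RHS]mule1 -(poisson_szego_mass d_gt0 xB) -ge0_integralZl//=.
- by apply: eq_integral => zeta _; rewrite mulrC EFinM.
- by apply/measurable_EFinP; apply: measurable_funTS; exact: measurable_poisson_szego_r.
- by move=> zeta _; rewrite lee_fin P0.
Qed.

Let QE x : ball x -> (\int[sigma]_(zeta in S) (P x zeta * h1 zeta)%:E = (Q x)%:E)%E.
Proof.
by move=> xB; rewrite fineK// (poisson_integral_fin mhS _ square_bound).
Qed.

Let Q0 x : ball x -> 0 <= Q x.
Proof. by move=> xB; rewrite fine_ge0//; apply: integral_ge0 => zeta _; rewrite lee_fin mulr_ge0 ?P0. Qed.

Let QB x : ball x -> Q x <= B.
Proof.
move=> xB; rewrite -lee_fin -QE// -(@poisson_cst x B)//; last exact: ltW.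
apply: ge0_le_integral => //=.
- by move=> zeta _; rewrite lee_fin mulr_ge0 ?P0.
- by move=> zeta _; rewrite lee_fin ler_wpM2l ?P0 ?h1B.
Qed.

(** Near the sphere the kernel at x concentrates at x / |x|, where h is close to h(x). *)
Lemma poisson_integral_boundary (e : R) : 0 < e -> exists2 r : R, r < 1 &
  forall x, r < enorm x -> ball x -> `|h1 x - Q x| <= e.
Proof.
move=> e0; have e2 : 0 < e / 2 by rewrite divr_gt0.
have hS r : 0 < r -> exists2 dl : R, 0 < dl & forall zeta x : V, S zeta -> enorm x <= 1 ->
    enorm (zeta - x) < dl -> `|h1 zeta - h1 x| <= r.
  move=> r0; have [dl dl0 hd] := sphere_uniform_continuity h_cont r0.
  by exists dl => // zeta x zS x1 zx; rewrite !h1E ?hd//; exact: sc.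
have hM x : enorm x <= 1 -> `|h1 x| <= B by move=> _; rewrite ger0_norm ?h1_ge0 ?h1B.
have [r [r0 r1 hr]] := poisson_szego_concentration d_gt0 mh B_gt0 hM hS e2.
have [dl dl0 hd] := hS _ e2.
exists (Num.max r (1 - dl)) => [|x]; first by rewrite gt_max r1 gtrBl.
rewrite gt_max => /andP[rx dx] xB; have x1 : enorm x < 1 := xB.
have x0 : 0 < enorm x by exact: lt_trans rx.
pose zeta := sphere_proj x.
have xE : x = (enorm x)%:C *: zeta.
  by rewrite /zeta /sphere_proj scalerA -rmorphM/= mulfV ?gt_eqF// scale1r.
have zS : S zeta.
  have := congr1 enorm xE; rewrite enormZ cabsR ger0_norm ?(ltW x0)// => /esym/eqP.
  by rewrite -[X in _ == X]mulr1 => /eqP/(mulfI _); apply; rewrite gt_eqF.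
have zx : enorm (zeta - x) < dl.
  rewrite [X in zeta - X]xE -[X in X - _]scale1r -scalerBl enormZ zS mulr1.
  have -> : 1 - (enorm x)%:C = (1 - enorm x)%:C by rewrite rmorphB rmorph1.
  by rewrite cabsR ger0_norm ?subr_ge0 ?(ltW x1)// ltrBlDr -ltrBlDl.
have ch := hr (enorm x) 1 zeta rx x1 r1 (lexx 1) zS; rewrite -xE in ch.
have dh := hd zeta x zS (ltW x1) zx.
have mabs : measurable_fun S (fun xi => (P x xi * `|h1 xi - h1 zeta|)%:E).
  apply/measurable_EFinP; apply: measurable_funM.
    by apply: measurable_funTS; exact: measurable_poisson_szego_r.
  by apply: measurableT_comp => //; exact: measurable_funB.
have {}ch : (\int[sigma]_(xi in S) (P x xi * `|h1 xi - h1 zeta|)%:E <= (e / 2)%:E)%E.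
  by apply: le_trans ch; under eq_integral do rewrite -[X in h1 X - _]scale1r.
have abs0 xi : 0 <= P x xi * `|h1 xi - h1 zeta| by rewrite mulr_ge0 ?P0.
have up : Q x <= h1 zeta + e / 2.
  rewrite -lee_fin -QE// EFinD; apply: (le_trans _ (leeD2l _ ch)).
  rewrite -(@poisson_cst x (h1 zeta))// -ge0_integralD//=; last 2 first.
  - by move=> xi _; rewrite lee_fin mulr_ge0 ?P0.
  - by move=> xi _; rewrite lee_fin.
  apply: ge0_le_integral => //=.
  - by move=> xi _; rewrite lee_fin mulr_ge0 ?P0.
  - exact: emeasurable_funD.
  - move=> xi _; rewrite -EFinD lee_fin -mulrDr ler_wpM2l ?P0// -lerBlDl.
    exact: ler_norm.
have lo : h1 zeta <= Q x + e / 2.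
  rewrite -lee_fin EFinD -QE//; apply: (le_trans _ (leeD2l _ ch)).
  rewrite -(@poisson_cst x (h1 zeta))// -ge0_integralD//=; last 2 first.
  - by move=> xi _; rewrite lee_fin mulr_ge0 ?P0.
  - by move=> xi _; rewrite lee_fin.
  apply: ge0_le_integral => //=.
  - by move=> xi _; rewrite lee_fin mulr_ge0 ?P0.
  - exact: emeasurable_funD.
  - move=> xi _; rewrite -EFinD lee_fin -mulrDr ler_wpM2l ?P0// -lerBlDl distrC.
    exact: ler_norm.
move: dh; rewrite ler_distl => /andP[d1 d2].
by rewrite ler_distl; apply/andP; split; lra.
Qed.

Let esum_h a := conf_esum X (fun x => (w a x * h x)%:E).
Let esum_Q a := conf_esum X (fun x => (w a x * Q x)%:E).

Let wh0 a x : ball x -> 0 <= w a x * h x.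
Proof. by move=> xB; rewrite mulr_ge0 ?ps_weight_ge0 ?h0//; exact: ltW. Qed.
Let wQ0 a x : ball x -> 0 <= w a x * Q x.
Proof. by move=> xB; rewrite mulr_ge0 ?ps_weight_ge0 ?Q0. Qed.

Let esum_h_fin a : 0 < a -> esum_h a \is a fin_num.
Proof.
move=> a0; rewrite ge0_fin_numE; last by apply: conf_esum_ball_ge0 => x /(wh0 a); rewrite lee_fin.
apply: (@le_lt_trans _ _ (B%:E * ps_mass X (d%:R + a) z)%E).
  rewrite -conf_esumZ_ball ?(ltW B_gt0)//; last by move=> x _; rewrite lee_fin ps_weight_ge0.
  apply: le_conf_esum => x xB; rewrite -EFinM lee_fin mulrC ler_wpM2r ?ps_weight_ge0//.
  by rewrite -h1E ?h1B//; exact: ltW.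
rewrite lte_mul_pinfty ?lee_fin ?(ltW B_gt0)//.
exact: (ps_mass_finite d_gt0 lambda_gt0 good_sigma z1 a0).
Qed.

Let esum_Q_fin a : 0 < a -> esum_Q a \is a fin_num.
Proof.
move=> a0; rewrite ge0_fin_numE; last by apply: conf_esum_ball_ge0 => x /(wQ0 a); rewrite lee_fin.
by apply: (poisson_integral_esum_finite d_gt0 lambda_gt0 good_sigma z1 mhS _ square_bound a0).
Qed.

(** Points near the sphere contribute at most a small fraction of the mass, and the others
    a bounded amount. *)
Let esum_compare (e : R) : 0 < e -> exists2 C : R, 0 <= C & forall a, 0 < a ->
  `|fine (esum_h a) - fine (esum_Q a)| <= e * M a + C.
Proof.
move=> e0; have [r r1 hr] := poisson_integral_boundary e0.
pose A := [set x : V | enorm x <= r].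
have cf : conf_count X A \is a fin_num.
  by rewrite ge0_fin_numE ?measure_ge0//; exact: conf_count_finite.
exists (B * fine (conf_count X A)) => [|a a0].
  by rewrite mulr_ge0 ?(ltW B_gt0)// fine_ge0// measure_ge0.
have Mf := ps_mass_fin_num d_gt0 lambda_gt0 good_sigma z1 a0.
have bound (u v : V -> R) : (forall x, ball x -> 0 <= v x) ->
    (forall x, ball x -> w a x * u x <= w a x * v x + e * w a x + B * \1_A x) ->
    (conf_esum X (fun x => (w a x * u x)%:E) <=
     conf_esum X (fun x => (w a x * v x)%:E) + (e * M a)%:E + (B * fine (conf_count X A))%:E)%E.
  move=> v0 uv; rewrite EFinM (EFinM B) !fineK// conf_countE /ps_mass.
  have e0' := ltW e0; have B0 := ltW B_gt0.
  rewrite -!conf_esumZ_ball//; last by move=> x _; rewrite lee_fin ps_weight_ge0.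
  rewrite -!conf_esumD_ball.
  - by apply: le_conf_esum => x xB; rewrite -!EFinM -!EFinD lee_fin uv.
  - by move=> x xB; rewrite -EFinM -EFinD lee_fin addr_ge0// mulr_ge0 ?ps_weight_ge0 ?v0.
  - by move=> x xB; rewrite -EFinM lee_fin mulr_ge0.
  - by move=> x xB; rewrite lee_fin mulr_ge0 ?ps_weight_ge0 ?v0.
  - by move=> x xB; rewrite -EFinM lee_fin mulr_ge0 ?ps_weight_ge0.
have pw (p q : R) x : ball x -> 0 <= p -> 0 <= q -> p <= B -> q <= B ->
    (r < enorm x -> `|p - q| <= e) -> w a x * p <= w a x * q + e * w a x + B * \1_A x.
  move=> xB pp0 qq0 pB qB pq; rewrite indicE.
  case: (boolP (x \in A)) => [_|/negP xA].
    have w1 : w a x <= 1 by apply: ps_weight_le1 => //; rewrite addr_ge0// ltW.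
    have w0 := ps_weight_ge0 (d%:R + a) z x; rewrite mulr1.
    have wp : w a x * p <= B by rewrite -[leRHS]mul1r ler_pM.
    by rewrite (le_trans wp)// lerDr addr_ge0// mulr_ge0// ltW.
  have rx : r < enorm x by rewrite ltNge; apply/negP => xr; apply: xA; rewrite inE.
  rewrite mulr0 addr0 (mulrC e) -mulrDr ler_wpM2l ?ps_weight_ge0// -lerBlDl.
  by rewrite (le_trans (ler_norm _))// pq.
have hx x : ball x -> h x = h1 x by move=> xB; rewrite h1E//; exact: ltW.
have i1 := bound h (fun x => Q x) Q0; have i2 := bound (fun x => Q x) h.
have {}i1 : (esum_h a <= esum_Q a + (e * M a)%:E + (B * fine (conf_count X A))%:E)%E.
  by apply: i1 => x xB; rewrite hx//; apply: pw => //; [exact: Q0|exact: QB|move=> rx; exact: hr].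
have {}i2 : (esum_Q a <= esum_h a + (e * M a)%:E + (B * fine (conf_count X A))%:E)%E.
  apply: i2 => x xB; first by rewrite hx.
  by rewrite hx//; apply: pw => //; [exact: Q0|exact: QB|move=> rx; rewrite distrC; exact: hr].
move: i1 i2; rewrite -(fineK (esum_h_fin a0)) -(fineK (esum_Q_fin a0)) -!EFinD !lee_fin => i1 i2.
by rewrite ler_distl; apply/andP; split; lra.
Qed.

(** The mass tends to infinity, so that the bounded discrepancy between h and its
    Poisson-Szego integral disappears, and the sums of the latter are known. *)
Lemma weak_limit_ge0 : fine (esum_h a) / M a @[a --> (0 : R)^'+] --> Q z.
Proof.
have kl0 : 0 < kl by rewrite mulr_gt0 ?limit_density_gt0.
have /cvgrPdist_le l := poisson_integral_limit d_gt0 lambda_gt0 good_sigma good_sigma z1 mhS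
  (fun zeta _ => h1_ge0 zeta) square_bound.
have /cvgrPdist_le Ml := Mlim.
apply/cvgrPdist_le => e e0; have e3 : 0 < e / 3 by rewrite divr_gt0.
have [C C0 hC] := esum_compare e3.
have C1 : 0 < C + 1 by rewrite ltr_wpDl.
have kl2 : 0 < kl / 2 by rewrite divr_gt0.
have c0 : 0 < e / 3 * (kl / 2) / (C + 1) by rewrite divr_gt0// mulr_gt0.
near=> a.
have a0 : 0 < a by near: a; exact: nbhs_right_gt.
have la : `|Q z - fine (esum_Q a) / M a| <= e / 3 by near: a; exact: l.
have aM : kl / 2 <= a * M a.
  have : `|kl - a * M a| <= kl / 2 by near: a; exact: Ml.
  by rewrite ler_distl => /andP[]; lra.
have aC : a * C <= e / 3 * (kl / 2).
  have : a <= e / 3 * (kl / 2) / (C + 1) by near: a; exact: nbhs_right_le.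
  by rewrite ler_pdivlMr//; lra.
have Ma := M0 a0.
have CM : C <= e / 3 * M a.
  have : a * C <= a * (e / 3 * M a).
    have := ler_wpM2l (ltW e3) aM; rewrite (mulrCA (e / 3) a (M a)).
    exact: le_trans aC.
  by rewrite ler_pM2l.
have hh : `|fine (esum_Q a) / M a - fine (esum_h a) / M a| <= 2 * (e / 3).
  rewrite -mulrBl normrM normfV (gtr0_norm Ma) ler_pdivrMr// distrC.
  by have := hC a a0; lra.
rewrite -(subrKA (fine (esum_Q a) / M a)) (le_trans (ler_normD _ _))//.
by rewrite (le_trans (lerD la hh))//; lra.
Unshelve. all: end_near. Qed.

Lemma ps_measure_limit_ge0 :
  [/\ forall a, 0 < a -> (\int[ps_measure X (d%:R + a) z]_(x in cball) (h x)%:E)%E \is a fin_num,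
      (\int[sigma]_(zeta in S) (h zeta * P z zeta)%:E)%E \is a fin_num &
      (\int[ps_measure X (d%:R + a) z]_(x in cball) (h x)%:E)%E @[a --> (0 : R)^'+] -->
      (\int[sigma]_(zeta in S) (h zeta * P z zeta)%:E)%E].
Proof.
have mhc : measurable_fun cball h.
  apply: (@eq_measurable_fun _ _ _ _ _ h1); first by move=> x /set_mem; exact: h1E.
  exact: measurable_funTS.
have E a : 0 < a -> (\int[ps_measure X (d%:R + a) z]_(x in cball) (h x)%:E =
    (fine (esum_h a) / M a)%:E)%E.
  by move=> a0; rewrite integral_ps_measure// mulrC EFinM fineK// esum_h_fin.
have F : (\int[sigma]_(zeta in S) (h zeta * P z zeta)%:E = (Q z)%:E)%E.
  rewrite -QE//; apply: eq_integral => zeta /set_mem zS.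
  by rewrite mulrC h1E//; exact: sc.
split; [by move=> a a0; rewrite E|by rewrite F|].
have wl : (fine (esum_h a) / M a)%:E @[a --> (0 : R)^'+] --> (Q z)%:E.
  by apply: cvg_EFin; [exact: nearW|exact: weak_limit_ge0].
rewrite F; apply: cvg_trans wl; apply: near_eq_cvg; near=> a; rewrite E//.
Unshelve. all: end_near. Qed.

End nonnegative_function.

Theorem ps_measure_limit (phi : V -> R) : {within cball, continuous phi} ->
  (\int[ps_measure X (d%:R + a) z]_(x in cball) (phi x)%:E)%E @[a --> (0 : R)^'+] -->
  (\int[sigma]_(zeta in S) (phi zeta * P z zeta)%:E)%E.
Proof.
move=> phi_cont.
have pos (f : V -> R) : {within cball, continuous f} -> {within cball, continuous f^\+}.
  by move=> fc x; apply: continuous_max; [exact: fc|exact: cst_continuous].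
have pc := pos phi phi_cont.
have nc : {within cball, continuous phi^\-}.
  by apply: (pos (fun x => - phi x)) => x; apply: continuousN; exact: phi_cont.
have p0 x : cball x -> 0 <= phi^\+ x by move=> _; rewrite /funrpos le_max lexx orbT.
have n0 x : cball x -> 0 <= phi^\- x by move=> _; rewrite /funrneg le_max lexx orbT.
have [Bp Bp0 hp] := ball_function_bounded pc; have [Bn Bn0 hn] := ball_function_bounded nc.
have [f1 f2 l1] := ps_measure_limit_ge0 pc p0 Bp0 hp.
have [g1 g2 l2] := ps_measure_limit_ge0 nc n0 Bn0 hn.
have P0 zeta : 0 <= P z zeta by rewrite poisson_szego_ge0// ltW.
have -> : (\int[sigma]_(zeta in S) (phi zeta * P z zeta)%:E =
    \int[sigma]_(zeta in S) (phi^\+%R zeta * P z zeta)%:E -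
    \int[sigma]_(zeta in S) (phi^\-%R zeta * P z zeta)%:E)%E.
  rewrite integralE; congr (_ - _)%E; apply: eq_integral => zeta _.
    by rewrite funeposE /funrpos -EFin_max maxr_pMl ?P0// mul0r.
  by rewrite funenegE /funrneg -EFinN -EFin_max maxr_pMl ?P0// mul0r mulNr.
have l : (\int[ps_measure X (d%:R + a) z]_(x in cball) (phi^\+%R x)%:E -
    \int[ps_measure X (d%:R + a) z]_(x in cball) (phi^\-%R x)%:E)%E @[a --> (0 : R)^'+] -->
    (\int[sigma]_(zeta in S) (phi^\+%R zeta * P z zeta)%:E -
    \int[sigma]_(zeta in S) (phi^\-%R zeta * P z zeta)%:E)%E.
  by apply: cvgeB => //; apply: fin_num_adde_defl; rewrite fin_numN.
apply: cvg_trans l; apply: near_eq_cvg; apply: nearW => a.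
rewrite [RHS]integralE; congr (_ - _)%E; apply: eq_integral => x _.
  by rewrite funeposE /funrpos -EFin_max.
by rewrite funenegE /funrneg -EFinN -EFin_max.
Qed.

End weak_convergence.

(** * Almost every configuration *)

Section almost_every_configuration.
Context {R : realType} {d : nat}.
Hypothesis d_gt0 : (0 < d)%N.
Local Notation V := 'rV[R[i]]_d.
Local Notation S := (@unit_sphere R d).
Local Notation ball := (@unit_ball R d).
Local Notation P := (@poisson_szego R d).
Variables (Pi : probability (Conf ball) R) (lambda : R).
Hypothesis Pi_var : small_variance Pi.
Hypothesis lambda_gt0 : 0 < lambda.
Hypothesis Pi_intensity : forall B : set V, measurable B -> B `<=` ball ->
  first_intensity Pi B = (lambda%:E * bergman_measure B)%E.

(** There are countably many rational points. *)
Lemma core_converges_ae (mu : probability V R) : mu S = 1%E ->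
  {ae Pi, forall X, core_converges X mu lambda}.
Proof.
move=> mu_sphere; have [C C0 var] := Pi_var.
have h (k : nat) : {ae Pi, forall X, forall t, unpickle k = Some t ->
    enorm (@rational_point R d t) < 1 ->
    (forall n, (\int[mu]_(zeta in S) poisson_sum X
       (fun x => (radial_weight (sample n) x * P (rational_point t) x)%R) zeta < +oo)%E) /\
    vanishes \oo (fun n => sqdist mu S
      (fun zeta => sample n * fine (poisson_sum X
         (fun x => radial_weight (sample n) x * P (rational_point t) x) zeta))
      (fun zeta => lambda * P (rational_point t) zeta))}.
  case E : (unpickle k : option (d.-tuple (rat * rat))) => [t|]; last by apply: aeW => X t.
  have [t1|t1] := pselect (enorm (@rational_point R d t) < 1); last first.
    by apply: aeW => X t' [<-] /t1.
  have H0 : 0 < (1 - enorm (@rational_point R d t)) ^- (2 * d).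
    by rewrite invr_gt0 exprn_gt0// subr_gt0.
  have hS e : 0 < e -> exists2 dl : R, 0 < dl & forall zeta x : V, S zeta -> enorm x <= 1 ->
      enorm (zeta - x) < dl -> `|P (rational_point t) zeta - P (rational_point t) x| <= e.
    move=> e0; have [dl dl0 hd] := poisson_szego_equicontinuous d_gt0 t1 e0.
    by exists dl => // zeta x zS x1 zx; rewrite hd// zS.
  have ae := core_sums_converge_ae d_gt0 (@measurable_poisson_szego_r _ _ (rational_point t)) H0
    (fun x => poisson_szego_ge0 x (ltW t1)) (fun x x1 => poisson_szego_bound t1 x1) hS
    lambda_gt0 Pi_intensity C0 var mu_sphere.
  by apply: filterS ae => X hX t' [<-].
have := ae_foralln h; apply: filterS => X hX t t1.
by apply: (hX (pickle t)) => //; rewrite pickleK.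
Qed.

End almost_every_configuration.

Lemma cvg_right_shift {R : realType} {T : Type} (F : R -> T) (G : set_system T) (c : R) :
  F (c + a) @[a --> (0 : R)^'+] --> G -> F s @[s --> c^'+] --> G.
Proof. by move=> FG A /FG; rewrite /nbhs/= => h; apply/nbhs_right0P. Qed.

Theorem theorem5p2 (R : realType) (d : nat) (d_gt0 : (0 < d)%N)
    (mu : probability 'rV[R[i]]_d R)
    (mu_sphere : mu (@unit_sphere R d) = 1%E)
    (Pi : probability (Conf (@unit_ball R d)) R)
    (Pi_var : small_variance Pi)
    (lambda : R) (lambda_gt0 : 0 < lambda)
    (Pi_intensity : forall B : set 'rV[R[i]]_d,
       measurable B -> B `<=` @unit_ball R d ->
       first_intensity Pi B = (lambda%:E * bergman_measure B)%E) :
  {ae Pi, forall X : Conf (@unit_ball R d),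
    [/\ forall (s : R) (z : 'rV[R[i]]_d), d%:R < s -> unit_ball z ->
          exists S : 'rV[R[i]]_d -> R[i],
            L2_unconditional_sum X mu (@unit_sphere R d)
              (fun x zeta => (ps_weight s z x * poisson_szego x zeta)%:C) S,
        forall (z : 'rV[R[i]]_d) (S : R -> 'rV[R[i]]_d -> R[i]), unit_ball z ->
          (forall s : R, d%:R < s ->
            L2_unconditional_sum X mu (@unit_sphere R d)
              (fun x zeta => (ps_weight s z x * poisson_szego x zeta)%:C)
              (S s)) ->
          L2norm mu (@unit_sphere R d)
            (fun zeta => S s zeta / (fine (ps_mass X s z))%:C
                         - (poisson_szego z zeta)%:C)
            @[s --> (d%:R : R)^'+] --> 0%E,
        forall (f : 'rV[R[i]]_d -> R[i]) (z : 'rV[R[i]]_d),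
          hardy2 mu f -> unit_ball z ->
          (forall s : R, d%:R < s ->
            (conf_esum X (fun x => (cabs ((ps_weight s z x)%:C * f x))%:E)
              < +oo)%E) /\
          conf_csum X (fun x => (ps_weight s z x)%:C * f x)
            / (fine (ps_mass X s z))%:C @[s --> (d%:R : R)^'+] --> f z
      & forall z : 'rV[R[i]]_d, unit_ball z ->
          [/\ forall s : R, d%:R < s ->
                ps_measure X s z (@closed_unit_ball R d) = 1%E,
              (\int[@surface_measure R d]_(zeta in @unit_sphere R d)
                 (poisson_szego z zeta)%:E = 1)%E
            & forall phi : 'rV[R[i]]_d -> R,
                {within @closed_unit_ball R d, continuous phi} ->
                (\int[ps_measure X s z]_(x in @closed_unit_ball R d)
                   (phi x)%:E)%E @[s --> (d%:R : R)^'+] -->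
                (\int[@surface_measure R d]_(zeta in @unit_sphere R d)
                   (phi zeta * poisson_szego z zeta)%:E)%E]]}.
Proof.
have sigma_sphere := @surface_measure_sphere R d d_gt0.
have ae1 := core_converges_ae d_gt0 Pi_var lambda_gt0 Pi_intensity mu_sphere.
have ae2 := @core_converges_ae R d d_gt0 Pi lambda Pi_var lambda_gt0 Pi_intensity
  (@surface_measure R d) sigma_sphere.
apply: filterS2 ae1 ae2 => X good good_sigma.
have sE (s : R) : d%:R < s -> exists2 a : R, 0 < a & s = d%:R + a.
  by move=> ds; exists (s - d%:R); [rewrite subr_gt0|rewrite addrC subrK].
split.
- move=> s z /sE[a a0 ->] z1; exists (fun zeta => (fine (weighted_sum X a z zeta))%:C).
  exact: (poisson_series_unconditional d_gt0 lambda_gt0 good z1 a0).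
- move=> z S z1 hS.
  apply: (cvg_right_shift (F := fun s => L2norm mu (@unit_sphere R d) (fun zeta =>
    S s zeta / (fine (ps_mass X s z))%:C - (poisson_szego z zeta)%:C))).
  apply/L2norm_cvg0.
  apply: (normalized_poisson_series d_gt0 lambda_gt0 good good_sigma z1 (Sa := fun a => S (d%:R + a))).
  by move=> a a0; apply: hS; rewrite ltrDl.
- move=> f z f_hardy z1; split=> [s /sE[a a0 ->]|].
    exact: (hardy_summable d_gt0 lambda_gt0 good z1 f_hardy a0).
  apply: (cvg_right_shift (F := fun s => conf_csum X (fun x => (ps_weight s z x)%:C * f x)
            / (fine (ps_mass X s z))%:C)).
  exact: (hardy_limit d_gt0 lambda_gt0 good_sigma good z1 f_hardy).
- move=> z z1; split=> [s /sE[a a0 ->]||phi phi_cont].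
  + exact: (ps_measure_closed_ball d_gt0 lambda_gt0 good_sigma z1 a0).
  + exact: poisson_szego_mass.
  + apply: (cvg_right_shift (F := fun s => (\int[ps_measure X s z]_(x in @closed_unit_ball R d) (phi x)%:E)%E)).
    exact: (ps_measure_limit d_gt0 lambda_gt0 good_sigma z1 phi_cont).
Qed.
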